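(* Consider the Cauchy problem $$i\partial_tu+\partial_x^2u+\mathcal N(u)u=0,\quad u(x,0)=u_0(x),\qquad \mathcal N(u)=\sum_{k=0}^\infty d_k|u|^{\alpha_k},\quad x\in\mathbb R. \tag{P}$$ (i) Let $\{d_k\}_{k\ge0}$ be a sequence of complex numbers and $\{\alpha_k\}_{k\ge0}$ a sequence of real numbers with $\alpha_k\ge 1$ for every $k\ge 0$, such that for every $R_0>0$ $$\sum_{k=0}^\infty|d_k|\big(1+|\alpha_k|+|\alpha_k|^2\big)R_0^{\alpha_k}<\infty .$$ Then for any $u_0\in H^1(\mathbb R)$ there exist $T>0$ and a unique solution $u\in C([-T,T],H^1(\mathbb R))$ of (P). Additionally, given $u_0\in H^1(\mathbb R)$, there exist a time $T>0$ and a neighborhood $V$ of $u_0$ in $H^1(\mathbb R)$ such that the data-to-solution flow map from $V$ into $C([-T,T];H^1(\mathbb R))$ is continuous. (ii) Let $\{d_k\}_{k\ge0}$ be a sequence of complex numbers and $\{\alpha_k\}_{k\ge0}$ a sequence of real numbers with $\alpha_k>2$ for every $k\ge 0$, such that for every $R_0>0$ $$\sum_{k=0}^\infty\frac{|d_k|}{\alpha_k-2}\big(1+|\alpha_k|+|\alpha_k|^2\big)R_0^{\alpha_k}<\infty .$$ For $v_0\in H^1(\mathbb R)\cap L^2(|x|^2dx)$ and $b\in\mathbb R$ define $u_0=e^{\frac{ib|x|^2}{4}}v_0$. If $b>0$ is sufficiently large, then there exists a unique global solution $u$ of (P) with initial data $u_0$ such that $u\in C([0,\infty);H^1(\mathbb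 R))$. Moreover, $u$ scatters in $H^1(\mathbb R)$, i.e., there exists $u_+\in H^1(\mathbb R)$ such that $$\lim_{t\to\infty}\|u(t)-e^{it\partial_x^2}u_+\|_{H^1}=0 .$$
   Context: All functions are complex valued on $\mathbb R$. $L^2(|x|^2dx)$ is the space of $f$ with $xf\in L^2(\mathbb R)$. $e^{it\partial_x^2}$ is the linear Schrödinger group (Fourier multiplier with symbol $e^{-it|\xi|^2}$). Solutions are understood in the sense of the integral (Duhamel) equation $u(t)=e^{it\partial_x^2}u_0+i\int_0^te^{i(t-\tau)\partial_x^2}\mathcal N(u(\tau))u(\tau)\,d\tau$. ''$b>0$ sufficiently large'' means: there is $b_0>0$ (depending on the fixed data $v_0$ and the sequences) such that the conclusion holds for every $b\ge b_0$. *)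

(* Defs.v *)
From HB Require Import structures.
From mathcomp Require Import all_boot all_order all_algebra.
From mathcomp Require Import all_classical all_reals all_analysis.
From mathcomp.real_closed Require Import complex.

Set Implicit Arguments.
Unset Strict Implicit.
Unset Printing Implicit Defensive.

Import Order.TTheory GRing.Theory Num.Theory.
Import numFieldNormedType.Exports.
Import ComplexField.Normc.

Local Open Scope classical_set_scope.
Local Open Scope ring_scope.
Local Open Scope complex_scope.

Section NLS.
Context {R : realType}.
Implicit Types f g u w : R -> R[i].

(* Functions are represented by Borel measurable representatives, and equality
   in L^2 or H^1 is equality almost everywhere. *)
Definition ae_same f g : Prop := {ae @lebesgue_measure R, forall x, f x = g x}.

Definition cmeasurable f : Prop :=
  measurable_fun setT (fun x => complex.Re (f x)) /\
  measurable_fun setT (fun x => complex.Im (f x)).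

Definition cintegral (D : set R) f : R[i] :=
  (\int[@lebesgue_measure R]_(x in D) complex.Re (f x)) +i*
  (\int[@lebesgue_measure R]_(x in D) complex.Im (f x)).

Definition cis (theta : R) : R[i] := cos theta +i* sin theta.

Definition L2norm f : \bar R :=
  ('N[@lebesgue_measure R]_(2%:E) [(fun x => (normc (f x))%:E)])%E.

Definition L2 : set (R -> R[i]) :=
  [set f | cmeasurable f /\ (L2norm f < +oo)%E].

Definition test_function (phi : R -> R) : Prop :=
  (forall (n : nat) (x : R), derivable (derive1n n phi) x 1) /\
  (exists M : R, forall x, M < `|x| -> phi x = 0).

Definition is_weak_derivative f g : Prop := forall phi : R -> R,
  test_function phi ->
  cintegral setT (fun x => f x * (derive1 phi x)%:C) =
  - cintegral setT (fun x => g x * (phi x)%:C).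

Definition H1 : set (R -> R[i]) :=
  [set f | L2 f /\ exists2 g, L2 g & is_weak_derivative f g].

(* A representative of the weak derivative; meaningful only for f in H1. *)
Definition weak_derivative f : R -> R[i] :=
  xget (fun=> 0) [set g | L2 g /\ is_weak_derivative f g].

(* Meaningful only for f in H1. *)
Definition H1norm f : R :=
  Num.sqrt (fine (L2norm f) ^+ 2 + fine (L2norm (weak_derivative f)) ^+ 2).

(* L^2 Fourier transform with phase exp (i s x xi), in the unitary
   normalization, as the limit in mean of the transforms of the truncations
   f 1_[-n, n]; s = -1 is the direct transform and s = 1 its inverse. *)
Definition truncated_fourier (s : R) f (n : nat) : R -> R[i] := fun xi =>
  ((Num.sqrt (2 * pi))^-1)%:C *
  cintegral `[- n%:R, n%:R] (fun x => cis (s * (x * xi)) * f x).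

Definition fourier_phase (s : R) f : R -> R[i] :=
  xget (fun=> 0)
    [set F | L2 F /\
       (fun n => L2norm (F \- truncated_fourier s f n)) @ \oo --> 0%E].

Definition fourier := fourier_phase (-1).
Definition inv_fourier := fourier_phase 1.

Definition schrodinger (t : R) f : R -> R[i] :=
  inv_fourier (fun xi => cis (- (t * xi ^+ 2)) * fourier f xi).

Definition nonlinearity (d : nat -> R[i]) (alpha : nat -> R) (z : R[i]) :
    R[i] :=
  limn (series (fun k => complex.Re (d k) * normc z `^ alpha k)) +i*
  limn (series (fun k => complex.Im (d k) * normc z `^ alpha k)).

Definition riemann_sum (a : R) (s : seq R) (tag : nat -> R)
    (G : R -> R -> R[i]) : R -> R[i] := fun x =>
  \sum_(i < size s) (nth a s i - nth a (a :: s) i)%:C * G (tag i) x.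

(* For a <= b: I is the H1-valued Riemann integral of G over [a, b]. Integrands
   below are continuous in time with values in H1. *)
Definition is_RInt_H1_le (a b : R) (G : R -> R -> R[i]) (I : R -> R[i]) :
    Prop :=
  [/\ forall tau, a <= tau <= b -> H1 (G tau),
      H1 I &
      forall eps : R, 0 < eps -> exists2 delta : R, 0 < delta &
        forall (s : seq R) (tag : nat -> R),
          itv_partition a b s ->
          (forall i, (i < size s)%N ->
             nth a (a :: s) i <= tag i <= nth a s i /\
             nth a s i - nth a (a :: s) i < delta) ->
          H1norm (riemann_sum a s tag G \- I) < eps].

Definition is_RInt_H1 (a b : R) (G : R -> R -> R[i]) (I : R -> R[i]) : Prop :=
  if a <= b then is_RInt_H1_le a b G I
  else is_RInt_H1_le b a G (fun x => - I x).

Definition continuous_H1 (J : set R) (u : R -> R -> R[i]) : Prop :=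
  (forall t, J t -> H1 (u t)) /\
  (forall t, J t ->
     (fun s => H1norm (u s \- u t)) @ within J (nbhs t) --> (0 : R)).

(* J is an interval containing 0. *)
Definition is_solution (d : nat -> R[i]) (alpha : nat -> R) (J : set R)
    (u0 : R -> R[i]) (u : R -> R -> R[i]) : Prop :=
  continuous_H1 J u /\
  forall t, J t -> exists2 I : R -> R[i],
    is_RInt_H1 0 t
      (fun tau => schrodinger (t - tau)
         (fun x => nonlinearity d alpha (u tau x) * u tau x)) I &
    ae_same (u t) (fun x => schrodinger t u0 x + (0 +i* 1) * I x).

Definition is_unique_solution (d : nat -> R[i]) (alpha : nat -> R)
    (J : set R) (u0 : R -> R[i]) (u : R -> R -> R[i]) : Prop :=
  is_solution d alpha J u0 u /\
  forall v, is_solution d alpha J u0 v -> forall t, J t -> ae_same (v t) (u t).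

Definition H1_neighborhood u (V : set (R -> R[i])) : Prop :=
  V `<=` H1 /\
  exists2 r : R, 0 < r & forall f, H1 f -> H1norm (f \- u) < r -> V f.

(* Phi maps V continuously into C([-T, T]; H1) with the supremum norm. *)
Definition continuous_flow (V : set (R -> R[i])) (T : R)
    (Phi : (R -> R[i]) -> R -> R -> R[i]) : Prop :=
  forall w0, V w0 -> forall eps : R, 0 < eps -> exists2 eta : R, 0 < eta &
    forall w, V w -> H1norm (w \- w0) < eta ->
      forall t, - T <= t <= T -> H1norm (Phi w t \- Phi w0 t) < eps.

End NLS.

(* Main.v *)
(** Write u(t) = U(t) f(t) with U(t) the free group. The Duhamel equation becomes
    the ordinary differential equation f' = i U(-t) F(U(t) f), F(z) = N(z) z, whose
    right-hand side is only Lipschitz on bounded sets of H^1. Part (i) is the Picard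
    iteration and Gronwall's lemma in the H^1 norm.

    For part (ii), put c = b/2. The operator K(t) = (1 + 2ct) d/dx - icx satisfies
    K(t) U(t) = U(t) K(0), and it acts on F(u) as a derivation because
    K(t) = (1 + 2ct) e^(i theta) d/dx e^(-i theta) with a quadratic phase theta and F is
    gauge invariant. The same identity and the Sobolev inequality give
    |U(t) f|_oo <= C (1 + 2ct)^(-1/2) (|f|_2 + |K(0) f|_2). Hence in the norm
    |f| + |K(0) f| + |f'|/(1+c) the vector field has a Lipschitz constant which is
    integrable in time, since all exponents exceed 2, with integral O(1/b); the norm of
    the chirped datum is bounded independently of b. So the Picard iteration contracts
    on every interval [0, n], and f(t) converges as t -> oo, which is scattering.

    On the Fourier side everything rests on Plancherel's theorem for the truncated
    transforms, checked on indicator functions of intervals. *)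
Require Import Defs.
From HB Require Import structures.
From mathcomp Require Import all_boot all_order all_algebra.
From mathcomp Require Import all_classical all_reals all_analysis.
From mathcomp.real_closed Require Import complex.
From mathcomp Require Import measurable_realfun.
From mathcomp Require Import ring lra.
Set Implicit Arguments.
Unset Strict Implicit.
Unset Printing Implicit Defensive.
Import Order.TTheory GRing.Theory Num.Theory.
Import numFieldNormedType.Exports.
Import ComplexField.Normc.
Local Open Scope classical_set_scope.
Local Open Scope ring_scope.
Local Open Scope complex_scope.

(** * Complex-valued functions, L^2 and L^1 *)

Section Complex.
Context {R : realType}.
Implicit Types (z w : R[i]) (a b : R).

(** Functions are representatives, so H^1 enters as a domain [D] with a seminorm [N] on a plain
    function space. The theory of differential equations is written for that situation: limits and
    solutions are determined only up to seminorm zero. Curves are integrated through [antider],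
    whose tagged increments match the Riemann sums in the notion of solution.

    The derivative is handled as the Fourier multiplier [i xi]. L^2 limits of difference quotients
    link it to test functions, and they also give the product rule for chirps and the chain rule for
    the nonlinearity.

    For [1 <= a] the map |z|^a z has a differential that is Lipschitz on bounded sets, although
    |z|^a itself need not be twice differentiable at 0. This is what makes the vector field
    Lipschitz in H^1; the constants of size 1 + a + a^2 are the ones summed in the hypothesis on the
    d_k.

    The weight 1/(1+c) on f' is dictated by the datum: differentiating the chirp costs a factor
    c. *)

Lemma normc_ge0 z : 0 <= normc z.
Proof. by case: z => a b /=; exact: sqrtr_ge0. Qed.

Lemma normcD z w : normc (z + w) <= normc z + normc w.
Proof. exact: le_normcD. Qed.

Lemma normcBC z w : normc (z - w) = normc (w - z).
Proof. by rewrite -(normcN (z - w)) opprB. Qed.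

Lemma normcB_triangle z w v : normc (z - v) <= normc (z - w) + normc (w - v).
Proof. by rewrite (le_trans _ (normcD _ _))// addrA subrK. Qed.

Lemma ler_normc_dist z w : `|normc z - normc w| <= normc (z - w).
Proof.
rewrite ler_norml; apply/andP; split.
- rewrite lerNl opprB lerBlDl -{1}(subrK z w) addrC normcBC.
  by rewrite (le_trans (normcD _ _)) // addrC normcBC lexx.
- by rewrite lerBlDl -{1}(subrK w z) (le_trans (normcD _ _))// addrC.
Qed.

Lemma normc_sqr z : normc z ^+ 2 = complex.Re z ^+ 2 + complex.Im z ^+ 2.
Proof. by case: z => a b /=; rewrite sqr_sqrtr// addr_ge0// sqr_ge0. Qed.

Lemma normc_Re z : `|complex.Re z| <= normc z.
Proof.
rewrite -(@ler_pXn2r _ 2)// ?nnegrE ?normc_ge0// normc_sqr real_normK ?num_real//.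
by rewrite lerDl sqr_ge0.
Qed.

Lemma normc_Im z : `|complex.Im z| <= normc z.
Proof.
rewrite -(@ler_pXn2r _ 2)// ?nnegrE ?normc_ge0// normc_sqr real_normK ?num_real//.
by rewrite lerDr sqr_ge0.
Qed.

Lemma normcR a : normc (a%:C : R[i]) = `|a|.
Proof. by rewrite /= expr0n addr0 sqrtr_sqr. Qed.

Lemma normc_ReIm z : normc z <= `|complex.Re z| + `|complex.Im z|.
Proof.
rewrite -(@ler_pXn2r _ 2)// ?nnegrE ?normc_ge0 ?addr_ge0// normc_sqr.
by rewrite sqrrD !real_normK ?num_real// lerD2r lerDl mulrn_wge0 ?mulr_ge0.
Qed.

Lemma normc_conj z : normc (conjc z) = normc z.
Proof. by case: z => a b /=; rewrite sqrrN. Qed.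

Lemma normc_eq0 z : (normc z == 0) = (z == 0).
Proof. by apply/eqP/eqP => [/eq0_normc//|->]; rewrite normc0. Qed.

Lemma mul_conjc z : z * conjc z = (normc z ^+ 2)%:C.
Proof. by rewrite normc_sqr; case: z => a b /=; simpc; congr (_ +i* _); ring. Qed.

Lemma ReD z w : complex.Re (z + w) = complex.Re z + complex.Re w.
Proof. by case: z w => [? ?] []. Qed.
Lemma ImD z w : complex.Im (z + w) = complex.Im z + complex.Im w.
Proof. by case: z w => [? ?] []. Qed.
Lemma ReN z : complex.Re (- z) = - complex.Re z.
Proof. by case: z. Qed.
Lemma ImN z : complex.Im (- z) = - complex.Im z.
Proof. by case: z. Qed.
Lemma ReM z w : complex.Re (z * w) =
  complex.Re z * complex.Re w - complex.Im z * complex.Im w.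
Proof. by case: z w => [? ?] []. Qed.
Lemma ImM z w : complex.Im (z * w) =
  complex.Re z * complex.Im w + complex.Im z * complex.Re w.
Proof. by case: z w => [? ?] []. Qed.
Lemma complexP z w : complex.Re z = complex.Re w ->
  complex.Im z = complex.Im w -> z = w.
Proof. by case: z w => [? ?] [? ?] /= -> ->. Qed.

Lemma conjcM z w : conjc (z * w) = conjc z * conjc w.
Proof. exact: rmorphM. Qed.
Lemma conjcR a : conjc (a%:C : R[i]) = a%:C.
Proof. by rewrite /= oppr0. Qed.

Lemma cisD a b : cis (a + b) = cis a * cis b.
Proof. by rewrite /cis cosD sinD; simpc; congr (_ +i* _); ring. Qed.

Lemma cis0 : cis (0 : R) = 1.
Proof. by rewrite /cis cos0 sin0. Qed.

Lemma cisN a : cis (- a) = conjc (cis a).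
Proof. by rewrite /cis cosN sinN. Qed.

Lemma normc_cis a : normc (cis a) = 1.
Proof. by rewrite /= cos2Dsin2 sqrtr1. Qed.

Lemma sin_le_abs a : `|sin a| <= `|a|.
Proof.
wlog a0 : a / 0 <= a => [h|].
  have [/h//|/ltW a0] := leP 0 a.
  by rewrite -normrN -sinN -(normrN a); apply: h; rewrite oppr_ge0.
move: a0; rewrite le_eqVlt => /predU1P[<-|a0]; first by rewrite sin0.
have [c _ ] := @MVT R sin cos 0 a a0 (fun x _ => is_derive_sin x)
  (continuous_subspaceT (@continuous_sin R)).
rewrite sin0 !subr0 => ->; rewrite normrM ler_piMl//.
by rewrite ler_norml cos_geN1 cos_le1.
Qed.

(** Half-angle formula: the modulus of e^(ia) - 1 is 2 |sin(a/2)|, and |sin| is bounded by the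
    absolute value of its argument. *)
Lemma normc_cisB1 a : normc (cis a - 1) <= `|a|.
Proof.
rewrite -(@ler_pXn2r _ 2)// ?nnegrE ?normc_ge0//.
rewrite normc_sqr /= real_normK ?num_real// subr0.
have -> : (cos a - 1) ^+ 2 + sin a ^+ 2 = (2 * sin (a / 2)) ^+ 2.
  have h : a = a / 2 + a / 2 by field.
  rewrite {1 2}h cosD sinD.
  have := cos2Dsin2 (a / 2); set c := cos _; set s := sin _ => cs.
  have {cs}-> : 1 = c ^+ 2 + s ^+ 2 by rewrite cs.
  have : s ^+ 2 * (c ^+ 2 + s ^+ 2) = s ^+ 2 by rewrite /c /s cos2Dsin2 mulr1.
  nra.
rewrite -[leLHS]real_normK ?num_real// -[leRHS]real_normK ?num_real//.
rewrite ler_pXn2r ?nnegrE// normrM ger0_norm//.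
have := sin_le_abs (a / 2); rewrite normrM (@ger0_norm _ 2^-1)// => ?; lra.
Qed.

Lemma normc_cisB a b : normc (cis a - cis b) <= `|a - b|.
Proof.
have -> : cis a - cis b = cis b * (cis (a - b) - 1).
  by rewrite mulrBr mulr1 -cisD [b + _]addrC subrK.
by rewrite normcM normc_cis mul1r normc_cisB1.
Qed.

End Complex.

(** * Measurability through real and imaginary parts *)

Section CMeasurable.
Context {R : realType}.
Implicit Types (f g : R -> R[i]).
Local Notation mu := (@lebesgue_measure R).

Lemma cm_cst (c : R[i]) : cmeasurable (fun _ : R => c).
Proof. by split; exact: measurable_cst. Qed.

Lemma cmD f g : cmeasurable f -> cmeasurable g -> cmeasurable (f \+ g).
Proof.
move=> [f1 f2] [g1 g2]; split.
  under eq_fun do rewrite ReD; exact: measurable_funD.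
under eq_fun do rewrite ImD; exact: measurable_funD.
Qed.

Lemma cmN f : cmeasurable f -> cmeasurable (\- f).
Proof.
move=> [f1 f2]; split.
  under eq_fun do rewrite ReN; exact: measurableT_comp.
under eq_fun do rewrite ImN; exact: measurableT_comp.
Qed.

Lemma cmB f g : cmeasurable f -> cmeasurable g -> cmeasurable (f \- g).
Proof. by move=> mf mg; apply: cmD => //; exact: cmN. Qed.

Lemma cmM f g : cmeasurable f -> cmeasurable g ->
  cmeasurable (fun x => f x * g x).
Proof.
move=> [f1 f2] [g1 g2]; split.
  under eq_fun do rewrite ReM; apply: measurable_funB; exact: measurable_funM.
under eq_fun do rewrite ImM; apply: measurable_funD; exact: measurable_funM.
Qed.

Lemma cmZ (c : R[i]) f : cmeasurable f -> cmeasurable (fun x => c * f x).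
Proof. by move=> ?; apply: cmM => //; exact: cm_cst. Qed.

Lemma cm_conj f : cmeasurable f -> cmeasurable (fun x => conjc (f x)).
Proof.
move=> [f1 f2]; split.
  by under eq_fun => x do (have -> : complex.Re (conjc (f x)) = complex.Re (f x) by case: (f x)).
under eq_fun => x do (have -> : complex.Im (conjc (f x)) = - complex.Im (f x) by case: (f x)).
exact: measurableT_comp.
Qed.

Lemma cm_real (f : R -> R) : measurable_fun setT f ->
  cmeasurable (fun x => (f x)%:C).
Proof. by move=> mf; split => //=; exact: measurable_cst. Qed.

Lemma cm_cis (f : R -> R) : measurable_fun setT f ->
  cmeasurable (fun x => cis (f x)).
Proof.
move=> mf; split => /=.
  apply: (@measurableT_comp _ _ _ _ _ _ cos) => //.
  by apply: continuous_measurable_fun; exact: continuous_cos.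
apply: (@measurableT_comp _ _ _ _ _ _ sin) => //.
by apply: continuous_measurable_fun; exact: continuous_sin.
Qed.

Lemma measurable_normc f : cmeasurable f ->
  measurable_fun setT (fun x => normc (f x)).
Proof.
move=> [f1 f2].
have -> : (fun x => normc (f x)) =
  (fun x => Num.sqrt (complex.Re (f x) ^+ 2 + complex.Im (f x) ^+ 2)).
  by apply/funext => x; case: (f x).
apply: (@measurableT_comp _ _ _ _ _ _ (@Num.sqrt R)).
  by apply: continuous_measurable_fun; exact: sqrt_continuous.
by apply: measurable_funD; exact: measurable_funX.
Qed.

Lemma cm_cvg (u : nat -> R -> R[i]) f : (forall n, cmeasurable (u n)) ->
  (forall x, (fun n => normc (u n x - f x)) @ \oo --> (0 : R)) ->
  cmeasurable f.
Proof.
move=> mu cu; split.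
- apply: (@measurable_fun_cvg _ _ _ _ (fun n x => complex.Re (u n x))).
    by move=> m; have [] := mu m.
  move=> x _; apply/cvgrPdist_lt => e e0.
  move/cvgrPdist_lt : (cu x) => /(_ e e0); apply: filterS => n.
  rewrite sub0r normrN ger0_norm ?normc_ge0//; apply: le_lt_trans.
  by rewrite distrC -ReN -ReD normc_Re.
- apply: (@measurable_fun_cvg _ _ _ _ (fun n x => complex.Im (u n x))).
    by move=> m; have [] := mu m.
  move=> x _; apply/cvgrPdist_lt => e e0.
  move/cvgrPdist_lt : (cu x) => /(_ e e0); apply: filterS => n.
  rewrite sub0r normrN ger0_norm ?normc_ge0//; apply: le_lt_trans.
  by rewrite distrC -ImN -ImD normc_Im.
Qed.

End CMeasurable.

(** * The L^2 seminorm on representatives *)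

Section L2.
Context {R : realType}.
Implicit Types (f g h : R -> R[i]).
Local Notation mu := (@lebesgue_measure R).

(** Kept in the extended reals, so that monotone, Fatou and dominated arguments apply before
    finiteness is known; [nrm] is its real square root and is meaningful on [L2]. *)
Definition sqint f : \bar R := (\int[mu]_x (normc (f x) ^+ 2)%:E)%E.
Definition nrm f : R := fine (L2norm f).

Lemma ae_imp (P Q : R -> Prop) : (forall x, P x -> Q x) ->
  {ae mu, forall x, P x} -> {ae mu, forall x, Q x}.
Proof. exact: (filterS (F := almost_everywhere mu)). Qed.

Lemma ae_imp2 (P Q S : R -> Prop) : (forall x, P x -> Q x -> S x) ->
  {ae mu, forall x, P x} -> {ae mu, forall x, Q x} -> {ae mu, forall x, S x}.
Proof. exact: (filterS2 (F := almost_everywhere mu)). Qed.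

Lemma sqint_ge0 f : (0 <= sqint f)%E.
Proof. by apply: integral_ge0 => x _; rewrite lee_fin sqr_ge0. Qed.

Lemma L2normE f : L2norm f = (sqint f `^ 2^-1)%E.
Proof.
rewrite /L2norm unlock /Lnorm; congr (_ `^ _)%E; apply: eq_integral => x _.
by rewrite gee0_abs ?lee_fin ?normc_ge0// poweR_EFin powR_mulrn ?normc_ge0.
Qed.

Lemma L2norm_ge0 f : (0 <= L2norm f)%E.
Proof. by rewrite L2normE poweR_ge0. Qed.

Lemma L2norm_lty f : (L2norm f < +oo)%E <-> (sqint f < +oo)%E.
Proof.
rewrite L2normE; split => [|?]; last exact: poweR_lty.
by apply: lty_poweRy; rewrite invr_neq0.
Qed.

Lemma L2P f : L2 f <-> cmeasurable f /\ (sqint f < +oo)%E.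
Proof.
split => -[mf h]; split => //; first exact/L2norm_lty.
exact/L2norm_lty.
Qed.

Lemma L2_cm f : L2 f -> cmeasurable f. Proof. by case. Qed.

Lemma L2normK f : L2 f -> L2norm f = (nrm f)%:E.
Proof.
move=> [_ h]; rewrite /nrm fineK// ge0_fin_numE//; exact: L2norm_ge0.
Qed.

Lemma nrm_ge0 f : 0 <= nrm f.
Proof. by rewrite /nrm fine_ge0// L2norm_ge0. Qed.

Lemma nrm_sqr f : L2 f -> (nrm f ^+ 2)%:E = sqint f.
Proof.
move=> Lf; have /L2P[_ h] := Lf; rewrite /nrm L2normE.
have sf : sqint f \is a fin_num by rewrite ge0_fin_numE// sqint_ge0.
rewrite -(fineK sf) poweR_EFin /= -powR_mulrn ?powR_ge0// -powRrM mulVf//.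
by rewrite powRr1// fine_ge0// sqint_ge0.
Qed.

Lemma measurable_sq f : cmeasurable f ->
  measurable_fun setT (fun x => (normc (f x) ^+ 2)%:E).
Proof.
move=> mf; apply/measurable_EFinP; apply: measurable_funX.
exact: measurable_normc.
Qed.

Lemma sqint_le f g : cmeasurable f -> cmeasurable g ->
  {ae mu, forall x, normc (f x) <= normc (g x)} -> (sqint f <= sqint g)%E.
Proof.
move=> mf mg fg; apply: ae_ge0_le_integral => //.
- by move=> x _; rewrite lee_fin sqr_ge0.
- exact: measurable_sq.
- by move=> x _; rewrite lee_fin sqr_ge0.
- exact: measurable_sq.
- apply: ae_imp fg => x fg _.
  by rewrite lee_fin ler_pXn2r ?nnegrE ?normc_ge0.
Qed.

Lemma L2_le f g : cmeasurable f -> L2 g ->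
  {ae mu, forall x, normc (f x) <= normc (g x)} -> L2 f /\ nrm f <= nrm g.
Proof.
move=> mf Lg fg; have /L2P[mg gy] := Lg.
have h := sqint_le mf mg fg.
have Lf : L2 f by apply/L2P; split => //; exact: le_lt_trans gy.
split => //; rewrite -(@ler_pXn2r _ 2)// ?nnegrE ?nrm_ge0//.
by rewrite -lee_fin !nrm_sqr.
Qed.

Lemma ae_sameW (P : R -> Prop) : (forall x, P x) -> {ae mu, forall x, P x}.
Proof. by move=> h; exact: aeW. Qed.

Lemma ae_same_refl f : ae_same f f.
Proof. exact: aeW. Qed.

Lemma ae_same_sym f g : ae_same f g -> ae_same g f.
Proof. by apply: ae_imp => x ->. Qed.

Lemma ae_same_trans f g h : ae_same f g -> ae_same g h -> ae_same f h.
Proof. by apply: ae_imp2 => x -> ->. Qed.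

Lemma L2_ae f g : cmeasurable g -> L2 f -> ae_same f g -> L2 g.
Proof.
move=> mg Lf fg; have [] // := L2_le mg Lf.
by apply: ae_imp fg => x ->.
Qed.

Lemma nrm_ae f g : L2 f -> L2 g -> ae_same f g -> nrm f = nrm g.
Proof.
move=> Lf Lg fg; apply/le_anti/andP; split.
- by have [] // := L2_le (L2_cm Lf) Lg _; apply: ae_imp fg => x ->.
- by have [] // := L2_le (L2_cm Lg) Lf _; apply: ae_imp fg => x ->.
Qed.

Lemma sqint0 : sqint (fun=> 0) = 0%E.
Proof.
by rewrite /sqint; under eq_integral do rewrite normc0 expr0n /=; rewrite integral0.
Qed.

Lemma L2_0 : L2 (fun _ : R => 0 : R[i]).
Proof. by apply/L2P; split; [exact: cm_cst|rewrite sqint0]. Qed.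

Lemma nrm0 : nrm (fun=> 0) = 0.
Proof. by apply/eqP; rewrite -sqrf_eq0 -eqe (nrm_sqr L2_0) sqint0. Qed.

Lemma nrm_eq0 f : L2 f -> nrm f = 0 <-> ae_same f (fun=> 0).
Proof.
move=> Lf; split => [f0|h]; last by rewrite (nrm_ae Lf L2_0 h) nrm0.
have := nrm_sqr Lf; rewrite f0 expr0n/= => /esym h.
have : (\int[mu]_x `|(normc (f x) ^+ 2)%:E| = 0)%E.
  rewrite -[RHS]h; apply: eq_integral => x _.
  by rewrite gee0_abs// lee_fin sqr_ge0.
move/(ae_eq_integral_abs mu measurableT (measurable_sq (L2_cm Lf))).
apply: ae_imp => x /(_ I) [] /eqP; rewrite sqrf_eq0 normc_eq0.
by move=> /eqP.
Qed.

Lemma L2norm_triangle f g : cmeasurable f -> cmeasurable g ->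
  (L2norm (f \+ g)%R <= L2norm f + L2norm g)%E.
Proof.
move=> mf mg.
have := @minkowski_EFin _ _ _ mu (fun x => normc (f x)) (fun x => normc (g x))
  2 (measurable_normc mf) (measurable_normc mg) (ler1n _ 2).
apply: le_trans.
have -> : ('N[mu]_2[EFin \o ((fun x => normc (f x)) \+ (fun x => normc (g x)))%R] =
    L2norm (fun x => (normc (f x) + normc (g x))%:C))%E.
  by apply: eq_Lnorm => x; rewrite normcR ger0_norm ?addr_ge0 ?normc_ge0.
rewrite !L2normE; apply: gt0_ler_poweR => //.
- by rewrite in_itv/= leey sqint_ge0.
- by rewrite in_itv/= leey sqint_ge0.
apply: sqint_le.
- exact: cmD.
- by apply: cm_real; apply: measurable_funD; exact: measurable_normc.
- apply: ae_sameW => x.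
  by rewrite normcR ger0_norm ?addr_ge0 ?normc_ge0 ?normcD.
Qed.

Lemma L2D f g : L2 f -> L2 g -> L2 (f \+ g).
Proof.
move=> Lf Lg; split; first by apply: cmD; exact: L2_cm.
apply: le_lt_trans (L2norm_triangle (L2_cm Lf) (L2_cm Lg)) _.
by rewrite !L2normK// -EFinD ltry.
Qed.

Lemma nrmD f g : L2 f -> L2 g -> nrm (f \+ g) <= nrm f + nrm g.
Proof.
move=> Lf Lg; rewrite -lee_fin EFinD -!L2normK//; last exact: L2D.
exact: L2norm_triangle (L2_cm Lf) (L2_cm Lg).
Qed.

Lemma sqintZ (c : R[i]) f : cmeasurable f ->
  sqint (fun x => c * f x) = ((normc c ^+ 2)%:E * sqint f)%E.
Proof.
move=> mf; rewrite /sqint -ge0_integralZl//.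
- by apply: eq_integral => x _; rewrite normcM exprMn.
- exact: measurable_sq.
- by move=> x _; rewrite lee_fin sqr_ge0.
- by rewrite lee_fin sqr_ge0.
Qed.

Lemma L2Z (c : R[i]) f : L2 f -> L2 (fun x => c * f x).
Proof.
move=> /L2P[mf fy]; apply/L2P; split; first exact: cmZ.
by rewrite sqintZ// lte_mul_pinfty// ?lee_fin ?sqr_ge0.
Qed.

Lemma nrmZ (c : R[i]) f : L2 f -> nrm (fun x => c * f x) = normc c * nrm f.
Proof.
move=> Lf; apply/eqP; rewrite -(@eqrXn2 _ 2)// ?nrm_ge0 ?mulr_ge0 ?normc_ge0 ?nrm_ge0//.
rewrite -eqe nrm_sqr; last exact: L2Z.
by rewrite (sqintZ _ (L2_cm Lf)) -(nrm_sqr Lf) -EFinM -exprMn.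
Qed.

Lemma L2N f : L2 f -> L2 (\- f).
Proof.
move=> /(@L2Z (-1)); congr L2; apply/funext => x; by rewrite mulN1r.
Qed.

Lemma nrmN f : nrm (\- f) = nrm f.
Proof. by rewrite /nrm; congr fine; apply: eq_Lnorm => x /=; rewrite normcN. Qed.

Lemma L2B f g : L2 f -> L2 g -> L2 (f \- g).
Proof. by move=> Lf Lg; apply: L2D => //; exact: L2N. Qed.

Lemma nrmBC f g : nrm (f \- g) = nrm (g \- f).
Proof.
by rewrite /nrm; congr fine; apply: eq_Lnorm => x /=; rewrite normcBC.
Qed.

Lemma nrmB_triangle f g h : L2 f -> L2 g -> L2 h ->
  nrm (f \- h) <= nrm (f \- g) + nrm (g \- h).
Proof.
move=> Lf Lg Lh; rewrite (le_trans _ (nrmD _ _)) //; [|exact: L2B|exact: L2B].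
rewrite le_eqVlt; apply/orP; left; apply/eqP; congr nrm; apply/funext => x /=.
by rewrite addrA subrK.
Qed.

Lemma nrm_dist f g : L2 f -> L2 g -> `|nrm f - nrm g| <= nrm (f \- g).
Proof.
move=> Lf Lg.
have h f1 g1 : L2 f1 -> L2 g1 -> nrm f1 - nrm g1 <= nrm (f1 \- g1).
  move=> L1 L2'; rewrite lerBlDr (le_trans _ (nrmD _ _))//; last exact: L2B.
  by rewrite le_eqVlt; apply/orP; left; apply/eqP; congr nrm; apply/funext => x /=; rewrite subrK.
by rewrite ler_norml h// andbT lerNl opprB nrmBC h.
Qed.

Lemma L2_conj f : L2 f -> L2 (fun x => conjc (f x)).
Proof.
move=> [mf fy]; split; first exact: cm_conj.
apply: le_lt_trans fy; rewrite le_eqVlt; apply/orP; left; apply/eqP.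
by apply: eq_Lnorm => x /=; rewrite normc_conj.
Qed.

Lemma nrm_conj f : nrm (fun x => conjc (f x)) = nrm f.
Proof. by congr fine; apply: eq_Lnorm => x /=; rewrite normc_conj. Qed.

Lemma L2_mulb (c : R) f g : cmeasurable f -> L2 g ->
  {ae mu, forall x, normc (f x) <= c} -> 0 <= c ->
  L2 (fun x => f x * g x) /\ nrm (fun x => f x * g x) <= c * nrm g.
Proof.
move=> mf Lg fc c0.
have -> : c * nrm g = nrm (fun x => c%:C * g x).
  by rewrite nrmZ// normcR ger0_norm.
apply: L2_le; [by apply: cmM => //; exact: L2_cm|exact: L2Z|].
apply: ae_imp fc => x fc; rewrite !normcM normcR ger0_norm//.
by rewrite ler_wpM2r// normc_ge0.
Qed.

Lemma L2_mulU f g : cmeasurable f -> L2 g -> (forall x, normc (f x) = 1) ->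
  L2 (fun x => f x * g x) /\ nrm (fun x => f x * g x) = nrm g.
Proof.
move=> mf Lg f1; have mfg : cmeasurable (fun x => f x * g x).
  by apply: cmM => //; exact: L2_cm.
have e x : normc (f x * g x) = normc (g x) by rewrite normcM f1 mul1r.
have h : L2norm (fun x => f x * g x) = L2norm g.
  by apply: eq_Lnorm => x /=; rewrite e.
by split; [split => //; rewrite h; case: Lg|rewrite /nrm h].
Qed.

End L2.

(** * Complex integrals and the bilinear pairing *)

Section L1.
Context {R : realType}.
Implicit Types (f g h : R -> R[i]).
Local Notation mu := (@lebesgue_measure R).

Definition cint f := cmeasurable f /\ (\int[mu]_x (normc (f x))%:E < +oo)%E.
Definition nrm1 f : R := \int[mu]_x normc (f x).
Definition ci f : R[i] := cintegral setT f.

Arguments ci : simpl never.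

Lemma cint_normc f : cint f -> mu.-integrable setT (EFin \o (fun x => normc (f x))).
Proof.
move=> [mf h]; apply/integrableP; split.
  by apply/measurable_EFinP; exact: measurable_normc.
by under eq_integral => x _ do rewrite /= ger0_norm ?normc_ge0//.
Qed.

Lemma cint_Re f : cint f -> mu.-integrable setT (EFin \o (fun x => complex.Re (f x))).
Proof.
move=> cf; apply: le_integrable (cint_normc cf) => //.
  by apply/measurable_EFinP; case: cf => -[].
by move=> x _ /=; rewrite lee_fin (ger0_norm (normc_ge0 _)) normc_Re.
Qed.

Lemma cint_Im f : cint f -> mu.-integrable setT (EFin \o (fun x => complex.Im (f x))).
Proof.
move=> cf; apply: le_integrable (cint_normc cf) => //.
  by apply/measurable_EFinP; case: cf => -[].
by move=> x _ /=; rewrite lee_fin (ger0_norm (normc_ge0 _)) normc_Im.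
Qed.

Lemma cint_le f (g : R -> R) : cmeasurable f ->
  mu.-integrable setT (EFin \o g) -> (forall x, normc (f x) <= g x) -> cint f.
Proof.
move=> mf ig fg; split => //.
have /integrableP[mg] := ig; apply: le_lt_trans.
apply: ge0_le_integral => //.
- by move=> x _; rewrite lee_fin normc_ge0.
- by apply/measurable_EFinP; exact: measurable_normc.
- exact: measurableT_comp.
- by move=> x _; rewrite /= lee_fin (le_trans (fg x))// ler_norm.
Qed.

Lemma cint_leC f g : cmeasurable f -> cint g ->
  (forall x, normc (f x) <= normc (g x)) -> cint f.
Proof. by move=> mf cg fg; apply: cint_le mf (cint_normc cg) fg. Qed.

Lemma cintD f g : cint f -> cint g -> cint (f \+ g).
Proof.
move=> cf cg; apply: (@cint_le _ (fun x => normc (f x) + normc (g x))).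
- by apply: cmD; [case: cf|case: cg].
- have := integrableD measurableT (cint_normc cf) (cint_normc cg).
  by congr (_.-integrable _ _).
- by move=> x; exact: normcD.
Qed.

Lemma cintZ (c : R[i]) f : cint f -> cint (fun x => c * f x).
Proof.
move=> cf; apply: (@cint_le _ (fun x => normc c * normc (f x))).
- by apply: cmZ; case: cf.
- have := integrableZl measurableT (normc c) (cint_normc cf).
  by congr (_.-integrable _ _).
- by move=> x; rewrite normcM.
Qed.

Lemma cintN f : cint f -> cint (\- f).
Proof. by move=> /(cintZ (-1)); congr cint; apply/funext => x; rewrite mulN1r. Qed.

Lemma cintB f g : cint f -> cint g -> cint (f \- g).
Proof. by move=> cf cg; apply: cintD => //; exact: cintN. Qed.

Lemma cint0 : cint (fun=> 0).
Proof.
split; first exact: cm_cst.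
by under eq_integral do rewrite normc0; rewrite integral0.
Qed.

Lemma ciD f g : cint f -> cint g -> ci (f \+ g) = ci f + ci g.
Proof.
move=> cf cg; rewrite /ci /cintegral; simpc; congr (_ +i* _).
- under eq_Rintegral do rewrite ReD.
  by rewrite RintegralD//; exact: cint_Re.
- under eq_Rintegral do rewrite ImD.
  by rewrite RintegralD//; exact: cint_Im.
Qed.

Lemma ciZ (c : R[i]) f : cint f -> ci (fun x => c * f x) = c * ci f.
Proof.
move=> cf; rewrite /ci /cintegral.
have i1 := cint_Re cf; have i2 := cint_Im cf.
have z (a : R) (k : R -> R) : mu.-integrable setT (EFin \o k) ->
    mu.-integrable setT (EFin \o (fun x => a * k x)).
  by move=> /(integrableZl measurableT a); congr (_.-integrable _ _).
case: c => a b; simpc; congr (_ +i* _).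
- under eq_Rintegral do rewrite ReM /=.
  by rewrite RintegralB ?RintegralZl//; exact: z.
- under eq_Rintegral do rewrite ImM /=.
  by rewrite RintegralD ?RintegralZl//; exact: z.
Qed.

Lemma ciN f : cint f -> ci (\- f) = - ci f.
Proof.
move=> cf; rewrite -mulN1r -ciZ//; congr ci; apply/funext => x /=.
by rewrite mulN1r.
Qed.

Lemma ciB f g : cint f -> cint g -> ci (f \- g) = ci f - ci g.
Proof. by move=> cf cg; rewrite -ciN// -ciD//; exact: cintN. Qed.

Lemma ci_conj f : cint f -> ci (fun x => conjc (f x)) = conjc (ci f).
Proof.
move=> cf; rewrite /ci /cintegral /=; congr (_ +i* _).
  by apply: eq_Rintegral => x _; case: (f x).
rewrite -mulN1r -RintegralZl//; last exact: cint_Im.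
by apply: eq_Rintegral => x _; case: (f x) => a b; rewrite mulN1r.
Qed.

Lemma ci_ae f g : cint f -> cint g -> ae_same f g -> ci f = ci g.
Proof.
move=> cf cg fg; rewrite /ci /cintegral /Rintegral; congr (fine _ +i* fine _);
  apply: ae_eq_integral => //.
- by case/integrableP : (cint_Re cf).
- by case/integrableP : (cint_Re cg).
- by apply: ae_imp fg => x -> _.
- by case/integrableP : (cint_Im cf).
- by case/integrableP : (cint_Im cg).
- by apply: ae_imp fg => x -> _.
Qed.

Lemma nrm1_ge0 f : 0 <= nrm1 f.
Proof. by apply: Rintegral_ge0 => x _; exact: normc_ge0. Qed.

(** The unimodular constant [c] rotates the integral onto the positive axis. Its modulus is then the
    real part of an integral, where the real inequality applies. *)
Lemma ci_le f : cint f -> normc (ci f) <= nrm1 f.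
Proof.
move=> cf; have [->|z0] := eqVneq (ci f) 0; first by rewrite normc0 nrm1_ge0.
pose c := conjc (ci f) / (normc (ci f))%:C.
have n0 : normc (ci f) != 0 by rewrite normc_eq0.
have nc : normc c = 1.
  by rewrite normcM normc_conj normcV normcR (ger0_norm (normc_ge0 _)) divff.
have e : (normc (ci f))%:C = ci (fun x => c * f x).
  rewrite ciZ// /c mulrAC [_ * ci f]mulrC mul_conjc expr2.
  move: n0; move: (normc (ci f)) => n n0; rewrite rmorphM mulfK//.
  by apply: contra n0 => /eqP[->].
have -> : normc (ci f) = complex.Re (ci (fun x => c * f x)) by rewrite -e.
have cc := cintZ c cf.
apply: le_Rintegral => //; [exact: cint_Re|exact: cint_normc|].
by move=> x _; rewrite (le_trans (ler_norm _))// (le_trans (normc_Re _))// normcM nc mul1r.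
Qed.

Lemma nrm1E f : cint f -> (nrm1 f)%:E = (\int[mu]_x (normc (f x))%:E)%E.
Proof.
move=> [mf h]; rewrite /nrm1 /Rintegral fineK// ge0_fin_numE//.
by apply: integral_ge0 => x _; rewrite lee_fin normc_ge0.
Qed.

Lemma L2_mul f g : L2 f -> L2 g -> cint (fun x => f x * g x) /\
  nrm1 (fun x => f x * g x) <= nrm f * nrm g.
Proof.
move=> Lf Lg.
have := @hoelder _ _ _ mu (fun x => normc (f x)) (fun x => normc (g x)) 2 2
  (measurable_normc (L2_cm Lf)) (measurable_normc (L2_cm Lg)).
have -> : (2^-1 + 2^-1 = 1 :> R) by field.
move=> /(_ (ltr0Sn R 1) (ltr0Sn R 1) erefl); rewrite -/(L2norm f) -/(L2norm g) !L2normK//.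
rewrite Lnorm1.
have -> : (\int[mu]_x `|(EFin \o ((fun x => normc (f x)) \* (fun x => normc (g x)))%R) x|
   = \int[mu]_x (normc (f x * g x))%:E)%E.
  by apply: eq_integral => x _; rewrite /= normcM ger0_norm// mulr_ge0 ?normc_ge0.
move=> h; have c : cint (fun x => f x * g x).
  split; first by apply: cmM; exact: L2_cm.
  by apply: le_lt_trans h _; rewrite -EFinM ltry.
by split => //; rewrite -lee_fin nrm1E// EFinM.
Qed.

(** No conjugation: this is the pairing with test functions, and the Fourier transform is symmetric
    for it ([pr_Fo]). The Hermitian product is obtained by conjugating the second entry. *)
Definition pr f g := ci (fun x => f x * g x).

Lemma pr_le f g : L2 f -> L2 g -> normc (pr f g) <= nrm f * nrm g.
Proof.
by move=> Lf Lg; have [c h] := L2_mul Lf Lg; exact: le_trans (ci_le c) h.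
Qed.

Lemma prC f g : pr f g = pr g f.
Proof. by congr ci; apply/funext => x; rewrite mulrC. Qed.

Lemma prDl f1 f2 g : L2 f1 -> L2 f2 -> L2 g -> pr (f1 \+ f2) g = pr f1 g + pr f2 g.
Proof.
move=> L1 L2' Lg; have [c1 _] := L2_mul L1 Lg; have [c2 _] := L2_mul L2' Lg.
by rewrite /pr -ciD//; congr ci; apply/funext => x /=; rewrite mulrDl.
Qed.

Lemma prBl f1 f2 g : L2 f1 -> L2 f2 -> L2 g -> pr (f1 \- f2) g = pr f1 g - pr f2 g.
Proof.
move=> L1 L2' Lg; have [c1 _] := L2_mul L1 Lg; have [c2 _] := L2_mul L2' Lg.
by rewrite /pr -ciB//; congr ci; apply/funext => x /=; rewrite mulrBl.
Qed.

Lemma prBr f g1 g2 : L2 f -> L2 g1 -> L2 g2 -> pr f (g1 \- g2) = pr f g1 - pr f g2.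
Proof. by move=> *; rewrite prC prBl// prC (prC g2). Qed.

Lemma prZl c f g : L2 f -> L2 g -> pr (fun x => c * f x) g = c * pr f g.
Proof.
move=> Lf Lg; have [cf _] := L2_mul Lf Lg.
by rewrite /pr -ciZ//; congr ci; apply/funext => x; rewrite mulrA.
Qed.

Lemma pr_ae f1 f2 g1 g2 : L2 f1 -> L2 f2 -> L2 g1 -> L2 g2 ->
  ae_same f1 f2 -> ae_same g1 g2 -> pr f1 g1 = pr f2 g2.
Proof.
move=> F1 F2 G1 G2 ff gg; have [c1 _] := L2_mul F1 G1; have [c2 _] := L2_mul F2 G2.
by apply: ci_ae => //; apply: ae_imp2 ff gg => x -> ->.
Qed.

Lemma pr_conj f : L2 f -> pr f (fun x => conjc (f x)) = (nrm f ^+ 2)%:C.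
Proof.
move=> Lf; apply: complexP => /=.
  rewrite /Rintegral; under eq_integral do rewrite mul_conjc.
  by rewrite -/(sqint f) -nrm_sqr.
by rewrite /Rintegral; under eq_integral do rewrite mul_conjc; rewrite integral0.
Qed.

Lemma pr_eq0 f : L2 f -> (forall g, L2 g -> pr f g = 0) -> ae_same f (fun=> 0).
Proof.
move=> Lf /(_ _ (L2_conj Lf)); rewrite pr_conj// => /complexI/eqP.
by rewrite sqrf_eq0 => /eqP/nrm_eq0; exact.
Qed.

End L1.

(** * Convergence in L^2 *)

Section Conv.
Context {R : realType}.
Implicit Types (f g h : R -> R[i]) (u : nat -> R -> R[i]).
Local Notation mu := (@lebesgue_measure R).

Lemma cvg0P (x : nat -> R) : (forall n, 0 <= x n) -> x @ \oo --> (0 : R) <->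
  (forall e, 0 < e -> exists N, forall n, (N <= n)%N -> x n < e).
Proof.
move=> x0; split=> [c e e0|c].
  move/cvgrPdist_lt : c => /(_ e e0) [N _ HN]; exists N => n /HN /=.
  by rewrite sub0r normrN ger0_norm.
apply/cvgrPdist_lt => e /c[N HN]; exists N => // n /= /HN.
by rewrite sub0r normrN ger0_norm.
Qed.

Lemma cvg0_le (x y : nat -> R) : (forall n, 0 <= x n) -> (forall n, x n <= y n) ->
  y @ \oo --> (0 : R) -> x @ \oo --> (0 : R).
Proof.
move=> x0 xy cy; apply: (@squeeze_cvgr _ _ _ _ (cst 0) y) => //.
  by apply: nearW => n; rewrite x0 xy.
exact: cvg_cst.
Qed.

Lemma cvg0D (x y : nat -> R) : x @ \oo --> (0 : R) -> y @ \oo --> (0 : R) ->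
  (fun n => x n + y n) @ \oo --> (0 : R).
Proof. by move=> cx cy; rewrite -[X in _ --> X](addr0 (0 : R)); exact: cvgD. Qed.

Lemma cvg0Z (a : R) (x : nat -> R) : x @ \oo --> (0 : R) ->
  (fun n => a * x n) @ \oo --> (0 : R).
Proof.
move=> cx; rewrite -[X in _ --> X](mulr0 a); apply: cvgM => //; exact: cvg_cst.
Qed.

Lemma cvg0_eq0 (x : R) : 0 <= x -> (forall e, 0 < e -> x <= e) -> x = 0.
Proof.
move=> x0 h; apply/le_anti; rewrite x0 andbT.
by apply/ler_addgt0Pl => e e0; rewrite addr0 h.
Qed.

(** Lower semicontinuity of the norm under convergence almost everywhere. It is used to prove that a
    limit lies in [L2] at all. *)
Lemma sqint_fatou u g (M : R) : (forall n, cmeasurable (u n)) -> cmeasurable g ->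
  {ae mu, forall x, (fun n => normc (u n x - g x)) @ \oo --> (0 : R)} ->
  (forall n, (sqint (u n) <= M%:E)%E) -> (sqint g <= M%:E)%E.
Proof.
move=> mu_ mg cu le_M.
pose s n x := (normc (u n x) ^+ 2)%:E.
have ms n : measurable_fun setT (s n) by exact: measurable_sq.
have s0 n x : (0 <= s n x)%E by rewrite lee_fin sqr_ge0.
have := @fatou _ _ _ mu setT measurableT s ms (fun n x _ => s0 n x).
have le2 : (limn_einf (fun n => \int[mu]_x s n x) <= M%:E)%E.
  rewrite limn_einf_lim; apply: lime_le; first exact: is_cvg_einfs.
  apply: nearW => n; apply: le_trans (le_M n).
  by apply: ereal_inf_lbound; exists n => /=.
move=> le1; apply: le_trans le2; apply: le_trans le1.
apply: ae_ge0_le_integral => //.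
- by move=> x _; rewrite lee_fin sqr_ge0.
- exact: measurable_sq.
- move=> x _; rewrite limn_einf_lim; apply: lime_ge; first exact: is_cvg_einfs.
  apply: nearW => n; apply: le_ereal_inf_tmp => _ [k _ <-]; exact: s0.
- rewrite (_ : (fun x => limn_einf (s^~ x)) = (fun x => - limn_esup (fun n => - s n x))%E).
    apply: measurableT_comp => //; apply: measurable_fun_limn_esup => n.
    by apply: (@measurableT_comp _ _ _ _ _ _ (@oppe R)) => //; exact: ms.
  by apply/funext => x; rewrite /limn_einf.
apply: ae_imp cu => x cu _.
rewrite le_eqVlt; apply/orP; left; apply/eqP.
have : s^~ x @ \oo --> (normc (g x) ^+ 2)%:E.
  apply: cvg_EFin; first exact: nearW.
  have c : (fun n => normc (u n x)) @ \oo --> normc (g x).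
    apply/cvgrPdist_lt => e e0; move/cvgrPdist_lt : cu => /(_ e e0).
    apply: filterS => n; rewrite sub0r normrN ger0_norm ?normc_ge0//.
    by apply: le_lt_trans; rewrite distrC ler_normc_dist.
  rewrite expr2 (_ : fine \o _ = (fun n => normc (u n x) * normc (u n x))).
    exact: cvgM.
  by apply/funext => n /=; rewrite expr2.
by move=> /cvg_limn_einf_sup[->].
Qed.

(** Fatou applied to the tails of [u n - f] bounds the norm of [g - f] by every positive number.
    This identifies limits in mean with functions computed pointwise. *)
Lemma cvg_nrm_ae u f g : (forall n, L2 (u n)) -> L2 f -> cmeasurable g ->
  (fun n => nrm (u n \- f)) @ \oo --> (0 : R) ->
  {ae mu, forall x, (fun n => normc (u n x - g x)) @ \oo --> (0 : R)} ->
  ae_same f g /\ L2 g.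
Proof.
move=> Lu Lf mg cu au.
have key e : 0 < e -> (sqint (g \- f)%R <= (e ^+ 2)%:E)%E.
  move=> e0; move/cvgrPdist_lt : cu => /(_ e e0) [N _ HN].
  apply: (@sqint_fatou (fun n => u (n + N)%N \- f)).
  - by move=> n; apply: cmB; exact: L2_cm.
  - by apply: cmB => //; exact: L2_cm.
  - apply: ae_imp au => x; rewrite -(cvg_shiftn N); apply: cvg_trans.
    apply: near_eq_cvg; apply: nearW => n /=; congr normc.
    by rewrite opprB addrA subrK.
  - move=> n; rewrite -nrm_sqr ?lee_fin; last exact: L2B.
    rewrite ler_pXn2r ?nnegrE ?nrm_ge0 ?ltW//.
    by have := HN (n + N)%N (leq_addl _ _); rewrite sub0r normrN ger0_norm ?nrm_ge0.
have Lgf : L2 (g \- f).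
  apply/L2P; split; first by apply: cmB => //; exact: L2_cm.
  by apply: le_lt_trans (key 1 ltr01) _; rewrite ltry.
have h : nrm (g \- f) = 0.
  apply/le_anti; rewrite nrm_ge0 andbT; apply/ler_addgt0Pl => e e0; rewrite addr0.
  have := key e e0; rewrite -nrm_sqr// lee_fin.
  by rewrite ler_pXn2r// ?nnegrE ?nrm_ge0 ?ltW.
have fg : ae_same f g.
  by move/nrm_eq0 : h => /(_ Lgf); apply: ae_imp => x /= /subr0_eq ->.
by split => //; exact: L2_ae fg.
Qed.

Lemma nrm_cvg0P u : (forall n, L2 (u n)) ->
  (fun n => sqint (u n)) @ \oo --> 0%E -> (fun n => nrm (u n)) @ \oo --> (0 : R).
Proof.
move=> Lu cu; apply/cvgrPdist_lt => e e0.
have : (fun n => (nrm (u n) ^+ 2)) @ \oo --> (0 : R).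
  have -> : (fun n => nrm (u n) ^+ 2) = fine \o (fun n => sqint (u n)).
    by apply/funext => n /=; rewrite -nrm_sqr.
  exact: fine_cvg.
move/cvgrPdist_lt => /(_ (e ^+ 2)); rewrite exprn_gt0// => /(_ isT).
apply: filterS => n; rewrite !sub0r !normrN !ger0_norm ?nrm_ge0 ?sqr_ge0//.
by rewrite ltr_pXn2r ?nnegrE ?nrm_ge0 ?ltW.
Qed.

Lemma L2_dominated u f h : (forall n, cmeasurable (u n)) -> cmeasurable f -> L2 h ->
  {ae mu, forall x, forall n, normc (u n x) <= normc (h x)} ->
  {ae mu, forall x, (fun n => normc (u n x - f x)) @ \oo --> (0 : R)} ->
  L2 f /\ (fun n => nrm (u n \- f)) @ \oo --> (0 : R).
Proof.
move=> mu_ mf Lh uh cu.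
have fh : {ae mu, forall x, normc (f x) <= normc (h x)}.
  apply: ae_imp2 uh cu => x uh cu.
  apply/ler_addgt0Pr => e e0; move/cvgrPdist_lt : cu => /(_ e e0) [N _ HN].
  have := HN N (leqnn _); rewrite sub0r normrN (ger0_norm (normc_ge0 _)) => h1.
  rewrite -[X in normc X](subrK (u N x)) addrC (le_trans (normcD _ _))//.
  by rewrite lerD// normcBC ltW.
have [Lf _] := L2_le mf Lh fh; split => //.
have Lu n : L2 (u n).
  by apply: (L2_le (mu_ n) Lh _).1; apply: ae_imp uh => x.
apply: nrm_cvg0P; first by move=> n; exact: L2B.
have mh := L2_cm Lh.
have ih : mu.-integrable setT (fun x => (4 * normc (h x) ^+ 2)%:E).
  apply/integrableP; split.
    apply/measurable_EFinP; apply: measurable_funM => //.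
    by apply: measurable_funX; exact: measurable_normc.
  have -> : (\int[mu]_x `|(4 * normc (h x) ^+ 2)%:E| =
      \int[mu]_x (4%:E * (normc (h x) ^+ 2)%:E))%E.
    apply: eq_integral => x _; rewrite gee0_abs ?EFinM// -EFinM lee_fin.
    by apply: mulr_ge0 => //; exact: sqr_ge0.
  rewrite ge0_integralZl//=; first last.
  - by move=> x _; rewrite lee_fin sqr_ge0.
  - exact: measurable_sq.
  by rewrite lte_mul_pinfty//; case/L2P : Lh.
have [] := @dominated_convergence _ _ _ mu setT measurableT
  (fun n x => (normc (u n x - f x) ^+ 2)%:E) (cst 0%E) _ _ _ _ ih.
- by move=> n; apply: measurable_sq; exact: cmB.
- exact: measurable_cst.
- apply: ae_imp cu => x cu _; apply: cvg_EFin; first exact: nearW.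
  rewrite (_ : fine \o _ = (fun n => normc (u n x - f x) * normc (u n x - f x))).
    by rewrite -[X in _ --> X](mulr0 (0 : R)); exact: cvgM.
  by apply/funext => n /=; rewrite expr2.
- apply: ae_imp2 uh fh => x uh fh n _.
  rewrite gee0_abs ?lee_fin ?sqr_ge0//.
  (* Both [u n] and its limit are bounded by [h], so their difference is bounded by [2 h]; hence the
     integrable majorant [4 h^2]. *)
  have -> : 4 * normc (h x) ^+ 2 = (2 * normc (h x)) ^+ 2 by ring.
  rewrite ler_pXn2r ?nnegrE ?normc_ge0 ?mulr_ge0 ?normc_ge0//.
  rewrite (le_trans (normcD _ _))// normcN mulr_natl mulr2n lerD//.
move=> _ _; rewrite integral0; apply: cvg_trans; apply: near_eq_cvg.
exact: nearW.
Qed.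

Lemma cvg_fast (x : nat -> R) (C : R) :
  (forall k, `|x k.+1 - x k| <= C * 2^-1 ^+ k) -> cvgn x.
Proof.
move=> h.
have h1 : cvgn (series (telescope x)).
  apply: normed_cvg; apply: (@series_le_cvg _ _ (fun k => C * 2^-1 ^+ k)).
  - by move=> n /=.
  - by move=> n; rewrite (le_trans _ (h n)).
  - by move=> n; exact: h.
  - have := @is_cvg_geometric_series R C 2^-1.
    by rewrite /geometric; apply; rewrite ger0_norm ?invf_lt1// ltr1n.
have -> : x = (fun n => x 0%N + series (telescope x) n).
  by apply/funext => n; exact: eq_sum_telescope.
by apply: is_cvgD => //; exact: is_cvg_cst.
Qed.

Lemma ccvg_fast (z : nat -> R[i]) (C : R) :
  (forall k, normc (z k.+1 - z k) <= C * 2^-1 ^+ k) ->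
  exists l : R[i], (fun k => normc (z k - l)) @ \oo --> (0 : R).
Proof.
move=> h.
have c1 : cvgn (fun k => complex.Re (z k)).
  apply: (@cvg_fast _ C) => k; apply: le_trans (h k).
  by rewrite -ReN -ReD normc_Re.
have c2 : cvgn (fun k => complex.Im (z k)).
  apply: (@cvg_fast _ C) => k; apply: le_trans (h k).
  by rewrite -ImN -ImD normc_Im.
exists (limn (fun k => complex.Re (z k)) +i* limn (fun k => complex.Im (z k))).
apply: (@squeeze_cvgr _ _ _ _ (cst 0) (fun k =>
   `|complex.Re (z k) - limn (fun k => complex.Re (z k))| +
   `|complex.Im (z k) - limn (fun k => complex.Im (z k))|)).
- apply: nearW => k; rewrite normc_ge0/= (le_trans (normc_ReIm _))//.
  by rewrite ReD ImD ReN ImN.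
- exact: cvg_cst.
- have cz (x : nat -> R) : cvgn x -> (fun k => `|x k - limn x|) @ \oo --> (0 : R).
    move=> c; rewrite -(normr0 R); apply: cvg_norm.
    by rewrite -[X in _ --> X](subrr (limn x)); apply: cvgB => //; exact: cvg_cst.
  by rewrite -[X in _ --> X](addr0 (0 : R)); apply: cvgD; exact: cz.
Qed.

(** Riesz-Fischer. Along a subsequence with increments at most 4^(-k), the sum of the 4^k |v_(k+1) -
    v_k|^2 is integrable; wherever it is finite the increments are O(2^(-k)), so the subsequence
    converges pointwise. Fatou turns this into convergence in mean of the full sequence. *)
Theorem L2_complete u : (forall n, L2 (u n)) ->
  (forall e : R, 0 < e -> exists N, forall n m, (N <= n)%N -> (N <= m)%N ->
     nrm (u n \- u m) < e) ->
  exists2 f, L2 f & (fun n => nrm (u n \- f)) @ \oo --> (0 : R).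
Proof.
move=> Lu cau.
have [N HN] : {N : nat -> nat & forall k n m, (N k <= n)%N -> (N k <= m)%N ->
    nrm (u n \- u m) < 4^-1 ^+ k}.
  apply: (@choice _ _ (fun k N => forall n m, (N <= n)%N -> (N <= m)%N ->
    nrm (u n \- u m) < 4^-1 ^+ k)) => k.
  by apply: cau; rewrite exprn_gt0// invr_gt0.
(* Running maxima make the indices nondecreasing, so two consecutive terms both lie beyond the rank
   [N k]. *)
pose phi k := (\max_(i < k.+1) N i)%N.
have phiN k : (N k <= phi k)%N.
  exact: (@leq_bigmax _ (fun i : 'I_k.+1 => N i) ord_max).
have phiS k : (phi k <= phi k.+1)%N by rewrite /phi [X in (_ <= X)%N]big_ord_recr leq_maxl.
pose v k := u (phi k).
have Lv k : L2 (v k) by exact: Lu.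
have dv k : nrm (v k.+1 \- v k) <= 4^-1 ^+ k.
  by apply/ltW/HN => //; exact: leq_trans (phiN k) (phiS k).
pose a k x := (4 ^+ k * normc (v k.+1 x - v k x) ^+ 2)%:E.
have ma k : measurable_fun setT (a k).
  apply/measurable_EFinP; apply: measurable_funM => //.
  apply: measurable_funX; apply: measurable_normc; apply: cmB; exact: L2_cm.
have a0 k x : (0 <= a k x)%E by rewrite lee_fin; apply: mulr_ge0; [exact: exprn_ge0|exact: sqr_ge0].
have mS : measurable_fun setT (fun x => (\sum_(0 <= k <oo) a k x)%E).
  by apply: ge0_emeasurable_sum => // k x _ _; exact: a0.
have iS : mu.-integrable setT (fun x => (\sum_(0 <= k <oo) a k x)%E).
  apply/integrableP; split => //.
  under eq_integral.
    by move=> x _; rewrite gee0_abs; [over|exact: nneseries_ge0].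
  rewrite integral_nneseries//.
  have le k : (\int[mu]_x a k x <= (4^-1 ^+ k)%:E)%E.
    rewrite /a; under eq_integral => x _ do rewrite EFinM.
    rewrite ge0_integralZl//; first last.
    - by move=> x _; rewrite lee_fin sqr_ge0.
    - apply: (@measurable_sq _ (v k.+1 \- v k)); apply: cmB; exact: L2_cm.
    rewrite -/(sqint (v k.+1 \- v k)) -nrm_sqr; last exact: L2B.
    rewrite -EFinM lee_fin.
    apply: (@le_trans _ _ (4 ^+ k * (4^-1 ^+ k) ^+ 2)).
      by rewrite ler_wpM2l ?exprn_ge0// ler_pXn2r ?nnegrE ?nrm_ge0 ?exprn_ge0.
    by rewrite expr2 mulrA -exprMn divff// expr1n mul1r.
  apply: (@le_lt_trans _ _ (\sum_(0 <= k <oo) (4^-1 ^+ k)%:E)%E).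
    by apply: lee_nneseries => k *; first [exact: le | apply: integral_ge0 => x _; exact: a0].
  have c : cvgn (series (geometric (1 : R) 4^-1)).
    by apply: is_cvg_geometric_series; rewrite ger0_norm ?invf_lt1// ltr1n.
  have -> : (\sum_(0 <= k <oo) (4^-1 ^+ k)%:E)%E = (limn (series (geometric (1 : R) 4^-1)))%:E.
    rewrite -EFin_lim//; congr (limn _); apply/funext => n /=.
    by rewrite /series /= -sumEFin; apply: eq_bigr => i _; rewrite mul1r.
  exact: ltry.
have key x : (\sum_(0 <= k <oo) a k x)%E \is a fin_num ->
    exists l : R[i], (fun k => normc (v k x - l)) @ \oo --> (0 : R).
  move=> fx; pose C := fine (\sum_(0 <= k <oo) a k x)%E.
  have C0 : 0 <= C by apply: fine_ge0; exact: nneseries_ge0.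
  apply: (@ccvg_fast _ (Num.sqrt C)) => k.
  have : (a k x <= C%:E)%E.
    rewrite /C fineK// (@nneseries_split R (fun k => a k x) 0%N k.+1 (fun k _ => a0 k x)).
    rewrite add0n big_nat_recr//= -addeA addeC -addeA leeDl// adde_ge0//.
      exact: nneseries_ge0.
    by apply: sume_ge0.
  rewrite lee_fin => h.
  rewrite -(@ler_pXn2r _ 2)// ?nnegrE ?normc_ge0 ?mulr_ge0 ?exprn_ge0 ?sqrtr_ge0//.
  rewrite exprMn sqr_sqrtr// -exprM mulnC exprM exprVn -exprVn.
  have -> : (2^-1 : R) ^+ 2 = 4^-1 by rewrite exprVn; congr (_ ^-1); ring.
  by rewrite exprVn ler_pdivlMr ?exprn_gt0// mulrC.
pose E := [set x | (\sum_(0 <= k <oo) a k x)%E \is a fin_num].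
have mE : measurable E.
  by rewrite -[X in measurable X]setTI; exact: emeasurable_fin_num.
(* Cutting to the measurable set [E] of convergence gives a sequence that converges everywhere,
   whose limit is therefore measurable. *)
pose w k x := (\1_E x : R)%:C * v k x.
have [f Hf] : {f : R -> R[i] & forall x, (fun k => normc (w k x - f x)) @ \oo --> (0 : R)}.
  apply: (@choice _ _ (fun x l => (fun k => normc (w k x - l)) @ \oo --> (0 : R))) => x.
  have [Ex|Ex] := pselect (E x).
    have [l Hl] := key x Ex; exists l; rewrite /w indicE mem_set//.
    by under eq_fun do rewrite mul1r.
  exists 0; rewrite /w indicE memNset//.
  under eq_fun do rewrite mul0r subr0 normc0; exact: cvg_cst.
have mf : cmeasurable f.
  apply: cm_cvg Hf => k; apply: cmM; last exact: L2_cm.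
  by apply: cm_real; exact: measurable_indic.
have vf : {ae mu, forall x, (fun k => normc (v k x - f x)) @ \oo --> (0 : R)}.
  have := integrable_ae measurableT iS; apply: ae_imp => x /(_ I) Ex.
  have := Hf x; rewrite /w indicE mem_set//.
  by under eq_fun do rewrite mul1r.
have est k n : (N k <= n)%N -> L2 (f \- u n) /\ nrm (f \- u n) <= 4^-1 ^+ k.
  move=> kn.
  have s : (sqint (f \- u n)%R <= ((4^-1 ^+ k) ^+ 2)%:E)%E.
    apply: (@sqint_fatou (fun m => v (m + k)%N \- u n)).
    - by move=> m; apply: cmB; exact: L2_cm.
    - by apply: cmB => //; exact: L2_cm.
    - apply: ae_imp vf => x; rewrite -(cvg_shiftn k); apply: cvg_trans.
      apply: near_eq_cvg; apply: nearW => m /=; congr normc.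
      by rewrite opprB addrA subrK.
    - move=> m; rewrite -nrm_sqr ?lee_fin; last exact: L2B.
      rewrite ler_pXn2r ?nnegrE ?nrm_ge0 ?exprn_ge0//; apply/ltW/HN => //.
      apply: leq_trans (phiN k) _; elim: m => [|m IH]; first by rewrite add0n.
      by rewrite addSn (leq_trans IH).
  have L : L2 (f \- u n).
    apply/L2P; split; first by apply: cmB => //; exact: L2_cm.
    exact: le_lt_trans s (ltry _).
  split => //; rewrite -(@ler_pXn2r _ 2) ?nnegrE ?nrm_ge0 ?exprn_ge0//.
  by rewrite -lee_fin nrm_sqr.
exists f.
  have [L _] := est 0%N (N 0%N) (leqnn _).
  have := L2D L (Lu (N 0%N)); congr L2; apply/funext => x /=.
  by rewrite subrK.
apply/cvgrPdist_lt => e e0.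
have [k ke] : exists k, (4^-1 : R) ^+ k < e.
  have := @cvg_expr R 4^-1; rewrite ger0_norm ?invf_lt1// ltr1n => /(_ isT).
  move/cvgrPdist_lt => /(_ e e0) [k _ /(_ k (leqnn k))].
  by rewrite sub0r normrN ger0_norm ?exprn_ge0//; exists k.
exists (N k) => // n kn; rewrite /= sub0r normrN ger0_norm ?nrm_ge0// nrmBC.
by have [_ h] := est k n kn; exact: le_lt_trans h ke.
Qed.

(** By contradiction and choice of a bad point within 1/(n+1) of [t] for each n. It turns dominated
    convergence, a statement on sequences, into continuity in a real parameter. *)
Lemma seq_eps (F : R -> R) (t : R) (P : R -> Prop) :
  (forall s : nat -> R, (forall n, P (s n)) -> s @ \oo --> t ->
     (F \o s) @ \oo --> (0 : R)) ->
  forall e, 0 < e -> exists2 d, 0 < d & forall s, P s -> `|s - t| < d -> `|F s| < e.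
Proof.
move=> h e e0; apply: contrapT => /forall2NP nd.
have [s Hs] : {s : nat -> R & forall n, [/\ P (s n), `|s n - t| < n.+1%:R^-1 & e <= `|F (s n)|]}.
  apply: (@choice _ _ (fun n s => [/\ P s, `|s - t| < n.+1%:R^-1 & e <= `|F s|])) => n.
  have [] := nd n.+1%:R^-1; first by rewrite invr_gt0.
  move=> /existsNP[s /not_implyP[Ps /not_implyP[st /negP]]].
  by rewrite -leNgt; exists s.
have st : s @ \oo --> t.
  apply/cvgrPdist_lt => d d0.
  have : (fun n => n.+1%:R^-1 : R) @ \oo --> (0 : R) by exact: cvg_harmonic.
  move/cvgrPdist_lt => /(_ d d0); apply: filterS => n.
  rewrite sub0r normrN ger0_norm ?invr_ge0// => /(lt_trans _); rewrite distrC; apply.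
  by have [] := Hs n.
have := h s (fun n => let: And3 p _ _ := Hs n in p) st.
move/cvgrPdist_lt => /(_ e e0)[n _ /(_ n (leqnn n))].
by rewrite sub0r normrN ltNge; have [_ _ ->] := Hs n.
Qed.

End Conv.

(** * A Fejer integral *)

Section Invariance.
Context {R : realType}.
Implicit Types (f g : R -> R[i]).
Local Notation mu := (@lebesgue_measure R).

Lemma measurable_shift (h : R) : measurable_fun setT (fun x : R => x + h).
Proof. by apply: measurable_funD => //; exact: measurable_cst. Qed.

(** The image measure agrees with Lebesgue measure on half-open intervals, which determine it. *)
Lemma lebesgue_shift (h : R) (A : set R) : measurable A ->
  mu ((fun x => x + h) @^-1` A) = mu A.
Proof.
move=> mA; have m := measurable_shift h.
rewrite -[LHS]/(pushforward mu (fun x : R => x + h) A); apply/esym.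
pose nu := @measure_function_pushforward__canonical__measure_function_Measure _ _ (measurableTypeR R) (measurableTypeR R) R mu _ m.
apply: (@lebesgue_measure_unique _ nu) => // X [[a b] _ <-].
rewrite /nu /= /pushforward.
have -> : (fun x : R => x + h) @^-1` `]a, b] = `]a - h, b - h]%classic.
  by apply/seteqP; split => x /=; rewrite !in_itv/= ltrBlDr lerBrDr.
rewrite !lebesgue_measure_itv/= !lte_fin ltrBlDr subrK.
by case: ifPn => // _; rewrite -!EFinB; congr (_%:E); ring.
Qed.

Lemma lebesgue_opp (A : set R) : measurable A ->
  mu (-%R @^-1` A) = mu A.
Proof.
move=> mA; have m := @oppr_measurable R setT.
rewrite -[LHS]/(pushforward mu (-%R : R -> R) A); apply/esym.
pose nu := @measure_function_pushforward__canonical__measure_function_Measure _ _ (measurableTypeR R) (measurableTypeR R) R mu _ m.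
apply: (@lebesgue_measure_unique _ nu) => // X [[a b] _ <-].
rewrite /nu /= /pushforward.
have -> : -%R @^-1` `]a, b] = `[- b, - a[%classic.
  by apply/seteqP; split => x /=; rewrite !in_itv/= ltrNr lerNl andbC.
rewrite !lebesgue_measure_itv/= !lte_fin ltrN2.
by case: ifPn => // _; rewrite -!EFinB; congr (_%:E); ring.
Qed.

Section Preserving.
Context (phi : R -> R) (mphi : measurable_fun setT phi).
Context (phiE : forall A : set R, measurable A -> mu (phi @^-1` A) = mu A).

Lemma ge0_integral_preserving (k : R -> \bar R) : measurable_fun setT k ->
  (forall x, 0 <= k x)%E -> (\int[mu]_x k (phi x) = \int[mu]_x k x)%E.
Proof.
move=> mk k0; rewrite -[LHS](@ge0_integral_pushforward _ _ (measurableTypeR R) (measurableTypeR R) R phi mphi mu setT k)//.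
by apply: eq_measure_integral => A mA _; exact: phiE.
Qed.

Lemma cm_preserving f : cmeasurable f -> cmeasurable (f \o phi).
Proof.
move=> [f1 f2]; split.
  exact: (@measurableT_comp _ _ _ _ _ _ (fun x => complex.Re (f x)) _ phi).
exact: (@measurableT_comp _ _ _ _ _ _ (fun x => complex.Im (f x)) _ phi).
Qed.

Lemma cint_preserving f : cint f -> cint (f \o phi).
Proof.
move=> [mf fy]; split; first exact: cm_preserving.
rewrite (ge0_integral_preserving (k := fun x => (normc (f x))%:E))//.
  by apply/measurable_EFinP; exact: measurable_normc.
by move=> x; rewrite lee_fin normc_ge0.
Qed.

Lemma sqint_preserving f : cmeasurable f -> sqint (f \o phi) = sqint f.
Proof.
move=> mf; rewrite /sqint (ge0_integral_preserving (k := fun x => (normc (f x) ^+ 2)%:E))//.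
  exact: measurable_sq.
by move=> x; rewrite lee_fin sqr_ge0.
Qed.

Lemma L2_preserving f : L2 f -> L2 (f \o phi) /\ nrm (f \o phi) = nrm f.
Proof.
move=> /L2P[mf fy]; split; last by rewrite /nrm !L2normE sqint_preserving.
by apply/L2P; split; [exact: cm_preserving|rewrite sqint_preserving].
Qed.

Lemma ci_preserving f : cint f -> ci (f \o phi) = ci f.
Proof.
move=> cf; have cp := cint_preserving cf; rewrite /ci /cintegral /Rintegral.
have h (k : R -> R) : mu.-integrable setT (EFin \o k) ->
    mu.-integrable setT (EFin \o (k \o phi)) ->
    (\int[mu]_x (k (phi x))%:E = \int[mu]_x (k x)%:E)%E.
  move=> ik ikp.
  rewrite -[LHS](@integral_pushforward _ _ (measurableTypeR R) (measurableTypeR R) R phi mphi mu setT (EFin \o k))//.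
    by apply: eq_measure_integral => A mA _; exact: phiE.
  by case/integrableP : ik.
congr (fine _ +i* fine _).
  exact: (h (fun x => complex.Re (f x)) (cint_Re cf) (cint_Re cp)).
exact: (h (fun x => complex.Im (f x)) (cint_Im cf) (cint_Im cp)).
Qed.

End Preserving.

Definition shift (h : R) f : R -> R[i] := fun x => f (x + h).

Lemma L2_shift h f : L2 f -> L2 (shift h f) /\ nrm (shift h f) = nrm f.
Proof. exact: L2_preserving (measurable_shift h) (lebesgue_shift h) f. Qed.

Lemma ci_shift h f : cint f -> cint (shift h f) /\ ci (shift h f) = ci f.
Proof.
move=> cf; split; first exact: cint_preserving (measurable_shift h) (lebesgue_shift h) _ cf.
exact: ci_preserving (measurable_shift h) (lebesgue_shift h) f cf.
Qed.

Lemma ci_opp f : cint f -> cint (f \o -%R) /\ ci (f \o -%R) = ci f.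
Proof.
move=> cf; split.
  exact: (@cint_preserving -%R (@oppr_measurable R setT) lebesgue_opp f cf).
exact: (@ci_preserving -%R (@oppr_measurable R setT) lebesgue_opp f cf).
Qed.

End Invariance.

(** * Evaluation of the Fejer integral by Laplace transforms *)

Section FejerIntegral.
Context {R : realType}.
Local Notation mu := (@lebesgue_measure R).

Lemma derivable_continuous (f : R -> R) : (forall x, derivable f x 1) -> continuous f.
Proof.
by move=> df x; apply: differentiable_continuous; apply/derivable1_diffP.
Qed.

Lemma cvg_expRNy (t : R) : 0 < t -> expR (- (t * x)) @[x --> +oo] --> (0 : R).
Proof.
move=> t0; apply/cvgrPdist_lt => e e0.
exists ((e * t)^-1); split; first by rewrite num_real.
move=> x /= xe; have x0 : 0 < x by apply: lt_trans xe; rewrite invr_gt0 mulr_gt0.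
rewrite sub0r normrN ger0_norm ?expR_ge0// expRN invf_plt ?posrE ?expR_gt0//.
apply: (@lt_le_trans _ _ (t * x)).
  by rewrite -ltr_pdivrMl// mulrC -invfM.
by apply: le_trans (expR_ge1Dx (t * x)); rewrite lerDr.
Qed.

Lemma integral_laplace_sqr (r : R) : 0 < r ->
  (\int[mu]_(t in `[0%R, +oo[) (t * expR (- (r * t)))%:E = (r ^- 2)%:E)%E.
Proof.
move=> r0.
pose F (t : R) := - (t / r + r ^- 2) * expR (- (r * t)).
have dF (t : R) : is_derive t 1 F (t * expR (- (r * t))).
  apply: is_derive_eq; rewrite /GRing.scale /=.
  by field; rewrite gt_eqF.
have cf : continuous (fun t : R => t * expR (- (r * t))).
  by apply: derivable_continuous => t; exact: ex_derive.
rewrite (@ge0_continuous_FTC2y _ _ F 0 0)//.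
- by rewrite -EFinB; congr (_%:E); rewrite /F mulr0 oppr0 expR0; field; rewrite gt_eqF.
- by move=> x x0; rewrite mulr_ge0 ?expR_ge0.
- exact: continuous_subspaceT.
(* Half of the exponential absorbs the linear factor, by (rt/2) e^(-rt/2) <= 1; the other half still
   tends to zero. *)
- pose G (t : R) := (2 / r ^+ 2 + r ^- 2) * expR (- (r / 2 * t)).
  have G0 : G t @[t --> +oo] --> (0 : R).
    rewrite -[X in _ --> X](mulr0 (2 / r ^+ 2 + r ^- 2)).
    by apply: cvgM; [exact: cvg_cst|apply: cvg_expRNy; rewrite divr_gt0].
  have GN0 : - G t @[t --> +oo] --> (0 : R).
    by rewrite -[X in _ --> X]oppr0; exact: cvgN.
  apply: (squeeze_cvgr _ GN0 (cvg_cst _)).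
  near=> t; have t0 : 0 <= t by near: t; exact: nbhs_pinfty_ge.
  rewrite /F mulNr oppr_le0 lerN2 mulr_ge0 ?expR_ge0//; last first.
    by rewrite addr_ge0// ?divr_ge0 ?invr_ge0 ?exprn_ge0 ?ltW.
  rewrite andbT /G.
  have -> : - (r * t) = - (r / 2 * t) + - (r / 2 * t) by field.
  rewrite expRD mulrA ler_wpM2r ?expR_ge0//.
  have E1 : expR (- (r / 2 * t)) <= 1.
    by rewrite -expR0 ler_expR oppr_le0 mulr_ge0// divr_ge0 ?ltW.
  rewrite mulrDl lerD//; last by rewrite ler_piMr ?invr_ge0 ?exprn_ge0 ?(ltW r0).
  have h : r / 2 * t * expR (- (r / 2 * t)) <= 1.
    rewrite expRN ler_pdivrMr ?expR_gt0// mul1r.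
    by apply: le_trans (expR_ge1Dx _); rewrite lerDr.
  have -> : t / r * expR (- (r / 2 * t)) =
     2 / r ^+ 2 * (r / 2 * t * expR (- (r / 2 * t))) by field; rewrite gt_eqF.
  by rewrite ler_piMr// divr_ge0// exprn_ge0 ?(ltW r0).
- by apply: cvg_at_right_filter; apply: differentiable_continuous; apply/derivable1_diffP.
- by move=> x _; rewrite derive1E; exact: derive_val.
Unshelve. all: by end_near. Qed.

Lemma integral_laplace_1Bcos (c t : R) : 0 < t ->
  (\int[mu]_(x in `[0%R, +oo[) ((1 - cos (c * x)) * expR (- (t * x)))%:E =
   (c ^+ 2 / (t * (t ^+ 2 + c ^+ 2)))%:E)%E.
Proof.
move=> t0.
have d0 : 0 < t ^+ 2 + c ^+ 2 by rewrite ltr_wpDr ?sqr_ge0 ?exprn_gt0.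
pose F (x : R) := (- t^-1 - (c * sin (c * x) - t * cos (c * x)) / (t ^+ 2 + c ^+ 2))
  * expR (- (t * x)).
have dF (x : R) : is_derive x 1 F ((1 - cos (c * x)) * expR (- (t * x))).
  apply: is_derive_eq; rewrite /GRing.scale /=.
  by field; rewrite !gt_eqF.
rewrite (@ge0_continuous_FTC2y _ _ F 0 0)//.
- rewrite /F !mulr0 oppr0 expR0 sin0 cos0 -EFinB; congr (_%:E).
  by field; rewrite !gt_eqF.
- by apply: continuous_subspaceT; apply: derivable_continuous => x; exact: ex_derive.
- pose B := t^-1 + (`|c| + t) / (t ^+ 2 + c ^+ 2).
  have G0 : B * expR (- (t * x)) @[x --> +oo] --> (0 : R).
    by rewrite -[X in _ --> X](mulr0 B); apply: cvgM; [exact: cvg_cst|exact: cvg_expRNy].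
  have GN0 : - (B * expR (- (t * x))) @[x --> +oo] --> (0 : R).
    by rewrite -[X in _ --> X]oppr0; exact: cvgN.
  apply: (squeeze_cvgr _ GN0 G0); apply: nearW => x.
  rewrite -ler_norml /F normrM (ger0_norm (expR_ge0 _)) ler_wpM2r ?expR_ge0//.
  rewrite /B (le_trans (ler_normB _ _))// normrN (ger0_norm (x := t^-1)) ?invr_ge0 ?(ltW t0)//.
  rewrite lerD2l normrM [X in _ * X]ger0_norm ?invr_ge0 ?(ltW d0)//.
  rewrite ler_wpM2r ?invr_ge0 ?(ltW d0)// (le_trans (ler_normB _ _))// !normrM.
  rewrite (ger0_norm (ltW t0)) lerD// ler_piMr// ?(ltW t0)// ler_norml ?sin_geN1 ?sin_le1 ?cos_geN1 ?cos_le1//.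
- by apply: cvg_at_right_filter; apply: differentiable_continuous; apply/derivable1_diffP.
- by move=> x _; rewrite derive1E; exact: derive_val.
Qed.

Lemma integral_invD_sqr (c : R) :
  (\int[mu]_(t in `[0%R, +oo[) (2 * c ^+ 2 / (t ^+ 2 + c ^+ 2))%:E = (pi * `|c|)%:E)%E.
Proof.
have [->|c0] := eqVneq c 0.
  rewrite normr0 mulr0; under eq_integral do rewrite expr0n mulr0 mul0r.
  by rewrite integral0.
wlog cp : c c0 / 0 < c => [h|].
  have [/h|cN|c00] := ltgtP 0 c; first exact.
    by rewrite -(sqrrN c) -normrN h ?oppr_eq0 ?oppr_gt0.
  by rewrite -c00 eqxx in c0.
have d0 (t : R) : t ^+ 2 + c ^+ 2 != 0 by rewrite gt_eqF// ltr_wpDl ?sqr_ge0 ?exprn_gt0.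
pose F (t : R) := 2 * c * atan (c^-1 * t).
have dF (x : R) : is_derive x 1 F (2 * c ^+ 2 / (x ^+ 2 + c ^+ 2)).
  apply: is_derive_eq; rewrite /GRing.scale /=.
  have e : 1 + (c^-1 * x) ^+ 2 = (x ^+ 2 + c ^+ 2) / c ^+ 2 by field.
  by rewrite e; field; rewrite d0.
rewrite (@ge0_continuous_FTC2y _ _ F 0 (pi * c))//.
- by rewrite /F mulr0 atan0 mulr0 sube0 gtr0_norm.
- by move=> x x0; apply: divr_ge0; [apply: mulr_ge0 => //; exact: sqr_ge0|apply: addr_ge0; exact: sqr_ge0].
- apply: continuous_subspaceT => x; apply: cvgM; first exact: cvg_cst.
  apply: cvgV => //; apply: cvgD; last exact: cvg_cst.
  exact: exprn_continuous.
- have -> : pi * c = 2 * c * (pi / 2) by field.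
  apply: cvgM; first exact: cvg_cst.
  have h : c^-1 * x @[x --> +oo] --> +oo by apply: gt0_cvgMry => //; rewrite invr_gt0.
  exact: (cvg_comp _ _ h (@cvgy_atan R)).
- by apply: cvg_at_right_filter; apply: differentiable_continuous; apply/derivable1_diffP.
- by move=> x _; rewrite derive1E; exact: derive_val.
Qed.

(* 1/x^2 is the Laplace transform of t at |x|; Tonelli exchanges the two integrals *)
Lemma integral_1Bcos (c : R) :
  (\int[mu]_x ((1 - cos (c * x)) / x ^+ 2)%:E = (pi * `|c|)%:E)%E.
Proof.
pose k (x t : R) := ((1 - cos (c * x)) * (\1_(`[0%R, +oo[%classic : set R) t * (t * expR (- (`|x| * t)))))%:E.
have k0 x t : (0 <= k x t)%E.
  rewrite lee_fin mulr_ge0 ?subr_ge0 ?cos_le1// indicE.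
  case: (boolP (t \in _)) => //=; last by rewrite mul0r.
  by rewrite inE/= in_itv/= andbT => t0; rewrite mul1r mulr_ge0 ?expR_ge0.
have q0 (x t : R) : 0 <= (\1_(`[0%R, +oo[%classic : set R) t * (t * expR (- (`|x| * t))) : R).
  rewrite indicE; case: (boolP (t \in _)) => //=; last by rewrite mul0r.
  by rewrite inE/= in_itv/= andbT => t0; rewrite mul1r mulr_ge0 ?expR_ge0.
have e1 x : (\int[mu]_t k x t = ((1 - cos (c * x)) / x ^+ 2)%:E)%E.
  (* At [x = 0] the right-hand side is 0 by the convention for division, and [k] vanishes there as
     well. *)
  have [->|x0] := eqVneq x 0.
    rewrite /k mulr0 cos0 subrr mul0r; under eq_integral do rewrite mul0r.
    by rewrite integral0.
  have mk : measurable_fun setT (fun t => (\1_(`[0%R, +oo[%classic : set R) t * (t * expR (- (`|x| * t))))%:E).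
    apply/measurable_EFinP; apply: measurable_funM; first exact: measurable_indic.
    apply: measurable_funM => //; apply: measurableT_comp => //.
    by apply: measurableT_comp => //; apply: measurable_funM.
  rewrite /k; under eq_integral do rewrite EFinM.
  rewrite ge0_integralZl ?lee_fin ?subr_ge0 ?cos_le1//; last first.
    by move=> t _; rewrite lee_fin; exact: q0.
  rewrite [X in (_ * X)%E](_ : _ = (`|x| ^- 2)%:E).
    by rewrite real_normK ?num_real.
  rewrite -integral_laplace_sqr ?normr_gt0// [RHS]integral_mkcond.
  apply: eq_integral => t _; rewrite patchE indicE.
  by case: ifPn => _; rewrite ?mul1r ?mul0r.
have e2 t : t \in (`]0%R, +oo[%classic : set R) ->
   (\int[mu]_x k x t = (2 * c ^+ 2 / (t ^+ 2 + c ^+ 2))%:E)%E.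
  rewrite inE/= in_itv/= andbT => t0.
  have ct : continuous (fun x : R => (1 - cos (c * x)) * expR (- (t * `|x|))).
    move=> x; apply: cvgM.
      have d (y : R) : is_derive y 1 (fun y : R => 1 - cos (c * y)) (c * sin (c * y)).
        by apply: is_derive_eq; rewrite /GRing.scale /=; ring.
      exact: (derivable_continuous (fun y => @ex_derive _ _ _ _ _ _ _ (d y))).
    apply: (@cvg_comp _ _ _ (fun x : R => - (t * `|x|)) (@expR R)); last exact: continuous_expR.
    apply: cvgN; apply: cvgM; [exact: cvg_cst|exact: norm_continuous].
  have -> : (\int[mu]_x k x t = \int[mu]_x (t%:E * ((1 - cos (c * x)) * expR (- (t * `|x|)))%:E))%E.
    apply: eq_integral => x _; rewrite /k indicE mem_set ?mul1r.
      by rewrite -EFinM; congr (_%:E); rewrite [`|x| * t]mulrC mulrCA.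
    by rewrite /= in_itv/= andbT ltW.
  have p0 (x : R) : 0 <= (1 - cos (c * x)) * expR (- (t * `|x|)).
    by rewrite mulr_ge0 ?expR_ge0// subr_ge0 cos_le1.
  rewrite ge0_integralZl ?lee_fin ?ltW//; first last.
    by apply/measurable_EFinP; exact: continuous_measurable_fun.
  rewrite ge0_symfun_integralT//; last first.
    by move=> x /=; rewrite mulrN cosN normrN.
  rewrite (_ : [set x : R | 0 <= x] = `[0%R, +oo[%classic); last first.
    by apply/seteqP; split => x /=; rewrite in_itv/= andbT.
  have -> : (\int[mu]_(x in `[0%R, +oo[) ((1 - cos (c * x)) * expR (- (t * `|x|)))%:E =
      \int[mu]_(x in `[0%R, +oo[) ((1 - cos (c * x)) * expR (- (t * x)))%:E)%E.
    by apply: eq_integral => x; rewrite inE/= in_itv/= andbT => x0; rewrite ger0_norm.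
  rewrite integral_laplace_1Bcos// -!EFinM; congr (_%:E).
  have d0 : t ^+ 2 + c ^+ 2 != 0 by rewrite gt_eqF// ltr_wpDr ?sqr_ge0 ?exprn_gt0.
  by field; rewrite d0 gt_eqF.
rewrite -integral_invD_sqr; transitivity (\int[mu]_x \int[mu]_t k x t)%E.
  by apply: eq_integral => x _; rewrite e1.
rewrite (@fubini_tonelli _ _ (measurableTypeR R) (measurableTypeR R) R mu mu (fun z => k z.1 z.2))//=; last first.
  apply/measurable_EFinP; apply: measurable_funM.
    apply: measurable_funB => //.
    apply: (@measurableT_comp _ _ _ _ _ _ (@cos R)).
      by apply: continuous_measurable_fun; exact: continuous_cos.
    by apply: measurable_funM.
  apply: measurable_funM.
    have mI : measurable_fun setT (\1_(`[0%R, +oo[%classic : set (measurableTypeR R)) : _ -> R).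
      exact: measurable_indic.
    exact: (measurableT_comp mI measurable_snd).
  apply: measurable_funM => //; apply: measurableT_comp => //.
  apply: measurableT_comp => //; apply: measurable_funM => //.
  exact: measurableT_comp.
(* The endpoint must be removed: at [t = 0] the inner integral is 0, while 2c^2/(t^2 + c^2) equals 2
   there unless c = 0. *)
rewrite -integral_itv_obnd_cbnd; last first.
  apply/measurable_EFinP; apply: measurable_funS measurableT _ _ => //.
  apply: measurable_funM; first exact: measurable_cst.
  under eq_fun do rewrite -powR_inv1 ?addr_ge0 ?sqr_ge0//.
  apply: (@measurableT_comp _ _ _ _ _ _ (fun x : R => x `^ (-1))).
    exact: measurable_powR.
  by apply: measurable_funD; [exact: exprn_measurable|exact: measurable_cst].
rewrite [RHS]integral_mkcond; apply: eq_integral => t _; rewrite patchE.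
case: ifPn => [/e2//|]; rewrite notin_setE /= in_itv/= andbT => /negP; rewrite -leNgt => t0.
rewrite /k; under eq_integral => x _.
  have -> : (\1_(`[0%R, +oo[%classic : set R) t * (t * expR (- (`|x| * t))) : R) = 0.
    have [->|tn0] := eqVneq t 0; first by rewrite mul0r mulr0.
    rewrite indicE memNset ?mul0r//= in_itv/= andbT; apply/negP.
    by rewrite -ltNge lt_neqAle tn0.
  rewrite mulr0; over.
by rewrite integral0.
Qed.

End FejerIntegral.

(** * The Plancherel isometry *)

Section FourierCut.
Context {R : realType}.
Implicit Types (f g : R -> R[i]) (s N a b x xi : R).
Local Notation mu := (@lebesgue_measure R).

Definition chi a b : R -> R[i] := fun x => (\1_(`[a, b]%classic : set R) x)%:C.
Definition cut (n : nat) f : R -> R[i] := fun x => chi (- n%:R) n%:R x * f x.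
Definition fcst : R[i] := ((Num.sqrt (2 * pi))^-1)%:C.
(** A pointwise absolutely convergent integral, used for integrable [f]; the L^2 transform is its
    limit in mean along [cut n f]. The sign [s] is kept as a parameter with [s ^+ 2 = 1], so that
    each result covers the transform and its inverse. *)
Definition FT s f xi : R[i] := fcst * ci (fun x => cis (s * (x * xi)) * f x).

Arguments chi : simpl never.
Arguments cut : simpl never.
Arguments fcst : simpl never.
Arguments FT : simpl never.

Lemma chiE a b x : chi a b x = if a <= x <= b then 1 else 0.
Proof.
rewrite /chi indicE; case: ifPn => h; first by rewrite mem_set//= in_itv.
by rewrite memNset//= in_itv/=; exact/negP.
Qed.

Lemma truncated_fourierE s f n : truncated_fourier s f n = FT s (cut n f).
Proof.
apply/funext => xi; rewrite /truncated_fourier /FT; congr (_ * _).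
have p (x : R) : cis (s * (x * xi)) * cut n f x =
   if x \in (`[- n%:R, n%:R]%classic : set R) then cis (s * (x * xi)) * f x else 0.
  rewrite /cut /chi indicE; case: ifPn => h; rewrite ?mul1r//.
  by rewrite mul0r mulr0.
rewrite /ci /cintegral; congr (_ +i* _); rewrite Rintegral_mkcond;
by apply: eq_Rintegral => x _; rewrite p patchE; case: ifPn.
Qed.

Lemma cm_chi a b : cmeasurable (chi a b).
Proof. by apply: cm_real; exact: measurable_indic. Qed.

Lemma normc_chi a b x : normc (chi a b x) = if a <= x <= b then 1 else 0.
Proof. by rewrite chiE; case: ifP; rewrite ?normc1 ?normc0. Qed.

Lemma normc_chi_le1 a b x : normc (chi a b x) <= 1.
Proof. by rewrite normc_chi; case: ifP. Qed.

Lemma sqint_chi a b : a <= b -> sqint (chi a b) = (b - a)%:E.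
Proof.
move=> ab; rewrite /sqint.
transitivity (\int[mu]_x (\1_(`[a, b]%classic : set R) x)%:E)%E.
  apply: eq_integral => x _; rewrite /chi normcR indicE.
  by case: (_ \in _); rewrite ?normr1 ?expr1n ?normr0 ?expr0n.
rewrite integral_indic//= setIT lebesgue_measure_itv/= lte_fin.
case: ltP => // ba; have /eqP-> : a == b by rewrite eq_le ab ba.
by rewrite subrr.
Qed.

Lemma L2_chi a b : L2 (chi a b).
Proof.
apply/L2P; split; first exact: cm_chi.
have [ab|ba] := leP a b; first by rewrite sqint_chi// ltry.
rewrite (_ : chi a b = fun=> 0) ?sqint0//; apply/funext => x; rewrite chiE.
by case: ifPn => // /andP[ax xb]; move: ba; rewrite ltNge (le_trans ax xb).
Qed.

Lemma nrm_chi a b : a <= b -> nrm (chi a b) ^+ 2 = b - a.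
Proof. by move=> ab; apply/eqP; rewrite -eqe nrm_sqr ?sqint_chi//; exact: L2_chi. Qed.

Lemma L2_cut n f : L2 f -> L2 (cut n f) /\ nrm (cut n f) <= nrm f.
Proof.
move=> Lf; have := L2_mulb (c := 1) (cm_chi (- n%:R) n%:R) Lf.
rewrite mul1r; apply => //; apply: ae_sameW => x; exact: normc_chi_le1.
Qed.

Lemma cut_idem n f : cut n (cut n f) = cut n f.
Proof.
by apply/funext => x; rewrite /cut chiE; case: ifP; rewrite ?mul1r ?mul0r.
Qed.

Lemma cint_cut n f : L2 f -> cint (cut n f).
Proof. by move=> Lf; have [] := L2_mul (L2_chi (- n%:R) n%:R) Lf. Qed.

(** Cauchy-Schwarz against the indicator of [-n, n], whose length is 2n. *)
Lemma nrm1_cut n f : L2 f -> nrm1 (cut n f) <= Num.sqrt (2 * n%:R) * nrm (cut n f).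
Proof.
move=> Lf; rewrite -{1}cut_idem.
have [Lc _] := L2_cut n Lf.
have [_] := L2_mul (L2_chi (- n%:R) n%:R) Lc.
move=> /le_trans; apply; rewrite ler_wpM2r ?nrm_ge0//.
rewrite -(@ler_pXn2r _ 2)// ?nnegrE ?nrm_ge0 ?sqrtr_ge0//.
rewrite nrm_chi ?sqr_sqrtr ?mulr_ge0//.
  by rewrite opprK -mulr2n mulr_natl.
by rewrite -subr_ge0 opprK addr_ge0.
Qed.

Lemma cut_cvg f : L2 f -> (fun n => nrm (cut n f \- f)) @ \oo --> (0 : R).
Proof.
move=> Lf; have mf := L2_cm Lf.
have [] // := @L2_dominated _ (fun n => cut n f) f f _ mf Lf.
- by move=> n; apply: cmM => //; exact: cm_chi.
- apply: ae_sameW => x n; rewrite normcM ler_piMl ?normc_ge0//.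
  exact: normc_chi_le1.
- apply: ae_sameW => x; apply: cvg_near_cst.
  near=> n; rewrite /cut chiE.
  have : `|x| <= n%:R by near: n; exact: nbhs_infty_ger.
  by rewrite ler_norml => ->; rewrite mul1r subrr normc0.
Unshelve. all: by end_near. Qed.

Lemma cm_phase s xi : cmeasurable (fun x => cis (s * (x * xi))).
Proof.
apply: cm_cis; apply: measurable_funM; first exact: measurable_cst.
by apply: measurable_funM => //; exact: measurable_cst.
Qed.

Lemma cint_phase s xi f : cint f -> cint (fun x => cis (s * (x * xi)) * f x).
Proof.
move=> cf; apply: (cint_leC _ cf).
  by apply: cmM; [exact: cm_phase|case: cf].
by move=> x; rewrite normcM normc_cis mul1r.
Qed.

Lemma nrm1_le f g : cint f -> cint g -> (forall x, normc (f x) <= normc (g x)) ->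
  nrm1 f <= nrm1 g.
Proof.
by move=> cf cg fg; apply: le_Rintegral => //; exact: cint_normc.
Qed.

Lemma fcst_ge0 : 0 <= (Num.sqrt (2 * pi))^-1 :> R.
Proof. by rewrite invr_ge0 sqrtr_ge0. Qed.

Lemma normc_fcst : normc fcst = (Num.sqrt (2 * pi))^-1.
Proof. by rewrite normcR ger0_norm// fcst_ge0. Qed.

Lemma fcst_sqr : (Num.sqrt (2 * pi))^-1 ^+ 2 = (2 * pi)^-1 :> R.
Proof. by rewrite exprVn sqr_sqrtr// mulr_ge0// pi_ge0. Qed.

Lemma FT_le s f xi : cint f -> normc (FT s f xi) <= (Num.sqrt (2 * pi))^-1 * nrm1 f.
Proof.
move=> cf; rewrite normcM normc_fcst ler_wpM2l ?fcst_ge0//.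
apply: le_trans (ci_le (cint_phase s xi cf)) _.
apply: nrm1_le => // [|x]; first exact: cint_phase.
by rewrite normcM normc_cis mul1r.
Qed.

Lemma FTD s f g : cint f -> cint g -> FT s (f \+ g) = FT s f \+ FT s g.
Proof.
move=> cf cg; apply/funext => xi; rewrite /FT /= -mulrDr -ciD; [|exact: cint_phase..].
by congr (_ * ci _); apply/funext => x /=; rewrite mulrDr.
Qed.

Lemma FTZ s c f : cint f -> FT s (fun x => c * f x) = fun xi => c * FT s f xi.
Proof.
move=> cf; apply/funext => xi; rewrite /FT [RHS]mulrCA -(ciZ c); last exact: cint_phase.
by congr (_ * ci _); apply/funext => x /=; rewrite mulrCA.
Qed.

Lemma FTB s f g : cint f -> cint g -> FT s (f \- g) = FT s f \- FT s g.
Proof.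
move=> cf cg; apply/funext => xi; rewrite /FT /= -mulrBr -ciB; [|exact: cint_phase..].
by congr (_ * ci _); apply/funext => x /=; rewrite mulrBr.
Qed.

Lemma FT_conj s f : cint f -> FT s (fun x => conjc (f x)) = fun xi => conjc (FT (- s) f xi).
Proof.
move=> cf; apply/funext => xi; rewrite /FT conjcM conjcR.
rewrite -ci_conj; last exact: cint_phase.
congr (_ * ci _); apply/funext => x; rewrite conjcM.
by rewrite -cisN mulNr opprK.
Qed.

(** On a bounded support the phase is Lipschitz in the frequency. This yields measurability of
    transforms ([cm_FT]) and keeps the transform of a narrow bump away from zero
    ([FT_bump_neq0]). *)
Lemma FT_lip s N f xi eta : 0 <= N -> cint f -> (forall x, N < `|x| -> f x = 0) ->
  normc (FT s f xi - FT s f eta) <=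
    (Num.sqrt (2 * pi))^-1 * (`|s| * N * nrm1 f) * `|xi - eta|.
Proof.
move=> N0 cf supp; rewrite /FT -mulrBr normcM normc_fcst -mulrA ler_wpM2l ?fcst_ge0//.
have c1 := cint_phase s xi cf; have c2 := cint_phase s eta cf.
rewrite -ciB//; apply: le_trans (ci_le (cintB c1 c2)) _.
pose c := (`|s| * N * `|xi - eta|)%:C : R[i].
have c0 : 0 <= `|s| * N * `|xi - eta| by rewrite !mulr_ge0.
apply: (@le_trans _ _ (nrm1 (fun x => c * f x))).
  apply: nrm1_le; [exact: cintB|exact: cintZ|] => x /=.
  have [xN|xN] := ltP N `|x|; first by rewrite supp// !mulr0 subrr.
  rewrite -mulrBl !normcM /c normcR (ger0_norm c0) ler_wpM2r ?normc_ge0//.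
  apply: le_trans (normc_cisB _ _) _.
  by rewrite -!mulrBr !normrM -mulrA ler_wpM2l// ler_wpM2r.
rewrite /nrm1; under eq_Rintegral do rewrite normcM /c normcR (ger0_norm c0).
rewrite RintegralZl//; last exact: cint_normc.
by rewrite le_eqVlt; apply/orP; left; apply/eqP; ring.
Qed.

Lemma lipschitz_cm (F : R -> R[i]) (L : R) :
  (forall x y, normc (F x - F y) <= L * `|x - y|) -> cmeasurable F.
Proof.
move=> lip.
have c (h : R -> R) : (forall x y, `|h x - h y| <= L * `|x - y|) -> continuous h.
  move=> hl x; apply/cvgrPdist_lt => e e0; near=> y.
  apply: le_lt_trans (hl _ _) _.
  apply: (@le_lt_trans _ _ ((`|L| + 1) * `|x - y|)).
    by rewrite ler_wpM2r// (le_trans (ler_norm _))// lerDl.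
  rewrite -ltr_pdivlMl ?ltr_wpDl//; near: y.
  by apply: cvgr_dist_lt; rewrite // mulr_gt0// invr_gt0 ltr_wpDl.
split; apply: continuous_measurable_fun; apply: c => x y; apply: le_trans (lip x y).
  by rewrite -ReN -ReD normc_Re.
by rewrite -ImN -ImD normc_Im.
Unshelve. all: by end_near. Qed.

Lemma cm_FT s N f : 0 <= N -> cint f -> (forall x, N < `|x| -> f x = 0) ->
  cmeasurable (FT s f).
Proof. by move=> N0 cf supp; apply: lipschitz_cm => x y; exact: FT_lip supp. Qed.

Lemma cut_supp n f x : n%:R < `|x| -> cut n f x = 0.
Proof.
move=> nx; rewrite /cut chiE; case: ifPn; rewrite ?mul0r// -ler_norml.
by rewrite leNgt nx.
Qed.

Lemma ae_neq0 : {ae mu, forall x : R, x != 0}.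
Proof.
exists [set 0]; split => //; first exact: lebesgue_measure_set1.
by move=> x /= /negP; rewrite negbK => /eqP.
Qed.

Lemma Rintegral_cos c a b : c != 0 -> a <= b ->
  \int[mu]_(x in `[a, b]) cos (c * x) = (sin (c * b) - sin (c * a)) / c.
Proof.
move=> c0; rewrite le_eqVlt => /predU1P[->|ab].
  by rewrite set_itv1 Rintegral_set1 subrr mul0r.
have d (x : R) : is_derive x 1 (fun x => sin (c * x) / c) (cos (c * x)).
  by apply: is_derive_eq; rewrite /GRing.scale /=; field.
have dc (x : R) : is_derive x 1 (fun x => cos (c * x)) (- (c * sin (c * x))).
  by apply: is_derive_eq; rewrite /GRing.scale /=; ring.
have cs := derivable_continuous (fun x => @ex_derive _ _ _ _ _ _ _ (d x)).
rewrite /Rintegral (continuous_FTC2 (F := fun x => sin (c * x) / c) ab).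
- by rewrite /= mulrBl.
- apply: continuous_subspaceT.
  exact: (derivable_continuous (fun x => @ex_derive _ _ _ _ _ _ _ (dc x))).
- split.
  + by move=> x _; exact: ex_derive.
  + by apply: cvg_at_right_filter; exact: cs.
  + by apply: cvg_at_left_filter; exact: cs.
- by move=> x _; rewrite derive1E; exact: derive_val.
Qed.

Lemma Rintegral_sin c a b : c != 0 -> a <= b ->
  \int[mu]_(x in `[a, b]) sin (c * x) = (cos (c * a) - cos (c * b)) / c.
Proof.
move=> c0; rewrite le_eqVlt => /predU1P[->|ab].
  by rewrite set_itv1 Rintegral_set1 subrr mul0r.
have d (x : R) : is_derive x 1 (fun x => - (cos (c * x) / c)) (sin (c * x)).
  by apply: is_derive_eq; rewrite /GRing.scale /=; field.
have dc (x : R) : is_derive x 1 (fun x => sin (c * x)) (c * cos (c * x)).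
  by apply: is_derive_eq; rewrite /GRing.scale /=; ring.
have cs := derivable_continuous (fun x => @ex_derive _ _ _ _ _ _ _ (d x)).
rewrite /Rintegral (continuous_FTC2 (F := fun x => - (cos (c * x) / c)) ab).
- by rewrite /= mulrBl opprK addrC.
- apply: continuous_subspaceT.
  exact: (derivable_continuous (fun x => @ex_derive _ _ _ _ _ _ _ (dc x))).
- split.
  + by move=> x _; exact: ex_derive.
  + by apply: cvg_at_right_filter; exact: cs.
  + by apply: cvg_at_left_filter; exact: cs.
- by move=> x _; rewrite derive1E; exact: derive_val.
Qed.

Lemma cint_chi a b : cint (chi a b).
Proof.
have [c _] := L2_mul (L2_chi a b) (L2_chi a b).
apply: cint_leC c _; first exact: cm_chi.
by move=> x; rewrite normcM normc_chi; case: ifP; rewrite ?mulr1 ?mulr0.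
Qed.

Lemma ciRe f : complex.Re (ci f) = \int[mu]_x complex.Re (f x).
Proof. by []. Qed.

Lemma FT_chi s N a xi : s != 0 -> - N <= a -> xi != 0 ->
  FT s (chi (- N) a) xi = fcst *
    ((sin (s * xi * a) + sin (s * xi * N)) / (s * xi) +i*
     ((cos (s * xi * N) - cos (s * xi * a)) / (s * xi))).
Proof.
move=> s0 Na x0; have c0 : s * xi != 0 by rewrite mulf_neq0.
rewrite /FT; congr (_ * _); rewrite /ci /cintegral; congr (_ +i* _).
  have := Rintegral_cos c0 Na; rewrite mulrN sinN opprK => <-.
  rewrite [RHS]Rintegral_mkcond; apply: eq_Rintegral => x _; rewrite patchE /chi indicE.
  by case: ifP => _ /=; rewrite ?mulr1 ?mulr0 ?subr0 ?subrr// mulrA mulrAC.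
have := Rintegral_sin c0 Na; rewrite mulrN cosN => <-.
rewrite [RHS]Rintegral_mkcond; apply: eq_Rintegral => x _; rewrite patchE /chi indicE.
by case: ifP => _ /=; rewrite ?mulr1 ?mulr0 ?addr0 ?add0r// mulrA mulrAC.
Qed.

Lemma sqr1_cases s : s ^+ 2 = 1 -> s = 1 \/ s = -1.
Proof.
move=> s1; have : (s == 1) || (s == -1) by rewrite -eqf_sqr expr1n s1.
by case/orP => /eqP; [left|right].
Qed.

Lemma sqr1_neq0 s : s ^+ 2 = 1 -> s != 0.
Proof. by move/sqr1_cases => [] ->; rewrite ?oppr_eq0 oner_eq0. Qed.

(** Up to the factor 1/pi, the squared modulus of the transform of an interval of length [c]. Its
    integral [pi |c|] is linear in the length, which is the isometry on indicators. *)
Definition fejer c x : R := (1 - cos (c * x)) / x ^+ 2.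

Lemma fejer_ge0 c x : 0 <= fejer c x.
Proof. by rewrite divr_ge0 ?sqr_ge0// subr_ge0 cos_le1. Qed.

Lemma measurable_fejer c : measurable_fun setT (fejer c).
Proof.
apply: measurable_funM.
  apply: measurable_funB; first exact: measurable_cst.
  apply: (@measurableT_comp _ _ _ _ _ _ (@cos R)).
    by apply: continuous_measurable_fun; exact: continuous_cos.
  by apply: measurable_funM => //; exact: measurable_cst.
under eq_fun do rewrite -powR_inv1 ?sqr_ge0//.
apply: (@measurableT_comp _ _ _ _ _ _ (fun x : R => x `^ (-1))).
  exact: measurable_powR.
exact: exprn_measurable.
Qed.

Lemma integrable_fejer c : mu.-integrable setT (EFin \o fejer c).
Proof.
apply/integrableP; split; first by apply/measurable_EFinP; exact: measurable_fejer.
under eq_integral => x _ do rewrite /= ger0_norm ?fejer_ge0//.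
by rewrite integral_1Bcos ltry.
Qed.

Lemma Rintegral_fejer c : \int[mu]_x fejer c x = pi * `|c|.
Proof. by rewrite /Rintegral integral_1Bcos. Qed.

Lemma normc_FT_chi s N a xi : s ^+ 2 = 1 -> - N <= a -> xi != 0 ->
  normc (FT s (chi (- N) a) xi) ^+ 2 = pi^-1 * fejer (a + N) xi.
Proof.
move=> s1 Na x0; have s0 := sqr1_neq0 s1.
rewrite FT_chi// normcM exprMn normc_fcst fcst_sqr normc_sqr /= /fejer.
rewrite !expr_div_n exprMn s1 mul1r -mulrDl.
have -> : cos ((a + N) * xi) = cos (s * xi * a) * cos (s * xi * N) - sin (s * xi * a) * sin (s * xi * N).
  by case: (sqr1_cases s1) => ->; [|rewrite -[LHS]cosN]; rewrite -cosD; congr cos; ring.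
have := cos2Dsin2 (s * xi * a); have := cos2Dsin2 (s * xi * N).
set A := cos _; set B := sin _; set C := cos _; set D := sin _ => e1 e2.
have -> : (D + B) ^+ 2 + (A - C) ^+ 2 = 2 * (1 - (C * A - D * B)) by nra.
have p0 : pi != 0 :> R by rewrite gt_eqF// pi_gt0.
by move: (pi) p0 => P p0; field; rewrite p0 x0.
Qed.

(** Polarised form of [normc_FT_chi]: the cross term of two intervals with the same left end is
    again a combination of Fejer kernels, so its integral is known. *)
Lemma Re_FT_chi s N a b xi : s ^+ 2 = 1 -> - N <= a -> - N <= b -> xi != 0 ->
  complex.Re (FT s (chi (- N) a) xi * conjc (FT s (chi (- N) b) xi)) =
  (2 * pi)^-1 * (fejer (a + N) xi + fejer (b + N) xi - fejer (a - b) xi).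
Proof.
move=> s1 Na Nb x0; have s0 := sqr1_neq0 s1.
have re (k u v u' v' : R) : complex.Re (k%:C * (u +i* v) * conjc (k%:C * (u' +i* v'))) =
    k ^+ 2 * (u * u' + v * v') by rewrite /=; ring.
rewrite !FT_chi// re fcst_sqr /fejer; congr (_ * _).
have e := sqr1_cases s1.
have -> : cos ((a + N) * xi) = cos (s * xi * a) * cos (s * xi * N) - sin (s * xi * a) * sin (s * xi * N).
  by case: e => ->; [|rewrite -[LHS]cosN]; rewrite -cosD; congr cos; ring.
have -> : cos ((b + N) * xi) = cos (s * xi * b) * cos (s * xi * N) - sin (s * xi * b) * sin (s * xi * N).
  by case: e => ->; [|rewrite -[LHS]cosN]; rewrite -cosD; congr cos; ring.
have -> : cos ((a - b) * xi) = cos (s * xi * a) * cos (s * xi * b) + sin (s * xi * a) * sin (s * xi * b).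
  by case: e => ->; [|rewrite -[LHS]cosN]; rewrite -cosB; congr cos; ring.
have := cos2Dsin2 (s * xi * N).
move: (cos (s * xi * a)) (sin (s * xi * a)) (cos (s * xi * b)) (sin (s * xi * b)).
move: (cos (s * xi * N)) (sin (s * xi * N)) => cN sN ca sa cb sb e2.
have -> : xi ^+ 2 = (s * xi) ^+ 2 by rewrite exprMn s1 mul1r.
have c0 : s * xi != 0 by rewrite mulf_neq0.
transitivity (((sa + sN) * (sb + sN) + (cN - ca) * (cN - cb)) / (s * xi) ^+ 2).
  by move: (s * xi) c0 => k c0; field.
rewrite -!mulrDl -mulrBl; congr (_ / _); nra.
Qed.

Lemma L2_FT_chi s N a : s ^+ 2 = 1 -> 0 <= N -> - N <= a -> L2 (FT s (chi (- N) a)).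
Proof.
move=> s1 N0 Na; have m : cmeasurable (FT s (chi (- N) a)).
  apply: (@cm_FT _ (Num.max N `|a|)); rewrite ?le_max ?N0//; first exact: cint_chi.
  move=> x; rewrite gt_max => /andP[Nx ax]; rewrite chiE; case: ifPn => // /andP[h1 h2].
  have [x0|x0] := leP 0 x.
    by move: ax; rewrite (ger0_norm x0) ltNge (le_trans h2 (ler_norm a)).
  by move: Nx; rewrite (ltr0_norm x0) ltrNr ltNge h1.
apply/L2P; split => //.
have -> : sqint (FT s (chi (- N) a)) = (\int[mu]_x (pi^-1 * fejer (a + N) x)%:E)%E.
  apply: ge0_ae_eq_integral => //.
  - exact: measurable_sq.
  - apply/measurable_EFinP; apply: measurable_funM; first exact: measurable_cst.
    exact: measurable_fejer.
  - by move=> x _; rewrite lee_fin sqr_ge0.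
  - by move=> x _; rewrite lee_fin mulr_ge0 ?fejer_ge0// invr_ge0 pi_ge0.
  - by apply: ae_imp ae_neq0 => x x0 _; rewrite normc_FT_chi.
under eq_integral do rewrite EFinM.
rewrite integralZl//; last exact: integrable_fejer.
by rewrite integral_1Bcos -EFinM ltry.
Qed.

Lemma FT_chi_opp s a b xi : FT s (chi a b) (- xi) = conjc (FT s (chi a b) xi).
Proof.
have e := FT_conj s (cint_chi a b).
have -> : conjc (FT s (chi a b) xi) = FT (- s) (fun x => conjc (chi a b x)) xi.
  by rewrite FT_conj ?opprK//; exact: cint_chi.
rewrite /FT; congr (_ * ci _); apply/funext => x; rewrite /chi conjc_real.
by rewrite mulrN mulrN mulNr.
Qed.

(** The real part integrates to half of (a + N) + (b + N) - |a - b|, that is, to min(a, b) + N, the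
    length of the intersection of the two intervals. *)
Lemma pr_FT_chi s N a b : s ^+ 2 = 1 -> 0 <= N -> - N <= a -> - N <= b ->
  pr (FT s (chi (- N) a)) (fun x => conjc (FT s (chi (- N) b) x)) = (Num.min a b + N)%:C.
Proof.
move=> s1 N0 Na Nb.
have La := L2_FT_chi s1 N0 Na; have Lb := L2_FT_chi s1 N0 Nb.
have [c _] := L2_mul La (L2_conj Lb).
apply: complexP.
- transitivity (\int[mu]_x ((2 * pi)^-1 *
    (fejer (a + N) x + fejer (b + N) x - fejer (a - b) x))); last first.
    have i1 := integrable_fejer (a + N); have i2 := integrable_fejer (b + N).
    have i3 := integrable_fejer (a - b).
    have i12 : mu.-integrable setT (EFin \o (fun x => fejer (a + N) x + fejer (b + N) x)).
      by have := integrableD measurableT i1 i2; congr (_.-integrable _ _).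
    have i123 : mu.-integrable setT (EFin \o (fun x => fejer (a + N) x + fejer (b + N) x - fejer (a - b) x)).
      by have := integrableB measurableT i12 i3; congr (_.-integrable _ _).
    rewrite RintegralZl// RintegralB// RintegralD// !Rintegral_fejer.
    rewrite (ger0_norm (x := a + N)) ?(ger0_norm (x := b + N)); [|by rewrite -lerBlDr sub0r..].
    have p0 : pi != 0 :> R by rewrite gt_eqF// pi_gt0.
    have [ab|ab] := leP a b.
      by rewrite ler0_norm ?subr_le0//; move: (pi) p0 => P p0 /=; field.
    by rewrite gtr0_norm ?subr_gt0//; move: (pi) p0 => P p0 /=; field.
  rewrite /pr ciRe; congr fine; apply: ae_eq_integral => //.
  + by have /integrableP[] := cint_Re c.
  + apply/measurable_EFinP; apply: measurable_funM; first exact: measurable_cst.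
    apply: measurable_funB; last exact: measurable_fejer.
    by apply: measurable_funD; exact: measurable_fejer.
  + by apply: ae_imp ae_neq0 => x x0 _; rewrite Re_FT_chi.
(* Reflection in [xi] conjugates each transform, so the integral equals its own conjugate and its
   imaginary part vanishes. *)
- have [_ e] := ci_opp c.
  have e2 : conjc (pr (FT s (chi (- N) a)) (fun x => conjc (FT s (chi (- N) b) x))) =
      pr (FT s (chi (- N) a)) (fun x => conjc (FT s (chi (- N) b) x)).
    rewrite -[RHS]/(ci _) -e; transitivity (ci (fun x => conjc (FT s (chi (- N) a) x * conjc (FT s (chi (- N) b) x)))).
      by rewrite (ci_conj c).
    apply: (congr1 ci); apply/funext => x.
    by rewrite conjcM -(FT_chi_opp s (- N) a x) -(FT_chi_opp s (- N) b x).
  move: e2; case: (pr _ _) => u v /= [] /eqP; rewrite eq_sym -addr_eq0 -mulr2n mulrn_eq0/=.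
  by move=> /eqP.
Qed.

Lemma pr_chi N a b : - N <= a -> - N <= b ->
  pr (chi (- N) a) (fun x => conjc (chi (- N) b x)) = (Num.min a b + N)%:C.
Proof.
move=> Na Nb.
have -> : pr (chi (- N) a) (fun x => conjc (chi (- N) b x)) =
   pr (chi (- N) (Num.min a b)) (fun x => conjc (chi (- N) (Num.min a b) x)).
  congr ci; apply/funext => x; rewrite /chi !conjc_real -!/(chi _ _ x) !chiE le_min.
  by case: (- N <= x) => //=; case: (x <= a); case: (x <= b); rewrite /= ?mulr1 ?mulr0 ?mul0r.
by rewrite pr_conj ?nrm_chi ?opprK ?le_min ?Na ?Nb//; exact: L2_chi.
Qed.

End FourierCut.

(** * Step functions, their density and the isometry *)

Section Plancherel.
Context {R : realType}.
Implicit Types (f g : R -> R[i]) (s N a b x xi : R).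
Local Notation mu := (@lebesgue_measure R).

(** All intervals are anchored at [- N]. This one-parameter family has the same Gram matrix before
    and after the transform ([pr_chi], [pr_FT_chi]), and other intervals arise as differences. *)
Inductive step (N : R) : (R -> R[i]) -> Prop :=
| step0 : step N (fun=> 0)
| stepS c a f : - N <= a -> a <= N -> step N f -> step N (fun x => c * chi (- N) a x + f x).

(** Sesquilinear extension of [pr_FT_chi] by induction on one argument at a time; [one] is the case
    in which the second function is a single indicator. *)
Lemma stepP N s f : s ^+ 2 = 1 -> 0 <= N -> step N f ->
  [/\ L2 f, cint f & L2 (FT s f)] /\ forall g, step N g ->
  pr (FT s f) (fun x => conjc (FT s g x)) = pr f (fun x => conjc (g x)).
Proof.
move=> s1 N0.
have FT0 : FT s (fun=> 0) = fun=> 0.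
  apply/funext => xi; rewrite /FT (_ : (fun x => _) = (fun=> 0)).
    have := ciZ 0 (cint0 (R := R)); under eq_fun do rewrite mulr0.
    by move=> ->; rewrite mul0r mulr0.
  by apply/funext => x; rewrite mulr0.
have FTS c a g : cint g -> FT s (fun x => c * chi (- N) a x + g x) =
    (fun xi => c * FT s (chi (- N) a) xi) \+ FT s g.
  move=> cg; rewrite -FTZ; last exact: cint_chi.
  by rewrite -FTD//; apply: cintZ; exact: cint_chi.
have base g : step N g -> [/\ L2 g, cint g & L2 (FT s g)].
  elim=> [|c a h Na aN _ [Lh ch LFh]].
    by rewrite FT0; split; [exact: L2_0|exact: cint0|exact: L2_0].
  split.
  - by apply: (L2D (f := fun x => c * chi (- N) a x)) => //; apply: L2Z; exact: L2_chi.
  - by apply: (cintD (f := fun x => c * chi (- N) a x)) => //; apply: cintZ; exact: cint_chi.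
  - by rewrite FTS//; apply: L2D => //; apply: L2Z; exact: L2_FT_chi.
have prl c f1 f2 g1 : L2 f1 -> L2 f2 -> L2 g1 ->
    pr ((fun x => c * f1 x) \+ f2) g1 = c * pr f1 g1 + pr f2 g1.
  by move=> L1 L2' Lg; rewrite prDl ?prZl//; exact: L2Z.
have one b g : - N <= b -> step N g -> pr (FT s g) (fun x => conjc (FT s (chi (- N) b) x)) =
   pr g (fun x => conjc (chi (- N) b x)).
  move=> Nb; elim=> [|c a h Na aN sh IH].
    rewrite FT0; congr ci; apply/funext => x; by rewrite !mul0r.
  have [Lh ch LFh] := base h sh.
  rewrite FTS// !prl// ?IH ?pr_FT_chi ?pr_chi//.
  - exact: L2_chi.
  - by apply: L2_conj; exact: L2_chi.
  - exact: L2_FT_chi.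
  - by apply: L2_conj; exact: L2_FT_chi.
move=> sf; split; first exact: base.
have [Lf cf LFf] := base f sf.
have prr c f1 f2 g1 : L2 f1 -> L2 f2 -> L2 g1 ->
    pr g1 (fun x => conjc (c * f1 x + f2 x)) =
    conjc c * pr g1 (fun x => conjc (f1 x)) + pr g1 (fun x => conjc (f2 x)).
  move=> L1 L2' Lg; rewrite prC (_ : (fun x => _) =
     (fun x => conjc c * conjc (f1 x)) \+ (fun x => conjc (f2 x))).
    by rewrite prl 1?prC ?(prC _ g1)//; exact: L2_conj.
  by apply/funext => x /=; rewrite rmorphD rmorphM.
move=> g; elim=> [|c b h Nb bN sh IH].
  rewrite FT0 /pr; congr ci; apply/funext => x; by rewrite conjc0 !mulr0.
have [Lh ch LFh] := base h sh.
rewrite FTS// [LHS]prr// ?prr// ?IH ?one//.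
- exact: L2_chi.
- exact: L2_FT_chi.
Qed.

Lemma step_isometry N s f : s ^+ 2 = 1 -> 0 <= N -> step N f ->
  nrm (FT s f) = nrm f.
Proof.
move=> s1 N0 sf; have [[Lf _ LFf] /(_ f sf)] := stepP s1 N0 sf.
rewrite !pr_conj// => /complexI/eqP.
by rewrite eqrXn2 ?nrm_ge0// => /eqP.
Qed.

Lemma stepD N f g : step N f -> step N g -> step N (f \+ g).
Proof.
move=> sf; elim: sf g => [g sg|c a h Na aN sh IH g /IH sg].
  by rewrite (_ : _ \+ _ = g)//; apply/funext => x /=; rewrite add0r.
have := stepS c Na aN sg; congr step; apply/funext => x /=.
by rewrite addrA.
Qed.

Lemma stepZ N c f : step N f -> step N (fun x => c * f x).
Proof.
elim=> [|d a h Na aN sh IH].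
  by under eq_fun do rewrite mulr0; exact: step0.
have := stepS (c * d) Na aN IH; congr step; apply/funext => x /=.
by rewrite mulrDr mulrA.
Qed.

Lemma step_chi N c a : - N <= a -> a <= N -> step N (fun x => c * chi (- N) a x).
Proof.
move=> Na aN; have := stepS c Na aN (step0 N); congr step.
by apply/funext => x; rewrite addr0.
Qed.

(** Stage j adds the value of [h] at the new grid point on the cell ending there, written as a
    difference of two anchored indicators. The initial stage is supported on the single point
    [- N]. *)
Definition grid_step N (h : R -> R) (d : R) :=
  fix F (j : nat) : R -> R[i] := if j is j'.+1 then
    F j' \+ ((fun x => (h (- N + j%:R * d))%:C * chi (- N) (- N + j%:R * d) x) \+
             (fun x => - (h (- N + j%:R * d))%:C * chi (- N) (- N + j'%:R * d) x))
  else (fun x => (h (- N))%:C * chi (- N) (- N) x).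

(** The sample point [t] is the right end of the cell of [x], hence at distance at most [d]; this is
    all that pointwise convergence to a continuous [h] requires. *)
Lemma grid_stepP N h d j : 0 <= N -> 0 <= d -> - N + j%:R * d <= N ->
  step N (grid_step N h d j) /\
  forall x, (- N <= x <= - N + j%:R * d ->
      exists t, [/\ - N <= t <= N, x <= t <= x + d & grid_step N h d j x = (h t)%:C]) /\
    (~~ (- N <= x <= - N + j%:R * d) -> grid_step N h d j x = 0).
Proof.
move=> N0 d0; elim: j => [|j IH] jN.
  split; first by apply: step_chi => //; rewrite -subr_ge0 opprK addr_ge0.
  move=> x; rewrite mul0r addr0 -eq_le /=; split => [/eqP<-|xN].
    exists (- N); rewrite lexx chiE lexx /= mulr1; split => //.
      by rewrite -subr_ge0 opprK addr_ge0.
    by rewrite lerDl.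
  by rewrite chiE -eq_le (negbTE xN) mulr0.
have jS : - N + j%:R * d <= - N + j.+1%:R * d.
  by rewrite lerD2l ler_wpM2r// ler_nat.
have Nj : - N <= - N + j%:R * d by rewrite lerDl mulr_ge0.
have [sj xj] := IH (le_trans jS jN).
split.
  apply: stepD => //; apply: stepD.
    by apply: step_chi => //; exact: le_trans jS.
  by apply: step_chi => //; exact: le_trans jN.
move=> x; have [xj1 xj2] := xj x; split => [/andP[Nx xS]|].
  have [xjd|jx] := leP x (- N + j%:R * d).
    have [|t [t1 t2 t3]] := xj1; first by rewrite Nx.
    exists t; split => //=; rewrite t3 !chiE Nx xS xjd /=.
    by rewrite !mulr1 subrr addr0.
  exists (- N + j.+1%:R * d); split => //.
  - by rewrite (le_trans Nj jS).
  - rewrite xS /= -natr1 mulrDl mul1r addrA lerD2r ltW//.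
  - rewrite /= xj2 ?chiE ?Nx ?xS ?[x <= _ + j%:R * d]leNgt ?jx//=.
    by rewrite mulr1 mulr0 addr0 add0r.
move=> xn /=; rewrite !chiE (negbTE xn).
have xn2 : ~~ (- N <= x <= - N + j%:R * d).
  by apply: contra xn => /andP[-> xS]; rewrite (le_trans xS).
by rewrite xj2// (negbTE xn2) !mulr0 !addr0.
Qed.

Lemma step_supp (n : nat) g : step n%:R g -> cut n g = g.
Proof.
elim=> [|c a h Na aN sh IH]; apply/funext => x; rewrite /cut ?mulr0//.
rewrite mulrDr -[X in _ + X]/(cut n h x) IH mulrCA; congr (_ * _ + _).
rewrite !chiE; case: (leP (- n%:R) x) => //= Nx; rewrite ?mulr0//.
by case: (leP x a) => xa; rewrite ?mulr0// (le_trans xa aN) mulr1.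
Qed.

Definition step_dense (n : nat) f := forall e, 0 < e ->
  exists2 g, step n%:R g & nrm (f \- g) < e.

Lemma step_L2 (n : nat) g : step n%:R g -> L2 g.
Proof. by move=> /(stepP (expr1n _ 2) (ler0n _ n)) [[]]. Qed.

Lemma step_denseD n f1 f2 : L2 f1 -> L2 f2 -> step_dense n f1 -> step_dense n f2 ->
  step_dense n (f1 \+ f2).
Proof.
move=> L1 L2' d1 d2 e e0; have e2 : 0 < e / 2 by rewrite divr_gt0.
have [g1 s1 h1] := d1 _ e2; have [g2 s2 h2] := d2 _ e2.
exists (g1 \+ g2); first exact: stepD.
rewrite (_ : _ \- _ = (f1 \- g1) \+ (f2 \- g2)).
  apply: le_lt_trans (nrmD (L2B L1 (step_L2 s1)) (L2B L2' (step_L2 s2))) _.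
  by rewrite (splitr e) ltrD.
by apply/funext => x /=; rewrite opprD addrACA.
Qed.

Lemma step_denseZ n c f : L2 f -> step_dense n f -> step_dense n (fun x => c * f x).
Proof.
move=> Lf df e e0; have c1 : 0 < normc c + 1 by rewrite ltr_wpDl ?normc_ge0.
have [g sg h] := df _ (divr_gt0 e0 c1).
exists (fun x => c * g x); first exact: stepZ.
rewrite (_ : _ \- _ = (fun x => c * (f \- g) x)).
  rewrite nrmZ; last by apply: L2B => //; exact: step_L2 sg.
  apply: (@le_lt_trans _ _ ((normc c + 1) * nrm (f \- g))).
    by rewrite ler_wpM2r ?nrm_ge0// lerDl.
  by rewrite mulrC -ltr_pdivlMr.
by apply/funext => x /=; rewrite mulrBr.
Qed.

Lemma step_dense_lim n f (u : nat -> R -> R[i]) : L2 f -> (forall k, L2 (u k)) ->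
  (forall k, step_dense n (u k)) -> (fun k => nrm (u k \- f)) @ \oo --> (0 : R) ->
  step_dense n f.
Proof.
move=> Lf Lu du /cvg0P cu e e0; have e2 : 0 < e / 2 by rewrite divr_gt0.
have [k /(_ k (leqnn _)) hk] := cu (fun _ => nrm_ge0 _) _ e2.
have [g sg h] := du k _ e2; exists g => //.
apply: le_lt_trans (nrmB_triangle Lf (Lu k) (step_L2 sg)) _.
by rewrite (splitr e) ltrD// nrmBC.
Qed.

Lemma step_dense_continuous n (h : R -> R) (B : R) : continuous h ->
  (forall x, `|h x| <= B) -> step_dense n (cut n (fun x => (h x)%:C)).
Proof.
move=> ch hB.
pose N : R := n%:R; have N0 : 0 <= N by rewrite /N.
pose d m : R := 2 * N / m.+1%:R.
have d0 m : 0 <= d m by rewrite divr_ge0 ?mulr_ge0.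
have dN m : - N + m.+1%:R * d m = N.
  by rewrite /d mulrCA divff ?pnatr_eq0// mulr1; ring.
pose u m := grid_step N h (d m) m.+1.
have dN' m : - N + m.+1%:R * d m <= N by rewrite dN.
have P m := grid_stepP h N0 (d0 m) (dN' m).
have [Lu su] : (forall m, L2 (u m)) /\ (forall m, step N (u m)).
  by split => m; have [] := P m => // /step_L2.
have mh : cmeasurable (fun x => (h x)%:C) by apply: cm_real; exact: continuous_measurable_fun.
have mc : cmeasurable (cut n (fun x => (h x)%:C)) by apply: cmM => //; exact: cm_chi.
have B0 : 0 <= B by apply: le_trans (hB 0).
have [] := @L2_dominated _ u (cut n (fun x => (h x)%:C)) (fun x => B%:C * chi (- N) N x) _ mc.
- by move=> m; exact: L2_cm.
- by apply: L2Z; exact: L2_chi.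
- apply: ae_sameW => x m; rewrite normcM normcR (ger0_norm B0) normc_chi.
  have [_ /(_ x)] := P m; rewrite dN => -[h1 h2]; case: ifPn => [xN|/h2 h0].
    by have [t [_ _]] := h1 xN; rewrite /u => ->; rewrite normcR mulr1.
  by rewrite /u h0 normc0 mulr0.
- apply: ae_sameW => x; apply/cvg0P => [m|e e0]; first exact: normc_ge0.
  have /cvgrPdist_lt/(_ e e0)/nbhs_ballP[r /= r0 hr] := ch x.
  have [M HM] : exists M, forall m, (M <= m)%N -> d m < r.
    have := cvg0Z (2 * N) (@cvg_harmonic R).
    by move=> /cvg0P; apply.
  exists M => m /HM dm.
  have [_ /(_ x)] := P m; rewrite dN /cut chiE => -[h1 h2]; case: ifPn => [xN|/h2 h0].
    have [t [_ /andP[xt tx]]] := h1 xN; rewrite /u => ->; rewrite mul1r -rmorphB normcR distrC.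
    by apply: hr; rewrite /ball/= distrC ger0_norm ?subr_ge0// ltrBlDl (le_lt_trans tx)// ltrD2l.
  by rewrite /u h0 mul0r subrr normc0.
move=> Lc cu; apply: (step_dense_lim Lc Lu _ cu) => m e e0.
exists (u m) => //; rewrite (_ : _ \- _ = fun=> 0) ?nrm0//.
by apply/funext => x /=; rewrite subrr.
Qed.

(** Continuous functions approximate [h] in L^1 on the interval. Once they are clipped to [-B, B],
    the squared error is at most 2B times the absolute error, so the approximation holds in L^2. *)
Lemma step_dense_bounded n (h : R -> R) (B : R) : measurable_fun setT h ->
  (forall x, `|h x| <= B) -> step_dense n (cut n (fun x => (h x)%:C)).
Proof.
move=> mh hB.
have B0 : 0 <= B by apply: le_trans (hB 0).
pose E : set R := `[- n%:R, n%:R]%classic.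
have mE : measurable E by exact: measurable_itv.
have Ey : (mu E < +oo)%E.
  by rewrite /E /= lebesgue_measure_itv/=; case: ifP => _; rewrite -?EFinB ltry.
have ih : mu.-integrable E (EFin \o h).
  apply: (@le_integrable _ _ R mu E mE (EFin \o h) (cst B%:E)) => //.
  - by apply/measurable_EFinP; exact: measurable_funS mh.
  - by move=> x _ /=; rewrite lee_fin (ger0_norm B0).
  - by apply/integrableP; split => //; rewrite integral_cst// lte_mul_pinfty ?lee_fin.
have [g [cg ig gh]] := approximation_continuous_integrable mE Ey ih.
(* Truncation to [-B, B], written with absolute values so that continuity and the Lipschitz constant
   1 are immediate. *)
pose clip (y : R) := (`|y + B| - `|y - B|) / 2.
have clipB y : `|clip y| <= B.
  rewrite /clip normrM (@ger0_norm _ 2^-1)// ler_pdivrMr//.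
  apply: le_trans (ler_dist_dist _ _) _.
  have -> : y + B - (y - B) = B * 2 by ring.
  by rewrite ger0_norm// mulr_ge0.
have cliph y : `|y| <= B -> clip y = y.
  rewrite ler_norml /clip => /andP[y1 y2].
  rewrite ger0_norm; last by rewrite -(opprK B) subr_ge0.
  by rewrite ler0_norm ?subr_le0//; field.
have clipL y z : `|clip y - clip z| <= `|y - z|.
  rewrite /clip -mulrBl normrM (@ger0_norm _ 2^-1)// ler_pdivrMr//.
  have -> : `|y + B| - `|y - B| - (`|z + B| - `|z - B|) =
    (`|y + B| - `|z + B|) - (`|y - B| - `|z - B|) by ring.
  apply: le_trans (ler_normB _ _) _.
  have a1 := ler_dist_dist (y + B) (z + B); have a2 := ler_dist_dist (y - B) (z - B).
  have e1 : y + B - (z + B) = y - z by ring.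
  have e2 : y - B - (z - B) = y - z by ring.
  by move: a1 a2; rewrite e1 e2 => a1 a2; rewrite mulr_natr mulr2n lerD.
have cclip k : continuous (clip \o g k).
  move=> x; apply: cvgM; last exact: cvg_cst.
  by apply: cvgB; apply: cvg_norm; apply: cvgD; [exact: cg|exact: cvg_cst|exact: cg|exact: cvg_cst].
have mcl k : measurable_fun setT (clip \o g k) by exact: continuous_measurable_fun.
have Lb (k : R -> R) : measurable_fun setT k -> (forall x, `|k x| <= B) ->
    L2 (cut n (fun x => (k x)%:C)).
  move=> mk kB; have [] // := @L2_mulb _ B (fun x => (k x)%:C) (chi (- n%:R) n%:R) (cm_real mk) (L2_chi _ _).
    by apply: ae_sameW => x; rewrite normcR.
  by under eq_fun do rewrite mulrC.
apply: (step_dense_lim (Lb _ mh hB) (fun k => Lb _ (mcl k) (fun x => clipB (g k x)))).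
  by move=> k; apply: step_dense_continuous => // x; exact: clipB.
apply: nrm_cvg0P => [k|]; first by apply: L2B; [exact: (Lb _ (mcl k) (fun x => clipB (g k x)))|exact: (Lb _ mh hB)].
have le k : (sqint (cut n (fun x => ((clip \o g k) x)%:C) \- cut n (fun x => (h x)%:C))%R <=
    (2 * B)%:E * \int[mu]_(x in E) `|(h x - g k x)%:E|)%E.
  have mgk : measurable_fun setT (g k) by exact: continuous_measurable_fun.
  rewrite -ge0_integralZl//; last 2 first.
  - apply: measurableT_comp => //; apply/measurable_EFinP.
    by apply: measurable_funS measurableT _ _ => //; exact: measurable_funB.
  - by rewrite lee_fin mulr_ge0.
  rewrite integral_mkcond; apply: ge0_le_integral => //.
  - by move=> x _; rewrite lee_fin sqr_ge0.
  - by apply: measurable_sq; apply: L2_cm; apply: L2B; [exact: (Lb _ (mcl k) (fun x => clipB (g k x)))|exact: (Lb _ mh hB)].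
  - apply/(measurable_restrictT _ _).1 => //.
    apply: measurable_funeM; apply: measurableT_comp => //; apply/measurable_EFinP.
    by apply: measurable_funS measurableT _ _ => //; exact: measurable_funB.
  move=> x _.
  have -> : (cut n (fun x => ((clip \o g k) x)%:C) \- cut n (fun x => (h x)%:C)) x =
    chi (- n%:R) n%:R x * (((clip \o g k) x)%:C - (h x)%:C) by rewrite mulrBr.
  rewrite patchE /chi indicE /E.
  case: ifPn => xE; last by rewrite mul0r normc0 expr0n.
  rewrite mul1r -rmorphB normcR abse_EFin -EFinM lee_fin expr2 ler_pM//.
    by apply: le_trans (ler_normB _ _) _; rewrite mulr_natl mulr2n lerD// clipB.
  by rewrite -{1}(cliph (h x))//= distrC -(distrC (g k x)) distrC clipL.
apply: (@squeeze_cvge _ _ _ _ (cst 0%E) _ (fun k => (2 * B)%:E * \int[mu]_(x in E) `|(h x - g k x)%:E|)%E).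
- by apply: nearW => k; rewrite sqint_ge0 le.
- exact: cvg_cst.
- by rewrite -[X in _ --> X](mule0 (2 * B)%:E); apply: cvgeZl.
Qed.

(** Truncating the values at modulus k gives bounded functions that converge by domination; their
    real and imaginary parts fall under the bounded case. *)
Lemma step_dense_L2 n f : L2 f -> step_dense n (cut n f).
Proof.
move=> Lf; have mf := L2_cm Lf.
pose u (k : nat) x : R[i] := if normc (f x) <= k%:R then f x else 0.
pose I (k : nat) : set R := [set x | normc (f x) <= k%:R].
have mI k : measurable (I k).
  have := measurable_normc mf measurableT (measurable_itv `]-oo, k%:R]); rewrite setTI.
  by congr measurable; apply/seteqP; split => x /=; rewrite in_itv.
have uE k x : u k x = (\1_(I k) x : R)%:C * f x.
  rewrite /u indicE; case: ifPn => h; first by rewrite mem_set// mul1r.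
  by rewrite memNset ?mul0r// => /= h2; rewrite h2 in h.
have mu_ k : cmeasurable (u k).
  rewrite (_ : u k = fun x => (\1_(I k) x : R)%:C * f x); last by apply/funext => x; exact: uE.
  by apply: cmM => //; apply: cm_real; exact: measurable_indic.
have uf k x : normc (u k x) <= normc (f x).
  by rewrite /u; case: ifP => // _; rewrite normc0 normc_ge0.
have uk k x : normc (u k x) <= k%:R.
  by rewrite /u; case: ifP => // _; rewrite normc0.
have Lu k : L2 (u k) by apply: (L2_le (mu_ k) Lf _).1; apply: ae_sameW => x.
have [Lc _] := L2_cut n Lf.
have mc k : cmeasurable (cut n (u k)) by apply: L2_cm; have [] := L2_cut n (Lu k).
have uh : {ae mu, forall x, forall k, normc (cut n (u k) x) <= normc (f x)}.
  apply: ae_sameW => x k; rewrite normcM; apply: le_trans (uf k x).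
  by rewrite ler_piMl ?normc_ge0 ?normc_chi_le1.
have cuh : {ae mu, forall x, (fun k => normc (cut n (u k) x - cut n f x)) @ \oo --> (0 : R)}.
  apply: ae_sameW => x; apply: cvg_near_cst; near=> k; rewrite /cut /u.
  have -> : normc (f x) <= k%:R by near: k; exact: nbhs_infty_ger.
  by rewrite subrr normc0.
have [_ cu] := @L2_dominated _ (fun k => cut n (u k)) (cut n f) f mc (L2_cm Lc) Lf
  uh cuh.
apply: (step_dense_lim Lc _ _ cu); first by move=> k; have [] := L2_cut n (Lu k).
move=> k; have [m1 m2] := mu_ k.
have b1 x : `|complex.Re (u k x)| <= k%:R by apply: le_trans (normc_Re _) (uk k x).
have b2 x : `|complex.Im (u k x)| <= k%:R by apply: le_trans (normc_Im _) (uk k x).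
have d1 := step_dense_bounded n m1 b1; have d2 := step_dense_bounded n m2 b2.
have Lb (h : R -> R) : measurable_fun setT h -> (forall x, `|h x| <= k%:R) ->
    L2 (cut n (fun x => (h x)%:C)).
  move=> mk kB; have [] // := @L2_mulb _ k%:R (fun x => (h x)%:C) (chi (- n%:R) n%:R) (cm_real mk) (L2_chi _ _).
    by apply: ae_sameW => x; rewrite normcR.
  by under eq_fun do rewrite mulrC.
have := step_denseD (Lb _ m1 b1) (L2Z (0 +i* 1) (Lb _ m2 b2)) d1 (step_denseZ (0 +i* 1) (Lb _ m2 b2) d2).
congr step_dense; apply/funext => x /=; rewrite /cut mulrCA -mulrDr; congr (_ * _).
by case: (u k x) => a b; simpc.
Unshelve. all: by end_near. Qed.

Lemma le_inv_lim (x C : R) : 0 <= x -> (forall m : nat, x <= C / m.+1%:R) -> x = 0.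
Proof.
move=> x0 h; apply: cvg0_eq0 => // e e0.
have := cvg0Z (`|C|) (@cvg_harmonic R); move/cvg0P => /(_ (fun n => mulr_ge0 (normr_ge0 _) _) e e0).
case=> [n|M /(_ M (leqnn _)) hM]; first by rewrite invr_ge0.
apply: le_trans (h M) _; apply: le_trans (ltW hM).
by rewrite ler_wpM2r ?invr_ge0// ler_norm.
Qed.

(** Steps [g k] that converge to the cut in L^2 converge in L^1 too, since the support is bounded,
    so their transforms converge at every frequency. Fatou applied to differences, on which the
    isometry is known, upgrades this to convergence in mean. *)
Theorem Plancherel_cut s n f : s ^+ 2 = 1 -> L2 f ->
  L2 (FT s (cut n f)) /\ nrm (FT s (cut n f)) = nrm (cut n f).
Proof.
move=> s1 Lf; have [Lc _] := L2_cut n Lf.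
have [g Hg] : {g : nat -> R -> R[i] & forall k, step n%:R (g k) /\ nrm (cut n f \- g k) < k.+1%:R^-1}.
  apply: (@choice _ _ (fun k g => step n%:R g /\ nrm (cut n f \- g) < k.+1%:R^-1)) => k.
  have k0 : 0 < k.+1%:R^-1 :> R by rewrite invr_gt0.
  by have [g sg h] := step_dense_L2 n Lf k0; exists g.
have sg k : step n%:R (g k) by have [] := Hg k.
have ng k : nrm (cut n f \- g k) <= k.+1%:R^-1 by have [_ /ltW] := Hg k.
have S k := (stepP s1 (ler0n R n) (sg k)).1.
have [Lg cg LFg] : [/\ forall k, L2 (g k), forall k, cint (g k) & forall k, L2 (FT s (g k))].
  by split=> k; have [] := S k.
have cf := cint_cut n Lf.
have mF : cmeasurable (FT s (cut n f)) by apply: (cm_FT _ (ler0n _ n) cf) => x; exact: cut_supp.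
have pw xi : (fun k => normc (FT s (g k) xi - FT s (cut n f) xi)) @ \oo --> (0 : R).
  pose C := (Num.sqrt (2 * pi))^-1 * Num.sqrt (2 * n%:R) : R.
  apply: (@cvg0_le _ _ (fun k => C * k.+1%:R^-1)).
  - by move=> k; exact: normc_ge0.
  - move=> k; have e : FT s (g k) xi - FT s (cut n f) xi = FT s (g k \- cut n f) xi by rewrite FTB.
    rewrite e; apply: le_trans (FT_le _ _ _) _; first exact: cintB.
    rewrite /C -mulrA ler_wpM2l ?fcst_ge0//.
    have e2 : g k \- cut n f = cut n (g k \- cut n f).
      apply/funext => x; have := congr1 (@^~ x) (step_supp (sg k)).
      have := congr1 (@^~ x) (cut_idem n f); rewrite /cut => h2 h1.
      by rewrite mulrBr h1 h2.
    rewrite e2; apply: le_trans (nrm1_cut _ _) _; first exact: L2B.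
    by rewrite -e2 ler_wpM2l ?sqrtr_ge0// nrmBC.
  - exact: cvg0Z (@cvg_harmonic R).
(* For [k + m >= m] both steps are within 1/(m+1) of the cut, which gives the constant 2/(m+1). *)
have key m : (sqint (FT s (cut n f) \- FT s (g m))%R <= ((2 / m.+1%:R) ^+ 2)%:E)%E.
  apply: (@sqint_fatou _ (fun k => FT s (g (k + m)%N) \- FT s (g m))).
  - by move=> k; apply: L2_cm; exact: L2B.
  - by apply: cmB => //; exact: L2_cm.
  - apply: ae_sameW => x; have := pw x; rewrite -(cvg_shiftn m); apply: cvg_trans.
    apply: near_eq_cvg; apply: nearW => k; apply: (congr1 (@normc R)).
    by rewrite /= opprB addrA subrK.
  - move=> k; rewrite -nrm_sqr; last exact: L2B.
    have sgm : step n%:R (g (k + m)%N \- g m).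
      have := stepD (sg (k + m)%N) (stepZ (-1) (sg m)); congr step.
      by apply/funext => x /=; rewrite mulN1r.
    rewrite -FTB// (step_isometry s1 (ler0n _ n) sgm).
    rewrite lee_fin ler_pXn2r ?nnegrE ?nrm_ge0 ?divr_ge0//.
    apply: le_trans (nrmB_triangle (Lg _) Lc (Lg _)) _.
    have -> : 2 / m.+1%:R = m.+1%:R^-1 + m.+1%:R^-1 :> R by rewrite -mulr2n mulr_natl.
    apply: lerD => //; rewrite nrmBC (le_trans (ng _))// lef_pV2 ?posrE// ler_nat ltnS.
    exact: leq_addl.
have Ld m : L2 (FT s (cut n f) \- FT s (g m)).
  by apply/L2P; split; [apply: cmB => //; exact: L2_cm|exact: le_lt_trans (key m) (ltry _)].
have LF : L2 (FT s (cut n f)).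
  have := L2D (Ld 0%N) (LFg 0%N); congr L2; apply/funext => x /=.
  by rewrite subrK.
split => //; apply/eqP; rewrite -subr_eq0 -normr_eq0; apply/eqP.
(* Two units of 1/(m+1) come from the distance of the transforms and one from the distance of [g m]
   to the cut. *)
apply: (@le_inv_lim _ 3) => // m.
have a1 : `|nrm (FT s (cut n f)) - nrm (g m)| <= 2 / m.+1%:R.
  rewrite -(step_isometry s1 (ler0n _ n) (sg m)).
  apply: le_trans (nrm_dist LF (LFg m)) _.
  by rewrite -(@ler_pXn2r _ 2)// ?nnegrE ?nrm_ge0 ?divr_ge0// -lee_fin nrm_sqr.
have a2 : `|nrm (g m) - nrm (cut n f)| <= m.+1%:R^-1.
  by apply: le_trans (nrm_dist (Lg m) Lc) _; rewrite nrmBC.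
have := ler_distD (nrm (g m)) (nrm (FT s (cut n f))) (nrm (cut n f)).
move=> /le_trans; apply; apply: le_trans (lerD a1 a2) _.
by rewrite -[X in _ + X]mul1r -mulrDl -(natrD R 2 1).
Qed.

End Plancherel.

(** * The Fourier transform on L^2 *)

Section FourierL2.
Context {R : realType}.
Implicit Types (f g : R -> R[i]) (s x xi : R).
Local Notation mu := (@lebesgue_measure R).
Local Notation Fo := (@fourier_phase R).

Lemma cvg_nrm_unique (u : nat -> R -> R[i]) f g : (forall n, L2 (u n)) -> L2 f -> L2 g ->
  (fun n => nrm (u n \- f)) @ \oo --> (0 : R) -> (fun n => nrm (u n \- g)) @ \oo --> (0 : R) ->
  ae_same f g.
Proof.
move=> Lu Lf Lg cf cg.
have : nrm (f \- g) = 0.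
  apply: cvg0_eq0 (nrm_ge0 _) _ => e e0.
  have /cvg0P := cvg0D cf cg => /(_ (fun n => addr_ge0 (nrm_ge0 _) (nrm_ge0 _)) e e0).
  move=> [N /(_ N (leqnn N)) h]; apply: le_trans (ltW h).
  by rewrite (nrmBC (u N) f); exact: nrmB_triangle.
move/(nrm_eq0 (L2B Lf Lg)).1; apply: ae_imp => x /= /eqP.
by rewrite subr_eq0 => /eqP.
Qed.

Lemma cvg_nrm_norm (u : nat -> R -> R[i]) f : (forall n, L2 (u n)) -> L2 f ->
  (fun n => nrm (u n \- f)) @ \oo --> (0 : R) -> (fun n => nrm (u n)) @ \oo --> nrm f.
Proof.
move=> Lu Lf /cvgrPdist_lt cf; apply/cvgrPdist_lt => e /cf; apply: filterS => n.
rewrite sub0r normrN ger0_norm ?nrm_ge0// => /(le_lt_trans _); apply.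
by rewrite distrC nrm_dist.
Qed.

Lemma cvg_eqfun (x y : nat -> R) (l : R) : (forall n, x n = y n) ->
  y @ \oo --> l -> x @ \oo --> l.
Proof. by move=> /funext ->. Qed.

Lemma cutB n f g : cut n (f \- g) = cut n f \- cut n g.
Proof. by apply/funext => x; rewrite /cut /= mulrBr. Qed.

Lemma cutD n f g : cut n (f \+ g) = cut n f \+ cut n g.
Proof. by apply/funext => x; rewrite /cut /= mulrDr. Qed.

Lemma cut_cut n m f : (m <= n)%N -> cut n (cut m f) = cut m f.
Proof.
move=> mn; apply/funext => x; rewrite /cut !chiE.
case: ifPn => [|h]; first by rewrite mul1r.
case: ifPn => [/andP[h1 h2]|]; last by rewrite !mul0r.
move: h; rewrite negb_and -!ltNge => /orP[|].
  rewrite ltNge (le_trans _ h1)//; last by rewrite lerN2 ler_nat.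
by rewrite ltNge (le_trans h2)// ler_nat.
Qed.

Lemma FT_cut_dist s n m f : s ^+ 2 = 1 -> L2 f ->
  nrm (FT s (cut n f) \- FT s (cut m f)) = nrm (cut n f \- cut m f).
Proof.
move=> s1 Lf; rewrite -FTB; [|exact: cint_cut..].
have e : cut n f \- cut m f = cut (maxn n m) (cut n f \- cut m f).
  by rewrite cutB !cut_cut ?leq_maxl ?leq_maxr.
rewrite e; have [] // := @Plancherel_cut R s (maxn n m) (cut n f \- cut m f) s1.
by apply: L2B; [exact: (L2_cut n Lf).1|exact: (L2_cut m Lf).1].
Qed.

(** Differences of cuts are transformed isometrically, so the truncated transforms are Cauchy. With
    existence established, the function picked by [xget] has its defining property. *)
Lemma FoP s f : s ^+ 2 = 1 -> L2 f -> L2 (Fo s f) /\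
  (fun n => nrm (FT s (cut n f) \- Fo s f)) @ \oo --> (0 : R).
Proof.
move=> s1 Lf.
have LF n : L2 (FT s (cut n f)) := (Plancherel_cut n s1 Lf).1.
have [G LG cG] : exists2 G, L2 G & (fun n => nrm (FT s (cut n f) \- G)) @ \oo --> (0 : R).
  apply: L2_complete => // e e0; have e2 : 0 < e / 2 by rewrite divr_gt0.
  have /cvg0P := cut_cvg Lf => /(_ (fun n => nrm_ge0 _) _ e2) [N HN].
  exists N => n m Nn Nm; rewrite FT_cut_dist//.
  apply: le_lt_trans (nrmB_triangle (L2_cut n Lf).1 Lf (L2_cut m Lf).1) _.
  by rewrite (splitr e) ltrD// ?HN// nrmBC HN.
have : exists G, [set F | L2 F /\
       (fun n => L2norm (F \- truncated_fourier s f n)) @ \oo --> 0%E] G.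
  exists G; split => //.
  have e : (fun n => L2norm (G \- truncated_fourier s f n)) =
     EFin \o (fun n => nrm (FT s (cut n f) \- G)).
    by apply/funext => n /=; rewrite nrmBC truncated_fourierE L2normK//; exact: L2B.
  by rewrite e; apply: cvg_EFin => //; exact: nearW.
move=> /(xgetPex (fun=> 0)) [L c]; split => //.
have e : (fun n => nrm (FT s (cut n f) \- Fo s f)) =
    fine \o (fun n => L2norm (Fo s f \- truncated_fourier s f n)).
  by apply/funext => n /=; rewrite nrmBC truncated_fourierE.
by rewrite e; apply: fine_cvg.
Qed.

Lemma L2_Fo s f : s ^+ 2 = 1 -> L2 f -> L2 (Fo s f).
Proof. by move=> s1 Lf; have [] := FoP s1 Lf. Qed.

Lemma nrm_Fo s f : s ^+ 2 = 1 -> L2 f -> nrm (Fo s f) = nrm f.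
Proof.
move=> s1 Lf; have [LF cF] := FoP s1 Lf.
have h1 := cvg_nrm_norm (fun n => (Plancherel_cut n s1 Lf).1) LF cF.
have h2 := cvg_nrm_norm (fun n => (L2_cut n Lf).1) Lf (cut_cvg Lf).
apply: cvg_unique h2 => //; apply: cvg_eqfun h1 => n.
by rewrite (Plancherel_cut n s1 Lf).2.
Qed.

Lemma Fo_unique s f g : s ^+ 2 = 1 -> L2 f -> L2 g ->
  (fun n => nrm (FT s (cut n f) \- g)) @ \oo --> (0 : R) -> ae_same (Fo s f) g.
Proof.
move=> s1 Lf Lg cg; have [LF cF] := FoP s1 Lf.
exact: cvg_nrm_unique (fun n => (Plancherel_cut n s1 Lf).1) LF Lg cF cg.
Qed.

Lemma FoD s f g : s ^+ 2 = 1 -> L2 f -> L2 g ->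
  ae_same (Fo s (f \+ g)) (Fo s f \+ Fo s g).
Proof.
move=> s1 Lf Lg; have [LF cF] := FoP s1 Lf; have [LG cG] := FoP s1 Lg.
apply: Fo_unique => //; [exact: L2D|exact: L2D|].
apply: cvg0_le (cvg0D cF cG) => n; first exact: nrm_ge0.
rewrite cutD FTD; [|exact: cint_cut..].
set a := FT _ _; set b := FT _ _.
rewrite (_ : _ \- _ = (a \- Fo s f) \+ (b \- Fo s g)).
  by apply: nrmD; apply: L2B => //; exact: (Plancherel_cut n s1 _).1.
by apply/funext => x /=; rewrite opprD addrACA.
Qed.

Lemma FoZ s c f : s ^+ 2 = 1 -> L2 f ->
  ae_same (Fo s (fun x => c * f x)) (fun x => c * Fo s f x).
Proof.
move=> s1 Lf; have [LF cF] := FoP s1 Lf.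
apply: Fo_unique => //; [exact: L2Z|exact: L2Z|].
have e : (fun n => nrm (FT s (cut n (fun x => c * f x)) \- (fun x => c * Fo s f x))) =
   (fun n => normc c * nrm (FT s (cut n f) \- Fo s f)).
  apply/funext => n; rewrite -nrmZ; last by apply: L2B => //; exact: (Plancherel_cut n s1 Lf).1.
  congr nrm; apply/funext => x; rewrite /= mulrBr; congr (_ - _).
  rewrite -[RHS]/((fun x => c * FT s (cut n f) x) x) -FTZ; last exact: cint_cut.
  apply: (congr1 (fun F => FT s F x)); apply/funext => y; exact: mulrCA.
by rewrite e; exact: cvg0Z.
Qed.

Lemma FoB s f g : s ^+ 2 = 1 -> L2 f -> L2 g ->
  ae_same (Fo s (f \- g)) (Fo s f \- Fo s g).
Proof.
move=> s1 Lf Lg; have h1 := FoD s1 Lf (L2Z (-1) Lg); have h2 := FoZ (-1) s1 Lg.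
rewrite (_ : f \- g = f \+ (fun x => -1 * g x)); last first.
  by apply/funext => x /=; rewrite mulN1r.
by apply: ae_imp2 h1 h2 => x /= -> ->; rewrite mulN1r.
Qed.

Lemma Fo_dist s f g : s ^+ 2 = 1 -> L2 f -> L2 g ->
  nrm (Fo s f \- Fo s g) = nrm (f \- g).
Proof.
move=> s1 Lf Lg; rewrite -(nrm_Fo s1 (L2B Lf Lg)); apply/esym/nrm_ae.
- by apply: L2_Fo => //; exact: L2B.
- by apply: L2B; exact: L2_Fo.
- exact: FoB.
Qed.

Lemma ae_nrmB f g : L2 f -> L2 g -> ae_same f g <-> nrm (f \- g) = 0.
Proof.
move=> Lf Lg; split => [h|/(nrm_eq0 (L2B Lf Lg)).1].
  by apply/(nrm_eq0 (L2B Lf Lg)); apply: ae_imp h => x /= ->; rewrite subrr.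
by apply: ae_imp => x /= /eqP; rewrite subr_eq0 => /eqP.
Qed.

Lemma Fo_ae s f g : s ^+ 2 = 1 -> L2 f -> L2 g -> ae_same f g ->
  ae_same (Fo s f) (Fo s g).
Proof.
move=> s1 Lf Lg fg; apply/ae_nrmB; [exact: L2_Fo|exact: L2_Fo|].
by rewrite Fo_dist//; exact/ae_nrmB.
Qed.

Lemma Fo_lim s (u : nat -> R -> R[i]) f : s ^+ 2 = 1 -> (forall n, L2 (u n)) -> L2 f ->
  (fun n => nrm (u n \- f)) @ \oo --> (0 : R) ->
  (fun n => nrm (Fo s (u n) \- Fo s f)) @ \oo --> (0 : R).
Proof.
move=> s1 Lu Lf; apply: cvg_eqfun => n.
by rewrite Fo_dist.
Qed.

Lemma Fo_modulation s h f : s ^+ 2 = 1 -> L2 f ->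
  ae_same (Fo s (fun x => cis (h * x) * f x)) (shift (s * h) (Fo s f)).
Proof.
move=> s1 Lf; have [LF cF] := FoP s1 Lf.
have mc : cmeasurable (fun x => cis (h * x)).
  by apply: cm_cis; apply: measurable_funM => //; exact: measurable_cst.
have Lm : L2 (fun x => cis (h * x) * f x).
  by have [] := L2_mulU mc Lf (fun x => normc_cis _).
apply: Fo_unique => //; first exact: (L2_shift _ LF).1.
apply: cvg_eqfun cF => n.
have LB : L2 (FT s (cut n f) \- Fo s f) by apply: L2B => //; exact: (Plancherel_cut n s1 Lf).1.
rewrite -(L2_shift (s * h) LB).2; apply: (congr1 (@nrm R)); apply/funext => xi.
rewrite /shift; apply: (congr1 (fun z => z - _)).
apply: (congr1 (fun F => fcst * ci F)); apply/funext => x.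
have -> : cis (s * (x * (xi + s * h))) = cis (s * (x * xi)) * cis (h * x).
  rewrite -cisD; congr cis.
  have -> : s * (x * (xi + s * h)) = s * (x * xi) + s ^+ 2 * (h * x) by ring.
  by rewrite s1 mul1r.
rewrite /cut; move: (cis _) (cis _) (chi _ _ _) (f x) => a b c d; ring.
Qed.

Lemma pr_cvg (u v : nat -> R -> R[i]) f g (l : R[i]) : (forall n, L2 (u n)) -> (forall n, L2 (v n)) ->
  L2 f -> L2 g -> (fun n => nrm (u n \- f)) @ \oo --> (0 : R) ->
  (fun n => nrm (v n \- g)) @ \oo --> (0 : R) ->
  (fun n => normc (pr (u n) (v n) - pr f g)) @ \oo --> (0 : R).
Proof.
move=> Lu Lv Lf Lg cu cv.
have cvv := cvg_nrm_norm Lv Lg cv.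
have c1 : (fun n => nrm (u n \- f) * nrm (v n)) @ \oo --> (0 : R).
  by rewrite -[X in _ --> X](mul0r (nrm g)); exact: cvgM.
apply: cvg0_le (cvg0D c1 (cvg0Z (nrm f) cv)) => n; first exact: normc_ge0.
have -> : pr (u n) (v n) - pr f g = pr (u n \- f) (v n) + pr f (v n \- g).
  by rewrite prBl// prBr// addrA subrK.
by apply: le_trans (normcD _ _) _; apply: lerD; apply: pr_le => //; exact: L2B.
Qed.

Local Notation T := (measurableTypeR R).

(** A majorant of product form makes the kernel integrable on the product and makes every section
    integrable, so that the iterated real integrals are genuine. *)
Lemma rFubini (k : R -> R -> R) (a b : R -> R) :
  measurable_fun setT (fun z : T * T => k z.1 z.2) ->
  mu.-integrable setT (EFin \o a) -> mu.-integrable setT (EFin \o b) ->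
  (forall x, 0 <= a x) -> (forall y, 0 <= b y) ->
  (forall x y, `|k x y| <= a x * b y) ->
  \int[mu]_x (\int[mu]_y k x y) = \int[mu]_y (\int[mu]_x k x y).
Proof.
move=> mk ia ib a0 b0 kab.
have mk1 x : measurable_fun (setT : set T) (k x).
  exact: (measurableT_comp mk (pair1_measurable (x : T))).
have mk2 y : measurable_fun (setT : set T) (k^~ y).
  exact: (measurableT_comp mk (pair2_measurable (y : T))).
have i1 x : mu.-integrable setT (EFin \o k x).
  have h := integrableZl measurableT (a x) ib.
  apply: (le_integrable measurableT _ _ h); first exact/measurable_EFinP.
  by move=> y _ /=; rewrite lee_fin (le_trans (kab x y))// ler_norm.
have i2 y : mu.-integrable setT (EFin \o k^~ y).
  have h := integrableZl measurableT (b y) ia.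
  apply: (le_integrable measurableT _ _ h); first exact/measurable_EFinP.
  by move=> x _ /=; rewrite lee_fin mulrC (le_trans (kab x y))// ler_norm.
rewrite /Rintegral; congr fine.
transitivity (\int[mu]_x \int[mu]_y (k x y)%:E)%E.
  by apply: eq_integral => x _; rewrite /= fineK//; exact: (integrable_fin_num measurableT (i1 x)).
transitivity (\int[mu]_y \int[mu]_x (k x y)%:E)%E; last first.
  by apply: eq_integral => y _; rewrite /= fineK//; exact: (integrable_fin_num measurableT (i2 y)).
have mE : measurable_fun setT (fun z : T * T => (k z.1 z.2)%:E) by exact/measurable_EFinP.
apply: (@Fubini _ _ T T R mu mu (fun z => (k z.1 z.2)%:E)).
apply/(integrable12ltyP mu mu mE) => /=.
have /integrableP[ma ay] := ia; have /integrableP[mb b_y] := ib.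
apply: (@le_lt_trans _ _ (\int[mu]_x ((a x)%:E * \int[mu]_y (b y)%:E))%E).
  apply: ge0_le_integral => //.
  - by move=> x _; apply: integral_ge0.
  - have mab : measurable_fun setT (fun z : T * T => `|(k z.1 z.2)%:E|%E) by exact: measurableT_comp.
    exact: (@measurable_fun_fubini_tonelli_F _ _ T T R mu _ mab (fun z => abse_ge0 _)).
  - exact: emeasurable_funM.
  - move=> x _; rewrite -ge0_integralZl//; [|by move=> ? _; rewrite lee_fin|by rewrite lee_fin].
    apply: ge0_le_integral => //.
    + have /measurable_EFinP mn : measurable_fun (setT : set T) (fun y => `|k x y|).
        by apply: measurableT_comp => //; exact: mk1.
      exact: mn.
    + by apply: measurable_funeM.
    + by move=> y _; rewrite -EFinM lee_fin.
have b1 : (\int[mu]_y (b y)%:E)%E \is a fin_num by exact: integrable_fin_num ib.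
have a1 : (\int[mu]_y (a y)%:E)%E \is a fin_num by exact: integrable_fin_num ia.
rewrite ge0_integralZr//; [|by move=> ? _; rewrite lee_fin|by apply: integral_ge0 => y _; rewrite lee_fin].
by rewrite -(fineK a1) -(fineK b1) -EFinM ltry.
Qed.

Lemma cFubini (f g : R -> R[i]) s : cint f -> cint g ->
  ci (fun xi => ci (fun x => cis (s * (x * xi)) * f x) * g xi) =
  ci (fun x => f x * ci (fun xi => cis (s * (xi * x)) * g xi)).
Proof.
move=> cf cg; pose H x xi : R[i] := cis (s * (x * xi)) * f x * g xi.
have Hb x xi : normc (H x xi) <= normc (f x) * normc (g xi).
  by rewrite /H !normcM normc_cis mul1r.
have e1 xi : ci (fun x => cis (s * (x * xi)) * f x) * g xi = ci (fun x => H x xi).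
  rewrite mulrC -ciZ; last exact: cint_phase.
  by apply: (congr1 ci); apply/funext => x; rewrite mulrC.
have e2 x : f x * ci (fun xi => cis (s * (xi * x)) * g xi) = ci (fun xi => H x xi).
  rewrite -ciZ; last exact: cint_phase.
  apply: (congr1 ci); apply/funext => xi; rewrite /H (mulrC xi x).
  by move: (cis _) (f x) (g xi) => a b c; ring.
under eq_fun do rewrite e1; under [in RHS]eq_fun do rewrite e2.
have [[mf1 mf2] _] := cf; have [[mg1 mg2] _] := cg.
have mph : measurable_fun setT (fun z : T * T => s * (z.1 * z.2)).
  by apply: measurable_funM => //; apply: measurable_funM.
have mc : measurable_fun setT (fun z : T * T => cos (s * (z.1 * z.2))).
  apply: (@measurableT_comp _ _ _ _ _ _ (@cos R)) => //.
  by apply: continuous_measurable_fun; exact: continuous_cos.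
have ms : measurable_fun setT (fun z : T * T => sin (s * (z.1 * z.2))).
  apply: (@measurableT_comp _ _ _ _ _ _ (@sin R)) => //.
  by apply: continuous_measurable_fun; exact: continuous_sin.
have c1 (h : R -> R) : measurable_fun setT h -> measurable_fun setT (fun z : T * T => h z.1).
  move=> mh; have mh' : measurable_fun (setT : set T) (h : T -> R) by exact: mh.
  exact: (measurableT_comp mh' measurable_fst).
have c2 (h : R -> R) : measurable_fun setT h -> measurable_fun setT (fun z : T * T => h z.2).
  move=> mh; have mh' : measurable_fun (setT : set T) (h : T -> R) by exact: mh.
  exact: (measurableT_comp mh' measurable_snd).
have mHR : measurable_fun setT (fun z : T * T => complex.Re (H z.1 z.2)).
  rewrite (_ : (fun z => _) = (fun z : T * T =>
     (cos (s * (z.1 * z.2)) * complex.Re (f z.1) - sin (s * (z.1 * z.2)) * complex.Im (f z.1)) * complex.Re (g z.2) -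
     (cos (s * (z.1 * z.2)) * complex.Im (f z.1) + sin (s * (z.1 * z.2)) * complex.Re (f z.1)) * complex.Im (g z.2))); last first.
    by apply/funext => z; rewrite /H; case: (f z.1) => a1 a2; case: (g z.2) => b1 b2.
  apply: measurable_funB; apply: measurable_funM.
  - by apply: measurable_funB; apply: measurable_funM => //; [exact: (c1 (fun x => complex.Re (f x)))|exact: (c1 (fun x => complex.Im (f x)))].
  - exact: (c2 (fun x => complex.Re (g x))).
  - by apply: measurable_funD; apply: measurable_funM => //; [exact: (c1 (fun x => complex.Im (f x)))|exact: (c1 (fun x => complex.Re (f x)))].
  - exact: (c2 (fun x => complex.Im (g x))).
have mHI : measurable_fun setT (fun z : T * T => complex.Im (H z.1 z.2)).
  rewrite (_ : (fun z => _) = (fun z : T * T =>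
     (cos (s * (z.1 * z.2)) * complex.Re (f z.1) - sin (s * (z.1 * z.2)) * complex.Im (f z.1)) * complex.Im (g z.2) +
     (cos (s * (z.1 * z.2)) * complex.Im (f z.1) + sin (s * (z.1 * z.2)) * complex.Re (f z.1)) * complex.Re (g z.2))); last first.
    by apply/funext => z; rewrite /H; case: (f z.1) => a1 a2; case: (g z.2) => b1 b2.
  apply: measurable_funD; apply: measurable_funM.
  - by apply: measurable_funB; apply: measurable_funM => //; [exact: (c1 (fun x => complex.Re (f x)))|exact: (c1 (fun x => complex.Im (f x)))].
  - exact: (c2 (fun x => complex.Im (g x))).
  - by apply: measurable_funD; apply: measurable_funM => //; [exact: (c1 (fun x => complex.Im (f x)))|exact: (c1 (fun x => complex.Re (f x)))].
  - exact: (c2 (fun x => complex.Re (g x))).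
apply: complexP; apply/esym.
- apply: (rFubini (k := fun x xi => complex.Re (H x xi)) mHR (cint_normc cf) (cint_normc cg)).
  + by move=> x; exact: normc_ge0.
  + by move=> x; exact: normc_ge0.
  + by move=> x y; exact: le_trans (normc_Re _) (Hb x y).
- apply: (rFubini (k := fun x xi => complex.Im (H x xi)) mHI (cint_normc cf) (cint_normc cg)).
  + by move=> x; exact: normc_ge0.
  + by move=> x; exact: normc_ge0.
  + by move=> x y; exact: le_trans (normc_Im _) (Hb x y).
Qed.

Lemma pr_FT s n m f g : s ^+ 2 = 1 -> L2 f -> L2 g ->
  pr (FT s (cut n f)) (cut m g) = pr (cut n f) (FT s (cut m g)).
Proof.
move=> s1 Lf Lg; have cf := cint_cut n Lf; have cg := cint_cut m Lg.
have [c1 _] := L2_mul (Plancherel_cut n s1 Lf).1 (L2_cut m Lg).1.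
have [c2 _] := L2_mul (L2_cut n Lf).1 (Plancherel_cut m s1 Lg).1.
have k0 : fcst != 0 :> R[i].
  rewrite -normc_eq0 normc_fcst invr_neq0// gt_eqF// sqrtr_gt0 mulr_gt0//.
  exact: pi_gt0.
pose P1 xi := ci (fun x => cis (s * (x * xi)) * cut n f x) * cut m g xi.
pose P2 x := cut n f x * ci (fun xi => cis (s * (xi * x)) * cut m g xi).
have i1 : cint P1.
  have := cintZ fcst^-1 c1; congr cint; apply/funext => xi.
  by rewrite /FT -[_ * _ * _]mulrA mulKf.
have i2 : cint P2.
  have := cintZ fcst^-1 c2; congr cint; apply/funext => xi.
  by rewrite /FT mulrCA mulKf.
transitivity (fcst * ci P1).
  rewrite -ciZ//; apply: (congr1 ci); apply/funext => xi; rewrite /FT /P1.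
  by rewrite mulrA.
rewrite /P1 (cFubini s cf cg) -/P2 -ciZ//; apply: (congr1 ci); apply/funext => x.
by rewrite /FT /P2 mulrCA.
Qed.

(** Symmetry holds for cuts by Fubini, and both sides are continuous in the L^2 norms. *)
Lemma pr_Fo s f g : s ^+ 2 = 1 -> L2 f -> L2 g -> pr (Fo s f) g = pr f (Fo s g).
Proof.
move=> s1 Lf Lg; have [LF cF] := FoP s1 Lf; have [LG cG] := FoP s1 Lg.
have c1 := pr_cvg 0 (fun n => (Plancherel_cut n s1 Lf).1) (fun n => (L2_cut n Lg).1) LF Lg cF (cut_cvg Lg).
have c2 := pr_cvg 0 (fun n => (L2_cut n Lf).1) (fun n => (Plancherel_cut n s1 Lg).1) Lf LG (cut_cvg Lf) cG.
apply/eqP; rewrite -subr_eq0 -normc_eq0; apply/eqP; apply: cvg0_eq0 (normc_ge0 _) _ => e e0.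
have /cvg0P := cvg0D c1 c2 => /(_ (fun n => addr_ge0 (normc_ge0 _) (normc_ge0 _)) e e0).
move=> [N /(_ N (leqnn N)) h]; apply: le_trans (ltW h); move: h => _.
rewrite (normcBC _ (pr (Fo s f) g)) pr_FT//; exact: normcB_triangle.
Qed.

Lemma FT_neg_conj s n f : L2 f ->
  FT s (cut n (fun x => conjc (f x))) = fun xi => conjc (FT (- s) (cut n f) xi).
Proof.
move=> Lf; rewrite -FT_conj; last exact: cint_cut.
by congr FT; apply/funext => x; rewrite /cut conjcM /chi conjcR.
Qed.

Lemma Fo_conj s f : s ^+ 2 = 1 -> L2 f ->
  ae_same (Fo s (fun x => conjc (f x))) (fun xi => conjc (Fo (- s) f xi)).
Proof.
move=> s1 Lf; have s1' : (- s) ^+ 2 = 1 by rewrite sqrrN.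
have [LF cF] := FoP s1' Lf.
apply: Fo_unique => //; [exact: L2_conj|exact: L2_conj|].
apply: cvg_eqfun cF => n.
rewrite FT_neg_conj// -nrm_conj; apply: (congr1 (@nrm R)); apply/funext => x.
have cB (a b : R[i]) : conjc (conjc a - conjc b) = a - b.
  by case: a => a1 a2; case: b => b1 b2; rewrite /= opprD !opprK.
exact: cB.
Qed.

Lemma nrm_sqrD f g : L2 f -> L2 g -> nrm (f \+ g) ^+ 2 =
  nrm f ^+ 2 + nrm g ^+ 2 + 2 * complex.Re (pr f (fun x => conjc (g x))).
Proof.
move=> Lf Lg; have Lfg := L2D Lf Lg.
have Lcf := L2_conj Lf; have Lcg := L2_conj Lg.
have e : pr (f \+ g) (fun x => conjc ((f \+ g) x)) =
   pr f (fun x => conjc (f x)) + pr g (fun x => conjc (g x)) +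
   (pr f (fun x => conjc (g x)) + conjc (pr f (fun x => conjc (g x)))).
  have -> : (fun x => conjc ((f \+ g) x)) = (fun x => conjc (f x)) \+ (fun x => conjc (g x)).
    by apply/funext => x /=; rewrite rmorphD.
  rewrite prDl//; last exact: L2D.
  rewrite ![pr _ (_ \+ _)]prC !prDl//.
  have -> : conjc (pr f (fun x => conjc (g x))) = pr (fun x => conjc (f x)) g.
    rewrite /pr -ci_conj; last exact: (L2_mul Lf Lcg).1.
    by congr ci; apply/funext => x; rewrite conjcM conjcK.
  rewrite (prC (fun x => conjc (f x)) f) (prC (fun x => conjc (g x)) g).
  rewrite (prC (fun x => conjc (g x)) f).
  move: (pr _ _) (pr _ _) (pr _ _) (pr _ _) => a b c d; ring.
have := congr1 (@complex.Re R) e; rewrite !pr_conj//.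
by rewrite !ReD; case: (pr _ _) => a b /= ->; ring.
Qed.

(** Unitarity from isometry by polarisation: the norm of a sum gives the real part of the Hermitian
    product. *)
Lemma pr_Fo_conj s f g : s ^+ 2 = 1 -> L2 f -> L2 g ->
  pr (Fo s f) (fun x => conjc (Fo s g x)) = pr f (fun x => conjc (g x)).
Proof.
move=> s1.
have re h k : L2 h -> L2 k -> complex.Re (pr (Fo s h) (fun x => conjc (Fo s k x))) =
   complex.Re (pr h (fun x => conjc (k x))).
  move=> Lh Lk; have e1 := nrm_sqrD Lh Lk.
  have e2 := nrm_sqrD (L2_Fo s1 Lh) (L2_Fo s1 Lk).
  have e3 : nrm (Fo s h \+ Fo s k) = nrm (h \+ k).
    rewrite -(nrm_Fo s1 (L2D Lh Lk)); apply/esym/nrm_ae; last exact: FoD.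
      by apply: L2_Fo => //; exact: L2D.
    by apply: L2D; exact: L2_Fo.
  by move: e2; rewrite e3 !nrm_Fo// e1 => /addrI/mulfI -> //; rewrite pnatr_eq0.
move=> Lf Lg; apply: complexP; first exact: re.
(* The real part for [- i f] is the imaginary part for [f]. *)
have := re (fun x => (0 -i* 1) * f x) g (L2Z _ Lf) Lg.
have Lcg := L2_conj Lg; have LcF := L2_conj (L2_Fo s1 Lg).
have LZ := L2Z (0 -i* 1) (L2_Fo s1 Lf).
rewrite (pr_ae (L2_Fo s1 (L2Z _ Lf)) LZ LcF LcF (FoZ _ s1 Lf) (ae_same_refl _)).
rewrite prZl//; last exact: L2_Fo.
rewrite prZl//; move: (pr _ _) (pr _ _) => [a b] [c d] /=.
by rewrite !mul0r !sub0r !mulN1r !opprK.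
Qed.

(** The error is tested against an arbitrary [g]. Symmetry moves the inverse transform onto [g],
    conjugation turns it into the conjugate of a direct transform, and unitarity concludes; no
    inversion kernel is computed. *)
Theorem Fo_inv s f : s ^+ 2 = 1 -> L2 f -> ae_same (Fo (- s) (Fo s f)) f.
Proof.
move=> s1 Lf; have s1' : (- s) ^+ 2 = 1 by rewrite sqrrN.
have LF := L2_Fo s1 Lf; have LFF := L2_Fo s1' LF.
have Ld := L2B LFF Lf.
have : ae_same (Fo (- s) (Fo s f) \- f) (fun=> 0).
  apply: pr_eq0 => // g Lg; rewrite prBl//; apply/eqP; rewrite subr_eq0; apply/eqP.
  rewrite pr_Fo//; pose k x := conjc (g x); have Lk : L2 k by exact: L2_conj.
  have gE : g = (fun x => conjc (k x)) by apply/funext => x; rewrite /k conjcK.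
  rewrite gE -(pr_Fo_conj s1 Lf Lk).
  have h := Fo_conj s1' Lk; rewrite opprK in h.
  exact: (pr_ae LF LF (L2_Fo s1' (L2_conj Lk)) (L2_conj (L2_Fo s1 Lk)) (ae_same_refl _) h).
by apply: ae_imp => x /= /eqP; rewrite subr_eq0 => /eqP.
Qed.

(** Cuts do not commute with translation, so the rule is derived from the one for modulations by
    inverting the transform. *)
Lemma Fo_shift s h f : s ^+ 2 = 1 -> L2 f ->
  ae_same (Fo s (shift h f)) (fun xi => cis (- (s * h) * xi) * Fo s f xi).
Proof.
move=> s1 Lf; have s1' : (- s) ^+ 2 = 1 by rewrite sqrrN.
have LF := L2_Fo s1 Lf; have [Ls _] := L2_shift h Lf.
have mc : cmeasurable (fun x : R => cis (- (s * h) * x)).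
  by apply: cm_cis; apply: measurable_funM => //; exact: measurable_cst.
have [Lm _] := L2_mulU mc LF (fun x => normc_cis _).
have e1 : ae_same (Fo (- s) (fun xi => cis (- (s * h) * xi) * Fo s f xi)) (shift h f).
  have := Fo_modulation (- (s * h)) s1' LF.
  rewrite mulrNN mulrA -expr2 s1 mul1r => /ae_same_trans; apply.
  have := Fo_inv s1 Lf; set k := Fo (- s) (Fo s f) => kf.
  have Lk : L2 k by exact: L2_Fo.
  apply/ae_nrmB; [exact: (L2_shift h Lk).1|exact: Ls|].
  rewrite -[LHS](_ : nrm (shift h (k \- f)) = _); last by [].
  by rewrite (L2_shift h (L2B Lk Lf)).2; exact/ae_nrmB.
have h1 := Fo_ae s1 (L2_Fo s1' Lm) Ls e1.
have h2 := Fo_inv s1' Lm; rewrite opprK in h2.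
exact: ae_same_trans (ae_same_sym h1) h2.
Qed.

End FourierL2.

(** * Weak derivatives *)

Section Calculus.
Context {R : realType}.
Implicit Types (f df : R -> R) (x y a b : R).

Lemma normr_sqr (z : R) : `|z| * `|z| = z ^+ 2.
Proof. by rewrite -expr2 real_normK ?num_real. Qed.

Lemma mvt_le f df a b (M : R) : a <= b ->
  (forall x, a < x < b -> is_derive x 1 f (df x)) ->
  (forall x, a < x < b -> `|df x| <= M) ->
  {within `[a, b], continuous f} -> `|f b - f a| <= M * (b - a).
Proof.
rewrite le_eqVlt => /predU1P[<- _ _ _|ab hd hM hc]; first by rewrite !subrr normr0 mulr0.
have hd' x : x \in `]a, b[%R -> is_derive x 1 f (df x) by rewrite in_itv/=; exact: hd.
have [c cab ->] := MVT ab hd' hc.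
rewrite normrM (gtr0_norm (_ : 0 < b - a)) ?subr_gt0//.
by rewrite ler_pM2r ?subr_gt0//; apply: hM; rewrite in_itv/= in cab.
Qed.

Lemma is_derive_continuous f df : (forall x, is_derive x 1 f (df x)) -> continuous f.
Proof. by move=> h; apply: derivable_continuous => x; have [] := h x. Qed.

Lemma mvt_dist f df a b (M : R) :
  (forall x, is_derive x 1 f (df x)) ->
  (forall x, `|x - a| <= `|b - a| -> `|df x| <= M) ->
  `|f b - f a| <= M * `|b - a|.
Proof.
move=> hd hM; have hc := is_derive_continuous hd.
have [ab|/ltW ba] := leP a b.
  rewrite (ger0_norm (_ : 0 <= b - a)) ?subr_ge0//; apply: (@mvt_le f df) => //.
    move=> x /andP[ax xb]; apply: hM.
    by rewrite !ger0_norm ?subr_ge0 ?(ltW ax)// lerD2r ltW.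
  exact: continuous_subspaceT.
rewrite distrC [X in _ * X]distrC (ger0_norm (_ : 0 <= a - b)) ?subr_ge0//.
apply: (@mvt_le f df) => //.
  move=> x /andP[bx xa]; apply: hM.
  by rewrite distrC [X in _ <= X]distrC !ger0_norm ?subr_ge0 ?(ltW xa)// lerD2l lerN2 ltW.
exact: continuous_subspaceT.
Qed.

(** Serves the point 0 of [flat], where a quadratic bound is available but no formula valid on both
    sides. *)
Lemma is_derive_quad f x d (C : R) :
  (forall y, `|f y - f x - d * (y - x)| <= C * (y - x) ^+ 2) -> is_derive x 1 f d.
Proof.
move=> h.
have C0 : 0 <= C.
  have := h (x + 1); rewrite (_ : x + 1 - x = 1); last by ring.
  by rewrite expr1n (mulr1 C); exact: (le_trans (normr_ge0 _)).
have c : (fun k : R => k^-1 *: (f (k *: (1 : R) + x) - f x)) @ 0^' --> d.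
  apply/cvgrPdist_lt => e e0; near=> k.
  have k0 : k != 0 by near: k; exact: nbhs_dnbhs_neq.
  have -> : d - k^-1 *: (f (k *: (1 : R) + x) - f x) =
      - (k^-1 * (f (k + x) - f x - d * ((k + x) - x))).
    by rewrite /GRing.scale /= mulr1 addrK; field.
  rewrite normrN normrM normfV; apply: le_lt_trans (ler_wpM2l _ (h _)) _.
    by rewrite invr_ge0.
  rewrite addrK -normr_sqr mulrCA mulKf ?normr_eq0//.
  have : `|k| < e / (C + 1).
    by near: k; apply: dnbhs0_lt; rewrite divr_gt0// ltr_wpDl.
  rewrite ltr_pdivlMr ?ltr_wpDl// => /(le_lt_trans _); apply.
  by rewrite mulrC ler_wpM2l// lerDl.
have dd : derivable f x 1 by apply/cvg_ex; exists d.
by apply: DeriveDef => //; exact: cvg_lim.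
Unshelve. all: by end_near. Qed.

Lemma is_derive_affine f df a b : (forall x, is_derive x 1 f (df x)) ->
  forall x, is_derive x 1 (fun y => f (a * y + b)) (a * df (a * x + b)).
Proof.
move=> hd x; have h : is_derive ((fun y => a * y + b) x) 1 f (df (a * x + b)) := hd _.
have g : is_derive x 1 (fun y => a * y + b) a.
  by apply: is_derive_eq; rewrite /GRing.scale /= mulr1 addr0.
by rewrite [X in is_derive _ _ _ X]mulrC; exact: (@is_derive1_comp _ f (fun y => a * y + b) _ _ _ h g).
Qed.

(** The classical smooth function e^(-1/x), multiplied by powers of 1/x so that the family is stable
    under differentiation. *)
Definition flat (k : nat) x : R := if 0 < x then x^-1 ^+ k * expR (- x^-1) else 0.

Lemma flat_ge0 k x : 0 <= flat k x.
Proof.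
rewrite /flat; case: ifPn => // x0.
by rewrite mulr_ge0// ?expR_ge0// exprn_ge0// invr_ge0 ltW.
Qed.

(** The Taylor term of order k + 2 bounds (1/x)^(k+2) by (k+2)! e^(1/x), which leaves two spare
    powers of x. *)
Lemma flat_le k x : 0 <= x -> flat k x <= k.+2`!%:R * x ^+ 2.
Proof.
move=> x0; rewrite /flat; case: ifPn => [{}x0|_]; last by rewrite mulr_ge0// sqr_ge0.
have y0 : 0 < x^-1 by rewrite invr_gt0.
have f0 : 0 < k.+2`!%:R :> R by rewrite ltr0n fact_gt0.
have : x^-1 ^+ k.+2 <= k.+2`!%:R * expR x^-1.
  rewrite mulrC -ler_pdivrMr//; apply: le_trans (expR_ge1Dxn k.+1 (ltW y0)).
  by rewrite lerDr.
move=> h; have := ler_wpM2r (_ : 0 <= x ^+ 2 * expR (- x^-1)) h.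
rewrite mulr_ge0 ?expR_ge0 ?sqr_ge0// => /(_ isT).
rewrite (_ : x^-1 ^+ k.+2 * _ = x^-1 ^+ k * expR (- x^-1) * (x^-1 * x) ^+ 2); last first.
  by rewrite !exprS expr0; ring.
rewrite mulVf ?gt_eqF// expr1n mulr1 => /le_trans; apply.
have e1 : expR x^-1 * expR (- x^-1) = 1 by rewrite -expRD subrr expR0.
rewrite [leLHS](_ : _ = k.+2`!%:R * x ^+ 2 * (expR x^-1 * expR (- x^-1))).
  by rewrite e1 mulr1.
by move: (expR x^-1) (expR (- x^-1)) (_%:R) => p q r; ring.
Qed.

Lemma is_derive_flat k x : is_derive x 1 (flat k) (- k%:R * flat k.+1 x + flat k.+2 x).
Proof.
have [x0|x0|->] := ltgtP x 0.
- have -> : - k%:R * flat k.+1 x + flat k.+2 x = 0.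
    by rewrite /flat ltNge (ltW x0)/= mulr0 addr0.
  apply: (@near_eq_is_derive _ _ _ (cst 0)) => //; near=> y.
  by rewrite /flat ltNge ltW//=; near: y; exact: lt_nbhsl.
- rewrite {2 3}/flat x0.
  apply: (@near_eq_is_derive _ _ _ (fun y => y^-1 ^+ k * expR (- y^-1))).
    by near=> y; rewrite /flat ifT//; near: y; exact: lt_nbhsr.
  have x1 : x != 0 by rewrite gt_eqF.
  have dV : is_derive x 1 (fun y : R => y^-1) (- x ^- 2).
    apply: (is_derive_eq (@is_deriveV R id x 1 1 x1 (is_derive_id _ _))).
    by rewrite /GRing.scale /= mulr1.
  have dN : is_derive x 1 (fun y : R => - y^-1) (x ^- 2).
    by apply: (is_derive_eq (@is_deriveN _ _ _ _ _ _ _ dV)); rewrite opprK.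
  have dE : is_derive x 1 (fun y : R => expR (- y^-1)) (x ^- 2 * expR (- x^-1)).
    by rewrite [X in is_derive _ _ _ X]mulrC; exact: (@is_derive1_comp _ expR (fun y => - y^-1) _ _ _ (is_derive_expR _) dN).
  have dX' : is_derive x 1 (fun y : R => y^-1 ^+ k) ((k%:R * x^-1 ^+ k.-1) *: - x ^- 2).
    have -> : (fun y : R => y^-1 ^+ k) = (fun y => y^-1) ^+ k.
      by apply/funext => y; elim: (k) => [//|j IH]; rewrite !exprS IH.
    exact: is_deriveX.
  apply: (is_derive_eq (@is_deriveM _ _ (fun y : R => y^-1 ^+ k) _ _ _ _ _ dX' dE)).
  rewrite /GRing.scale /=; move: (expR _) => e; case: k {dX'} => [|k].
    by rewrite mul0r mul0r mulr0 addr0 oppr0 mul0r add0r expr0 mul1r exprVn.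
  rewrite [_.-1]/= -exprVn !exprS expr0; move: (x^-1 ^+ k) (x^-1) => z y; ring.
- have -> : - k%:R * flat k.+1 0 + flat k.+2 0 = 0 :> R.
    by rewrite /flat ltxx mulr0 addr0.
  apply: (@is_derive_quad _ _ _ k.+2`!%:R) => y.
  rewrite {2}/flat ltxx !subr0 mul0r subr0 ger0_norm ?flat_ge0//.
  have [y0|y0] := leP 0 y; first exact: flat_le.
  by rewrite /flat ltNge (ltW y0)/= mulr_ge0// sqr_ge0.
Unshelve. all: by end_near. Qed.

(** The factors vanish for n x <= -1 and for n x >= 1 respectively. A large [n] narrows the support
    and so widens the band of frequencies on which the transform does not vanish. *)
Definition bump (n : nat) (k l : nat) x : R := flat k (n%:R * x + 1) * flat l (- n%:R * x + 1).

(* the linear span of the bumps is closed under differentiation *)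
Inductive bumps n : (R -> R) -> Prop :=
| bumps_bump k l : bumps n (bump n k l)
| bumpsZ c f : bumps n f -> bumps n (fun x => c * f x)
| bumpsD f g : bumps n f -> bumps n g -> bumps n (fun x => f x + g x).

Lemma bumps_derive n f : bumps n f ->
  exists2 g, bumps n g & forall x, is_derive x 1 f (g x).
Proof.
elim => [k l|c {}f _ [g bg hg]|f1 f2 _ [g1 b1 h1] _ [g2 b2 h2]].
- have d1 := is_derive_affine n%:R 1 (is_derive_flat k).
  have d2 := is_derive_affine (- n%:R) 1 (is_derive_flat l).
  exists (fun x => (n%:R * - k%:R) * bump n k.+1 l x + n%:R * bump n k.+2 l x +
     ((- n%:R * - l%:R) * bump n k l.+1 x + - n%:R * bump n k l.+2 x)).
    by apply: bumpsD; apply: bumpsD; apply: bumpsZ; exact: bumps_bump.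
  move=> x; apply: (is_derive_eq (@is_deriveM _ _ _ _ _ _ _ _ (d1 x) (d2 x))).
  by rewrite /GRing.scale /= /bump; ring.
- exists (fun x => c * g x); first exact: bumpsZ.
  by move=> x; exact: (@is_deriveZ _ _ _ _ c _ _ _ (hg x)).
- exists (fun x => g1 x + g2 x); first exact: bumpsD.
  by move=> x; exact: (@is_deriveD _ _ _ _ _ _ _ _ _ (h1 x) (h2 x)).
Qed.

Lemma bumps_derive1n n f m : bumps n f -> bumps n (derive1n m f).
Proof.
move=> bf; elim: m => [//|m /bumps_derive[g bg hg]].
rewrite derive1nS (_ : derive1 (derive1n m f) = g)//; apply/funext => x.
by rewrite derive1E; have [] := hg x.
Qed.

Lemma bump_supp n k l x : 1 < `|n%:R * x| -> bump n k l x = 0.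
Proof.
rewrite lter_normr => /orP[h|h]; rewrite /bump /flat.
  by rewrite [_ < - _ * x + 1]ltNge (_ : - n%:R * x + 1 <= 0) ?mulr0//; lra.
by rewrite [_ < n%:R * x + 1]ltNge (_ : n%:R * x + 1 <= 0) ?mul0r//; lra.
Qed.

Lemma test_bump n k l : (0 < n)%N -> test_function (bump n k l).
Proof.
move=> n0; split => [m x|].
  have [g _ h] := bumps_derive (bumps_derive1n m (bumps_bump n k l)).
  by have [] := h x.
exists 1 => x x1; apply: bump_supp; rewrite normrM normr_nat.
by apply: lt_le_trans x1 _; rewrite ler_peMl// ler1n.
Qed.

Lemma bump_ge n x : `|n%:R * x| <= 2^-1 -> expR (- 2) ^+ 2 <= bump n 0 0 x.
Proof.
rewrite ler_norml => /andP[h1 h2].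
have aux y : 2^-1 <= y -> expR (- 2) <= flat 0 y.
  move=> y2; have y0 : 0 < y by exact: lt_le_trans y2.
  rewrite /flat y0 expr0 mul1r ler_expR lerN2 -[leRHS]invrK lef_pV2//.
  by rewrite posrE.
rewrite expr2; apply: ler_pM; rewrite ?expR_ge0//; apply: aux; lra.
Qed.

Lemma bump_ge0 n k l x : 0 <= bump n k l x.
Proof. by rewrite mulr_ge0// flat_ge0. Qed.

Lemma test_derive1 (phi : R -> R) : test_function phi -> test_function (derive1 phi).
Proof.
move=> [hd [M hM]]; split => [n x|]; first by rewrite -derive1Sn; exact: hd.
exists M => x Mx; rewrite derive1E (@near_eq_derive _ _ _ _ (cst 0)) ?derive_cst//.
have : nbhs x [set y | M < `|y|].
  exact: (@norm_continuous _ R x _ (lt_nbhsr Mx)).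
by apply: filterS => y /= /hM.
Qed.

Lemma test_is_derive (phi : R -> R) x : test_function phi ->
  is_derive x 1 phi (derive1 phi x).
Proof.
by move=> [/(_ 0 x) h _]; rewrite derive1E; exact: derivableP.
Qed.

Lemma test_continuous (phi : R -> R) : test_function phi -> continuous phi.
Proof. by move=> h; apply: is_derive_continuous => x; exact: test_is_derive. Qed.

Lemma test_bounded (phi : R -> R) : test_function phi ->
  exists2 B, 0 <= B & forall x, `|phi x| <= B.
Proof.
move=> tp; have [_ [M hM]] := tp.
have cn : continuous (fun x => `|phi x|).
  by move=> x; apply: continuous_comp; [exact: test_continuous|exact: norm_continuous].
have M0 : - `|M| <= `|M| by rewrite (le_trans _ (normr_ge0 _))// oppr_le0.
have [c _ hc] := EVT_max M0 (continuous_subspaceT cn).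
exists `|phi c| => // x; have [h|h] := leP `|x| `|M|.
  by apply: hc; rewrite in_itv/= -ler_norml.
by rewrite hM ?normr0// (le_lt_trans (ler_norm _)).
Qed.

(** The second derivative is again a test function, hence bounded; applying the mean value
    inequality twice makes the remainder uniform in [x] and [y]. *)
Lemma test_taylor (phi : R -> R) : test_function phi ->
  exists2 B, 0 <= B & forall x y,
    `|phi y - phi x - derive1 phi x * (y - x)| <= B * (y - x) ^+ 2.
Proof.
move=> tp; have tp' := test_derive1 tp.
have [B B0 hB] := test_bounded (test_derive1 tp'); exists B => // x y.
have l z : `|derive1 phi z - derive1 phi x| <= B * `|z - x|.
  apply: (mvt_dist (df := derive1 (derive1 phi))) => [u|u _]; last exact: hB.
  exact: test_is_derive.
pose G u := phi u - derive1 phi x * u.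
have := @mvt_dist G (fun u => derive1 phi u - derive1 phi x) x y (B * `|y - x|).
have -> : G y - G x = phi y - phi x - derive1 phi x * (y - x) by rewrite /G; ring.
rewrite -mulrA normr_sqr; apply.
  move=> u; have hu := test_is_derive u tp.
  have h2 : is_derive u 1 (fun u => derive1 phi x * u) (derive1 phi x).
    by apply: is_derive_eq; rewrite /GRing.scale /= mulr1.
  exact: (@is_deriveB _ _ _ _ _ _ _ _ _ hu h2).
by move=> u ux; apply: le_trans (l u) _; rewrite ler_wpM2l.
Qed.

Lemma cis_taylor (t : R) : normc (cis t - 1 - (0 +i* t)) <= 2 * t ^+ 2.
Proof.
apply: le_trans (normc_ReIm _) _; rewrite /= !subr0.
have e1 : `|cos t - 1| <= t ^+ 2.
  have := @mvt_dist cos (fun u => - sin u) 0 t `|t|.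
  rewrite cos0 !subr0 normr_sqr; apply=> x.
  by rewrite subr0 normrN => /(le_trans _); apply; exact: sin_le_abs.
have c1 (u : R) : `|cos u - 1| <= `|u|.
  have := @mvt_dist cos (fun u => - sin u) 0 u 1.
  rewrite cos0 subr0 mul1r; apply=> x _.
  by rewrite normrN ler_norml sin_geN1 sin_le1.
have e2 : `|sin t - t| <= t ^+ 2.
  have := @mvt_dist (fun u => sin u - u) (fun u => cos u - 1) 0 t `|t|.
  rewrite sin0 !subr0 normr_sqr; apply=> x.
  by rewrite subr0 => /(le_trans _); apply; exact: c1.
by rewrite mulr2n mulrDl mul1r lerD// oppr0 ?addr0.
Qed.

End Calculus.

(** * Weak derivatives, difference quotients and Fourier multipliers *)

Section WeakDerivative.
Context {R : realType}.
Implicit Types (f g : R -> R[i]) (s x xi h : R).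
Local Notation mu := (@lebesgue_measure R).
Local Notation Fo := (@fourier_phase R).

Lemma cvg0_norm (h : nat -> R) : h @ \oo --> (0 : R) ->
  (fun n => `|h n|) @ \oo --> (0 : R).
Proof. by move=> c; rewrite -(@normr0 _ R); apply: cvg_norm. Qed.

Definition dq h f : R -> R[i] := fun x => (h^-1)%:C * (shift h f x - f x).

Lemma L2_dq h f : L2 f -> L2 (dq h f).
Proof. by move=> Lf; apply: L2Z; apply: L2B => //; exact: (L2_shift h Lf).1. Qed.

Lemma Fo_dq s h f : s ^+ 2 = 1 -> L2 f -> ae_same (Fo s (dq h f))
  (fun xi => (h^-1)%:C * (cis (- (s * h) * xi) - 1) * Fo s f xi).
Proof.
move=> s1 Lf; have Ls := (L2_shift h Lf).1.
have h1 := FoZ (h^-1)%:C s1 (L2B Ls Lf); have h2 := FoB s1 Ls Lf.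
have h3 := Fo_shift h s1 Lf.
apply: ae_same_trans h1 _; apply: ae_imp2 h2 h3 => x /= -> /= ->.
by rewrite -mulrA mulrBl mul1r.
Qed.

Lemma cm_imag : cmeasurable (fun xi : R => 0 +i* xi).
Proof. by split => /=. Qed.

(* H^1 on the Fourier side; wdf_weak and weak_wdf identify it with
   is_weak_derivative. *)
Definition wdf f g := [/\ L2 f, L2 g &
  ae_same (Fo (-1) g) (fun xi => (0 +i* xi) * Fo (-1) f xi)].

Lemma sqrN1 : (-1 : R) ^+ 2 = 1.
Proof. by rewrite sqrrN expr1n. Qed.

Lemma normcI (a : R) : normc (0 +i* a) = `|a|.
Proof. by rewrite /normc expr0n add0r sqrtr_sqr. Qed.

Lemma normc_multiplier h xi : h != 0 ->
  normc ((h^-1)%:C * (cis (h * xi) - 1)) <= `|xi|.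
Proof.
move=> h0; rewrite normcM normcR normfV ler_pdivrMl ?normr_gt0//.
by rewrite -normrM normc_cisB1.
Qed.

Lemma multiplier_cvg h xi : h != 0 ->
  normc ((h^-1)%:C * (cis (h * xi) - 1) - (0 +i* xi)) <= `|h| * (2 * xi ^+ 2).
Proof.
move=> h0.
have -> : (h^-1)%:C * (cis (h * xi) - 1) - (0 +i* xi) =
   (h^-1)%:C * (cis (h * xi) - 1 - (0 +i* (h * xi))).
  rewrite [RHS]mulrBr; congr (_ - _).
  by apply: complexP; rewrite /= ?(mul0r, mulr0, subr0, addr0) ?mulKf.
rewrite normcM normcR normfV ler_pdivrMl ?normr_gt0//.
apply: le_trans (cis_taylor _) _.
by rewrite [leRHS]mulrA normr_sqr exprMn mulrCA.
Qed.

(** On the Fourier side the quotient is multiplication by (e^(ih xi) - 1)/h, up to the sign of the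
    frequency. Its modulus is at most |xi|, so the transform of [g] dominates and convergence is
    pointwise. *)
Lemma mult_dq s f g (h : nat -> R) : s ^+ 2 = 1 -> L2 f -> L2 g ->
  ae_same (Fo s g) (fun xi => (0 +i* (- (s * xi))) * Fo s f xi) ->
  (forall n, h n != 0) -> h @ \oo --> (0 : R) ->
  (fun n => nrm (dq (h n) f \- g)) @ \oo --> (0 : R).
Proof.
move=> s1 Lf Lg fg h0 hc.
pose G xi := (0 +i* (- (s * xi))) * Fo s f xi.
pose M n xi := ((h n)^-1)%:C * (cis (h n * - (s * xi)) - 1) * Fo s f xi.
have LF := L2_Fo s1 Lf.
have ms : measurable_fun setT (fun xi : R => - (s * xi)).
  by apply: measurableT_comp => //; apply: measurable_funM => //; exact: measurable_cst.
have mG : cmeasurable G.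
  apply: cmM; last exact: L2_cm.
  by split => //=; exact: measurable_cst.
have LG : L2 G by apply: L2_ae mG (L2_Fo s1 Lg) fg.
have mM n : cmeasurable (M n).
  apply: cmM; last exact: L2_cm.
  apply: cmZ; apply: cmB; last exact: cm_cst.
  by apply: cm_cis; apply: measurable_funM => //; exact: measurable_cst.
have MG n xi : normc (M n xi) <= normc (G xi).
  by rewrite /M /G !normcM ler_wpM2r ?normc_ge0// normcI -normcM normc_multiplier.
have MGc xi : (fun n => normc (M n xi - G xi)) @ \oo --> (0 : R).
  apply: cvg0_le (cvg0Z (2 * (- (s * xi)) ^+ 2 * normc (Fo s f xi)) (cvg0_norm hc)) => n; first exact: normc_ge0.
  rewrite -mulrBl normcM mulrAC ler_wpM2r ?normc_ge0//.
  by rewrite [leRHS]mulrC; exact: multiplier_cvg.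
have [_ c] := @L2_dominated R M G G mM mG LG (ae_sameW (fun x n => MG n x)) (ae_sameW MGc).
apply: cvg_eqfun c => n.
rewrite -(Fo_dist s1 (L2_dq _ Lf) Lg); apply: nrm_ae.
- by apply: L2B; [exact: L2_Fo (L2_dq _ Lf)|exact: L2_Fo].
- by apply: L2B => //; have [] // := L2_le (mM n) LG _; exact: ae_sameW.
- apply: ae_imp2 (Fo_dq (h n) s1 Lf) fg => x /= -> ->.
  by rewrite /M /G; congr (_ * (cis _ - 1) * _ - _); ring.
Qed.

Lemma wdf_dq f g (h : nat -> R) : wdf f g -> (forall n, h n != 0) -> h @ \oo --> (0 : R) ->
  (fun n => nrm (dq (h n) f \- g)) @ \oo --> (0 : R).
Proof.
move=> [Lf Lg fg]; apply: mult_dq sqrN1 Lf Lg _; apply: ae_imp fg => x ->.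
by rewrite mulN1r opprK.
Qed.

Lemma cvg_harmonic0 : (@harmonic R) @ \oo --> (0 : R).
Proof. exact: cvg_harmonic. Qed.

Lemma harmonic_neq0 n : @harmonic R n != 0.
Proof. by rewrite invr_neq0// pnatr_eq0. Qed.

(** Converse of [mult_dq]: the transforms of the quotients converge in mean to that of [g] and
    pointwise to the multiplier, and the two limits must agree. *)
Lemma dq_Fo s f g : s ^+ 2 = 1 -> L2 f -> L2 g ->
  (fun n => nrm (dq (harmonic n) f \- g)) @ \oo --> (0 : R) ->
  ae_same (Fo s g) (fun xi => (0 +i* (- (s * xi))) * Fo s f xi).
Proof.
move=> s1 Lf Lg c; have LD n := L2_dq (harmonic n) Lf.
have c1 := Fo_lim s1 LD Lg c.
pose G xi := (0 +i* (- (s * xi))) * Fo s f xi.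
have mG : cmeasurable G.
  apply: cmM; last exact: L2_cm (L2_Fo s1 Lf).
  split => /=; first exact: measurable_cst.
  apply: measurableT_comp => //; apply: measurable_funM => //; exact: measurable_cst.
suff h : {ae mu, forall x, (fun n => normc (Fo s (dq (harmonic n) f) x - G x)) @ \oo --> (0 : R)}.
  by have [] := cvg_nrm_ae (fun n => L2_Fo s1 (LD n)) (L2_Fo s1 Lg) mG c1 h.
have h0 : {ae mu, forall x, forall n, Fo s (dq (harmonic n) f) x =
    ((harmonic n)^-1)%:C * (cis (- (s * harmonic n) * x) - 1) * Fo s f x}.
  by apply: ae_foralln => n; exact: Fo_dq.
apply: ae_imp h0 => xi hn.
apply: cvg0_le (cvg0Z (2 * xi ^+ 2 * normc (Fo s f xi)) (cvg_harmonic0)) => n; first exact: normc_ge0.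
rewrite hn /G -mulrBl normcM mulrAC ler_wpM2r ?normc_ge0//.
have -> : - (s * harmonic n) * xi = harmonic n * - (s * xi) by ring.
have := multiplier_cvg (- (s * xi)) (harmonic_neq0 n).
rewrite sqrrN exprMn s1 mul1r ger0_norm ?invr_ge0// => /le_trans; apply.
by rewrite mulrC.
Qed.

Lemma dq_wdf f g : L2 f -> L2 g ->
  (fun n => nrm (dq (harmonic n) f \- g)) @ \oo --> (0 : R) -> wdf f g.
Proof.
move=> Lf Lg c; split => //; apply: ae_imp (dq_Fo sqrN1 Lf Lg c) => x ->.
by rewrite mulN1r opprK.
Qed.

(** Difference quotients do not see the sign of the phase, so either transform may be used to test
    [wdf]. The case [s = 1] makes multiplication by [x] a derivative in frequency. *)
Lemma mult_wdf s f g : s ^+ 2 = 1 -> L2 f -> L2 g ->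
  ae_same (Fo s g) (fun xi => (0 +i* (- (s * xi))) * Fo s f xi) -> wdf f g.
Proof.
move=> s1 Lf Lg h; apply: dq_wdf => //.
exact: mult_dq s1 Lf Lg h harmonic_neq0 cvg_harmonic0.
Qed.

Lemma wdf_Fo s f g : s ^+ 2 = 1 -> wdf f g ->
  ae_same (Fo s g) (fun xi => (0 +i* (- (s * xi))) * Fo s f xi).
Proof.
move=> s1 w; have [Lf Lg _] := w; apply: dq_Fo => //.
exact: wdf_dq w harmonic_neq0 cvg_harmonic0.
Qed.

Definition toC (phi : R -> R) : R -> R[i] := fun x => (phi x)%:C.

Lemma cm_toC (phi : R -> R) : continuous phi -> cmeasurable (toC phi).
Proof. by move=> c; apply: cm_real; exact: continuous_measurable_fun. Qed.

Lemma L2_supp_bounded f (n : nat) (B : R) : cmeasurable f ->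
  (forall x, n%:R < `|x| -> f x = 0) -> (forall x, normc (f x) <= B) ->
  L2 f /\ cut n f = f.
Proof.
move=> mf h hB.
have c : cut n f = f.
  apply/funext => x; rewrite /cut chiE; case: ifPn; rewrite ?mul1r// mul0r.
  by rewrite -ler_norml -ltNge => /h.
split => //; have B0 : 0 <= B by exact: le_trans (normc_ge0 _) (hB 0).
have [] // := @L2_le R f (fun x => B%:C * chi (- n%:R) n%:R x) mf (L2Z _ (L2_chi _ _)) _.
apply: ae_sameW => x; rewrite normcM normcR (ger0_norm B0) normc_chi.
have := congr1 (@normc R) (congr1 (fun F => F x) c); rewrite /cut normcM normc_chi.
by case: ifPn => _; rewrite ?mul0r ?mulr1// => <-; rewrite mulr0.
Qed.

Lemma test_L2 phi : test_function phi -> exists n, L2 (toC phi) /\ cut n (toC phi) = toC phi.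
Proof.
move=> tp; have [B B0 hB] := test_bounded tp; have [_ [M hM]] := tp.
have [n Mn] : exists n : nat, M <= n%:R.
  by exists (Num.truncn `|M|).+1; rewrite (le_trans (ler_norm M))// ltW// truncnS_gt.
exists n; apply: (@L2_supp_bounded _ _ B).
- exact: cm_toC (test_continuous tp).
- by move=> x nx; rewrite /toC hM// (le_lt_trans Mn).
- by move=> x; rewrite normcR.
Qed.

Lemma test_dq phi (h : nat -> R) : test_function phi -> (forall n, h n != 0) ->
  (forall n, `|h n| <= 1) -> h @ \oo --> (0 : R) ->
  (fun n => nrm (dq (h n) (toC phi) \- toC (derive1 phi))) @ \oo --> (0 : R).
Proof.
move=> tp h0 h1 hc; have tp' := test_derive1 tp.
have [_ [M hM]] := tp; have [B B0 hB] := test_taylor tp.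
have [D D0 hD] := test_bounded tp'.
have [N MN] : exists n : nat, M + 1 <= n%:R.
  by exists (Num.truncn `|M + 1|).+1; rewrite (le_trans (ler_norm _))// ltW// truncnS_gt.
have [_ [Lp _]] := test_L2 tp; have [_ [Lp' _]] := test_L2 tp'.
have dqE n x : dq (h n) (toC phi) x = toC (fun x => (h n)^-1 * (phi (x + h n) - phi x)) x.
  by rewrite /dq /shift /toC -!(rmorphB, rmorphM).
have lip x y : `|phi y - phi x| <= D * `|y - x|.
  apply: (mvt_dist (df := derive1 phi)) => [u|u _]; last exact: hD.
  exact: test_is_derive.
have [] // := @L2_dominated R (fun n => dq (h n) (toC phi)) (toC (derive1 phi))
  (fun x => D%:C * chi (- N%:R) N%:R x) _ _ (L2Z _ (L2_chi _ _)) _ _.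
- by move=> n; apply: L2_cm; exact: L2_dq.
- exact: L2_cm.
- apply: ae_sameW => x n; rewrite dqE normcR normcM (normcR D) normc_chi (ger0_norm D0).
  case: ifPn => [_|].
    rewrite mulr1 normrM normfV ler_pdivrMl ?normr_gt0// mulrC.
    by have := lip x (x + h n); rewrite addrAC subrr add0r.
  rewrite -ler_norml -ltNge mulr0 => Nx.
  have x1 : M + 1 < `|x| by exact: le_lt_trans Nx.
  rewrite !hM ?subrr ?mulr0 ?normr0//; first by rewrite (le_lt_trans _ x1)// lerDl.
  have := ler_normB (x + h n) (h n); rewrite addrK => hx.
  by have := h1 n; move: hx x1; lra.
- apply: ae_sameW => x; apply: cvg0_le (cvg0Z B (cvg0_norm hc)) => n; first exact: normc_ge0.
  rewrite dqE /toC -rmorphB normcR.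
  have -> : (h n)^-1 * (phi (x + h n) - phi x) - derive1 phi x =
     (h n)^-1 * (phi (x + h n) - phi x - derive1 phi x * (x + h n - x)).
    by rewrite (addrAC x) subrr add0r [RHS]mulrBr (mulrCA _ _ (h n)) mulVf// mulr1.
  rewrite normrM normfV ler_pdivrMl ?normr_gt0//; apply: le_trans (hB _ _) _.
  by rewrite (addrAC x) subrr add0r [leRHS]mulrCA normr_sqr.
Qed.

(** Discrete integration by parts, from the translation invariance of the integral. *)
Lemma pr_dq h f g : L2 f -> L2 g -> pr (dq h f) g = - pr f (dq (- h) g).
Proof.
move=> Lf Lg; have [Ls _] := L2_shift h Lf; have [Lm _] := L2_shift (- h) Lg.
have e : pr (shift h f) g = pr f (shift (- h) g).
  have [cfg _] := L2_mul Lf Lm; rewrite /pr -(ci_shift h cfg).2.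
  by apply: (congr1 ci); apply/funext => x; rewrite /shift addrK.
rewrite {1}/dq prZl//; last exact: L2B.
have Ld : L2 (shift (- h) g \- g) by exact: L2B.
rewrite prBl// (prC f (dq _ _)) (prZl _ Ld Lf) prBl// invrN rmorphN mulNr opprK e.
by rewrite (prC f (shift _ _)) (prC f g).
Qed.

Lemma normcNC (z w : R[i]) : normc (- z + w) = normc (z - w).
Proof. by rewrite normcBC addrC. Qed.

Lemma lim_normc_unique (z : nat -> R[i]) (a b : R[i]) :
  (fun n => normc (z n - a)) @ \oo --> (0 : R) -> (fun n => normc (z n - b)) @ \oo --> (0 : R) ->
  a = b.
Proof.
move=> ca cb; apply/eqP; rewrite -subr_eq0 -normc_eq0; apply/eqP.
apply: cvg0_eq0 (normc_ge0 _) _ => e e0.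
have /cvg0P := cvg0D ca cb => /(_ (fun n => addr_ge0 (normc_ge0 _) (normc_ge0 _)) e e0).
move=> [N /(_ N (leqnn N)) hN]; apply: le_trans (ltW hN); move: hN => _.
by rewrite (normcBC _ a); exact: normcB_triangle.
Qed.

Lemma wdf_weak f g : wdf f g -> is_weak_derivative f g.
Proof.
move=> w phi tp; have [Lf Lg _] := w; have tp' := test_derive1 tp.
have [_ [Lp _]] := test_L2 tp; have [_ [Lp' _]] := test_L2 tp'.
have c1 := wdf_dq w harmonic_neq0 cvg_harmonic0.
have c2 := @test_dq phi (fun n => - harmonic n) tp _ _ _.
change (pr f (toC (derive1 phi)) = - pr g (toC phi)).
have z : (fun n => nrm (toC phi \- toC phi)) @ \oo --> (0 : R).
  have -> : toC phi \- toC phi = (fun=> 0) by apply/funext => x /=; rewrite subrr.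
  by rewrite nrm0; exact: cvg_cst.
have z' : (fun n : nat => nrm (f \- f)) @ \oo --> (0 : R).
  have -> : f \- f = (fun=> 0) by apply/funext => x /=; rewrite subrr.
  by rewrite nrm0; exact: cvg_cst.
have a1 := pr_cvg 0 (fun n => L2_dq (harmonic n) Lf) (fun=> Lp) Lg Lp c1 z.
have a2 := pr_cvg 0 (fun=> Lf) (fun n => L2_dq (- harmonic n) Lp) Lf Lp' z' (c2 _ _ _).
apply/eqP; rewrite -eqr_oppLR; apply/eqP; apply: lim_normc_unique a1.
apply: cvg_eqfun (a2 _ _ _) => [n|n|n|].
- by rewrite pr_dq// opprK normcNC.
- by rewrite oppr_eq0 harmonic_neq0.
- by rewrite normrN ger0_norm ?invr_ge0// invf_le1// ler1n.
- by rewrite -oppr0; apply: cvgN; exact: cvg_harmonic0.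
Qed.

Lemma Fo_supp s n f : s ^+ 2 = 1 -> L2 f -> cut n f = f -> ae_same (Fo s f) (FT s f).
Proof.
move=> s1 Lf cf; have LF := (Plancherel_cut n s1 Lf).1; rewrite cf in LF.
apply: Fo_unique => //; apply/cvg0P => [m|e e0]; first exact: nrm_ge0.
exists n => m nm; have -> : cut m f = f by rewrite -cf cut_cut.
have -> : FT s f \- FT s f = (fun=> 0) by apply/funext => x /=; rewrite subrr.
by rewrite nrm0.
Qed.

Lemma test_shift phi y : test_function phi -> test_function (fun x => phi (x + y)) /\
  derive1 (fun x => phi (x + y)) = fun x => derive1 phi (x + y).
Proof.
have gen (psi : R -> R) : (forall x, derivable psi x 1) ->
   forall x, is_derive x 1 (fun x => psi (x + y)) (derive1 psi (x + y)).
  move=> hd x.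
  have := @is_derive_affine R psi (derive1 psi) 1 y _ x; rewrite !mul1r.
  have -> : (fun z => psi (1 * z + y)) = (fun z => psi (z + y)) by apply/funext => z; rewrite mul1r.
  by apply => z; rewrite derive1E; exact: derivableP.
move=> [hd [M hM]].
have dn n : derive1n n (fun x => phi (x + y)) = fun x => derive1n n phi (x + y).
  elim: n => [//|n IH]; rewrite derive1nS IH; apply/funext => x.
  by rewrite derive1E derive1nS; have [_ ->] := gen _ (hd n) x.
split; last exact: (dn 1%N).
split => [n x|]; first by rewrite dn; have [] := gen _ (hd n) x.
exists (M + `|y|) => x xM; apply: hM.
have := ler_normB (x + y) y; rewrite addrK; move: xM; lra.
Qed.

(** A product of two L^2 functions is integrable, so the transforms of its cuts converge at every
    frequency, not only in mean. *)
Lemma ci_phase_cvg s y W1 P : s ^+ 2 = 1 -> L2 W1 -> L2 P ->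
  (fun n => normc (FT s (cut n (fun x => W1 x * P x)) y -
     fcst * ci (fun x => cis (s * (x * y)) * (W1 x * P x)))) @ \oo --> (0 : R).
Proof.
move=> s1 LW LP.
have [LcP _] := L2_mulU (cm_phase s y) LP (fun x => normc_cis _).
have z : (fun n : nat => nrm ((fun x => cis (s * (x * y)) * P x) \- (fun x => cis (s * (x * y)) * P x))) @ \oo --> (0 : R).
  rewrite (_ : _ \- _ = (fun=> 0)) ?nrm0; first exact: cvg_cst.
  by apply/funext => x /=; rewrite subrr.
have := pr_cvg 0 (fun n => (L2_cut n LW).1) (fun=> LcP) LW LcP (cut_cvg LW) z.
move/(cvg0Z (normc (fcst : R[i]))); apply: cvg_eqfun => n.
rewrite -normcM mulrBr; congr normc; congr (_ - _); apply: (congr1 (fun k => fcst * ci k));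
  apply/funext => x; rewrite /cut.
  by move: (cis _) (chi _ _ _) (W1 x) (P x) => a b c d; ring.
by rewrite mulrCA.
Qed.

Lemma ci_nonneg (k : R -> R) : cint (toC k) -> (forall x, 0 <= k x) ->
  ci (toC k) = (nrm1 (toC k))%:C.
Proof.
move=> ik k0; apply: complexP.
  rewrite ciRe /= /nrm1; congr Rintegral; apply/funext => x.
  by rewrite normcR ger0_norm.
rewrite /ci /cintegral /= /Rintegral (_ : (\int[_]_(x in _) _)%E = 0%E)//.
by apply: integral0_eq.
Qed.

Lemma nrm1_chi a b : a <= b -> nrm1 (chi a b : R -> R[i]) = b - a.
Proof.
move=> ab; apply: EFin_inj; rewrite nrm1E; last exact: cint_chi.
rewrite -(sqint_chi ab); apply: eq_integral => x _.
by rewrite normc_chi; case: ifP; rewrite ?expr1n// expr0n.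
Qed.

(** At frequency 0 the transform is the mass of the bump, up to the normalisation, and its Lipschitz
    constant is at most that value times 1/(n+1), because the support has radius 1/(n+1). It cannot
    vanish for |xi| < (n+1)/2. *)
Lemma FT_bump_neq0 (n : nat) xi : cint (toC (bump n.+1 0 0)) -> `|xi| < n.+1%:R / 2 ->
  FT 1 (toC (bump n.+1 0 0)) xi != 0.
Proof.
set phi := toC _ => ip hxi; apply/negP => /eqP e0.
have N0 : 0 < n.+1%:R :> R by rewrite ltr0n.
have c0 : 0 < (Num.sqrt (2 * pi))^-1 :> R.
  by rewrite invr_gt0 sqrtr_gt0 mulr_gt0// pi_gt0.
have p0 : 0 < nrm1 phi.
  pose m : R := expR (- 2) ^+ 2; have m0 : 0 < m by rewrite exprn_gt0// expR_gt0.
  pose a : R := 2^-1 / n.+1%:R; have a0 : 0 < a by rewrite divr_gt0.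
  have ic := cintZ m%:C (cint_chi (- a) a).
  apply: lt_le_trans (nrm1_le ic ip _).
    have -> : nrm1 (fun x => m%:C * chi (- a) a x) = m * (a - (- a)).
      rewrite -nrm1_chi; last by lra.
      apply: EFin_inj; rewrite EFinM !nrm1E//; last exact: cint_chi.
      rewrite -ge0_integralZl//; first by apply: eq_integral => x _; rewrite normcM normcR gtr0_norm.
      - apply/measurable_EFinP; exact: measurable_normc (cm_chi _ _).
      - by move=> x _; rewrite lee_fin normc_ge0.
      - by rewrite lee_fin ltW.
    by rewrite mulr_gt0//; lra.
  move=> x; rewrite normcM normc_chi !normcR (gtr0_norm m0) (ger0_norm (bump_ge0 _ _ _ _)).
  case: ifPn => [|_]; last by rewrite mulr0 bump_ge0.
  rewrite mulr1 -ler_norml => xa; apply: bump_ge.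
  by rewrite normrM normr_nat mulrC -ler_pdivlMr.
have supp x : n.+1%:R^-1 < `|x| -> phi x = 0.
  move=> hx; rewrite /phi /toC bump_supp//.
  by rewrite normrM normr_nat -ltr_pdivrMl// mulr1.
have i0 : 0 <= n.+1%:R^-1 :> R by rewrite invr_ge0 ltW.
have := FT_lip 1 xi 0 i0 ip supp.
rewrite e0 sub0r subr0 normr1 mul1r.
have -> : FT 1 phi 0 = fcst * (nrm1 phi)%:C.
  rewrite /FT -ci_nonneg//; last by move=> x; exact: bump_ge0.
  by congr (_ * ci _); apply/funext => x; rewrite mulr0 mulr0 cis0 mul1r.
have nN (z : R[i]) : normc (- z) = normc z by rewrite -[- z]sub0r normcBC subr0.
rewrite nN normcM normc_fcst normcR gtr0_norm// -!mulrA ler_pM2l//.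
rewrite [leRHS]mulrC -mulrA ler_pMr//; apply/negP; rewrite -ltNge.
by rewrite ltr_pdivrMr// mul1r (lt_trans hxi)// ltr_pdivrMr// ltr_pMr// ltr1n.
Qed.

(** Only the translates of one bump are tested, for each band of frequencies. By symmetry the weak
    identity says that the transform of [W] vanishes at every point; so [W = 0], and dividing by the
    nonvanishing factor [P] gives the multiplier relation on the band. The bands exhaust the
    line. *)
Lemma weak_wdf f g : L2 f -> L2 g -> is_weak_derivative f g -> wdf f g.
Proof.
move=> Lf Lg wd; split => //; have s1 := sqrN1; have s1' : (1 : R) ^+ 2 = 1 by rewrite expr1n.
have LF := L2_Fo s1 Lf; have LG := L2_Fo s1 Lg.
have key (n : nat) : {ae mu, forall xi, `|xi| < n.+1%:R / 2 -> Fo (-1) g xi = (0 +i* xi) * Fo (-1) f xi}.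
  pose phi := bump n.+1 0 0 : R -> R.
  have tp : test_function phi by exact: test_bump.
  have tp' := test_derive1 tp.
  have [N [Lp cp]] := test_L2 tp; have [N' [Lp' cp']] := test_L2 tp'.
  pose P := FT 1 (toC phi); pose P' := FT 1 (toC (derive1 phi)).
  have e1 : ae_same (Fo 1 (toC phi)) P by exact: Fo_supp cp.
  have e2 : ae_same (Fo 1 (toC (derive1 phi))) P' by exact: Fo_supp cp'.
  have ip : cint (toC phi) by rewrite -cp; exact: cint_cut.
  have ip' : cint (toC (derive1 phi)) by rewrite -cp'; exact: cint_cut.
  have LP : L2 P by rewrite /P -cp; exact: (Plancherel_cut N s1' Lp).1.
  have LP' : L2 P' by rewrite /P' -cp'; exact: (Plancherel_cut N' s1' Lp').1.
  have wphi : wdf (toC phi) (toC (derive1 phi)).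
    apply: dq_wdf => //; apply: test_dq => //; [exact: harmonic_neq0| |exact: cvg_harmonic0].
    by move=> m; rewrite ger0_norm ?invr_ge0// invf_le1// ler1n.
  have e3 : ae_same P' (fun xi => (0 +i* (- xi)) * P xi).
    apply: ae_same_trans (ae_same_sym e2) _; apply: ae_imp2 (wdf_Fo s1' wphi) e1 => x -> ->.
    by rewrite mul1r.
  (* Pairing with the translate by [y] is, on the Fourier side, an integral against the phase
     e^(-ixy). *)
  have orth y : ci (fun x => cis (-1 * (x * y)) * (Fo (-1) f x * P' x)) +
                ci (fun x => cis (-1 * (x * y)) * (Fo (-1) g x * P x)) = 0.
    have [ty dy] := test_shift y tp; have := wd _ ty; rewrite dy.
    have aux k u Q : L2 k -> L2 (toC u) -> L2 Q -> ae_same (Fo 1 (toC u)) Q ->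
       pr k (shift y (toC u)) = ci (fun x => cis (-1 * (x * y)) * (Fo (-1) k x * Q x)).
      move=> Lk Lu LQ uQ; have [Lsu _] := L2_shift y Lu.
      have [LcQ _] := L2_mulU (cm_phase (-1) y) LQ (fun x => normc_cis _).
      have hinv := Fo_inv s1' Lsu.
      rewrite (pr_ae Lk Lk Lsu (L2_Fo s1 (L2_Fo s1' Lsu)) (ae_same_refl _) (ae_same_sym hinv)).
      rewrite -(pr_Fo s1 Lk (L2_Fo s1' Lsu)).
      rewrite (pr_ae (L2_Fo s1 Lk) (L2_Fo s1 Lk) (L2_Fo s1' Lsu) LcQ (ae_same_refl _)).
        by apply: (congr1 ci); apply/funext => x; rewrite mulrCA.
      apply: ae_imp2 (Fo_shift y s1' Lu) uQ => x -> ->.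
      by rewrite mul1r mulN1r mulNr (mulrC y).
    move=> e; have {e} : pr f (shift y (toC (derive1 phi))) = - pr g (shift y (toC phi)) by exact: e.
    by rewrite (aux f _ P' Lf Lp' LP' e2) (aux g _ P Lg Lp LP e1) => ->; rewrite addNr.
  pose W x := Fo (-1) f x * P' x + Fo (-1) g x * P x.
  have bd k : cint k -> exists c, forall x, normc (FT 1 k x) <= c.
    by move=> ik; exists ((Num.sqrt (2 * pi))^-1 * nrm1 k) => x; exact: FT_le.
  have [c hc] := bd _ ip; have [c' hc'] := bd _ ip'.
  have pos (k : R -> R[i]) (d : R) : (forall x, normc (k x) <= d) -> 0 <= d.
    by move=> /(_ 0); exact: le_trans (normc_ge0 _).
  have LW1 : L2 (fun x => Fo (-1) f x * P' x).
    have [h _] := L2_mulb (L2_cm LP') LF (ae_sameW hc') (pos _ _ hc').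
    by have -> : (fun x => Fo (-1) f x * P' x) = (fun x => P' x * Fo (-1) f x) by apply/funext => x; rewrite mulrC.
  have LW2 : L2 (fun x => Fo (-1) g x * P x).
    have [h _] := L2_mulb (L2_cm LP) LG (ae_sameW hc) (pos _ _ hc).
    by have -> : (fun x => Fo (-1) g x * P x) = (fun x => P x * Fo (-1) g x) by apply/funext => x; rewrite mulrC.
  have LW : L2 W by exact: L2D.
  (* The transforms of the cuts of [W] tend to zero at every point by [orth], and in mean to the
     transform of [W]. *)
  have FW : ae_same (Fo (-1) W) (fun=> 0).
    have [LFW cFW] := FoP s1 LW.
    suff h y : (fun m => normc (FT (-1) (cut m W) y - 0)) @ \oo --> (0 : R).
      by have [] := cvg_nrm_ae (fun m => (Plancherel_cut m s1 LW).1) LFW (cm_cst 0) cFW (ae_sameW h).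
    apply: cvg0_le (cvg0D (ci_phase_cvg y s1 LF LP') (ci_phase_cvg y s1 LG LP)) => m; first exact: normc_ge0.
    apply: le_trans (normcD _ _); rewrite le_eqVlt; apply/orP; left; apply/eqP; congr normc.
    have alg (A B c0 a b : R[i]) : a + b = 0 -> A - c0 * a + (B - c0 * b) = A + B - 0.
      move=> ab; transitivity (A + B - c0 * (a + b)); first by ring.
      by rewrite ab mulr0.
    rewrite (alg _ _ _ _ _ (orth y)); congr (_ - _).
    rewrite -[RHS]/((FT (-1) (cut m (fun x => Fo (-1) f x * P' x)) \+ FT (-1) (cut m (fun x => Fo (-1) g x * P x))) y).
    rewrite -FTD; [|exact: cint_cut..].
    by rewrite -cutD.
  have W0 : ae_same W (fun=> 0).
    apply/(nrm_eq0 LW); rewrite -(nrm_Fo s1 LW); apply/(nrm_eq0 (L2_Fo s1 LW)); exact: FW.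
  have P0 xi : `|xi| < n.+1%:R / 2 -> P xi != 0.
    exact: FT_bump_neq0 ip.
  apply: ae_imp2 W0 e3 => xi; rewrite /W => h0 h3 /P0 p0.
  move: h0; rewrite h3 mulrCA mulrA -mulrDl => /eqP; rewrite mulf_eq0 (negPf p0) orbF.
  by rewrite addrC addr_eq0 => /eqP ->; rewrite -mulNr; congr (_ * _); apply: complexP => /=; rewrite ?oppr0 ?opprK.
have /ae_foralln := key; apply: ae_imp => x hx.
have [n xn] : exists n : nat, `|x| < n.+1%:R / 2.
  exists (Num.truncn (`|x| * 2)); rewrite ltr_pdivlMr//; exact: truncnS_gt.
exact: hx n xn.
Qed.

End WeakDerivative.

Local Opaque fourier_phase L2.

Section AeAnd.
Context {R : realType}.

Lemma ae_and (P Q : R -> Prop) : {ae @lebesgue_measure R, forall x, P x} ->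
  {ae @lebesgue_measure R, forall x, Q x} -> {ae @lebesgue_measure R, forall x, P x /\ Q x}.
Proof. by apply: ae_imp2 => x. Qed.

Lemma ae_cong (k : R -> R[i] -> R[i]) (f f' : R -> R[i]) : ae_same f f' ->
  ae_same (fun x => k x (f x)) (fun x => k x (f' x)).
Proof. by apply: ae_imp => x ->. Qed.

Lemma ae_cong2 (k : R -> R[i] -> R[i] -> R[i]) (f f' g g' : R -> R[i]) :
  ae_same f f' -> ae_same g g' ->
  ae_same (fun x => k x (f x) (g x)) (fun x => k x (f' x) (g' x)).
Proof. by apply: ae_imp2 => x -> ->. Qed.

Lemma ae_sameD (f f' g g' : R -> R[i]) : ae_same f f' -> ae_same g g' ->
  ae_same (f \+ g) (f' \+ g').
Proof. by apply: ae_imp2 => x /= -> ->. Qed.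

Lemma ae_sameB (f f' g g' : R -> R[i]) : ae_same f f' -> ae_same g g' ->
  ae_same (f \- g) (f' \- g').
Proof. by apply: ae_imp2 => x /= -> ->. Qed.

Lemma ae_same_eq (f g : R -> R[i]) : (forall x, f x = g x) -> ae_same f g.
Proof. by move=> h; exact: ae_sameW. Qed.

End AeAnd.

(** * Algebra and closedness of the derivative, and chirps *)

Section Derivatives.
Context {R : realType}.
Implicit Types (f g v : R -> R[i]) (s x xi h c t : R).
Local Notation mu := (@lebesgue_measure R).
Local Notation Fo := (@fourier_phase R).

Lemma L2_imag g c : cmeasurable g -> L2 (fun x => (0 +i* x) * g x) ->
  L2 (fun x => (0 +i* (c * x)) * g x).
Proof.
move=> mg L; have := L2Z c%:C L; congr L2; apply/funext => x.
by rewrite mulrA; congr (_ * _); apply: complexP; rewrite /= ?(mul0r, mulr0, subr0, addr0).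
Qed.

Lemma Fo_inj s f g : s ^+ 2 = 1 -> L2 f -> L2 g -> ae_same (Fo s f) (Fo s g) -> ae_same f g.
Proof.
move=> s1 Lf Lg h; apply/(ae_nrmB Lf Lg); rewrite -(Fo_dist s1 Lf Lg).
by apply/(ae_nrmB (L2_Fo s1 Lf) (L2_Fo s1 Lg)).
Qed.

Lemma wdf_L2l f g : wdf f g -> L2 f. Proof. by case. Qed.
Lemma wdf_L2r f g : wdf f g -> L2 g. Proof. by case. Qed.

Lemma sqr1 : (1 : R) ^+ 2 = 1. Proof. by rewrite expr1n. Qed.

Lemma wdfD f f' g g' : wdf f f' -> wdf g g' -> wdf (f \+ g) (f' \+ g').
Proof.
move=> [Lf Lf' hf] [Lg Lg' hg]; split; [exact: L2D|exact: L2D|].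
have h1 := FoD (sqrN1 (R:=R)) Lf Lg; have h2 := FoD (sqrN1 (R:=R)) Lf' Lg'.
apply: ae_same_trans h2 _.
apply: (@ae_imp2 _ _ _ _ _ h1 (ae_imp2 _ hf hg)) => [x e1 e2|x e1 e2]; last first.
  exact: (conj e1 e2).
by case: e2 => e2 e3; rewrite e1 /= e2 e3 mulrDr.
Qed.

Lemma wdfZ z f f' : wdf f f' -> wdf (fun x => z * f x) (fun x => z * f' x).
Proof.
move=> [Lf Lf' hf]; split; [exact: L2Z|exact: L2Z|].
have h1 := FoZ z (sqrN1 (R:=R)) Lf; have h2 := FoZ z (sqrN1 (R:=R)) Lf'.
apply: ae_same_trans h2 _; apply: ae_imp2 h1 hf => x -> ->.
by rewrite mulrCA.
Qed.

Lemma wdfB f f' g g' : wdf f f' -> wdf g g' -> wdf (f \- g) (f' \- g').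
Proof.
move=> hf hg; have := wdfD hf (wdfZ (-1) hg).
by congr wdf; apply/funext => x /=; rewrite mulN1r.
Qed.

Lemma wdf0 : wdf (fun _ : R => 0 : R[i]) (fun=> 0).
Proof.
have h := dq_wdf (@L2_0 R) (@L2_0 R); apply: h.
have -> : (fun n => nrm (dq (harmonic n) (fun _ : R => 0 : R[i]) \- (fun=> 0))) = (fun=> 0).
  apply/funext => n; rewrite (_ : _ \- _ = fun=> 0) ?nrm0//.
  by apply/funext => x; rewrite /dq /shift /= !subr0 mulr0.
exact: cvg_cst.
Qed.

Lemma wdf_ae f f2 g g2 : wdf f g -> L2 f2 -> L2 g2 -> ae_same f f2 -> ae_same g g2 -> wdf f2 g2.
Proof.
move=> [Lf Lg h] L1 L2' e1 e2; split; [exact: L1|exact: L2'|].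
have h1 := Fo_ae (sqrN1 (R:=R)) Lf L1 e1; have h2 := Fo_ae (sqrN1 (R:=R)) Lg L2' e2.
apply: ae_same_trans (ae_same_sym h2) _; apply: ae_same_trans h _.
by apply: ae_imp h1 => x ->.
Qed.

Lemma wdf_uniq f g1 g2 : wdf f g1 -> wdf f g2 -> ae_same g1 g2.
Proof.
move=> [Lf L1 h1] [_ L2' h2]; apply: (Fo_inj (sqrN1 (R:=R))) => //.
exact: ae_same_trans h1 (ae_same_sym h2).
Qed.

Lemma wdf_uniq_ae f1 f2 g1 g2 : wdf f1 g1 -> wdf f2 g2 -> ae_same f1 f2 -> ae_same g1 g2.
Proof.
move=> w1 w2 e; apply: (wdf_uniq w1).
exact: wdf_ae w2 (wdf_L2l w1) (wdf_L2r w2) (ae_same_sym e) (ae_same_refl _).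
Qed.

(** Closedness of the derivative: the weak formulation passes to the limit one test function at a
    time. *)
Lemma wdf_lim (u u' : nat -> R -> R[i]) f f' : (forall n, wdf (u n) (u' n)) -> L2 f -> L2 f' ->
  (fun n => nrm (u n \- f)) @ \oo --> (0 : R) -> (fun n => nrm (u' n \- f')) @ \oo --> (0 : R) ->
  wdf f f'.
Proof.
move=> w Lf Lf' c c'; apply: weak_wdf => // phi tp.
have tp' := test_derive1 tp; have [_ [Lp _]] := test_L2 tp; have [_ [Lp' _]] := test_L2 tp'.
change (pr f (toC (derive1 phi)) = - pr f' (toC phi)).
have z k : L2 k -> (fun n : nat => nrm (k \- k)) @ \oo --> (0 : R).
  move=> Lk; rewrite (_ : k \- k = (fun=> 0)) ?nrm0; first exact: cvg_cst.
  by apply/funext => x /=; rewrite subrr.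
have a1 := pr_cvg 0 (fun n => wdf_L2l (w n)) (fun=> Lp') Lf Lp' c (z _ Lp').
have a2 := pr_cvg 0 (fun n => wdf_L2r (w n)) (fun=> Lp) Lf' Lp c' (z _ Lp).
apply: lim_normc_unique a1 _; apply: cvg_eqfun a2 => n.
have -> : pr (u n) (toC (derive1 phi)) = - pr (u' n) (toC phi) by exact: wdf_weak (w n) phi tp.
by rewrite opprK normcNC.
Qed.

(** Dominated by [f] itself, as the multipliers are unimodular. On the Fourier side it gives the
    continuity of translations and of the group. *)
Lemma mult_cvg (m : nat -> R -> R[i]) f : L2 f -> (forall n, cmeasurable (m n)) ->
  (forall n x, normc (m n x) = 1) ->
  (forall x, (fun n => normc (m n x - 1)) @ \oo --> (0 : R)) ->
  (fun n => nrm ((fun x => m n x * f x) \- f)) @ \oo --> (0 : R).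
Proof.
move=> Lf mm m1 mc.
have mf n : cmeasurable (fun x => m n x * f x) by apply: cmM => //; exact: L2_cm.
have b : {ae mu, forall x, forall n, normc (m n x * f x) <= normc (f x)}.
  by apply: ae_sameW => x n; rewrite normcM m1 mul1r.
have c : {ae mu, forall x, (fun n => normc (m n x * f x - f x)) @ \oo --> (0 : R)}.
  apply: ae_sameW => x; apply: cvg_eqfun (cvg0Z (normc (f x)) (mc x)) => n.
  by rewrite -normcM mulrBr mulr1 (mulrC (f x)).
by have [] := L2_dominated mf (L2_cm Lf) Lf b c.
Qed.

Lemma cm_cisM c : cmeasurable (fun x : R => cis (c * x)).
Proof. by apply: cm_cis; apply: measurable_funM => //; exact: measurable_cst. Qed.

Lemma cm_cisX c : cmeasurable (fun x : R => cis (c * x ^+ 2)).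
Proof. by apply: cm_cis; apply: measurable_funM => //; exact: measurable_cst. Qed.

Lemma L2_chirp c f : L2 f -> L2 (fun x => cis (c * x ^+ 2) * f x) /\
  nrm (fun x => cis (c * x ^+ 2) * f x) = nrm f.
Proof. by move=> Lf; exact: L2_mulU (cm_cisX c) Lf (fun x => normc_cis _). Qed.

(* product rule for a quadratic phase: x^2 is handled by the weight on v *)
Lemma wdf_chirp c v v' : wdf v v' -> L2 (fun x => (0 +i* x) * v x) ->
  wdf (fun x => cis (c * x ^+ 2) * v x)
      (fun x => cis (c * x ^+ 2) * (v' x + (0 +i* (2 * c * x)) * v x)).
Proof.
move=> w Lxv; have [Lv Lv' _] := w; have mv := L2_cm Lv.
have Lcxv := L2_imag (2 * c) mv Lxv.
pose h n : R := harmonic n.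
have h0 n : 0 < h n by rewrite invr_gt0.
have h1 n : h n <= 1 by rewrite invf_le1// ler1n.
have hc : h @ \oo --> (0 : R) := cvg_harmonic0.
pose p n x := cis (c * (x + h n) ^+ 2) : R[i].
have mp n : cmeasurable (p n).
  apply: cm_cis; apply: measurable_funM; first exact: measurable_cst.
  by apply: measurable_funX; exact: measurable_shift.
have p1 n x : normc (p n x) = 1 by exact: normc_cis.
have Ldq n : L2 (dq (h n) v \- v') by apply: L2B => //; exact: L2_dq.
(* The difference quotient of the product minus its expected limit is [A + B + (Cu - Cl)]: the error
   of the quotient of [v], the displaced phase acting on [v'], and the quotient of the phase acting
   on [v]. *)
pose A n x := p n x * (dq (h n) v \- v') x.
have [LA nA] : (forall n, L2 (A n)) /\ (forall n, nrm (A n) = nrm (dq (h n) v \- v')).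
  by split => n; have [] := L2_mulU (mp n) (Ldq n) (p1 n).
have cA : (fun n => nrm (A n)) @ \oo --> (0 : R).
  by apply: cvg_eqfun nA _; exact: wdf_dq w (@harmonic_neq0 R) hc.
pose m n x := cis (h n * (c * (2 * x + h n))) : R[i].
have pm n x : p n x = m n x * cis (c * x ^+ 2).
  by rewrite -cisD; congr cis; ring.
have mm n : cmeasurable (m n).
  apply: cm_cis; apply: measurable_funM; first exact: measurable_cst.
  apply: measurable_funM; first exact: measurable_cst.
  by apply: measurable_funD; [apply: measurable_funM => //; exact: measurable_cst|exact: measurable_cst].
have cm1 x : (fun n => normc (m n x - 1)) @ \oo --> (0 : R).
  apply: cvg0_le (cvg0Z (`|c| * (2 * `|x| + 1)) hc) => n; first exact: normc_ge0.
  apply: le_trans (normc_cisB1 _) _; rewrite 2!normrM gtr0_norm// mulrC ler_wpM2r ?(ltW (h0 n))//.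
  rewrite ler_wpM2l//; apply: le_trans (ler_normD _ _) _; rewrite normrM (ger0_norm (_ : 0 <= 2))//.
  by rewrite lerD2l gtr0_norm.
have [Lcv' _] := L2_chirp c Lv'.
pose B n x := m n x * (cis (c * x ^+ 2) * v' x) - cis (c * x ^+ 2) * v' x.
have LB n : L2 (B n).
  by apply: L2B => //; have [] := L2_mulU (mm n) Lcv' (fun x => normc_cis _).
have cB : (fun n => nrm (B n)) @ \oo --> (0 : R).
  exact: mult_cvg Lcv' mm (fun n x => normc_cis _) cm1.
pose q n x := ((h n)^-1)%:C * (m n x - 1) : R[i].
have mq n : cmeasurable (q n) by apply: cmZ; apply: cmB => //; exact: cm_cst.
have qle n x : normc (q n x) <= `|c * (2 * x + h n)|.
  by apply: normc_multiplier; rewrite gt_eqF.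
pose Cu n x := q n x * (cis (c * x ^+ 2) * v x).
pose Cl x := (0 +i* (2 * c * x)) * (cis (c * x ^+ 2) * v x).
have [Lcv _] := L2_chirp c Lv.
have mCl : cmeasurable Cl.
  apply: cmM; last exact: L2_cm Lcv.
  by split => /=; [exact: measurable_cst|apply: measurable_funM => //; exact: measurable_cst].
(* Dominates every [Cu n], because |c (2x + h)| <= |c| (2|x| + 1) for 0 < h <= 1; it is square
   integrable by the weight assumed on [v]. *)
pose H x := (2 * `|c|)%:C * (`|x|%:C * v x) + `|c|%:C * v x.
have LH : L2 H.
  apply: L2D; last exact: L2Z.
  apply: L2Z; have [] // := @L2_le R (fun x => `|x|%:C * v x) _ _ Lxv _.
    by apply: cmM => //; apply: cm_real; exact: measurableT_comp.
  by apply: ae_sameW => x; rewrite !normcM normcR normr_id normcI.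
have HE x : normc (H x) = (2 * `|c| * `|x| + `|c|) * normc (v x).
  have -> : H x = (2 * `|c| * `|x| + `|c|)%:C * v x.
    by rewrite /H mulrA -mulrDl -rmorphM -rmorphD.
  by rewrite normcM normcR ger0_norm// addr_ge0// !mulr_ge0.
have CuH n x : normc (Cu n x) <= normc (H x).
  rewrite HE /Cu normcM [normc (cis _ * _)]normcM normc_cis mul1r ler_wpM2r ?normc_ge0//.
  apply: le_trans (qle n x) _; rewrite normrM.
  have : `|2 * x + h n| <= 2 * `|x| + 1.
    apply: le_trans (ler_normD _ _) _; rewrite normrM (ger0_norm (_ : 0 <= 2))//.
    by rewrite lerD2l gtr0_norm.
  by move=> /(ler_wpM2l (normr_ge0 c)) /le_trans; apply; rewrite mulrDr mulr1 mulrA (mulrC _ 2).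
have cCx x : (fun n => normc (Cu n x - Cl x)) @ \oo --> (0 : R).
  pose K := normc (cis (c * x ^+ 2) * v x).
  pose Y := `|c| * (2 * `|x| + 1).
  have c0 : (fun n => K * (2 * Y ^+ 2 + `|c|) * h n) @ \oo --> (0 : R) by exact: cvg0Z.
  apply: cvg0_le c0 => n; first exact: normc_ge0.
  have -> : normc (Cu n x - Cl x) = K * normc (q n x - (0 +i* (2 * c * x))).
    by rewrite /Cu /Cl -mulrBl normcM mulrC.
  rewrite -(mulrA K); apply: ler_wpM2l; first exact: normc_ge0.
  set y := c * (2 * x + h n).
  have yY : `|y| <= Y.
    rewrite /y /Y normrM ler_wpM2l//; apply: le_trans (ler_normD _ _) _.
    by rewrite normrM (ger0_norm (_ : 0 <= 2))// lerD2l gtr0_norm.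
  have e : q n x - (0 +i* (2 * c * x)) = (q n x - (0 +i* y)) + (0 +i* (c * h n)).
    rewrite -addrA; congr (_ + _); apply: complexP; rewrite /= ?oppr0 ?addr0//.
    by rewrite /y; ring.
  rewrite e; apply: le_trans (normcD _ _) _; rewrite mulrDl; apply: lerD.
    apply: le_trans (multiplier_cvg y (lt0r_neq0 (h0 n))) _.
    rewrite gtr0_norm// mulrC ler_wpM2r ?(ltW (h0 n))// ler_wpM2l//.
    by rewrite -(real_normK (num_real y)) ler_pXn2r// nnegrE (le_trans _ yY).
  by rewrite normcI normrM (gtr0_norm (h0 n)).
have [LCl cC] := L2_dominated (fun n => cmM (mq n) (L2_cm Lcv)) mCl LH (ae_sameW (fun x n => CuH n x)) (ae_sameW cCx).
have LCu n : L2 (Cu n).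
  by have [] // := L2_le (cmM (mq n) (L2_cm Lcv)) LH (ae_sameW (CuH n)).
have Lw' : L2 (fun x => cis (c * x ^+ 2) * (v' x + (0 +i* (2 * c * x)) * v x)).
  by have [] // := L2_chirp c (L2D Lv' Lcxv).
apply: dq_wdf => //.
apply: cvg0_le (cvg0D (cvg0D cA cB) cC) => n; first exact: nrm_ge0.
rewrite (_ : _ \- _ = (A n \+ B n) \+ (Cu n \- Cl)).
  apply: le_trans (nrmD (L2D (LA n) (LB n)) (L2B (LCu n) LCl)) _.
  by rewrite lerD2r; exact: nrmD.
apply/funext => x; rewrite /dq /shift /A /B /Cu /Cl /q /= -/(h n) -/(p n x) pm /dq /shift.
move: (m n x) (cis _) (v (x + h n)) (v x) (v' x) (_%:C) (0 +i* _) => a b d e k l j; ring.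
Qed.

End Derivatives.

(** * The Schrodinger group *)

Section Schrodinger.
Context {R : realType}.
Implicit Types (f g v : R -> R[i]) (s x xi h c t : R).
Local Notation mu := (@lebesgue_measure R).
Local Notation Fo := (@fourier_phase R).
Local Notation U := (@schrodinger R).
Let mone := sqrN1 (R:=R).
Let one1 := sqr1 (R:=R).

Lemma phaseE t f : (fun xi => cis (- (t * xi ^+ 2)) * f xi) = (fun xi => cis (- t * xi ^+ 2) * f xi) :> (R -> R[i]).
Proof. by apply/funext => x; rewrite mulNr. Qed.

Lemma schrodingerE t f : U t f = Fo 1 (fun xi => cis (- t * xi ^+ 2) * Fo (-1) f xi).
Proof. by rewrite -phaseE. Qed.

Local Opaque schrodinger.

Lemma Fo_inv1 f : L2 f -> ae_same (Fo 1 (Fo (-1) f)) f.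
Proof. by move=> Lf; have := Fo_inv mone Lf; rewrite opprK. Qed.

Lemma Fo_inv2 f : L2 f -> ae_same (Fo (-1) (Fo 1 f)) f.
Proof. exact: Fo_inv one1. Qed.

Lemma L2_U t f : L2 f -> L2 (U t f).
Proof.
by move=> Lf; rewrite schrodingerE; apply: (L2_Fo one1 (L2_chirp _ (L2_Fo mone Lf)).1).
Qed.

Lemma nrm_U t f : L2 f -> nrm (U t f) = nrm f.
Proof.
move=> Lf; have LF := L2_Fo mone Lf; rewrite schrodingerE (nrm_Fo one1 (L2_chirp _ LF).1).
by rewrite (L2_chirp _ LF).2 (nrm_Fo mone Lf).
Qed.

Lemma Fo_U t f : L2 f -> ae_same (Fo (-1) (U t f)) (fun xi => cis (- t * xi ^+ 2) * Fo (-1) f xi).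
Proof. by move=> Lf; rewrite schrodingerE; apply: Fo_inv2 (L2_chirp _ (L2_Fo mone Lf)).1. Qed.

Lemma U_ae t f g : L2 f -> L2 g -> ae_same f g -> ae_same (U t f) (U t g).
Proof.
move=> Lf Lg fg; apply: (Fo_inj mone (L2_U t Lf) (L2_U t Lg)).
apply: ae_same_trans (Fo_U t Lf) _; apply: ae_same_trans _ (ae_same_sym (Fo_U t Lg)).
by apply: ae_imp (Fo_ae mone Lf Lg fg) => x ->.
Qed.

Lemma UD t f g : L2 f -> L2 g -> ae_same (U t (f \+ g)) (U t f \+ U t g).
Proof.
move=> Lf Lg; have Lfg := L2D Lf Lg.
have Lf' := L2_U t Lf; have Lg' := L2_U t Lg.
apply: (Fo_inj mone (L2_U t Lfg) (L2D Lf' Lg')).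
apply: ae_same_trans (Fo_U t Lfg) _; apply: ae_same_trans _ (ae_same_sym (FoD mone Lf' Lg')).
apply: ae_same_trans (ae_cong (fun x z => cis (- t * x ^+ 2) * z) (FoD mone Lf Lg)) _.
rewrite (_ : (fun x => _) = (fun x => cis (- t * x ^+ 2) * Fo (-1) f x) \+
   (fun x => cis (- t * x ^+ 2) * Fo (-1) g x)); last by apply/funext => x; exact: mulrDr.
exact: ae_sameD (ae_same_sym (Fo_U t Lf)) (ae_same_sym (Fo_U t Lg)).
Qed.

Lemma UZ t z f : L2 f -> ae_same (U t (fun x => z * f x)) (fun x => z * U t f x).
Proof.
move=> Lf; have LZ := L2Z z Lf; have Lf' := L2_U t Lf.
apply: (Fo_inj mone (L2_U t LZ) (L2Z z Lf')).
apply: ae_same_trans (Fo_U t LZ) _; apply: ae_same_trans _ (ae_same_sym (FoZ z mone Lf')).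
apply: ae_imp2 (FoZ z mone Lf) (Fo_U t Lf) => x -> ->.
by rewrite mulrCA.
Qed.

Lemma UB t f g : L2 f -> L2 g -> ae_same (U t (f \- g)) (U t f \- U t g).
Proof.
move=> Lf Lg.
have -> : f \- g = f \+ (fun x => -1 * g x) by apply/funext => x /=; rewrite mulN1r.
have := ae_cong2 (fun x a b => a + b) (ae_same_refl (U t f)) (UZ t (-1) Lg).
move/(ae_same_trans (UD t Lf (L2Z (-1) Lg))); congr ae_same; apply/funext => x.
by rewrite mulN1r.
Qed.

Lemma U_dist t f g : L2 f -> L2 g -> nrm (U t f \- U t g) = nrm (f \- g).
Proof.
move=> Lf Lg; rewrite -(nrm_U t (L2B Lf Lg)); apply/esym/nrm_ae; last exact: UB.
  exact: L2_U (L2B Lf Lg).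
by apply: L2B; exact: L2_U.
Qed.

Lemma U0 f : L2 f -> ae_same (U 0 f) f.
Proof.
move=> Lf; apply: (Fo_inj mone (L2_U 0 Lf) Lf); apply: ae_imp (Fo_U 0 Lf) => x ->.
by rewrite oppr0 mul0r cis0 mul1r.
Qed.

Lemma U_add t s f : L2 f -> ae_same (U t (U s f)) (U (t + s) f).
Proof.
move=> Lf; have Ls := L2_U s Lf; apply: (Fo_inj mone (L2_U t Ls) (L2_U _ Lf)).
apply: ae_same_trans (Fo_U t Ls) _; apply: ae_same_trans _ (ae_same_sym (Fo_U _ Lf)).
by apply: ae_imp (Fo_U s Lf) => x ->; rewrite mulrA -cisD; congr (cis _ * _); ring.
Qed.

Lemma UK t f : L2 f -> ae_same (U t (U (- t) f)) f.
Proof.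
by move=> Lf; apply: ae_same_trans (U_add t (- t) Lf) _; rewrite subrr; exact: U0.
Qed.

Lemma NUK t f : L2 f -> ae_same (U (- t) (U t f)) f.
Proof.
by move=> Lf; apply: ae_same_trans (U_add (- t) t Lf) _; rewrite addNr; exact: U0.
Qed.

Lemma wdf_U t f f' : wdf f f' -> wdf (U t f) (U t f').
Proof.
move=> [Lf Lf' h]; split; [exact: L2_U|exact: L2_U|].
apply: ae_same_trans (Fo_U t Lf') _.
by apply: ae_imp2 h (Fo_U t Lf) => x -> ->; rewrite mulrCA.
Qed.

(** Continuity at time 0 is dominated convergence of the multiplier. The group law and the isometry
    transport it to all pairs of times, so [d] depends only on [f] and [e]. *)
Lemma U_cont f : L2 f -> forall e, 0 < e -> exists2 d, 0 < d &
  forall t s, `|t - s| < d -> nrm (U t f \- U s f) < e.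
Proof.
move=> Lf e e0; have LF := L2_Fo mone Lf.
have [d d0 hd] : exists2 d, 0 < d & forall s, True -> `|s - 0| < d -> `|nrm (U s f \- f)| < e.
  apply: seq_eps e e0 => s _ s0.
  have mc n : cmeasurable (fun xi : R => cis (- s n * xi ^+ 2)) by exact: cm_cisX.
  have c x : (fun n => normc (cis (- s n * x ^+ 2) - 1)) @ \oo --> (0 : R).
    apply: cvg0_le (cvg0Z (x ^+ 2) (cvg0_norm s0)) => n; first exact: normc_ge0.
    apply: le_trans (normc_cisB1 _) _.
    by rewrite normrM normrN mulrC (ger0_norm (sqr_ge0 x)).
  apply: cvg_eqfun (mult_cvg LF mc (fun n x => normc_cis _) c) => n /=.
  have Ls := L2_U (s n) Lf; rewrite -(Fo_dist mone Ls Lf); apply: nrm_ae.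
  - by apply: L2B; [exact: L2_Fo mone Ls|exact: LF].
  - by apply: L2B; [exact: (L2_chirp _ LF).1|exact: LF].
  - by apply: ae_imp (Fo_U (s n) Lf) => x /= ->.
exists d => // t s ts; rewrite -(U_dist (- s) (L2_U t Lf) (L2_U s Lf)).
have := hd (t - s) I; rewrite subr0 => /(_ ts); apply: le_lt_trans.
rewrite ger0_norm ?nrm_ge0// le_eqVlt; apply/orP; left; apply/eqP; apply: nrm_ae.
- by apply: L2B; apply: L2_U; exact: L2_U.
- exact: L2B (L2_U _ Lf) Lf.
- have := U_add (- s) t Lf; rewrite (addrC (- s)) => h.
  exact: ae_sameB h (NUK s Lf).
Qed.

Lemma shift_cvg f (h : nat -> R) : L2 f -> h @ \oo --> (0 : R) ->
  (fun n => nrm (shift (h n) f \- f)) @ \oo --> (0 : R).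
Proof.
move=> Lf hc; have LF := L2_Fo mone Lf.
have mc n : cmeasurable (fun xi : R => cis (h n * xi)) by exact: cm_cisM.
have c x : (fun n => normc (cis (h n * x) - 1)) @ \oo --> (0 : R).
  apply: cvg0_le (cvg0Z `|x| (cvg0_norm hc)) => n; first exact: normc_ge0.
  by apply: le_trans (normc_cisB1 _) _; rewrite normrM mulrC.
apply: cvg_eqfun (mult_cvg LF mc (fun n x => normc_cis _) c) => n /=.
have [Ls _] := L2_shift (h n) Lf; rewrite -(Fo_dist mone Ls Lf); apply: nrm_ae.
- by apply: L2B; [exact: L2_Fo mone Ls|exact: LF].
- by apply: L2B; [exact: (L2_mulU (mc n) LF (fun x => normc_cis _)).1|exact: LF].
- by apply: ae_imp (Fo_shift (h n) mone Lf) => x /= ->; rewrite mulN1r opprK.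
Qed.

Lemma wdf_shift h f g : wdf f g -> wdf (shift h f) (shift h g).
Proof.
move=> w; have [Lf Lg hw] := w.
split; [exact: (L2_shift h Lf).1|exact: (L2_shift h Lg).1|].
apply: ae_imp2 (Fo_shift h mone Lg) (ae_and (Fo_shift h mone Lf) hw) => x -> [-> ->].
by rewrite mulrCA.
Qed.

(* In frequency space multiplication by x becomes a derivative, to which the
   product rule for the phase of the group applies. *)
Lemma U_x t f f' : wdf f f' -> L2 (fun x => (0 +i* x) * f x) ->
  L2 (fun x => (0 +i* x) * U t f x) /\
  ae_same (fun x => (0 +i* x) * U t f x) (U t (fun x => (0 +i* x) * f x + (2 * t)%:C * f' x)).
Proof.
move=> w Lx; have [Lf Lf' hw] := w; have LF := L2_Fo mone Lf.
pose k x := (0 +i* x) * f x; pose psi := Fo (-1) k.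
have Lpsi : L2 psi := L2_Fo mone Lx.
(* The frequency derivative of the transform of f is the transform of -ix f; hence the factor -1. *)
have w1 : wdf (Fo (-1) f) (fun x => -1 * psi x).
  apply: (mult_wdf one1 LF (L2Z (-1) Lpsi)).
  apply: ae_same_trans (FoZ (-1) one1 Lpsi) _.
  apply: ae_same_trans (ae_cong (fun x z => -1 * z) (Fo_inv1 Lx)) _.
  apply: ae_same_trans _ (ae_cong (fun x z => (0 +i* - (1 * x)) * z) (ae_same_sym (Fo_inv1 Lf))).
  apply: ae_same_eq => x; rewrite mulrA; congr (_ * _).
  by apply: complexP; rewrite /= ?(mul0r, mulr0, subr0, addr0, mulN1r, oppr0, mul1r).
have Lxi : L2 (fun xi => (0 +i* xi) * Fo (-1) f xi).
  by apply: L2_ae hw; [apply: cmM; [exact: cm_imag|exact: L2_cm]|exact: L2_Fo].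
(* The roles are exchanged: the multiplier of the group is a chirp in frequency, and the weight it
   requires is the square integrability of f'. *)
have w2 := wdf_chirp (- t) w1 Lxi.
have h := wdf_Fo one1 w2; rewrite -schrodingerE in h.
have Lm : L2 (fun x => k x + (2 * t)%:C * f' x) by apply: L2D => //; exact: L2Z.
have e1 : ae_same (Fo (-1) (fun x => k x + (2 * t)%:C * f' x))
   (fun xi => psi xi + (2 * t)%:C * ((0 +i* xi) * Fo (-1) f xi)).
  apply: ae_same_trans (FoD mone Lx (L2Z (2 * t)%:C Lf')) _.
  apply: ae_sameD (ae_same_refl _) _.
  apply: ae_same_trans (FoZ (2 * t)%:C mone Lf') _.
  by apply: ae_imp hw => x hx; congr (_ * _); exact: hx.
have Lr := wdf_L2r w2.
have e2 : ae_same (fun x => (0 +i* x) * U t f x) (U t (fun x => k x + (2 * t)%:C * f' x)).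
  have L3 := L2Z (-1) Lr.
  have e3 : ae_same (fun x => (0 +i* x) * U t f x) (Fo 1 (fun x => -1 * (cis (- t * x ^+ 2) *
       (-1 * psi x + (0 +i* (2 * - t * x)) * Fo (-1) f x)))).
    apply: ae_same_sym; apply: ae_same_trans (FoZ (-1) one1 Lr) _.
    apply: ae_same_trans (ae_cong (fun x z => -1 * z) h) _.
    apply: ae_same_eq => x; rewrite mulrA; congr (_ * _).
    by apply: complexP; rewrite /= ?(mul0r, mulr0, subr0, addr0, mulN1r, oppr0, mul1r, opprK).
  apply: ae_same_trans e3 _; rewrite schrodingerE.
  apply: (Fo_ae one1 L3 (L2_chirp _ (L2_Fo mone Lm)).1).
  apply: ae_same_trans _ (ae_cong (fun x z => cis (- t * x ^+ 2) * z) (ae_same_sym e1)).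
  apply: ae_same_eq => x.
  have -> : (0 +i* (2 * - t * x)) = - ((2 * t)%:C * (0 +i* x)) :> R[i].
    by apply: complexP; rewrite /= ?(mul0r, mulr0, subr0, addr0, oppr0)// mulrN mulNr.
  move: (cis _) (psi x) (_%:C) (0 +i* x) (Fo (-1) f x) => a b c d e; ring.
split; last exact: e2.
apply: (L2_ae _ (L2_U t Lm) (ae_same_sym e2)).
by apply: cmM; [exact: cm_imag|exact: L2_cm (L2_U t Lf)].
Qed.

(** The multiplier 1/(1 + i l xi), split into real and imaginary parts. *)
Definition resolvent (l : R) : R -> R[i] := fun xi =>
  (1 + (l * xi) ^+ 2)^-1 +i* (- (l * xi) / (1 + (l * xi) ^+ 2)).

Lemma resolventE l xi : resolvent l xi * (1 +i* (l * xi)) = 1.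
Proof.
have d0 : 1 + (l * xi) ^+ 2 != 0 by rewrite gt_eqF// ltr_wpDr ?sqr_ge0.
by apply: complexP => /=; field.
Qed.

Lemma continuous_resolvent l : continuous (fun xi : R => (1 + (l * xi) ^+ 2)^-1).
Proof.
move=> x; apply: cvgV; first by rewrite gt_eqF// ltr_wpDr ?sqr_ge0.
apply: cvgD; first exact: cvg_cst.
apply: (@continuous_comp _ _ _ (fun x : R => l * x) (fun y : R => y ^+ 2)).
  by apply: cvgM; [exact: cvg_cst|exact: cvg_id].
exact: exprn_continuous.
Qed.

Lemma cm_resolvent l : cmeasurable (resolvent l).
Proof.
have h : measurable_fun setT (fun xi : R => (1 + (l * xi) ^+ 2)^-1).
  by apply: continuous_measurable_fun; exact: continuous_resolvent.
split => //=; apply: measurable_funM => //.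
by apply: measurableT_comp => //; apply: measurable_funM => //; exact: measurable_cst.
Qed.

Lemma normc_resolvent l xi : normc (resolvent l xi) ^+ 2 = (1 + (l * xi) ^+ 2)^-1.
Proof.
have d0 : 1 + (l * xi) ^+ 2 != 0 by rewrite gt_eqF// ltr_wpDr ?sqr_ge0.
by rewrite normc_sqr /=; field.
Qed.

Lemma L2_resolvent l : 0 < l -> L2 (resolvent l) /\ nrm (resolvent l) ^+ 2 = pi / l.
Proof.
move=> l0.
have e : sqint (resolvent l) = (pi / l)%:E.
  transitivity (\int[mu]_x (((1 + (l * x) ^+ 2)^-1)%:E))%E.
    by apply: eq_integral => x _; rewrite normc_resolvent.
  rewrite ge0_symfun_integralT//.
  - rewrite (_ : [set x : R | 0 <= x] = `[0%R, +oo[%classic); last first.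
      by apply/seteqP; split => x /=; rewrite in_itv/= andbT.
    rewrite -ge0_integralZl//; last first.
    + by move=> x _; rewrite lee_fin invr_ge0 addr_ge0// sqr_ge0.
    + apply/measurable_EFinP; apply: measurable_funTS; apply: continuous_measurable_fun.
      exact: continuous_resolvent.
    have := integral_invD_sqr l^-1; rewrite gtr0_norm ?invr_gt0// => <-.
    apply: eq_integral => x _; rewrite -EFinM; congr (_%:E).
    have d0 : 1 + (l * x) ^+ 2 != 0 by rewrite gt_eqF// ltr_wpDr ?sqr_ge0.
    have d1 : x ^+ 2 + l^-1 ^+ 2 != 0 by rewrite gt_eqF// ltr_wpDl ?sqr_ge0// exprn_gt0// invr_gt0.
    have l1 : l != 0 by rewrite gt_eqF.
    rewrite -mulrA; have -> : l^-1 ^+ 2 / (x ^+ 2 + l^-1 ^+ 2) = (1 + (l * x) ^+ 2)^-1.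
      apply: (mulfI d0); rewrite mulfV//; apply: (mulIf d1); rewrite mul1r -!mulrA mulVf// mulr1.
      rewrite exprMn exprVn; field.
      by [].
    by [].
  - by move=> x; rewrite invr_ge0 addr_ge0// sqr_ge0.
  - exact: continuous_resolvent.
  - by move=> x /=; rewrite mulrN sqrrN.
have L : L2 (resolvent l) by apply/L2P; rewrite e ltry; split => //; exact: cm_resolvent.
by split => //; apply: EFin_inj; rewrite nrm_sqr.
Qed.

(** The normalisation of the inverse transform times the part of the norm of [resolvent l] that does
    not depend on [l]. *)
Definition sobc : R := (Num.sqrt (2 * pi))^-1 * Num.sqrt pi.

(** The transform of f is the resolvent times that of f + l f', a product of two L^2 functions;
    Cauchy-Schwarz bounds its L^1 norm, and the inverse transform is bounded by that. The free
    length [l] is what later produces the decay in time. *)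
Lemma sobolev l f f' : 0 < l -> wdf f f' ->
  {ae mu, forall x, normc (f x) <= sobc / Num.sqrt l * (nrm f + l * nrm f')}.
Proof.
move=> l0 w; have [Lf Lf' hw] := w; have LF := L2_Fo mone Lf; have LF' := L2_Fo mone Lf'.
have [LW nW] := L2_resolvent l0.
pose g x := Fo (-1) f x + l%:C * Fo (-1) f' x.
have Lg : L2 g by apply: L2D => //; exact: L2Z.
have ng : nrm g <= nrm f + l * nrm f'.
  apply: le_trans (nrmD LF (L2Z _ LF')) _.
  by rewrite nrmZ// normcR gtr0_norm// !nrm_Fo.
have [ck nk] := L2_mul LW Lg.
pose k x := resolvent l x * g x.
have fk : ae_same (Fo (-1) f) k.
  apply: ae_imp hw => x hx; rewrite /k /g hx mulrA -[X in X + _]mul1r -mulrDl mulrA.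
  rewrite (_ : 1 + l%:C * (0 +i* x) = 1 +i* (l * x)); first by rewrite resolventE mul1r.
  by apply: complexP; rewrite /= ?(mul0r, mulr0, subr0, addr0, add0r).
have Lk : L2 k by apply: L2_ae fk => //; exact: (ck.1).
pose K := (Num.sqrt (2 * pi))^-1 * nrm1 k.
have bd n x : normc (FT 1 (cut n k) x) <= K.
  apply: le_trans (FT_le _ _ (cint_cut n Lk)) _; rewrite /K ler_wpM2l ?fcst_ge0//.
  apply: nrm1_le => //; first exact: cint_cut.
  by move=> y; rewrite /cut normcM ler_piMl ?normc_ge0// normc_chi_le1.
have KC : K <= sobc / Num.sqrt l * (nrm f + l * nrm f').
  rewrite /K /sobc -!mulrA ler_wpM2l ?fcst_ge0//.
  apply: le_trans nk _; rewrite mulrA; apply: ler_pM => //; rewrite ?nrm_ge0//.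
  rewrite -(@ler_pXn2r _ 2) ?nnegrE ?nrm_ge0 ?divr_ge0 ?sqrtr_ge0//.
  by rewrite nW expr_div_n !sqr_sqrtr ?(ltW l0)// ltW// pi_gt0.
have fE : ae_same (Fo 1 k) f.
  have L1 := L2_Fo one1 Lk.
  exact: ae_same_trans (Fo_ae one1 Lk LF (ae_same_sym fk)) (Fo_inv1 Lf).
have [LFk cFk] := FoP one1 Lk.
have L3 n : L2 (FT 1 (cut n k)) := (Plancherel_cut n one1 Lk).1.
have z : (fun n : nat => nrm ((fun x => g x) \- g)) @ \oo --> (0 : R).
  rewrite (_ : _ \- _ = fun=> 0) ?nrm0; first exact: cvg_cst.
  by apply/funext => x /=; rewrite subrr.
(* The pointwise inversion integral satisfies the bound everywhere, and it agrees almost everywhere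
   with the limit in mean. *)
pose Fk y := fcst * ci (fun x => cis (1 * (x * y)) * k x).
have cpt y : (fun n => normc (FT 1 (cut n k) y - Fk y)) @ \oo --> (0 : R).
  exact: (@ci_phase_cvg R 1 y (resolvent l) g one1 LW Lg).
have mFk : cmeasurable Fk := cm_cvg (fun n => L2_cm (L3 n)) cpt.
have [FkE _] := cvg_nrm_ae L3 LFk mFk cFk (ae_sameW cpt).
have FkK y : normc (Fk y) <= K.
  apply/ler_addgt0Pr => e e0.
  have /cvg0P := cpt y => /(_ (fun n => normc_ge0 _) e e0) [n /(_ n (leqnn n)) hn].
  have := normcB_triangle (Fk y) (FT 1 (cut n k) y) 0; rewrite !subr0 => /le_trans; apply.
  by rewrite addrC lerD// normcBC ltW.
apply: ae_imp2 fE FkE => x <- ->; exact: le_trans (FkK x) KC.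
Qed.

End Schrodinger.

(** * Differential equations in a complete seminormed space *)

Section Seminormed.
Context {R : realType} (V : lmodType R) (D : V -> Prop) (N : V -> R).

(** Modelled on H^1 functions rather than classes: the axioms hold only on the domain [D], [N] may
    vanish off zero, and completeness gives some limit, not a unique one. *)
Definition seminormed := [/\ [/\ D 0, forall u v, D u -> D v -> D (u + v) &
    forall (a : R) u, D u -> D (a *: u)],
  forall u, 0 <= N u, forall u v, D u -> D v -> N (u + v) <= N u + N v,
  forall (a : R) u, D u -> N (a *: u) = `|a| * N u &
  forall u : nat -> V, (forall n, D (u n)) ->
    (forall e, 0 < e -> exists n0, forall n m, (n0 <= n)%N -> (n0 <= m)%N -> N (u n - u m) < e) ->
    exists2 v, D v & forall e, 0 < e -> exists n0, forall n, (n0 <= n)%N -> N (u n - v) < e].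

Context (H : seminormed).
Implicit Types (u v w : V) (A B s t tau e d : R) (P Q G : R -> V).

Lemma sn_D0 : D 0. Proof. by case: H => [[]]. Qed.
Lemma sn_DD u v : D u -> D v -> D (u + v). Proof. by case: H => [[_ + _]] _ _ _ _; apply. Qed.
Lemma sn_DZ (a : R) u : D u -> D (a *: u). Proof. by case: H => [[_ _ +]] _ _ _ _; apply. Qed.
Lemma sn_ge0 u : 0 <= N u. Proof. by case: H => _ + _ _ _; apply. Qed.
Lemma sn_ND u v : D u -> D v -> N (u + v) <= N u + N v. Proof. by case: H => _ _ + _ _; apply. Qed.
Lemma sn_NZ (a : R) u : D u -> N (a *: u) = `|a| * N u. Proof. by case: H => _ _ _ + _; apply. Qed.

Lemma sn_DN u : D u -> D (- u).
Proof. by move=> /(sn_DZ (-1)); rewrite scaleN1r. Qed.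

Lemma sn_DB u v : D u -> D v -> D (u - v).
Proof. by move=> Du Dv; apply: sn_DD => //; exact: sn_DN. Qed.

Lemma sn_N0 : N 0 = 0.
Proof. by rewrite -(scale0r (0 : V)) sn_NZ ?normr0 ?mul0r//; exact: sn_D0. Qed.

Lemma sn_NN u : D u -> N (- u) = N u.
Proof. by move=> Du; rewrite -scaleN1r sn_NZ// normrN normr1 mul1r. Qed.

Lemma sn_NBC u v : D u -> D v -> N (u - v) = N (v - u).
Proof. by move=> Du Dv; rewrite -opprB sn_NN//; exact: sn_DB. Qed.

Lemma sn_triangle u v w : D u -> D v -> D w -> N (u - w) <= N (u - v) + N (v - w).
Proof.
move=> Du Dv Dw; rewrite -[u - w](subrKA v).
by apply: sn_ND; exact: sn_DB.
Qed.

Lemma sn_NB u v : D u -> D v -> N (u - v) <= N u + N v.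
Proof. by move=> Du Dv; apply: le_trans (sn_ND Du (sn_DN Dv)) _; rewrite sn_NN. Qed.

Lemma sn_Nle u v : D u -> D v -> N u <= N v + N (u - v).
Proof. by move=> Du Dv; rewrite -{1}(subrK v u) addrC; apply: sn_ND => //; exact: sn_DB. Qed.

Lemma sub3 u v w u' v' w' :
  u - v - w - (u' - v' - w') = (u - u') - (v - v') - (w - w').
Proof. by rewrite !opprD !opprK addrACA [X in X + _]addrACA. Qed.

Lemma sn_sum n (F : nat -> V) : (forall i, (i < n)%N -> D (F i)) ->
  D (\sum_(i < n) F i) /\ N (\sum_(i < n) F i) <= \sum_(i < n) N (F i).
Proof.
elim: n => [_|n IH h]; first by rewrite !big_ord0 sn_N0; split => //; exact: sn_D0.
have [D1 N1] := IH (fun i hi => h i (ltnW hi)).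
rewrite !big_ord_recr /=; split; first by apply: sn_DD => //; exact: h.
by apply: le_trans (sn_ND D1 (h n (ltnSn n))) _; rewrite lerD2r.
Qed.

(* A strong antiderivative: increments are compared with an arbitrary tag, so that
   Riemann sums converge to increments without any theory of vector integrals. *)
Definition antider A B P G := (forall t, A <= t <= B -> D (P t) /\ D (G t)) /\
  forall e, 0 < e -> exists2 d, 0 < d & forall s tau t, A <= s -> s <= tau <= t -> t <= B ->
    t - s < d -> N (P t - P s - (t - s) *: G tau) <= e * (t - s).

Definition ucont A B G := forall e, 0 < e -> exists2 d, 0 < d &
  forall s t, A <= s <= B -> A <= t <= B -> `|s - t| < d -> N (G s - G t) < e.

(** The interval is crossed in steps of length d/2; the bounds [L t - L s] telescope. *)
Lemma local_to_global A B Q (L : R -> R) d : 0 < d -> (forall t, A <= t <= B -> D (Q t)) ->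
  (forall s t, A <= s -> s <= t -> t <= B -> t - s < d -> N (Q t - Q s) <= L t - L s) ->
  forall s t, A <= s -> s <= t -> t <= B -> N (Q t - Q s) <= L t - L s.
Proof.
move=> d0 DQ h s t As st tB.
have [n] : exists n : nat, t - s < n%:R * (d / 2).
  exists (Num.truncn ((t - s) / (d / 2))).+1.
  by rewrite -ltr_pdivrMr ?divr_gt0// truncnS_gt.
elim: n s As st => [s _ st|n IH s As st hn].
  by rewrite mul0r ltNge subr_ge0 st.
have [ts|ts] := ltP (t - s) d; first exact: h.
have mt : s + d / 2 <= t by move: ts; lra.
have sm : s <= s + d / 2 by lra.
have Am : A <= s + d / 2 by exact: le_trans As sm.
have h1 : N (Q t - Q (s + d / 2)) <= L t - L (s + d / 2).
  by apply: IH => //; move: hn; rewrite -natr1 mulrDl mul1r; lra.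
have h2 : N (Q (s + d / 2) - Q s) <= L (s + d / 2) - L s.
  by apply: h => //; [exact: le_trans tB|lra].
have Dm : D (Q (s + d / 2)) by apply: DQ; rewrite Am (le_trans mt).
have Dt : D (Q t) by apply: DQ; rewrite (le_trans As st).
have Ds : D (Q s) by apply: DQ; rewrite As (le_trans st).
by apply: le_trans (sn_triangle Dt Dm Ds) _; lra.
Qed.

Lemma le_eps_mul (x y z : R) : 0 <= z -> (forall e, 0 < e -> x <= y + e * z) -> x <= y.
Proof.
move=> z0 h; apply/ler_addgt0Pr => e e0.
have z1 : 0 < z + 1 by rewrite ltr_wpDl.
have := h (e / (z + 1)) (divr_gt0 e0 z1) => /le_trans; apply.
rewrite lerD2l mulrAC ler_pdivrMr// ler_wpM2l ?(ltW e0)//.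
by rewrite lerDl.
Qed.

(** The comparison may be made at any point of a short interval. Growing majorants use the left end
    and decaying ones the right end, so no integral of [N (G t)] is ever formed. *)
Lemma mean_value A B P G (L : R -> R) : antider A B P G ->
  (forall s t, A <= s -> s <= t -> t <= B -> exists2 tau, s <= tau <= t & N (G tau) * (t - s) <= L t - L s) ->
  forall s t, A <= s -> s <= t -> t <= B -> N (P t - P s) <= L t - L s.
Proof.
move=> [DPG hP] hL s t As st tB.
apply: (@le_eps_mul _ _ (t - s)); first by rewrite subr_ge0.
move=> e e0; have [d d0 hd] := hP e e0.
rewrite -addrA [- _ + _]addrC addrA.
have -> : L t + e * (t - s) - L s = (L t + e * t) - (L s + e * s) by ring.
apply: (@local_to_global A B P (fun t => L t + e * t) d) => //.
  by move=> r /DPG[].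
move=> {As st tB}s {}t As st tB ts; have [tau stau hG] := hL s t As st tB.
have inI r : s <= r <= t -> A <= r <= B.
  by move=> /andP[sr rt]; rewrite (le_trans As sr) (le_trans rt).
have [Dt _] := DPG t (inI t (introT andP (conj st (lexx t)))).
have [Ds _] := DPG s (inI s (introT andP (conj (lexx s) st))).
have [_ Dtau] := DPG tau (inI tau stau).
apply: le_trans (sn_Nle (sn_DB Dt Ds) (sn_DZ (t - s) Dtau)) _.
rewrite sn_NZ// ger0_norm ?subr_ge0// mulrC.
have := hd s tau t As stau tB ts; move: hG; lra.
Qed.

(** Needed because the vector field is respected by equality almost everywhere only up to seminorm
    zero. *)
Lemma antider_eq A B P G G' : antider A B P G ->
  (forall t, A <= t <= B -> D (G' t) /\ N (G t - G' t) = 0) -> antider A B P G'.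
Proof.
move=> [DPG hP] h; split=> [t tI|e e0]; first by split; [case: (DPG t tI)|case: (h t tI)].
have [d d0 hd] := hP e e0; exists d => // s tau t As stau tB ts.
have inI r : s <= r <= t -> A <= r <= B.
  by move=> /andP[sr rt]; rewrite (le_trans As sr) (le_trans rt).
have [st1 st2] := andP stau; have st := le_trans st1 st2.
have [Dt _] := DPG t (inI t (introT andP (conj st (lexx t)))).
have [Ds _] := DPG s (inI s (introT andP (conj (lexx s) st))).
have [_ Dtau] := DPG tau (inI tau stau).
have [D' N'] := h tau (inI tau stau).
rewrite (_ : _ - _ = (P t - P s - (t - s) *: G tau) + (t - s) *: (G tau - G' tau)); last first.
  by rewrite scalerBr addrA subrK.
have Dd := sn_DB Dtau D'.
apply: le_trans (sn_ND (sn_DB (sn_DB Dt Ds) (sn_DZ _ Dtau)) (sn_DZ _ Dd)) _.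
by rewrite sn_NZ// N' mulr0 addr0; exact: hd.
Qed.

Lemma antiderB A B P Q G G' : antider A B P G -> antider A B Q G' ->
  antider A B (fun t => P t - Q t) (fun t => G t - G' t).
Proof.
move=> [D1 h1] [D2 h2]; split => [t tI|e e0].
  by have [? ?] := D1 t tI; have [? ?] := D2 t tI; split; exact: sn_DB.
have e2 : 0 < e / 2 by rewrite divr_gt0.
have [d1 d10 hd1] := h1 _ e2; have [d2 d20 hd2] := h2 _ e2.
exists (Num.min d1 d2); first by rewrite lt_min d10.
move=> s tau t As stau tB; rewrite lt_min => /andP[ts1 ts2].
have inI r : s <= r <= t -> A <= r <= B.
  by move=> /andP[sr rt]; rewrite (le_trans As sr) (le_trans rt).
have [st1 st2] := andP stau; have st := le_trans st1 st2.
have tI := inI t (introT andP (conj st (lexx t))).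
have sI := inI s (introT andP (conj (lexx s) st)).
have tauI := inI tau stau.
have a1 := hd1 s tau t As stau tB ts1; have a2 := hd2 s tau t As stau tB ts2.
rewrite (_ : _ - _ = (P t - P s - (t - s) *: G tau) - (Q t - Q s - (t - s) *: G' tau)); last first.
  by rewrite sub3 scalerBr.
have [Pt _] := D1 t tI; have [Ps _] := D1 s sI; have [_ Gt] := D1 tau tauI.
have [Qt _] := D2 t tI; have [Qs _] := D2 s sI; have [_ Gt'] := D2 tau tauI.
have X1 : D (P t - P s - (t - s) *: G tau) by apply: sn_DB; [exact: sn_DB|exact: sn_DZ].
have X2 : D (Q t - Q s - (t - s) *: G' tau) by apply: sn_DB; [exact: sn_DB|exact: sn_DZ].
by apply: le_trans (sn_NB X1 X2) _; lra.
Qed.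

Lemma antider_shift A B P G c : D c -> antider A B P G -> antider A B (fun t => c + P t) G.
Proof.
move=> Dc [D1 h1]; split => [t tI|e e0].
  by have [? ?] := D1 t tI; split => //; exact: sn_DD.
have [d d0 hd] := h1 e e0; exists d => // s tau t As stau tB ts.
by rewrite opprD addrACA subrr add0r; exact: hd.
Qed.

Lemma antider_opp A B P G : antider A B P G ->
  antider (- B) (- A) (fun t => P (- t)) (fun t => - G (- t)).
Proof.
move=> [D1 h1]; split => [t /andP[t1 t2]|e e0].
  have tI : A <= - t <= B by rewrite lerNr t2 lerNl.
  by have [? ?] := D1 _ tI; split => //; exact: sn_DN.
have [d d0 hd] := h1 e e0; exists d => // s tau t Bs /andP[stau taut] tA ts.
have h := hd (- t) (- tau) (- s).
have a1 : A <= - t by rewrite lerNr.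
have a2 : - t <= - tau <= - s by rewrite !lerN2 stau taut.
have a3 : - s <= B by rewrite lerNl.
have := h a1 a2 a3; rewrite opprK [- s + t]addrC => /(_ ts).
have [Dt _] := D1 (- t) (introT andP (conj a1 (le_trans (le_trans (proj1 (andP a2)) (proj2 (andP a2))) a3))).
have [Ds _] := D1 (- s) (introT andP (conj (le_trans a1 (le_trans (proj1 (andP a2)) (proj2 (andP a2)))) a3)).
have [_ Dtau] := D1 (- tau) (introT andP (conj (le_trans a1 (proj1 (andP a2))) (le_trans (proj2 (andP a2)) a3))).
move/(le_trans _); apply; rewrite scalerN opprK -sn_NN.
  by rewrite opprD opprB.
by apply: sn_DD; [exact: sn_DB|exact: sn_DZ].
Qed.

(** * Antiderivatives of uniformly continuous curves *)

Section Existence.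
Context (A B : R) (G : R -> V) (AB : A <= B).
Context (DG : forall t, A <= t <= B -> D (G t)) (uG : ucont A B G).

Let x (n j : nat) : R := A + j%:R * ((B - A) / n.+1%:R).
(** For [A <= t] this is the length of the part of cell j lying to the left of [t]. So [Pn n] is the
    integral from [A] of the step function that takes the values of [G] at left grid points. *)
Let len n j t := Num.min t (x n j.+1) - Num.min t (x n j).
Let Pn (n : nat) t : V := \sum_(j < n.+1) len n j t *: G (x n j).

Lemma grid_xS n j : x n j.+1 = x n j + (B - A) / n.+1%:R.
Proof. by rewrite /x -natr1 mulrDl mul1r addrA. Qed.

Lemma grid_h0 n : 0 <= (B - A) / n.+1%:R.
Proof. by rewrite divr_ge0// subr_ge0. Qed.

Lemma grid_xI n j : (j < n.+1)%N -> A <= x n j <= B.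
Proof.
move=> jn; rewrite /x lerDl mulr_ge0 ?grid_h0//=.
rewrite -lerBrDl mulrCA ler_piMr ?subr_ge0//.
by rewrite ler_pdivrMr// mul1r ler_nat ltnW.
Qed.

Lemma grid_x_last n : x n n.+1 = B.
Proof. by rewrite /x mulrC divfK// addrC subrK. Qed.

Lemma grid_len_sum n s t : A <= s -> s <= t -> t <= B ->
  \sum_(j < n.+1) (len n j t - len n j s) = t - s.
Proof.
move=> As st tB.
have tel r : A <= r -> r <= B -> \sum_(j < n.+1) len n j r = r - A.
  move=> Ar rB; rewrite -(big_mkord xpredT (fun j => len n j r)) telescope_sumr//.
  by rewrite grid_x_last (min_l rB) /x mul0r addr0 (min_r Ar).
rewrite sumrB !tel//; [lra|exact: le_trans st tB|exact: le_trans st].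
Qed.

Lemma grid_len_ge0 n j s t : s <= t -> 0 <= len n j t - len n j s.
Proof.
move=> st; have := grid_h0 n; rewrite /len grid_xS; set h := _ / _ => hh; rewrite !minEle.
by do 4 case: ifP; lra.
Qed.

Lemma grid_len_eq0 n j s t : s <= t -> t <= x n j \/ x n j.+1 <= s -> len n j t - len n j s = 0.
Proof.
move=> st; have := grid_h0 n; rewrite /len grid_xS; set h := _ / _ => hh; rewrite !minEle.
by do 4 case: ifP; case; lra.
Qed.

Lemma grid_DPn n t : D (Pn n t).
Proof. by have [] := @sn_sum n.+1 (fun j => len n j t *: G (x n j)) (fun j jn => sn_DZ _ (DG (grid_xI jn))). Qed.

(** Only cells that meet [s, t] contribute, and their left grid points lie within [d] of [tau] once
    both the mesh and t - s are below d/2. The estimate is uniform in [n], which is what survives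
    the limit. *)
Lemma grid_approx e : 0 < e -> exists2 d, 0 < d & exists n0, forall n, (n0 <= n)%N ->
  forall s tau t, A <= s -> s <= tau <= t -> t <= B -> t - s < d ->
  N (Pn n t - Pn n s - (t - s) *: G tau) <= e * (t - s).
Proof.
move=> e0; have [d d0 hd] := uG e0; exists (d / 2); first by rewrite divr_gt0.
have d2 : 0 < d / 2 by rewrite divr_gt0.
exists (Num.truncn ((B - A) / (d / 2))).+1 => n nn s tau t As stau tB ts.
have [st1 st2] := andP stau; have st := le_trans st1 st2.
have hn : (B - A) / n.+1%:R < d / 2.
  rewrite ltr_pdivrMr// mulrC -ltr_pdivrMr//.
  by apply: lt_le_trans (truncnS_gt _) _; rewrite ler_nat (leq_trans nn).
have tauI : A <= tau <= B by rewrite (le_trans As st1) (le_trans st2).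
pose F j := (len n j t - len n j s) *: (G (x n j) - G tau).
have -> : Pn n t - Pn n s - (t - s) *: G tau = \sum_(j < n.+1) F j.
  rewrite /F /Pn -sumrB -(grid_len_sum n As st tB) scaler_suml -sumrB.
  by apply: eq_bigr => j _; rewrite scalerBr [in RHS]scalerBl.
have DF j : (j < n.+1)%N -> D (F j).
  by move=> jn; apply: sn_DZ; apply: sn_DB; apply: DG => //; exact: grid_xI.
have [_ /le_trans] := sn_sum DF; apply.
rewrite -[leRHS](_ : \sum_(j < n.+1) e * (len n j t - len n j s) = _); last first.
  by rewrite -mulr_sumr grid_len_sum.
apply: ler_sum => j _; have jI := grid_xI (ltn_ord j).
rewrite sn_NZ; last by apply: sn_DB; exact: DG.
have l0 := grid_len_ge0 n j st; rewrite ger0_norm// mulrC.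
have [z|xt] := leP t (x n j); first by rewrite grid_len_eq0 ?mulr0//; left.
have [z|xs] := leP (x n j.+1) s; first by rewrite grid_len_eq0 ?mulr0//; right.
apply: ler_wpM2r => //; apply: ltW; apply: hd => //.
rewrite grid_xS in xs; rewrite ltr_norml.
move: (x n j) (_ / _) hn xs xt => y h hn xs xt; apply/andP; split; lra.
Qed.

(** The functions [Pn n] vanish at [A] and their increments are close on short intervals, so they
    are uniformly Cauchy by [local_to_global]. A pointwise limit is chosen and inherits
    [grid_approx]. *)
Lemma antider_exists : exists P, antider A B P G.
Proof.
have PA n : Pn n A = 0.
  apply: big1 => j _; rewrite /len !min_l ?subrr ?scale0r//.
    by have := grid_xI (ltn_ord j) => /andP[].
  by rewrite /x lerDl mulr_ge0 ?grid_h0.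
have cauchy e : 0 < e -> exists n0, forall n m, (n0 <= n)%N -> (n0 <= m)%N ->
    forall t, A <= t <= B -> N (Pn n t - Pn m t) < e.
  move=> e0; pose e' := e / (2 * (B - A) + 1).
  have c0 : 0 < 2 * (B - A) + 1 by move: AB; lra.
  have [d d0 [n0 hn0]] := grid_approx (divr_gt0 e0 c0); exists n0 => n m nn nm t /andP[At tB].
  have := @local_to_global A B (fun t => Pn n t - Pn m t) (fun t => 2 * e' * t) d d0 _ _ A t (lexx A) At tB.
  rewrite !PA subrr subr0 -mulrBr; move=> /(_ _ _) /le_lt_trans; apply.
  - by move=> r _; apply: sn_DB; exact: grid_DPn.
  - move=> {At tB}s {}t As st tB ts.
    have a1 := hn0 n nn s s t As (introT andP (conj (lexx s) st)) tB ts.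
    have a2 := hn0 m nm s s t As (introT andP (conj (lexx s) st)) tB ts.
    have Gs : D (G s) by apply: DG; rewrite As (le_trans st).
    rewrite (_ : _ - _ = (Pn n t - Pn n s - (t - s) *: G s) - (Pn m t - Pn m s - (t - s) *: G s)); last first.
      by rewrite sub3 subrr subr0.
    have X k : D (Pn k t - Pn k s - (t - s) *: G s).
      by apply: sn_DB; [apply: sn_DB; exact: grid_DPn|exact: sn_DZ].
    by apply: le_trans (sn_NB (X n) (X m)) _; rewrite /e'; move: a1 a2; lra.
  - rewrite /e'; apply: le_lt_trans (_ : e * (2 * (B - A) / (2 * (B - A) + 1)) < e).
      rewrite [leLHS](_ : _ = e * (2 * (t - A) / (2 * (B - A) + 1))); last by ring.
      rewrite ler_wpM2l ?(ltW e0)// ler_pM2r ?invr_gt0//; lra.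
    by rewrite gtr_pMr// ltr_pdivrMr// mul1r ltrDl.
have /choice [P hP] : forall t, exists v : V, A <= t <= B -> D v /\
    forall e, 0 < e -> exists n0, forall n, (n0 <= n)%N -> N (Pn n t - v) < e.
  move=> t; have [tI|tI] := pselect (A <= t <= B); last by exists 0.
  have [_ _ _ _ /(_ (fun n => Pn n t) (fun n => grid_DPn n t))] := H.
  case=> [e e0|v Dv hv]; last by exists v.
  by have [n0 hn0] := cauchy e e0; exists n0 => n m nn nm; exact: hn0.
exists P; split => [t tI|e e0]; first by have [] := hP t tI; split => //; exact: DG.
have [d d0 [n0 hn0]] := grid_approx e0; exists d => // s tau t As stau tB ts.
have [st1 st2] := andP stau; have st := le_trans st1 st2.
have tauI : A <= tau <= B by rewrite (le_trans As st1) (le_trans st2).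
have [Dt ct] := hP t (introT andP (conj (le_trans As st) tB)).
have [Ds cs] := hP s (introT andP (conj As (le_trans st tB))).
apply/ler_addgt0Pr => eta eta0; have eta2 : 0 < eta / 2 by rewrite divr_gt0.
have [n1 h1] := ct _ eta2; have [n2 h2] := cs _ eta2.
pose n := maxn n0 (maxn n1 n2).
have a0 := hn0 n (leq_maxl _ _) s tau t As stau tB ts.
have a1 := h1 n (leq_trans (leq_maxl _ _) (leq_maxr _ _)).
have a2 := h2 n (leq_trans (leq_maxr _ _) (leq_maxr _ _)).
have Gt := DG tauI.
have Dnt := grid_DPn n t; have Dns := grid_DPn n s.
have X1 : D (Pn n t - Pn n s - (t - s) *: G tau) by apply: sn_DB; [exact: sn_DB|exact: sn_DZ].
have X : D (P t - P s - (t - s) *: G tau) by apply: sn_DB; [exact: sn_DB|exact: sn_DZ].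
apply: le_trans (sn_Nle X X1) _; apply: lerD => //.
rewrite (_ : _ - _ = - (Pn n t - P t) + (Pn n s - P s)); last first.
  by rewrite sub3 subrr subr0 !opprB.
have Y1 : D (Pn n t - P t) by exact: sn_DB.
have Y2 : D (Pn n s - P s) by exact: sn_DB.
by apply: le_trans (sn_ND (sn_DN Y1) Y2) _; rewrite sn_NN//; lra.
Qed.

End Existence.


Lemma ucont_lip A B G (L : R) : (forall s t, A <= s -> s <= t -> t <= B ->
    [/\ D (G s), D (G t) & N (G t - G s) <= L * (t - s)]) -> ucont A B G.
Proof.
move=> h e e0; have L1 : 0 < `|L| + 1 by rewrite ltr_wpDl.
exists (e / (`|L| + 1)); first by rewrite divr_gt0.
have aux s t : A <= s -> s <= t -> t <= B -> t - s < e / (`|L| + 1) -> N (G t - G s) < e.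
  move=> As st tB; rewrite ltr_pdivlMr// => hts.
  have [_ _ /le_lt_trans] := h s t As st tB; apply; apply: le_lt_trans hts.
  rewrite mulrC ler_wpM2l ?subr_ge0//.
  by rewrite (le_trans (ler_norm _))// lerDl.
move=> s t /andP[As sB] /andP[At tB]; have [st|/ltW ts] := leP s t.
  rewrite distrC ger0_norm ?subr_ge0// => hd; have [Ds Dt _] := h s t As st tB.
  by rewrite sn_NBC//; exact: aux.
by rewrite ger0_norm ?subr_ge0// => hd; exact: aux.
Qed.

(** Compactness in its near-covering form, with the filter of small positive tolerances as parameter
    space. *)
Lemma heine_cantor A B G : (forall t, A <= t <= B -> D (G t)) ->
  (forall t, A <= t <= B -> forall e, 0 < e -> exists2 d, 0 < d &
     forall s, A <= s <= B -> `|s - t| < d -> N (G s - G t) < e) -> ucont A B G.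
Proof.
move=> DG hc e e0.
have := @segment_compact R A B; rewrite compact_near_coveringP => /(_ R (0 : R)^'+ _).
move=> /(_ (fun d t => forall s, A <= s <= B -> A <= t <= B -> `|s - t| < d -> N (G s - G t) < e)) K.
have : \forall d \near (0 : R)^'+, `[A, B]%classic `<=`
    (fun t => forall s, A <= s <= B -> A <= t <= B -> `|s - t| < d -> N (G s - G t) < e).
  apply: K => t; rewrite /= in_itv/= => tI.
  have e2 : 0 < e / 2 by rewrite divr_gt0.
  have [d d0 hd] := hc t tI _ e2; have d2 : 0 < d / 2 by rewrite divr_gt0.
  exists ([set r | `|r - t| < d / 2], [set k | k < d / 2]) => /=.
    split; last by exact: nbhs_right_lt.
    by apply: filterS (nbhsx_ballx t (d / 2) d2) => r; rewrite /ball/= distrC.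
  move=> [r k] /= [rt kd] s sI rI sr.
  have Dr := DG r rI; have Ds := DG s sI; have Dt := DG t tI.
  apply: le_lt_trans (sn_triangle Ds Dt Dr) _; rewrite (splitr e); apply: ltrD.
    apply: hd => //; have := ler_normD (s - r) (r - t); rewrite subrKA.
    by move: (lt_trans sr kd) rt; lra.
  by rewrite sn_NBC//; apply: hd => //; move: rt; lra.
move=> hd; have [d [d0 {}hd]] := filter_ex (filterI (@nbhs_right_gt R 0) hd).
exists d => // s t sI tI; exact: hd.
Qed.

Lemma chain_mono (f : nat -> R) n : (forall i, (i < n)%N -> f i <= f i.+1) ->
  forall i j, (i <= j)%N -> (j <= n)%N -> f i <= f j.
Proof.
move=> h i j; elim: j => [|j IH]; first by rewrite leqn0 => /eqP ->.
rewrite leq_eqVlt => /predU1P[-> //|ij jn].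
by apply: le_trans (h j jn); apply: IH => //; exact: ltnW.
Qed.

Lemma riemann_cvg A B P G a b : antider A B P G -> A <= a -> a <= b -> b <= B ->
  forall e, 0 < e -> exists2 d, 0 < d & forall (r : seq R) (tag : nat -> R),
    itv_partition a b r ->
    (forall i, (i < size r)%N -> nth a (a :: r) i <= tag i <= nth a r i /\
       nth a r i - nth a (a :: r) i < d) ->
    D (\sum_(i < size r) (nth a r i - nth a (a :: r) i) *: G (tag i)) /\
    N (\sum_(i < size r) (nth a r i - nth a (a :: r) i) *: G (tag i) - (P b - P a)) <= e * (b - a).
Proof.
move=> [DPG hP] Aa ab bB e e0; have [d d0 hd] := hP e e0; exists d => // r tag [_ /eqP lr] ht.
pose f i := nth a (a :: r) i.
have mono i : (i < size r)%N -> f i <= f i.+1.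
  by move=> ir; have [/andP[h1 h2] _] := ht i ir; exact: le_trans h2.
have f0 : f 0%N = a by [].
have fn : f (size r) = b by rewrite /f -lr (last_nth a).
have fI i : (i <= size r)%N -> A <= f i <= B.
  move=> ir; rewrite (le_trans Aa) -?f0 ?(chain_mono mono)//.
  by apply: le_trans bB; rewrite -fn (chain_mono mono).
have tI i : (i < size r)%N -> A <= tag i <= B.
  move=> ir; have [/andP[h1 h2] _] := ht i ir.
  have /andP[a1 _] := fI i (ltnW ir); have /andP[_ a2] := fI i.+1 ir.
  by rewrite (le_trans a1) ?(le_trans _ a2).
have DS i : (i < size r)%N -> D ((f i.+1 - f i) *: G (tag i)).
  by move=> ir; apply: sn_DZ; have [] := DPG _ (tI i ir).
have [D1 _] := sn_sum DS; split; first exact: D1.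
have tP : P b - P a = \sum_(i < size r) (P (f i.+1) - P (f i)).
  by rewrite -(big_mkord xpredT (fun i => P (f i.+1) - P (f i))) telescope_sumr// f0 fn.
have tE : b - a = \sum_(i < size r) (f i.+1 - f i).
  by rewrite -(big_mkord xpredT (fun i => f i.+1 - f i)) telescope_sumr// f0 fn.
have Df i : (i <= size r)%N -> D (P (f i)) by move=> ir; have [] := DPG _ (fI i ir).
have DF i : (i < size r)%N -> D ((f i.+1 - f i) *: G (tag i) - (P (f i.+1) - P (f i))).
  by move=> ir; apply: sn_DB; [exact: DS|apply: sn_DB; apply: Df => //; exact: ltnW].
rewrite tP -sumrB; have [_ /le_trans] := sn_sum DF; apply.
rewrite tE mulr_sumr; apply: ler_sum => i _; have ir := ltn_ord i.
rewrite sn_NBC; [|exact: DS|by apply: sn_DB; apply: Df => //; exact: ltnW].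
have [tagI step] := ht i ir.
apply: hd => //; first by have /andP[] := fI i (ltnW ir).
by have /andP[] := fI i.+1 ir.
Qed.

Lemma fine_partition a b d : a <= b -> 0 < d -> exists2 r : seq R, itv_partition a b r &
  forall i, (i < size r)%N -> nth a (a :: r) i <= nth a r i /\ nth a r i - nth a (a :: r) i < d.
Proof.
rewrite le_eqVlt => /predU1P[<- d0|ab d0]; first by exists [::] => //; split.
have [n] : exists n : nat, b - a < n%:R * (d / 2).
  exists (Num.truncn ((b - a) / (d / 2))).+1.
  by rewrite -ltr_pdivrMr ?divr_gt0// truncnS_gt.
elim: n a ab => [a ab|n IH a ab hn]; first by rewrite mul0r ltNge subr_ge0 ltW.
have [ba|ba] := ltP (b - a) d.
  by exists [:: b] => [|[]//= _]; [split => //=; rewrite ab|rewrite ltW].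
have mb : a + d / 2 < b by move: ba; lra.
have [|r [rp rl] hr] := IH _ mb; first by move: hn; rewrite -natr1 mulrDl mul1r; lra.
exists (a + d / 2 :: r); first by split => //=; rewrite rp andbT; lra.
case=> [|i] /=; first by move=> _; split; lra.
rewrite ltnS => ir; have := hr i ir.
by rewrite !(set_nth_default (a + d / 2) a)//= ltnW.
Qed.

(** Any limit of Riemann sums equals the increment of an antiderivative up to seminorm zero: both
    are approached along a common fine partition. This is how the integral in the notion of solution
    is read off. *)
Lemma riemann_unique A B P G a b v : antider A B P G -> A <= a -> a <= b -> b <= B -> D v ->
  (forall e, 0 < e -> exists2 d, 0 < d & forall (r : seq R) (tag : nat -> R),
    itv_partition a b r ->
    (forall i, (i < size r)%N -> nth a (a :: r) i <= tag i <= nth a r i /\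
       nth a r i - nth a (a :: r) i < d) ->
    N (\sum_(i < size r) (nth a r i - nth a (a :: r) i) *: G (tag i) - v) < e) ->
  N (P b - P a - v) = 0.
Proof.
move=> aP Aa ab bB Dv hv; apply/eqP; rewrite eq_le sn_ge0 andbT.
apply: (@le_eps_mul _ _ (b - a + 1)); first by rewrite addr_ge0// subr_ge0.
move=> e e0; rewrite add0r.
have [d1 d10 h1] := riemann_cvg aP Aa ab bB e0; have [d2 d20 h2] := hv e e0.
have d0 : 0 < Num.min d1 d2 by rewrite lt_min d10.
have [r rp hr] := fine_partition ab d0.
have hr1 i : (i < size r)%N -> nth a (a :: r) i <= nth a r i <= nth a r i /\ nth a r i - nth a (a :: r) i < d1.
  by move=> /hr[x1]; rewrite lt_min => /andP[x2 x3]; rewrite x1 lexx.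
have hr2 i : (i < size r)%N -> nth a (a :: r) i <= nth a r i <= nth a r i /\ nth a r i - nth a (a :: r) i < d2.
  by move=> /hr[x1]; rewrite lt_min => /andP[x2 x3]; rewrite x1 lexx.
have [DS a1] := h1 r (nth a r) rp hr1; have a2 := h2 r (nth a r) rp hr2.
have [DP _] := aP.
have [Da _] := DP a (introT andP (conj Aa (le_trans ab bB))).
have [Db _] := DP b (introT andP (conj (le_trans Aa ab) bB)).
have Dab := sn_DB Db Da.
apply: le_trans (sn_triangle Dab DS Dv) _.
by rewrite sn_NBC// mulrDr mulr1; apply: lerD => //; exact: ltW.
Qed.

Lemma geometric_small (c e : R) : 0 <= c -> 0 < e -> exists n : nat, c * 2^-1 ^+ n < e.
Proof.
move=> c0 e0; have i1 : `|2^-1 : R| < 1 by rewrite ger0_norm// invf_lt1// ltr1n.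
have /cvg0P h := cvg_geometric c i1.
have [n|n /(_ n (leqnn n)) hn] := h _ e e0; last by exists n.
by rewrite /geometric /= mulr_ge0// exprn_ge0// invr_ge0.
Qed.

(** A bound A e^(2Lt) inserted in the equation returns (N (h 0) + A/2) e^(2Lt). Iterating halves the
    a priori constant [K] each time and leaves 2 N (h 0); the doubled exponent pays for the
    halving. *)
Lemma gronwall_right B (h k : R -> V) (L K : R) : 0 <= B -> 0 <= L -> antider 0 B h k ->
  (forall t, 0 <= t <= B -> N (k t) <= L * N (h t)) ->
  (forall t, 0 <= t <= B -> N (h t) <= K) ->
  forall t, 0 <= t <= B -> N (h t) <= 2 * N (h 0) * expR (2 * L * t).
Proof.
move=> B0 L0 ah hk hK.
have [Dh _] := ah; have [D0 _] := Dh 0 (introT andP (conj (lexx 0) B0)).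
have K0 : 0 <= K by apply: le_trans (hK 0 _); rewrite ?sn_ge0// lexx.
have e1 t : 0 <= t -> 1 <= expR (2 * L * t).
  by move=> t0; rewrite -expR0 ler_expR !mulr_ge0.
have step n t : 0 <= t <= B -> N (h t) <= (2 * N (h 0) + K * 2^-1 ^+ n) * expR (2 * L * t).
  elim: n t => [t tI|n IH t /andP[t0 tB]].
    have /andP[t0 _] := tI; apply: le_trans (hK t tI) _; rewrite expr0 mulr1.
    apply: le_trans (_ : K * 1 <= _); first by rewrite mulr1.
    by apply: ler_pM => //; rewrite ?e1// lerDr mulr_ge0// sn_ge0.
  set A := 2 * N (h 0) + K * 2^-1 ^+ n.
  have A0 : 0 <= A by rewrite addr_ge0 ?mulr_ge0 ?sn_ge0// exprn_ge0// invr_ge0.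
  have mv := @mean_value 0 B h k (fun t => A / 2 * expR (2 * L * t)) ah _ 0 t (lexx 0) t0 tB.
  have {}mv : N (h t - h 0) <= A / 2 * expR (2 * L * t) - A / 2.
    have := mv; rewrite mulr0 expR0 mulr1; apply.
    move=> s r s0 sr rB; exists s; first by rewrite lexx.
    have sI : 0 <= s <= B by rewrite s0 (le_trans sr).
    apply: le_trans (ler_wpM2r (_ : 0 <= r - s) (hk s sI)) _; first by rewrite subr_ge0.
    apply: le_trans (ler_wpM2r (_ : 0 <= r - s) (ler_wpM2l L0 (IH s sI))) _; first by rewrite subr_ge0.
    rewrite -/A -mulrBr.
    have -> : 2 * L * r = 2 * L * s + 2 * L * (r - s) by ring.
    rewrite expRD; have := expR_ge1Dx (2 * L * (r - s)); set E := expR (_ * (r - s)) => hE.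
    have E0 := expR_ge0 (2 * L * s); move: (expR (2 * L * s)) E0 => F F0.
    have : 0 <= A * F * (E - (1 + 2 * L * (r - s))) by rewrite !mulr_ge0// subr_ge0.
    by lra.
  have [Dt _] := Dh t (introT andP (conj t0 tB)).
  have le1 := sn_Nle Dt D0; have E1 := e1 t t0.
  apply: le_trans le1 _; apply: le_trans (lerD (lexx (N (h 0))) mv) _.
  have -> : 2 * N (h 0) + K * 2^-1 ^+ n.+1 = N (h 0) + A / 2 by rewrite /A exprS; field.
  have n0 := sn_ge0 (h 0); move: (expR _) E1 => E E1.
  have : 0 <= N (h 0) * (E - 1) by rewrite mulr_ge0// subr_ge0.
  by move: A0; lra.
move=> t tI; apply/ler_addgt0Pr => e e0.
have E0 := expR_gt0 (2 * L * t).
pose c := K * expR (2 * L * t).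
have c0 : 0 <= c by rewrite mulr_ge0// ltW.
have [n hn] : exists n : nat, c * 2^-1 ^+ n < e.
  exact: geometric_small.
apply: le_trans (step n t tI) _; rewrite mulrDl lerD2l mulrAC.
exact: ltW.
Qed.

(** Negative times are reduced to positive ones by reflecting the antiderivative. *)
Lemma gronwall A B (h k : R -> V) (L K : R) : A <= 0 -> 0 <= B -> 0 <= L -> antider A B h k ->
  (forall t, A <= t <= B -> N (k t) <= L * N (h t)) ->
  (forall t, A <= t <= B -> N (h t) <= K) ->
  forall t, A <= t <= B -> N (h t) <= 2 * N (h 0) * expR (2 * L * `|t|).
Proof.
move=> A0 B0 L0 ah hk hK t /andP[At tB].
have sub A' B' h' k' A1 B1 : antider A' B' h' k' -> A' <= A1 -> B1 <= B' -> antider A1 B1 h' k'.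
  move=> [D1 h1] AA BB; split => [r /andP[r1 r2]|e e0].
    by apply: D1; rewrite (le_trans AA) ?(le_trans r2).
  have [d d0 hd] := h1 e e0; exists d => // s tau r s1 sr rB rs.
  by apply: hd => //; [exact: le_trans s1|exact: le_trans rB _].
have [t0|/ltW t0] := leP 0 t.
  rewrite ger0_norm//; apply: (@gronwall_right B h k L K) => //.
  - exact: sub ah A0 (lexx B).
  - by move=> r /andP[r0 rB]; apply: hk; rewrite (le_trans A0).
  - by move=> r /andP[r0 rB]; apply: hK; rewrite (le_trans A0).
  - by rewrite t0.
rewrite ler0_norm//; have ah' := antider_opp ah.
have [Dh _] := ah.
have inI r : 0 <= r <= - A -> A <= - r <= B.
  by move=> /andP[r0 rA]; rewrite lerNr rA (le_trans _ B0)// oppr_le0.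
have := @gronwall_right (- A) (fun t => h (- t)) (fun t => - k (- t)) L K _ L0 _ _ _ (- t).
rewrite oppr0 opprK; apply.
- by rewrite oppr_ge0.
- by apply: sub ah' _ (lexx _); rewrite oppr_le0.
- move=> r /inI rI; rewrite sn_NN; first exact: hk.
  by have [] := Dh _ rI.
- by move=> r /inI rI; exact: hK.
- by rewrite oppr_ge0 t0 lerN2.
Qed.

(** * Picard iteration with a time-dependent Lipschitz rate *)

Section Picard.
Context (A B : R) (G : R -> V -> V) (u0 : V) (M L : R) (l Lam : R -> R).
Context (A0 : A <= 0) (B0 : 0 <= B) (Du0 : D u0) (Mu0 : 2 * N u0 <= M).
Context (DG : forall t v, A <= t <= B -> D v -> D (G t v)).
Context (Glip : forall t v w, A <= t <= B -> D v -> D w -> N v <= M -> N w <= M ->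
  N (G t v - G t w) <= l t * N (v - w)).
Context (Gle : forall t v, A <= t <= B -> D v -> N v <= M -> N (G t v) <= l t * N v).
Context (lL : forall t, A <= t <= B -> 0 <= l t <= L).
Context (lLam : forall s t, A <= s -> s <= t -> t <= B ->
  exists2 tau, s <= tau <= t & l tau * (t - s) <= Lam t - Lam s).
Context (Lam2 : Lam B - Lam A <= 2^-1).
Context (Gcont : forall f : R -> V, (forall t, A <= t <= B -> D (f t) /\ N (f t) <= M) ->
  ucont A B f -> ucont A B (fun t => G t (f t))).

Let good (f : R -> V) := (forall t, A <= t <= B -> D (f t) /\ N (f t) <= M) /\ ucont A B f.

Lemma picard_M0 : 0 <= M.
Proof. by apply: le_trans Mu0; rewrite mulr_ge0// sn_ge0. Qed.

(** Increments of [Lam] play the role of the integral of the rate [l]. Their total of at most 1/2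
    serves twice: with [2 * N u0 <= M] it keeps iterates in the ball of radius [M], and it makes the
    iteration contract by one half. *)
Lemma picard_Lam s t : A <= s -> s <= t -> t <= B -> 0 <= Lam t - Lam s <= 2^-1.
Proof.
have pos r q : A <= r -> r <= q -> q <= B -> 0 <= Lam q - Lam r.
  move=> Ar rq qB; have [tau /andP[h1 h2] /(le_trans _)] := lLam Ar rq qB; apply.
  rewrite mulr_ge0 ?subr_ge0//.
  by have /andP[] := lL (introT andP (conj (le_trans Ar h1) (le_trans h2 qB))).
move=> As st tB; rewrite pos//=.
have h1 := pos A s (lexx A) As (le_trans st tB).
have h2 := pos t B (le_trans As st) tB (lexx B).
by move: Lam2; lra.
Qed.

Lemma picard_dist (P k : R -> V) (c : R) : antider A B P k -> 0 <= c ->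
  (forall t, A <= t <= B -> N (k t) <= l t * c) ->
  forall s t, A <= s -> s <= t -> t <= B -> N (P t - P s) <= c * (Lam t - Lam s).
Proof.
move=> aP c0 hk s t As st tB; rewrite mulrBr.
apply: (@mean_value A B P k (fun t => c * Lam t)) => // {As st tB}s {}t As st tB.
have [tau h1 h2] := lLam As st tB; exists tau => //.
have tI : A <= tau <= B by have /andP[h3 h4] := h1; rewrite (le_trans As) ?(le_trans h4).
rewrite -mulrBr; apply: le_trans (ler_wpM2r (_ : 0 <= t - s) (hk tau tI)) _; first by rewrite subr_ge0.
by rewrite mulrAC mulrC ler_wpM2l.
Qed.

Lemma picard_dist0 (P k : R -> V) (c : R) : antider A B P k -> 0 <= c ->
  (forall t, A <= t <= B -> N (k t) <= l t * c) ->
  forall t, A <= t <= B -> N (P t - P 0) <= c / 2.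
Proof.
move=> aP c0 hk t /andP[At tB]; have [DP _] := aP.
have [D0 _] := DP 0 (introT andP (conj A0 B0)).
have [Dt _] := DP t (introT andP (conj At tB)).
have [t0|/ltW t0] := leP 0 t.
  apply: le_trans (picard_dist aP c0 hk A0 t0 tB) _.
  by rewrite ler_wpM2l//; have /andP[] := picard_Lam A0 t0 tB.
rewrite sn_NBC//; apply: le_trans (picard_dist aP c0 hk At t0 B0) _.
by rewrite ler_wpM2l//; have /andP[] := picard_Lam At t0 B0.
Qed.

Lemma picard_step f : good f -> exists g, [/\ good g, antider A B g (fun t => G t (f t)) & g 0 = u0].
Proof.
move=> [hf uf].
have AB : A <= B by exact: le_trans B0.
have DGf t : A <= t <= B -> D (G t (f t)) by move=> tI; apply: DG => //; have [] := hf t tI.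
have [P aP] := antider_exists AB DGf (Gcont hf uf).
have [DP _] := aP; have [D0 _] := DP 0 (introT andP (conj A0 B0)).
have Mle := picard_M0.
have hk t : A <= t <= B -> N (G t (f t)) <= l t * M.
  move=> tI; have [Df Nf] := hf t tI; apply: le_trans (Gle tI Df Nf) _.
  by rewrite ler_wpM2l//; have /andP[] := lL tI.
exists (fun t => (u0 - P 0) + P t); split; last by rewrite subrK.
  split=> [t tI|].
    have [Dt _] := DP t tI; rewrite -addrA [- _ + _]addrC; split.
      by apply: sn_DD => //; exact: sn_DB.
    apply: le_trans (sn_ND Du0 (sn_DB Dt D0)) _.
    by have := picard_dist0 aP Mle hk tI; move: Mu0; lra.
  apply: (@ucont_lip A B _ (L * M)) => s t As st tB.
  have [Ds _] := DP s (introT andP (conj As (le_trans st tB))).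
  have [Dt _] := DP t (introT andP (conj (le_trans As st) tB)).
  split; [by apply: sn_DD => //; exact: sn_DB|by apply: sn_DD => //; exact: sn_DB|].
  rewrite opprD addrACA subrr add0r [leRHS]mulrBr.
  apply: (@mean_value A B P (fun t => G t (f t)) (fun t => L * M * t)) => // {Ds Dt As st tB}s {}t As st tB.
  exists s; first by rewrite lexx.
  have sI : A <= s <= B by rewrite As (le_trans st).
  rewrite -mulrBr ler_wpM2r ?subr_ge0//; apply: le_trans (hk s sI) _.
  by rewrite ler_wpM2r//; have /andP[] := lL sI.
by apply: antider_shift => //; exact: sn_DB.
Qed.

Lemma picard_contract f g P Q (c : R) : good f -> good g -> 0 <= c ->
  antider A B P (fun t => G t (f t)) -> antider A B Q (fun t => G t (g t)) ->
  P 0 = u0 -> Q 0 = u0 -> (forall t, A <= t <= B -> N (f t - g t) <= c) ->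
  forall t, A <= t <= B -> N (P t - Q t) <= c / 2.
Proof.
move=> [hf _] [hg _] c0 aP aQ P0 Q0 hc t tI.
have := picard_dist0 (antiderB aP aQ) c0 _ tI; rewrite P0 Q0 subrr subr0; apply.
move=> r rI; have [Df Nf] := hf r rI; have [Dg Ng] := hg r rI.
apply: le_trans (Glip rI Df Dg Nf Ng) _.
by rewrite ler_wpM2l ?hc//; have /andP[] := lL rI.
Qed.

(** Geometric convergence of the iterates in the uniform seminorm. Antiderivatives are not unique,
    so the iteration map [F] is fixed once by choice. *)
Theorem picard : exists f, [/\ good f, antider A B f (fun t => G t (f t)) & f 0 = u0].
Proof.
have Mle := picard_M0.
have M4 : 0 <= 4 * M by rewrite mulr_ge0.
have M8 : 0 <= 4 * M * 2 by rewrite mulr_ge0.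
have g0 : good (fun=> u0).
  split=> [t _|]; first by split => //; move: Mu0 (sn_ge0 u0); lra.
  by apply: (@ucont_lip A B _ 0) => s t *; rewrite subrr sn_N0 mul0r.
have [F hF] : exists F : (R -> V) -> (R -> V), forall f, good f ->
    [/\ good (F f), antider A B (F f) (fun t => G t (f t)) & F f 0 = u0].
  have /choice[F hF] : forall f, exists g, good f -> [/\ good g, antider A B g (fun t => G t (f t)) & g 0 = u0].
    move=> f; have [gf|ngf] := pselect (good f); last by exists f.
    by have [g hg] := picard_step gf; exists g.
  by exists F.
pose f n := iter n F (fun=> u0).
have gf n : good (f n) by elim: n => [//|n /hF[]].
have af n : antider A B (f n.+1) (fun t => G t (f n t)) by have [] := hF _ (gf n).
have f0 n : f n.+1 0 = u0 by have [] := hF _ (gf n).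
have Df n t : A <= t <= B -> D (f n t) by move=> tI; have [] := (gf n).1 t tI.
(* The first two curves lie in the ball of radius [M], so they are at most 2M apart; each further
   step halves the distance. *)
have d1 n t : A <= t <= B -> N (f n.+1 t - f n t) <= 2 * M * 2^-1 ^+ n.
  elim: n t => [t tI|n IH t tI].
    rewrite expr0 mulr1; apply: le_trans (sn_NB (Df 1%N t tI) (Df 0%N t tI)) _.
    by have := ((gf 1%N).1 t tI).2; have := ((gf 0%N).1 t tI).2; lra.
  rewrite exprSr mulrA; apply: (picard_contract (gf n.+1) (gf n) _ (af n.+1) (af n)) => //.
    by rewrite !mulr_ge0// exprn_ge0// invr_ge0.
have d2 n m t : A <= t <= B -> N (f (n + m)%N t - f n t) <= 4 * M * 2^-1 ^+ n.
  move=> tI; have p0 k : 0 <= 2^-1 ^+ k :> R by rewrite exprn_ge0// invr_ge0.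
  suff : N (f (n + m)%N t - f n t) <= 4 * M * (2^-1 ^+ n - 2^-1 ^+ (n + m)).
    move/le_trans; apply; rewrite ler_wpM2l ?mulr_ge0//.
    by rewrite gerBl.
  elim: m => [|m IH]; first by rewrite addn0 !subrr sn_N0 mulr0.
  rewrite addnS; have := sn_triangle (Df (n + m).+1 t tI) (Df (n + m)%N t tI) (Df n t tI).
  have := d1 (n + m)%N t tI; rewrite exprS; move: IH; set x := 2^-1 ^+ (n + m); set y := 2^-1 ^+ n.
  lra.
have /choice[g hg] : forall t, exists v : V, A <= t <= B -> D v /\
    forall e, 0 < e -> exists n0, forall n, (n0 <= n)%N -> N (f n t - v) < e.
  move=> t; have [tI|tI] := pselect (A <= t <= B); last by exists 0.
  have [_ _ _ _ /(_ (fun n => f n t) (fun n => Df n t tI))] := H.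
  case=> [e e0|v Dv hv]; last by exists v.
  have [n hn] := geometric_small M8 e0.
  exists n => i j ni nj; have a1 := d2 n (i - n)%N t tI; have a2 := d2 n (j - n)%N t tI.
  rewrite !subnKC// in a1 a2.
  have := sn_triangle (Df i t tI) (Df n t tI) (Df j t tI).
  rewrite (sn_NBC (Df n t tI) (Df j t tI)); move: hn a1 a2; set x := 2^-1 ^+ n; lra.
have d3 n t : A <= t <= B -> N (f n t - g t) <= 4 * M * 2^-1 ^+ n.
  move=> tI; have [Dg hgt] := hg t tI; apply/ler_addgt0Pr => e e0.
  have [n0 /(_ (n + n0)%N (leq_addl _ _)) a1] := hgt e e0; have a2 := d2 n n0 t tI.
  have := sn_triangle (Df n t tI) (Df (n + n0)%N t tI) Dg.
  by rewrite (sn_NBC (Df n t tI) (Df _ t tI)); move: a1 a2; lra.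
have Dg t : A <= t <= B -> D (g t) by move=> /hg[].
have lim0 (x : R) : 0 <= x -> (forall n, x <= 4 * M * 2^-1 ^+ n) -> x = 0.
  move=> x0 hx; apply/eqP; rewrite eq_le x0 andbT; apply/ler_addgt0Pr => e e0.
  have [n hn] := geometric_small M4 e0.
  by rewrite add0r (le_trans (hx n))// ltW.
have gg : good g.
  split=> [t tI|e e0].
    split; first exact: Dg.
    apply/ler_addgt0Pr => e e0; have [n hn] := geometric_small M4 e0.
    have := sn_Nle (Dg t tI) (Df n t tI); rewrite (sn_NBC (Dg t tI) (Df n t tI)).
    by have := d3 n t tI; have := ((gf n).1 t tI).2; move: hn; lra.
  have e3 : 0 < e / 4 by rewrite divr_gt0.
  have [n hn] := geometric_small M4 e3.
  have [d d0 hd] := (gf n).2 _ e3; exists d => // s t sI tI st.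
  have a0 := hd s t sI tI st; have a1 := d3 n s sI; have a2 := d3 n t tI.
  have := sn_triangle (Dg s sI) (Df n s sI) (Dg t tI).
  have := sn_triangle (Df n s sI) (Df n t tI) (Dg t tI).
  by rewrite (sn_NBC (Dg s sI) (Df n s sI)); move: hn a0 a1 a2; lra.
(* The pointwise limit [g] is not known to be an antiderivative. One more Picard step gives [h],
   which is at seminorm zero from [g], so [g] may be replaced by [h] inside the field. *)
have [h [gh ah h0]] := picard_step gg; exists h; split => //.
apply: (antider_eq ah) => t tI.
have Dh : D (h t) by have [] := gh.1 t tI.
split; first exact: DG.
have hz : N (g t - h t) = 0.
  apply: lim0 (sn_ge0 _) _ => n.
  have c0 : 0 <= 4 * M * 2^-1 ^+ n by rewrite !mulr_ge0// exprn_ge0// invr_ge0.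
  have a1 := picard_contract (gf n) gg c0 (af n) ah (f0 n) h0 (d3 n) tI.
  have a2 := d3 n.+1 t tI; rewrite exprS in a2.
  have := sn_triangle (Dg t tI) (Df n.+1 t tI) Dh.
  by rewrite (sn_NBC (Dg t tI) (Df n.+1 t tI)); move: a1 a2; set x := 2^-1 ^+ n; lra.
apply/eqP; rewrite eq_le sn_ge0 andbT.
have := Glip tI (Dg t tI) Dh (gg.1 t tI).2 (gh.1 t tI).2.
by rewrite hz mulr0.
Qed.

End Picard.

End Seminormed.

(** * The nonlinearity *)

Section RealPowers.
Context {R : realType}.
Implicit Types (r s m a p : R).

Lemma powR_mono r m p : 0 <= p -> 0 <= r -> r <= m -> r `^ p <= m `^ p.
Proof. by move=> p0 r0 rm; apply: ge0_ler_powR => //; rewrite nnegrE// (le_trans r0). Qed.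

Lemma powR_pred r a : 1 <= a -> 0 <= r -> r `^ a = r `^ (a - 1) * r.
Proof.
move=> a1; rewrite le_eqVlt => /predU1P[<-|r0].
  by rewrite powR0 ?mulr0// gt_eqF// (lt_le_trans ltr01).
rewrite -{3}[r]powRr1 ?(ltW r0)// -powRD ?subrK//.
by rewrite (gt_eqF r0) implybT.
Qed.

Lemma powR_lip r s m a : 1 <= a -> 0 <= r <= m -> 0 <= s <= m ->
  `|r `^ a - s `^ a| <= a * m `^ (a - 1) * `|r - s|.
Proof.
move=> a1; have a0 : 0 <= a by exact: le_trans a1.
wlog rs : r s / s <= r.
  move=> h hr hs; have [/ltW|] := ltP r s; last by move=> h1; exact: h.
  by move=> h1; rewrite distrC [X in _ * X]distrC; exact: h.
move=> /andP[r0 rm] /andP[s0 sm]; rewrite (ger0_norm (_ : 0 <= r - s)) ?subr_ge0//.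
have am1 : 0 <= a - 1 by rewrite subr_ge0.
move: s0; rewrite le_eqVlt => /predU1P[s0|s0].
  rewrite -s0 powR0 ?gt_eqF ?(lt_le_trans ltr01)// !subr0 ger0_norm ?powR_ge0//.
  rewrite powR_pred// ler_wpM2r//; apply: le_trans (powR_mono am1 r0 rm) _.
  by rewrite ler_peMl// powR_ge0.
apply: (@mvt_le R (fun x => x `^ a) (fun x => a * x `^ (a - 1))) => //.
- by move=> x /andP[sx _]; apply: is_derive1_powR; exact: lt_trans sx.
- move=> x /andP[sx xr]; rewrite ger0_norm ?mulr_ge0 ?powR_ge0// ler_wpM2l//.
  by apply: powR_mono => //; [rewrite ltW// (lt_trans s0)|rewrite (le_trans (ltW xr))].
- apply: derivable_within_continuous => x; rewrite in_itv/= => /andP[sx _].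
  by have [] := is_derive1_powR a (lt_le_trans s0 sx).
Qed.

(** For 1 < a < 2 the second derivative of r^a is unbounded at 0. The extra factor [r], which in
    |z|^a z is the modulus of z, restores a quadratic remainder. *)
Lemma powR_taylor r s m a : 1 <= a -> 0 <= r <= m -> 0 <= s <= m ->
  `|r * (s `^ a - r `^ a) - a * r `^ a * (s - r)| <= a * (a + 1) * m `^ (a - 1) * (s - r) ^+ 2.
Proof.
move=> a1 rI sI; have a0 : 0 <= a by exact: le_trans a1.
have ap : 0 < a by exact: lt_le_trans a1.
have /andP[r0 rm] := rI; have /andP[s0 sm] := sI.
have am1 : 0 <= a - 1 by rewrite subr_ge0.
have pm0 : 0 <= m `^ (a - 1) := powR_ge0 _ _.
have [rz|rn] := eqVneq r 0.
  rewrite rz powR0 ?gt_eqF// mul0r mulr0 mul0r subrr normr0.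
  by rewrite !mulr_ge0// ?addr_ge0// sqr_ge0.
have rp : 0 < r by rewrite lt_neqAle eq_sym rn.
have [sz|sn] := eqVneq s 0.
  rewrite sz powR0 ?gt_eqF// !sub0r sqrrN (powR_pred a1 r0).
  have pr := powR_mono am1 r0 rm; have pr0 := powR_ge0 r (a - 1).
  set x := r `^ (a - 1) in pr pr0 *.
  rewrite (_ : _ - _ = (a - 1) * x * r ^+ 2); last by ring.
  rewrite ger0_norm ?mulr_ge0 ?sqr_ge0// ler_wpM2r ?sqr_ge0//.
  by apply: ler_pM => //; nra.
have sp : 0 < s by rewrite lt_neqAle eq_sym sn.
have [<-|rs] := eqVneq r s.
  by rewrite !subrr !mulr0 subrr normr0 expr0n /= mulr0.
have [c [c1 c2 hc]] : exists c, [/\ 0 <= c <= m, `|c - r| <= `|s - r| &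
    s `^ a - r `^ a = a * c `^ (a - 1) * (s - r)].
  have gen x y : 0 < x -> x < y -> exists2 c, x < c < y & y `^ a - x `^ a = a * c `^ (a - 1) * (y - x).
    move=> x0 xy; have [|x' |c] := @MVT R (fun x => x `^ a) (fun x => a * x `^ (a - 1)) x y xy.
    - move=> z; rewrite in_itv/= => /andP[xz _]; apply: is_derive1_powR; exact: lt_trans xz.
    - apply: derivable_within_continuous => z; rewrite in_itv/= => /andP[xz _].
      by have [] := is_derive1_powR a (lt_le_trans x0 xz).
    - by rewrite in_itv/= => h1 h2; exists c.
  have [lt|gt|eq] := ltgtP r s; last by rewrite eq eqxx in rs.
    have [c /andP[c1 c2] hc] := gen _ _ rp lt; exists c; split => //.
      by rewrite (ltW (lt_trans rp c1)) (le_trans (ltW c2)).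
    by rewrite !ger0_norm ?subr_ge0 ?ltW// ltrD2r.
  have [c /andP[c1 c2] hc] := gen _ _ sp gt; exists c; split => //.
    by rewrite (ltW (lt_trans sp c1)) (le_trans (ltW c2)).
  - by rewrite distrC [X in _ <= X]distrC !ger0_norm ?subr_ge0 ?ltW// ltrD2l ltrN2.
  - by rewrite -opprB hc -mulrN opprB.
have h1 := powR_lip a1 c1 rI.
have /andP[c0 cm] := c1; have hcm := powR_mono am1 c0 cm; have hc0 := powR_ge0 c (a - 1).
(* Exchanging [r] for [c] in front of the power leaves only Lipschitz bounds at exponent [a]; the
   power a - 1 need not be Lipschitz near 0. *)
have e1 : r * c `^ (a - 1) - r `^ a = (c `^ a - r `^ a) - (c - r) * c `^ (a - 1).
  by rewrite (powR_pred a1 c0); ring.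
have h2 : `|r * c `^ (a - 1) - r `^ a| <= (a + 1) * m `^ (a - 1) * `|s - r|.
  rewrite e1; apply: le_trans (ler_normB _ _) _; rewrite normrM (ger0_norm hc0) mulrDl mul1r mulrDl.
  apply: lerD; first by apply: le_trans h1 _; rewrite ler_wpM2l// mulr_ge0.
  by rewrite mulrC; apply: ler_pM.
rewrite hc (_ : _ - _ = a * (s - r) * (r * c `^ (a - 1) - r `^ a)); last by ring.
rewrite !normrM (ger0_norm a0) -normr_sqr.
apply: le_trans (ler_wpM2l (_ : 0 <= a * `|s - r|) h2) _; first by rewrite mulr_ge0.
by rewrite le_eqVlt; apply/orP; left; apply/eqP; ring.
Qed.

End RealPowers.

(** * The map |z|^a z and its real differential *)

Section PowerTerms.
Context {R : realType}.
Implicit Types (z w h : R[i]) (m a : R).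

Lemma RCB (x y : R) : (x - y)%:C = x%:C - y%:C :> R[i].
Proof. exact: rmorphB. Qed.

Lemma RCD (x y : R) : (x + y)%:C = x%:C + y%:C :> R[i].
Proof. exact: rmorphD. Qed.

Lemma RCM (x y : R) : (x * y)%:C = x%:C * y%:C :> R[i].
Proof. exact: rmorphM. Qed.

Lemma normcRM (x : R) z : normc (x%:C * z) = `|x| * normc z.
Proof. by rewrite normcM normcR. Qed.

Lemma Re_RM (x : R) z : complex.Re (x%:C * z) = x * complex.Re z.
Proof. by case: z => a b /=; ring. Qed.

Lemma conjcB z w : conjc (z - w) = conjc z - conjc w.
Proof. exact: rmorphB. Qed.

(** The direction z/|z|, equal to 0 at the origin by the convention for the inverse. *)
Definition sgnc z : R[i] := z * ((normc z)^-1)%:C.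

Lemma normc_sgnc z : normc (sgnc z) <= 1.
Proof.
rewrite normcM normcR normfV ger0_norm ?normc_ge0//.
have [->|n0] := eqVneq (normc z) 0; first by rewrite mul0r.
by rewrite mulfV.
Qed.

Lemma sgncE z : (normc z)%:C * sgnc z = z.
Proof.
rewrite /sgnc mulrCA -rmorphM; have [n0|n0] := eqVneq (normc z) 0.
  by move/eqP: (n0); rewrite normc_eq0 => /eqP ->; rewrite mul0r.
by rewrite mulfV// mulr1.
Qed.

(** The direction is not continuous at 0; multiplied by the modulus of one of the points it becomes
    Lipschitz. *)
Lemma sgnc_lip z w : normc z * normc (sgnc z - sgnc w) <= 2 * normc (z - w).
Proof.
rewrite -{1}(ger0_norm (normc_ge0 z)) -(normcR (normc z)) -normcM mulrBr sgncE.
have -> : z - (normc z)%:C * sgnc w = (z - w) + ((normc w - normc z)%:C * sgnc w).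
  by rewrite rmorphB mulrBl sgncE addrA subrK.
apply: le_trans (normcD _ _) _; rewrite normcM normcR mulr2n mulrDl mul1r lerD2l.
apply: le_trans (_ : `|normc w - normc z| * 1 <= _).
  by rewrite ler_wpM2l// normc_sgnc.
by rewrite mulr1 normcBC ler_normc_dist.
Qed.

(** Orthogonal projection of [h] onto the real line spanned by [z]; its coefficient is the
    derivative of the modulus in the direction [h]. *)
Definition radial z h : R[i] := (complex.Re (conjc (sgnc z) * h))%:C * sgnc z.

Lemma normc_radial z h : normc (radial z h) <= normc h.
Proof.
rewrite normcM normcR; apply: le_trans (_ : (normc h) * 1 <= _); last by rewrite mulr1.
apply: ler_pM; rewrite ?normc_ge0 ?normc_sgnc//.
apply: le_trans (normc_Re _) _; rewrite normcM normc_conj.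
by rewrite ler_piMl ?normc_ge0// normc_sgnc.
Qed.

Lemma radialD z h1 h2 : radial z (h1 + h2) = radial z h1 + radial z h2.
Proof. by rewrite /radial mulrDr ReD rmorphD mulrDl. Qed.

Lemma radialZ z (c : R) h : radial z (c%:C * h) = c%:C * radial z h.
Proof.
by rewrite /radial (mulrCA (conjc _) c%:C) Re_RM RCM mulrA.
Qed.

Lemma radial_lip z w h : normc z * normc (radial z h - radial w h) <= 4 * normc (z - w) * normc h.
Proof.
have -> : radial z h - radial w h = (complex.Re (conjc (sgnc z - sgnc w) * h))%:C * sgnc z +
    (complex.Re (conjc (sgnc w) * h))%:C * (sgnc z - sgnc w).
  rewrite /radial conjcB mulrBl ReD ReN -/(complex.Re _ - _) RCB.
  move: (complex.Re (conjc (sgnc z) * h)) (complex.Re (conjc (sgnc w) * h)) => x y.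
  by move: (sgnc z) (sgnc w) => p q; ring.
have z0 := normc_ge0 z; have l := sgnc_lip z w.
apply: le_trans (ler_wpM2l z0 (normcD _ _)) _.
rewrite 2!normcRM.
set x := normc (sgnc z - sgnc w) in l *.
have h0 := normc_ge0 h; have x0 : 0 <= x := normc_ge0 _.
have a1 : `|complex.Re (conjc (sgnc z - sgnc w) * h)| * normc (sgnc z) <= x * normc h.
  apply: le_trans (_ : x * normc h * 1 <= _); last by rewrite mulr1.
  apply: ler_pM; rewrite ?normc_ge0 ?normc_sgnc//.
  by apply: le_trans (normc_Re _) _; rewrite normcM normc_conj.
have a2 : `|complex.Re (conjc (sgnc w) * h)| * x <= x * normc h.
  rewrite mulrC ler_wpM2l//; apply: le_trans (normc_Re _) _; rewrite normcM normc_conj.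
  by rewrite ler_piMl// normc_sgnc.
apply: le_trans (ler_wpM2l z0 (lerD a1 a2)) _.
have -> : normc z * (x * normc h + x * normc h) = 2 * (normc z * x) * normc h by ring.
rewrite ler_wpM2r//; lra.
Qed.

Definition pterm a z : R[i] := (normc z `^ a)%:C * z.
(** The differential of |z|^a z applied to [h]; it is only real-linear in [h], because of the radial
    part. *)
Definition dpterm a z h : R[i] := (normc z `^ a)%:C * h + (a * normc z `^ a)%:C * radial z h.

Lemma dpterm_le a m z h : 1 <= a -> normc z <= m -> normc (dpterm a z h) <= (1 + a) * m `^ a * normc h.
Proof.
move=> a1 zm; have a0 : 0 <= a by exact: le_trans a1.
have p := powR_mono a0 (normc_ge0 z) zm; have p0 := powR_ge0 (normc z) a.
apply: le_trans (normcD _ _) _; rewrite 2!normcRM normrM (ger0_norm a0) (ger0_norm p0).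
rewrite !mulrDl mul1r; apply: lerD; first by rewrite ler_wpM2r// normc_ge0.
apply: ler_pM; rewrite ?normc_ge0 ?normc_radial ?mulr_ge0//.
by rewrite ler_wpM2l.
Qed.

Lemma pterm_lip a m z w : 1 <= a -> normc z <= m -> normc w <= m ->
  normc (pterm a z - pterm a w) <= (1 + a) * m `^ a * normc (z - w).
Proof.
move=> a1 zm wm; have a0 : 0 <= a by exact: le_trans a1.
have p := powR_mono a0 (normc_ge0 z) zm; have p0 := powR_ge0 (normc z) a.
have m0 : 0 <= m := le_trans (normc_ge0 z) zm.
have -> : pterm a z - pterm a w = (normc z `^ a)%:C * (z - w) + (normc z `^ a - normc w `^ a)%:C * w.
  by rewrite /pterm RCB; move: ((normc z `^ a)%:C) ((normc w `^ a)%:C) => x y; ring.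
apply: le_trans (normcD _ _) _; rewrite !normcM !normcR (ger0_norm p0).
rewrite !mulrDl mul1r; apply: lerD; first by rewrite ler_wpM2r// normc_ge0.
have l := @powR_lip R (normc z) (normc w) m a a1 _ _.
rewrite !normc_ge0 zm wm in l; have {}l := l isT isT.
have d := ler_normc_dist z w.
apply: le_trans (_ : a * m `^ (a - 1) * normc (z - w) * m <= _).
  apply: ler_pM; rewrite ?normc_ge0//; apply: le_trans l _.
  by rewrite ler_wpM2l// mulr_ge0// powR_ge0.
by rewrite (powR_pred a1 m0) le_eqVlt; apply/orP; left; apply/eqP; ring.
Qed.

(** The factor [m] on the left turns m^(a-1) into m^a, so that the weights used for the function
    itself also sum the second-order constants, at the price of a division by [m]. *)
Lemma dpterm_lip a m z w h : 1 <= a -> normc z <= m -> normc w <= m ->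
  m * normc (dpterm a z h - dpterm a w h) <= 5 * (1 + a + a ^+ 2) * m `^ a * (normc (z - w) * normc h).
Proof.
move=> a1 zm wm; have a0 : 0 <= a by exact: le_trans a1.
have m0 : 0 <= m := le_trans (normc_ge0 z) zm.
have am1 : 0 <= a - 1 by rewrite subr_ge0.
have p := powR_mono am1 (normc_ge0 z) zm; have p0 := powR_ge0 (normc z) (a - 1).
have l := @powR_lip R (normc z) (normc w) m a a1 _ _.
rewrite !normc_ge0 zm wm in l; have {}l := l isT isT.
have d := ler_normc_dist z w; have h0 := normc_ge0 h; have zw0 := normc_ge0 (z - w).
have P0 : 0 <= m `^ (a - 1) := powR_ge0 _ _.
have {l d}l : `|normc z `^ a - normc w `^ a| <= a * m `^ (a - 1) * normc (z - w).
  by apply: le_trans l _; rewrite ler_wpM2l// mulr_ge0.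
have -> : dpterm a z h - dpterm a w h = (normc z `^ a - normc w `^ a)%:C * h +
   (a%:C * ((normc z `^ a - normc w `^ a)%:C * radial w h) + a%:C * ((normc z `^ a)%:C * (radial z h - radial w h))).
  rewrite /dpterm RCB !RCM.
  by move: (a%:C) ((normc z `^ a)%:C) ((normc w `^ a)%:C) (radial z h) (radial w h) => t x y u v; ring.
have b1 : normc ((normc z `^ a - normc w `^ a)%:C * h) <= a * m `^ (a - 1) * normc (z - w) * normc h.
  by rewrite normcM normcR ler_wpM2r.
have b2 : normc (a%:C * ((normc z `^ a - normc w `^ a)%:C * radial w h)) <= a * (a * m `^ (a - 1) * normc (z - w) * normc h).
  rewrite 2!normcRM (ger0_norm a0) ler_wpM2l//.
  by apply: ler_pM; rewrite ?normc_ge0 ?normc_radial.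
have b3 : normc (a%:C * ((normc z `^ a)%:C * (radial z h - radial w h))) <= a * (m `^ (a - 1) * (4 * normc (z - w) * normc h)).
  rewrite 2!normcRM (ger0_norm a0) ler_wpM2l// (ger0_norm (powR_ge0 _ _)).
  rewrite (powR_pred a1 (normc_ge0 z)) -[leLHS]mulrA; apply: ler_pM => //; last exact: radial_lip.
  by rewrite mulr_ge0 ?normc_ge0.
apply: le_trans (ler_wpM2l m0 (le_trans (normcD _ _) (lerD b1 (le_trans (normcD _ _) (lerD b2 b3))))) _.
rewrite (powR_pred a1 m0); set X := m `^ (a - 1) in P0 *; set Y := normc (z - w) in zw0 *.
rewrite [leLHS](_ : _ = (5 * a + a ^+ 2) * (X * m * (Y * normc h))); last by ring.
rewrite [leRHS](_ : _ = (5 * (1 + a + a ^+ 2)) * (X * m * (Y * normc h))); last by ring.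
by rewrite ler_wpM2r ?mulr_ge0//; have := sqr_ge0 a; lra.
Qed.

(** The remainder splits into the variation of the power times [h] and two terms along the direction
    of [z]: the Taylor remainder of the scalar power, and the error of the linearised modulus. *)
Lemma pterm_taylor a m z w : 1 <= a -> normc z <= m -> normc w <= m ->
  m * normc (pterm a w - pterm a z - dpterm a z (w - z)) <=
  5 * (1 + a + a ^+ 2) * m `^ a * normc (w - z) ^+ 2.
Proof.
move=> a1 zm wm; have a0 : 0 <= a by exact: le_trans a1.
have m0 : 0 <= m := le_trans (normc_ge0 z) zm.
have am1 : 0 <= a - 1 by rewrite subr_ge0.
set r := normc z; set s := normc w; set h := w - z.
have rI : 0 <= r <= m by rewrite normc_ge0.
have sI : 0 <= s <= m by rewrite normc_ge0.
have p := powR_mono am1 (normc_ge0 z) zm; have p0 := powR_ge0 r (a - 1).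
have l := powR_lip a1 sI rI; have t := powR_taylor a1 rI sI.
have P0 : 0 <= m `^ (a - 1) := powR_ge0 _ _.
have d : `|s - r| <= normc h by exact: ler_normc_dist.
have h0 := normc_ge0 h.
have d2 : (s - r) ^+ 2 <= normc h ^+ 2.
  by rewrite -(real_normK (num_real (s - r))) ler_pXn2r// nnegrE.
set c := complex.Re (conjc (sgnc z) * h).
(* The law of cosines: the linear approximation of the modulus has a quadratic error once it is
   multiplied by [r]. *)
have hc : 2 * (r * (s - r - c)) = normc h ^+ 2 - (s - r) ^+ 2.
  have e1 : r * c = complex.Re (conjc z * h).
    have aux (e : R[i]) : complex.Re (conjc (r%:C * e) * h) = r * complex.Re (conjc e * h).
      by rewrite conjcM conjcR -mulrA Re_RM.
    by have := aux (sgnc z); rewrite sgncE.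
  have e2 : s ^+ 2 = r ^+ 2 + 2 * complex.Re (conjc z * h) + normc h ^+ 2.
    rewrite /s /r -[w](subrK z) -/h !normc_sqr; case: (z) (h) => z1 z2 [h1 h2] /=; ring.
  by rewrite !mulrBr e1; rewrite sqrrB e2; ring.
have hc1 : `|r * (s - r - c)| <= normc h ^+ 2.
  have := sqr_ge0 (s - r); have := sqr_ge0 (normc h).
  by rewrite ler_norml; move: hc d2; lra.
have rE : r `^ a = r `^ (a - 1) * r := powR_pred a1 (normc_ge0 z).
have -> : pterm a w - pterm a z - dpterm a z h = (s `^ a - r `^ a)%:C * h +
   ((r * (s `^ a - r `^ a) - a * r `^ a * (s - r))%:C * sgnc z + (a * r `^ (a - 1) * (r * (s - r - c)))%:C * sgnc z).
  rewrite -mulrDl -RCD.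
  have -> : r * (s `^ a - r `^ a) - a * r `^ a * (s - r) + a * r `^ (a - 1) * (r * (s - r - c)) =
     r * (s `^ a - r `^ a) - a * r `^ a * c.
    by rewrite rE; ring.
  rewrite /pterm /dpterm /radial -/r -/s -/c.
  have -> : w = h + z by rewrite subrK.
  have zE := sgncE z; rewrite -/r in zE.
  rewrite !RCB !RCM RCB; move: (sgnc z) zE => e zE; rewrite -zE.
  move: (r%:C) (a%:C) (c%:C) ((s `^ a)%:C) ((r `^ a)%:C) => x1 x2 x3 x4 x5; ring.
have b1 : normc ((s `^ a - r `^ a)%:C * h) <= a * m `^ (a - 1) * normc h ^+ 2.
  rewrite normcM normcR expr2 mulrA ler_wpM2r//; apply: le_trans l _.
  by rewrite ler_wpM2l// mulr_ge0.
have sg (x : R) : normc (x%:C * sgnc z) <= `|x|.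
  by rewrite normcM normcR ler_piMr// normc_sgnc.
have b2 : normc ((r * (s `^ a - r `^ a) - a * r `^ a * (s - r))%:C * sgnc z) <= a * (a + 1) * m `^ (a - 1) * normc h ^+ 2.
  apply: le_trans (sg _) _; apply: le_trans t _.
  by rewrite ler_wpM2l// !mulr_ge0// addr_ge0.
have b3 : normc ((a * r `^ (a - 1) * (r * (s - r - c)))%:C * sgnc z) <= a * m `^ (a - 1) * normc h ^+ 2.
  apply: le_trans (sg _) _; rewrite normrM (ger0_norm (mulr_ge0 a0 p0)).
  by apply: ler_pM => //; [rewrite mulr_ge0|rewrite ler_wpM2l].
apply: le_trans (ler_wpM2l m0 (le_trans (normcD _ _) (lerD b1 (le_trans (normcD _ _) (lerD b2 b3))))) _.
rewrite (powR_pred a1 m0); set X := m `^ (a - 1) in P0 *.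
rewrite [leLHS](_ : _ = (3 * a + a ^+ 2) * (X * m * normc h ^+ 2)); last by ring.
rewrite [leRHS](_ : _ = (5 * (1 + a + a ^+ 2)) * (X * m * normc h ^+ 2)); last by ring.
by rewrite ler_wpM2r ?mulr_ge0 ?sqr_ge0//; have := sqr_ge0 a; lra.
Qed.

(* Gauge invariance: the differential treats the weight i c x of the Galilean
   operator like multiplication by a scalar. *)
Lemma dpterm_gauge a z (c : R) : dpterm a z ((0 +i* c) * z) = (0 +i* c) * pterm a z.
Proof.
rewrite /dpterm /pterm /radial.
have -> : complex.Re (conjc (sgnc z) * ((0 +i* c) * z)) = 0.
  have aux (e : R[i]) (r : R) : complex.Re (conjc e * ((0 +i* c) * (r%:C * e))) = 0.
    by case: e => e1 e2 /=; ring.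
  by have := aux (sgnc z) (normc z); rewrite sgncE.
by rewrite mul0r mulr0 addr0 mulrCA.
Qed.

End PowerTerms.

(** * Absolutely convergent complex series *)

Section ComplexSeries.
Context {R : realType}.
Implicit Types (x y : nat -> R[i]) (B : R).

Definition csum x : R[i] := limn (series (fun k => complex.Re (x k))) +i*
  limn (series (fun k => complex.Im (x k))).

(** Absolute summability with an explicit bound, which passes to the sum by [csum_le]; estimates of
    a series thus reduce to estimates of its terms. *)
Definition summ x B := forall n : nat, \sum_(0 <= k < n) normc (x k) <= B.

Lemma bounded_series_cvg (u : nat -> R) B : (forall n : nat, \sum_(0 <= k < n) `|u k| <= B) ->
  cvgn (series u).
Proof.
move=> h; apply: normed_cvg; apply: nondecreasing_is_cvgn.
  by apply: nondecreasing_series => n _ _ /=.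
by exists B => _ [n _ <-]; exact: h.
Qed.

Lemma Re_sum n x : complex.Re (\sum_(0 <= k < n) x k) = \sum_(0 <= k < n) complex.Re (x k).
Proof.
elim: n => [|n IH]; first by rewrite !big_geq.
by rewrite !big_nat_recr//= ReD IH.
Qed.

Lemma Im_sum n x : complex.Im (\sum_(0 <= k < n) x k) = \sum_(0 <= k < n) complex.Im (x k).
Proof.
elim: n => [|n IH]; first by rewrite !big_geq.
by rewrite !big_nat_recr//= ImD IH.
Qed.

Lemma normc_sum n x : normc (\sum_(0 <= k < n) x k) <= \sum_(0 <= k < n) normc (x k).
Proof.
elim: n => [|n IH]; first by rewrite !big_geq// (normcR (0 : R)) normr0.
by rewrite !big_nat_recr//=; apply: le_trans (normcD _ _) _; rewrite lerD2r.
Qed.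

Lemma csum_cvg x B : summ x B ->
  (fun n => normc (\sum_(0 <= k < n) x k - csum x)) @ \oo --> (0 : R).
Proof.
move=> h.
have c1 : cvgn (series (fun k => complex.Re (x k))).
  apply: (@bounded_series_cvg _ B) => n; apply: le_trans (h n).
  by apply: ler_sum_nat => k _; exact: normc_Re.
have c2 : cvgn (series (fun k => complex.Im (x k))).
  apply: (@bounded_series_cvg _ B) => n; apply: le_trans (h n).
  by apply: ler_sum_nat => k _; exact: normc_Im.
have z (u : nat -> R) : cvgn u -> (fun n => `|u n - limn u|) @ \oo --> (0 : R).
  move=> cu; have : (fun n => u n - limn u) @ \oo --> limn u - limn u.
    by apply: cvgB => //; exact: cvg_cst.
  by rewrite subrr => /cvg0_norm.
apply: cvg0_le (cvg0D (z _ c1) (z _ c2)) => n; first exact: normc_ge0.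
apply: le_trans (normc_ReIm _) _; rewrite ReD ImD ReN ImN Re_sum Im_sum.
by rewrite lexx.
Qed.

Lemma csum_le x B : summ x B -> normc (csum x) <= B.
Proof.
move=> h; apply/ler_addgt0Pr => e e0.
have /cvg0P := csum_cvg h => /(_ (fun n => normc_ge0 _) e e0) [n /(_ n (leqnn n)) hn].
have := normcB_triangle (csum x) (\sum_(0 <= k < n) x k) 0.
rewrite !subr0 => /le_trans; apply; rewrite addrC; apply: lerD.
  by apply: le_trans (normc_sum _ _) _; exact: h.
by rewrite normcBC ltW.
Qed.

Lemma csumD x y B C : summ x B -> summ y C -> csum (fun k => x k + y k) = csum x + csum y.
Proof.
move=> hx hy.
have hxy : summ (fun k => x k + y k) (B + C).
  move=> n; apply: le_trans (lerD (hx n) (hy n)); rewrite -big_split /=.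
  by apply: ler_sum_nat => k _; exact: normcD.
apply: lim_normc_unique (csum_cvg hxy) _.
apply: cvg0_le (cvg0D (csum_cvg hx) (csum_cvg hy)) => n; first exact: normc_ge0.
by rewrite big_split /= opprD addrACA; exact: normcD.
Qed.

Lemma csumZ x (c : R[i]) B : summ x B -> csum (fun k => c * x k) = c * csum x.
Proof.
move=> hx.
have hc : summ (fun k => c * x k) (normc c * B).
  move=> n; under eq_bigr do rewrite normcM.
  by rewrite -mulr_sumr ler_wpM2l ?normc_ge0.
apply: lim_normc_unique (csum_cvg hc) _.
apply: cvg_eqfun (cvg0Z (normc c) (csum_cvg hx)) => n.
by rewrite -normcM mulrBr mulr_sumr.
Qed.

Lemma csumB x y B C : summ x B -> summ y C -> csum (fun k => x k - y k) = csum x - csum y.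
Proof.
move=> hx hy; have h1 := csumZ (-1) hy.
have hc : summ (fun k => -1 * y k) C.
  move=> n; apply: le_trans (hy n); apply: ler_sum_nat => k _.
  by rewrite mulN1r -[- y k]sub0r normcBC subr0.
rewrite -[RHS]/(csum x + - csum y) -mulN1r -h1 -(csumD hx hc).
by congr csum; apply/funext => k; rewrite mulN1r.
Qed.

End ComplexSeries.

(** * The nonlinearity, its differential and their bounds *)

Section Nonlinearity.
Context {R : realType} (d : nat -> R[i]) (alpha : nat -> R).
Context (alpha1 : forall k, 1 <= alpha k).
Implicit Types (z w h : R[i]) (m : R) (k : nat).

(** One weight for all orders: 1 for a term of the series, 1 + alpha for its differential, and
    alpha^2 for the second-order constants, on the disc of radius [m]. *)
Definition wterm m k : R := normc (d k) * (1 + alpha k + alpha k ^+ 2) * m `^ alpha k.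

Definition wsum m : R := limn (series (wterm m)).

Context (wfin : forall m, 0 <= m -> exists B, forall n : nat, \sum_(0 <= k < n) wterm m k <= B).

Lemma wterm_ge0 m k : 0 <= wterm m k.
Proof.
rewrite /wterm !mulr_ge0 ?normc_ge0 ?powR_ge0//.
by have := alpha1 k; have := sqr_ge0 (alpha k); lra.
Qed.

Lemma wsum_cvg m : 0 <= m -> cvgn (series (wterm m)).
Proof.
move=> m0; have [B hB] := wfin m0; apply: (@bounded_series_cvg _ _ B) => n.
by apply: le_trans (hB n); apply: ler_sum_nat => k _; rewrite ger0_norm// wterm_ge0.
Qed.

Lemma wsum_ge m n : 0 <= m -> \sum_(0 <= k < n) wterm m k <= wsum m.
Proof.
move=> m0; apply: (@nondecreasing_cvgn_le R (series (wterm m))); last exact: wsum_cvg.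
by apply: nondecreasing_series => k _ _; exact: wterm_ge0.
Qed.

Lemma wsum_ge0 m : 0 <= m -> 0 <= wsum m.
Proof. by move=> m0; have := wsum_ge 0 m0; rewrite big_geq. Qed.

Lemma wsum_mono m1 m2 : 0 <= m1 -> m1 <= m2 -> wsum m1 <= wsum m2.
Proof.
move=> h1 h2; have h3 := le_trans h1 h2.
apply: lim_series_le; [exact: wsum_cvg|exact: wsum_cvg|move=> k].
rewrite /wterm ler_wpM2l//.
  rewrite mulr_ge0 ?normc_ge0//; have := alpha1 k; have := sqr_ge0 (alpha k); lra.
by apply: powR_mono => //; exact: le_trans (alpha1 k).
Qed.

Lemma summ_wterm (x : nat -> R[i]) m (c C : R) : 0 <= c -> 0 < C -> 0 <= m ->
  (forall k, C * normc (x k) <= c * wterm m k) -> summ x (c * wsum m / C).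
Proof.
move=> c0 C0 m0 h n; rewrite ler_pdivlMr// mulrC mulr_sumr.
apply: le_trans (_ : \sum_(0 <= k < n) c * wterm m k <= _); first exact: ler_sum_nat.
by rewrite -mulr_sumr ler_wpM2l// wsum_ge.
Qed.

Definition nlF z : R[i] := nonlinearity d alpha z * z.
Definition nlD z h : R[i] := csum (fun k => d k * dpterm (alpha k) z h).

Let a0 k : 0 <= alpha k := le_trans ler01 (alpha1 k).

Lemma nlF_summ z m : normc z <= m -> summ (fun k => d k * pterm (alpha k) z) (normc z * wsum m / 1).
Proof.
move=> zm; have m0 := le_trans (normc_ge0 z) zm; apply: summ_wterm => //; first exact: normc_ge0.
move=> k; rewrite mul1r normcM /pterm normcRM ger0_norm ?powR_ge0// /wterm.
have p := powR_mono (a0 k) (normc_ge0 z) zm.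
rewrite [leRHS](_ : _ = normc (d k) * ((1 + alpha k + alpha k ^+ 2) * m `^ alpha k * normc z)); last by ring.
rewrite ler_wpM2l ?normc_ge0// ler_wpM2r ?normc_ge0//; apply: le_trans p _.
rewrite ler_peMl ?powR_ge0//; have := a0 k; have := sqr_ge0 (alpha k); lra.
Qed.

Lemma nlD_summ z h m : normc z <= m -> summ (fun k => d k * dpterm (alpha k) z h) (normc h * wsum m / 1).
Proof.
move=> zm; have m0 := le_trans (normc_ge0 z) zm; apply: summ_wterm => //; first exact: normc_ge0.
move=> k; rewrite mul1r normcM /wterm.
rewrite [leRHS](_ : _ = normc (d k) * ((1 + alpha k + alpha k ^+ 2) * m `^ alpha k * normc h)); last by ring.
rewrite ler_wpM2l ?normc_ge0//; apply: le_trans (dpterm_le h (alpha1 k) zm) _.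
rewrite ler_wpM2r ?normc_ge0// ler_wpM2r ?powR_ge0//; have := sqr_ge0 (alpha k); lra.
Qed.

Lemma nlFE z : nlF z = csum (fun k => d k * pterm (alpha k) z).
Proof.
have e : nonlinearity d alpha z = csum (fun k => d k * (normc z `^ alpha k)%:C).
  rewrite /nonlinearity /csum; congr (limn (series _) +i* limn (series _)); apply/funext => k.
    by case: (d k) => p q /=; rewrite mulr0 subr0.
  by case: (d k) => p q /=; rewrite mulr0 add0r.
have s : summ (fun k => d k * (normc z `^ alpha k)%:C) (1 * wsum (normc z) / 1).
  apply: summ_wterm => //; first exact: normc_ge0.
  move=> k; rewrite !mul1r normcM normcR ger0_norm ?powR_ge0// /wterm ler_wpM2r ?powR_ge0//.
  by rewrite ler_peMr ?normc_ge0//; have := a0 k; have := sqr_ge0 (alpha k); lra.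
rewrite /nlF e mulrC -(csumZ z s); congr csum; apply/funext => k.
by rewrite /pterm mulrCA (mulrC z).
Qed.

Lemma nlF_lip z w m : normc z <= m -> normc w <= m ->
  normc (nlF z - nlF w) <= wsum m * normc (z - w).
Proof.
move=> zm wm; have m0 := le_trans (normc_ge0 z) zm.
rewrite !nlFE -(csumB (nlF_summ zm) (nlF_summ wm)).
rewrite mulrC -[leRHS]divr1; apply: csum_le; apply: summ_wterm => //; first exact: normc_ge0.
move=> k; rewrite mul1r -mulrBr normcM /wterm.
rewrite [leRHS](_ : _ = normc (d k) * ((1 + alpha k + alpha k ^+ 2) * m `^ alpha k * normc (z - w))); last by ring.
rewrite ler_wpM2l ?normc_ge0//; apply: le_trans (pterm_lip (alpha1 k) zm wm) _.
rewrite ler_wpM2r ?normc_ge0// ler_wpM2r ?powR_ge0//; have := sqr_ge0 (alpha k); lra.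
Qed.

Lemma nlF0 : nlF 0 = 0. Proof. by rewrite /nlF mulr0. Qed.

Lemma nlF_le z m : normc z <= m -> normc (nlF z) <= wsum m * normc z.
Proof.
move=> zm; have m0 := le_trans (normc_ge0 z) zm.
have z0 : normc (0 : R[i]) <= m by rewrite (normcR (0 : R)) normr0.
by have := nlF_lip zm z0; rewrite nlF0 !subr0.
Qed.

Lemma nlD_le z h m : normc z <= m -> normc (nlD z h) <= wsum m * normc h.
Proof.
by move=> zm; rewrite mulrC -[leRHS]divr1; apply: csum_le; exact: nlD_summ.
Qed.

Lemma nlDD z h1 h2 : nlD z (h1 + h2) = nlD z h1 + nlD z h2.
Proof.
rewrite -(csumD (nlD_summ h1 (lexx (normc z))) (nlD_summ h2 (lexx (normc z)))).
congr csum; apply/funext => k; rewrite /dpterm radialD.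
by move: (_%:C) (_%:C) (radial z h1) (radial z h2) (d k) => x y p q c; ring.
Qed.

Lemma nlDZ z (c : R) h : nlD z (c%:C * h) = c%:C * nlD z h.
Proof.
rewrite -(csumZ c%:C (nlD_summ h (lexx (normc z)))).
congr csum; apply/funext => k; rewrite /dpterm radialZ.
by move: ((normc z `^ alpha k)%:C) ((alpha k * normc z `^ alpha k)%:C) (radial z h) (d k) (c%:C) => x y p q e; ring.
Qed.

Lemma nlDB z h1 h2 : nlD z (h1 - h2) = nlD z h1 - nlD z h2.
Proof.
have e : - h2 = (-1 : R)%:C * h2 by rewrite rmorphN mulN1r.
by rewrite e nlDD nlDZ rmorphN mulN1r.
Qed.

Lemma nlD_gauge z (c : R) : nlD z ((0 +i* c) * z) = (0 +i* c) * nlF z.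
Proof.
rewrite nlFE -(csumZ (0 +i* c) (nlF_summ (lexx (normc z)))).
by congr csum; apply/funext => k; rewrite dpterm_gauge mulrCA.
Qed.

Lemma nlD_lip z w h m : 0 < m -> normc z <= m -> normc w <= m ->
  normc (nlD z h - nlD w h) <= 5 * normc (z - w) * normc h * wsum m / m.
Proof.
move=> m0 zm wm; rewrite -(csumB (nlD_summ h zm) (nlD_summ h wm)).
apply: csum_le; apply: summ_wterm; rewrite ?(ltW m0)//.
  by rewrite !mulr_ge0 ?normc_ge0.
move=> k; rewrite -mulrBr normcM /wterm mulrCA.
rewrite [leRHS](_ : _ = normc (d k) * (5 * (1 + alpha k + alpha k ^+ 2) * m `^ alpha k * (normc (z - w) * normc h))); last by ring.
by rewrite ler_wpM2l ?normc_ge0//; exact: dpterm_lip.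
Qed.

(** The termwise Taylor bounds are summed with the weights; this is the quantitative
    differentiability behind the chain rule [wdf_nlF]. *)
Lemma nl_taylor z w m : 0 < m -> normc z <= m -> normc w <= m ->
  normc (nlF w - nlF z - nlD z (w - z)) <= 5 * normc (w - z) ^+ 2 * wsum m / m.
Proof.
move=> m0 zm wm; rewrite !nlFE.
have s : summ (fun k => d k * pterm (alpha k) w - d k * pterm (alpha k) z)
    (normc (w - z) * wsum m / 1).
  apply: summ_wterm => //; [exact: normc_ge0|exact: ltW|move=> k].
  rewrite mul1r -mulrBr normcM /wterm.
  rewrite [leRHS](_ : _ = normc (d k) * ((1 + alpha k + alpha k ^+ 2) * m `^ alpha k * normc (w - z))); last by ring.
  rewrite ler_wpM2l ?normc_ge0//; apply: le_trans (pterm_lip (alpha1 k) wm zm) _.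
  rewrite ler_wpM2r ?normc_ge0// ler_wpM2r ?powR_ge0//; have := sqr_ge0 (alpha k); lra.
rewrite -(csumB (nlF_summ wm) (nlF_summ zm)) -(csumB s (nlD_summ (w - z) zm)).
apply: csum_le; apply: summ_wterm; rewrite ?(ltW m0)//.
  by rewrite mulr_ge0 ?sqr_ge0.
move=> k; rewrite -!mulrBr normcM /wterm mulrCA.
rewrite [leRHS](_ : _ = normc (d k) * (5 * (1 + alpha k + alpha k ^+ 2) * m `^ alpha k * normc (w - z) ^+ 2)); last by ring.
by rewrite ler_wpM2l ?normc_ge0//; exact: pterm_taylor.
Qed.

Lemma cm_csum (x : nat -> R -> R[i]) (B : R -> R) : (forall k, cmeasurable (x k)) ->
  (forall t, summ (x^~ t) (B t)) -> cmeasurable (fun t => csum (x^~ t)).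
Proof.
move=> mx hx; apply: (@cm_cvg R (fun n t => \sum_(0 <= k < n) x k t)).
  elim=> [|n IH]; first by under eq_fun do rewrite big_geq//; exact: cm_cst.
  by under eq_fun do rewrite big_nat_recr//=; exact: cmD.
by move=> t; exact: csum_cvg (hx t).
Qed.

Lemma cm_powR (u : R -> R[i]) (p : R) : cmeasurable u -> cmeasurable (fun x => (normc (u x) `^ p)%:C).
Proof.
move=> mu; apply: cm_real.
exact: (measurableT_comp (measurable_powR p) (measurable_normc mu)).
Qed.

Lemma cm_sgnc (u : R -> R[i]) : cmeasurable u -> cmeasurable (fun x => sgnc (u x)).
Proof.
move=> mu; rewrite /sgnc; apply: cmM => //.
have := cm_powR (-1) mu; congr cmeasurable; apply/funext => x.
by rewrite powR_inv1// normc_ge0.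
Qed.

Lemma cm_nlF (u : R -> R[i]) : cmeasurable u -> cmeasurable (fun x => nlF (u x)).
Proof.
move=> mu; under eq_fun do rewrite nlFE.
apply: (@cm_csum (fun k x => d k * pterm (alpha k) (u x))) => [k|t].
  by apply: cmZ; apply: cmM => //; exact: cm_powR.
exact: nlF_summ (lexx _).
Qed.

Lemma cm_nlD (u v : R -> R[i]) : cmeasurable u -> cmeasurable v -> cmeasurable (fun x => nlD (u x) (v x)).
Proof.
move=> mu mv.
apply: (@cm_csum (fun k x => d k * dpterm (alpha k) (u x) (v x))) => [k|t]; last exact: nlD_summ (lexx _).
apply: cmZ; have mp := cm_powR (alpha k) mu.
apply: (@cmD R (fun x => (normc (u x) `^ alpha k)%:C * v x)
  (fun x => (alpha k * normc (u x) `^ alpha k)%:C * radial (u x) (v x))).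
  exact: cmM.
apply: cmM.
  by under eq_fun do rewrite RCM; exact: cmZ.
have ms := cm_sgnc mu; apply: cmM => //.
have [m1 _] := cmM (cm_conj ms) mv.
exact: cm_real m1.
Qed.

End Nonlinearity.

(** * The Galilean norm *)

Local Opaque schrodinger.

(** A separate name, so that functions can carry the structure of a real vector space that the
    abstract theory expects. *)
Definition cfun (R : realType) : Type := R -> R[i].

HB.instance Definition _ (R : realType) := GRing.Zmodule.copy (cfun R) (R -> R[i]).

Section CfunModule.
Context {R : realType}.
Implicit Types (f g : cfun R) (a b : R).

Definition cscale a f : cfun R := fun x => a%:C * f x.

Fact cscaleA a b f : cscale a (cscale b f) = cscale (a * b) f.
Proof. by apply/funext => x; rewrite /cscale mulrA -rmorphM. Qed.

Fact cscale1 : left_id 1 cscale.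
Proof. by move=> f; apply/funext => x; rewrite /cscale mul1r. Qed.

Fact cscaleDr : right_distributive cscale +%R.
Proof. by move=> a f g; apply/funext => x; rewrite /cscale mulrDr. Qed.

Fact cscaleDl f : {morph cscale^~ f : a b / a + b}.
Proof. by move=> a b; apply/funext => x; rewrite /cscale rmorphD mulrDl. Qed.

HB.instance Definition _ := GRing.Zmodule_isLmodule.Build R (cfun R)
  cscaleA cscale1 cscaleDr cscaleDl.

Lemma cfun_sum n (F : 'I_n -> cfun R) x : (\sum_(i < n) F i) x = \sum_(i < n) F i x.
Proof. by elim/big_rec2: _ => // i y z _ <-. Qed.
End CfunModule.

(** * The domain and norm adapted to the Galilean operator *)

Section Space.
Context {R : realType}.
Implicit Types (f g u v : R -> R[i]) (c l t x : R) (z : R[i]).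
Local Notation mu := (@lebesgue_measure R).

Definition imx c : R -> R[i] := fun x => 0 +i* (c * x).

Lemma cm_imx c : cmeasurable (imx c).
Proof. by split => /=; [exact: measurable_cst|apply: measurable_funM => //; exact: measurable_cst]. Qed.

Lemma imxE c x : imx c x = c%:C * (0 +i* x).
Proof. by apply: complexP; rewrite /= ?(mul0r, mulr0, subr0, addr0). Qed.

Lemma imx0 f : (fun x => imx 0 x * f x) = (fun=> 0).
Proof. by apply/funext => x; rewrite imxE mul0r mul0r. Qed.

(* the domain of d/dx and of the Galilean operator at once: for c = 0 the
   weight is void and this is H^1 *)
Definition dom c f := (exists g, wdf f g) /\ L2 (fun x => imx c x * f x).

Definition dx f : R -> R[i] := weak_derivative f.

Lemma wdf_dx f g : wdf f g -> wdf f (dx f).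
Proof.
move=> w; have : exists g, [set g | L2 g /\ is_weak_derivative f g] g.
  by exists g; split; [exact: wdf_L2r w|exact: wdf_weak].
move=> /(xgetPex (fun=> 0)) [L h].
exact: weak_wdf (wdf_L2l w) L h.
Qed.

Lemma dom_wdf c f : dom c f -> wdf f (dx f).
Proof. by move=> [[g w] _]; exact: wdf_dx w. Qed.

Lemma dom_L2 c f : dom c f -> L2 f.
Proof. by move=> /dom_wdf /wdf_L2l. Qed.

Lemma dom_dx c f : dom c f -> L2 (dx f).
Proof. by move=> /dom_wdf /wdf_L2r. Qed.

Lemma dom_imx c f : dom c f -> L2 (fun x => imx c x * f x). Proof. by case. Qed.

(** The operator K(0); for [c = 0] it is the plain derivative ([gal0]), so H^1 and the weighted
    space are treated together. *)
Definition gal c f : R -> R[i] := dx f \- (fun x => imx c x * f x).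

Lemma dom_gal c f : dom c f -> L2 (gal c f).
Proof. by move=> h; exact: L2B (dom_dx h) (dom_imx h). Qed.

Lemma dx_eq f g : wdf f g -> ae_same (dx f) g.
Proof. by move=> w; exact: wdf_uniq (wdf_dx w) w. Qed.

(** The first two terms control U(t) f in the sup norm; the third retains f', which K(0) f alone
    does not bound. Its factor is compensated by the growth in [c] of the derivative of a chirped
    datum. *)
Definition gnorm c f : R := nrm f + nrm (gal c f) + (1 + c)^-1 * nrm (dx f).

Lemma dom0 c : dom c (fun=> 0).
Proof.
split; first by exists (fun=> 0); exact: wdf0.
by under eq_fun do rewrite mulr0; exact: L2_0.
Qed.

Lemma domD c f g : dom c f -> dom c g -> dom c (f \+ g).
Proof.
move=> hf hg; split; first by exists (dx f \+ dx g); exact: wdfD (dom_wdf hf) (dom_wdf hg).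
have := L2D (dom_imx hf) (dom_imx hg); congr L2; apply/funext => x.
by rewrite /= mulrDr.
Qed.

Lemma domZ c z f : dom c f -> dom c (fun x => z * f x).
Proof.
move=> hf; split; first by exists (fun x => z * dx f x); exact: wdfZ (dom_wdf hf).
have := L2Z z (dom_imx hf); congr L2; apply/funext => x.
by rewrite mulrCA.
Qed.

Lemma domB c f g : dom c f -> dom c g -> dom c (f \- g).
Proof.
move=> hf hg; have := domD hf (domZ (-1) hg); congr dom; apply/funext => x.
by rewrite /= mulN1r.
Qed.

Lemma gal_eq c f g : wdf f g -> ae_same (gal c f) (g \- (fun x => imx c x * f x)).
Proof. by move=> w; exact: ae_sameB (dx_eq w) (ae_same_refl _). Qed.

Lemma dxD c f g : dom c f -> dom c g -> ae_same (dx (f \+ g)) (dx f \+ dx g).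
Proof. by move=> hf hg; exact: dx_eq (wdfD (dom_wdf hf) (dom_wdf hg)). Qed.

Lemma dxB c f g : dom c f -> dom c g -> ae_same (dx (f \- g)) (dx f \- dx g).
Proof. by move=> hf hg; exact: dx_eq (wdfB (dom_wdf hf) (dom_wdf hg)). Qed.

Lemma dxZ c z f : dom c f -> ae_same (dx (fun x => z * f x)) (fun x => z * dx f x).
Proof. by move=> hf; exact: dx_eq (wdfZ z (dom_wdf hf)). Qed.

Lemma galD c f g : dom c f -> dom c g -> ae_same (gal c (f \+ g)) (gal c f \+ gal c g).
Proof.
move=> hf hg; apply: ae_same_trans (gal_eq c (wdfD (dom_wdf hf) (dom_wdf hg))) _.
by apply: ae_same_eq => x; rewrite /gal /= mulrDr opprD addrACA.
Qed.

Lemma galZ c z f : dom c f -> ae_same (gal c (fun x => z * f x)) (fun x => z * gal c f x).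
Proof.
move=> hf; apply: ae_same_trans (gal_eq c (wdfZ z (dom_wdf hf))) _.
by apply: ae_same_eq => x; rewrite /gal /= mulrBr (mulrCA z).
Qed.

Lemma galB c f g : dom c f -> dom c g -> ae_same (gal c (f \- g)) (gal c f \- gal c g).
Proof.
move=> hf hg; apply: ae_same_trans (gal_eq c (wdfB (dom_wdf hf) (dom_wdf hg))) _.
apply: ae_same_eq => x; rewrite /gal /=.
by move: (dx f x) (dx g x) (imx c x) (f x) (g x) => a b d e k; ring.
Qed.

Lemma gnorm_ge0 c f : 0 <= c -> 0 <= gnorm c f.
Proof. by move=> c0; rewrite /gnorm !addr_ge0 ?mulr_ge0 ?invr_ge0 ?nrm_ge0// addr_ge0. Qed.

Lemma nrm_gnorm c f : 0 <= c -> nrm f <= gnorm c f.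
Proof.
by move=> c0; rewrite /gnorm -addrA lerDl addr_ge0 ?mulr_ge0 ?invr_ge0 ?nrm_ge0// addr_ge0.
Qed.

Lemma gal_gnorm c f : 0 <= c -> nrm f + nrm (gal c f) <= gnorm c f.
Proof.
by move=> c0; rewrite /gnorm lerDl ?mulr_ge0 ?invr_ge0 ?nrm_ge0// addr_ge0.
Qed.

Lemma dx_gnorm c f : 0 <= c -> nrm (dx f) <= (1 + c) * gnorm c f.
Proof.
move=> c0; have c1 : 0 < 1 + c by lra.
rewrite mulrC -ler_pdivrMr// mulrC /gnorm lerDr.
by rewrite addr_ge0 ?nrm_ge0.
Qed.

Lemma gnormD c f g : 0 <= c -> dom c f -> dom c g -> gnorm c (f \+ g) <= gnorm c f + gnorm c g.
Proof.
move=> c0 hf hg; have hfg := domD hf hg.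
rewrite /gnorm (nrm_ae (dom_gal hfg) (L2D (dom_gal hf) (dom_gal hg)) (galD hf hg)).
rewrite (nrm_ae (dom_dx hfg) (L2D (dom_dx hf) (dom_dx hg)) (dxD hf hg)).
have e : 0 <= (1 + c)^-1 by rewrite invr_ge0 addr_ge0.
have a1 := nrmD (dom_L2 hf) (dom_L2 hg).
have a2 := nrmD (dom_gal hf) (dom_gal hg).
have a3 := ler_wpM2l e (nrmD (dom_dx hf) (dom_dx hg)).
rewrite mulrDr in a3; lra.
Qed.

Lemma gnormZ c z f : dom c f -> gnorm c (fun x => z * f x) = normc z * gnorm c f.
Proof.
move=> hf; have hz := domZ z hf.
rewrite /gnorm (nrm_ae (dom_gal hz) (L2Z z (dom_gal hf)) (galZ z hf)).
rewrite (nrm_ae (dom_dx hz) (L2Z z (dom_dx hf)) (dxZ z hf)).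
rewrite (nrmZ _ (dom_L2 hf)) (nrmZ _ (dom_gal hf)) (nrmZ _ (dom_dx hf)); ring.
Qed.

Lemma dom_ae c f g : dom c f -> L2 g -> ae_same f g -> dom c g.
Proof.
move=> hf Lg e; have w := dom_wdf hf; split.
  by exists (dx f); exact: wdf_ae w Lg (wdf_L2r w) e (ae_same_refl _).
apply: (L2_ae _ (dom_imx hf)); first by apply: cmM; [exact: cm_imx|exact: L2_cm].
by apply: ae_imp e => x ->.
Qed.

Lemma dx_ae c f g : dom c f -> dom c g -> ae_same f g -> ae_same (dx f) (dx g).
Proof. by move=> hf hg; exact: wdf_uniq_ae (dom_wdf hf) (dom_wdf hg). Qed.

Lemma gnorm_ae c f g : dom c f -> L2 g -> ae_same f g -> gnorm c f = gnorm c g.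
Proof.
move=> hf Lg e; have hg := dom_ae hf Lg e; have ed := dx_ae hf hg e.
rewrite /gnorm (nrm_ae (dom_L2 hf) Lg e) (nrm_ae (dom_dx hf) (dom_dx hg) ed).
rewrite (nrm_ae (dom_gal hf) (dom_gal hg))//.
apply: ae_sameB => //; by apply: ae_imp e => x ->.
Qed.

Lemma gnorm_eq0 c f : 0 <= c -> dom c f -> gnorm c f = 0 <-> ae_same f (fun=> 0).
Proof.
move=> c0 hf; have Lf := dom_L2 hf; split => [h|h].
  apply/(nrm_eq0 Lf)/eqP; rewrite eq_le nrm_ge0 andbT -h; exact: nrm_gnorm.
rewrite (gnorm_ae hf (L2_0 (R:=R)) h) -[X in gnorm c X](_ : (fun x => 0 * (f x)) = _).
  by rewrite gnormZ// (normcR (0 : R)) normr0 mul0r.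
by apply/funext => x; rewrite mul0r.
Qed.

(* checked on bounded intervals, where multiplication by x is bounded *)
Lemma imx_closed c (u : nat -> R -> R[i]) f g : (forall n, L2 (u n)) ->
  (forall n, L2 (fun x => imx c x * u n x)) -> L2 f -> L2 g ->
  (fun n => nrm (u n \- f)) @ \oo --> (0 : R) ->
  (fun n => nrm ((fun x => imx c x * u n x) \- g)) @ \oo --> (0 : R) ->
  ae_same g (fun x => imx c x * f x).
Proof.
move=> Lu Lcu Lf Lg cf cg.
have bd m v : L2 v -> L2 (cut m (fun x => imx c x * v x)) /\
   nrm (cut m (fun x => imx c x * v x)) <= `|c| * m%:R * nrm v.
  move=> Lv; have c0 : 0 <= `|c| * m%:R by rewrite mulr_ge0.
  have m1 : cmeasurable (fun x => chi (- m%:R) m%:R x * imx c x).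
    by apply: cmM; [exact: cm_chi|exact: cm_imx].
  have b1 : {ae mu, forall x, normc (chi (- m%:R) m%:R x * imx c x) <= `|c| * m%:R}.
    apply: ae_sameW => x; rewrite normcM normc_chi /imx normcI.
    case: ifPn => [|_]; last by rewrite mul0r mulr_ge0.
    by rewrite mul1r -ler_norml normrM => h; rewrite ler_wpM2l.
  have := L2_mulb m1 Lv b1 c0; rewrite /cut.
  by under eq_fun do rewrite -mulrA.
have key m : ae_same (cut m g) (cut m (fun x => imx c x * f x)).
  have [L1 _] := L2_cut m Lg; have [L2' _] := bd m f Lf.
  apply/(ae_nrmB L1 L2'); apply: cvg0_eq0 (nrm_ge0 _) _ => e e0.
  have /cvg0P := cvg0D cg (cvg0Z (`|c| * m%:R) cf).
  move=> /(_ (fun n => addr_ge0 (nrm_ge0 _) (mulr_ge0 (mulr_ge0 (normr_ge0 _) (ler0n _ _)) (nrm_ge0 _))) e e0).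
  move=> [n /(_ n (leqnn n)) hn]; apply: le_trans (ltW hn); move: hn => _.
  have [L3 n3] := bd m (u n \- f) (L2B (Lu n) Lf).
  have [L4 n4] := L2_cut m (L2B (Lcu n) Lg).
  rewrite (_ : cut m g \- _ = cut m (fun x => imx c x * (u n \- f) x) \- cut m ((fun x => imx c x * u n x) \- g)).
    rewrite addrC; apply: le_trans (_ : nrm (cut m (fun x => imx c x * (u n \- f) x)) + nrm (cut m ((fun x => imx c x * u n x) \- g)) <= _).
      by have := nrmD L3 (L2N L4); rewrite nrmN.
    by apply: lerD.
  by apply/funext => x; rewrite /cut /=; move: (chi _ _ _) (imx c x) => a b; ring.
have /ae_foralln := key; apply: ae_imp => x hx.
have xn : `|x| <= (Num.truncn `|x|).+1%:R by rewrite ltW// truncnS_gt.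
have := hx (Num.truncn `|x|).+1; rewrite /cut chiE -ler_norml xn !mul1r.
exact.
Qed.

(** For completeness, the functions, their derivatives and their Galilean derivatives are Cauchy
    separately. The weighted functions are the difference of the last two sequences, and
    [imx_closed] identifies their limit. *)
Theorem gspace c : 0 <= c -> seminormed (V := cfun R) (dom c) (gnorm c).
Proof.
move=> c0; have c1 : 0 < 1 + c by lra.
split.
- split; [exact: dom0|exact: domD|move=> a f; exact: domZ].
- by move=> f; exact: gnorm_ge0.
- by move=> f g; exact: gnormD.
- by move=> a f hf; rewrite -normcR; exact: (gnormZ a%:C hf).
move=> u Du hu.
have cauchy (k : (R -> R[i]) -> R -> R[i]) (K : R) : 0 < K -> (forall n, L2 (k (u n))) ->
    (forall n m, nrm (k (u n) \- k (u m)) <= K * gnorm c (u n \- u m)) ->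
    exists2 f, L2 f & (fun n => nrm (k (u n) \- f)) @ \oo --> (0 : R).
  move=> K0 Lk hk; apply: L2_complete => // e e0.
  have [n0 hn0] := hu _ (divr_gt0 e0 K0); exists n0 => n m nn nm.
  apply: le_lt_trans (hk n m) _; rewrite mulrC -ltr_pdivlMr//; exact: hn0.
have Lu n := dom_L2 (Du n).
have [f Lf cf] : exists2 f, L2 f & (fun n => nrm (u n \- f)) @ \oo --> (0 : R).
  apply: (cauchy id 1) => // n m; rewrite mul1r; exact: nrm_gnorm.
have nB n m := domB (Du n) (Du m).
have hdx n m : nrm (dx (u n) \- dx (u m)) <= (1 + c) * gnorm c (u n \- u m).
  rewrite -(nrm_ae (dom_dx (nB n m)) (L2B (dom_dx (Du n)) (dom_dx (Du m))) (dxB (Du n) (Du m))).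
  exact: dx_gnorm.
have [f' Lf' cf'] := cauchy dx (1 + c) c1 (fun n => dom_dx (Du n)) hdx.
have hga n m : nrm (gal c (u n) \- gal c (u m)) <= 1 * gnorm c (u n \- u m).
  rewrite mul1r -(nrm_ae (dom_gal (nB n m)) (L2B (dom_gal (Du n)) (dom_gal (Du m))) (galB (Du n) (Du m))).
  by apply: le_trans (gal_gnorm _ c0); rewrite lerDr nrm_ge0.
have [k Lk ck] := cauchy (gal c) 1 ltr01 (fun n => dom_gal (Du n)) hga.
have w : wdf f f' by exact: wdf_lim (fun n => dom_wdf (Du n)) Lf Lf' cf cf'.
have Lg : L2 (f' \- k) by exact: L2B.
have cx : (fun n => nrm ((fun x => imx c x * u n x) \- (f' \- k))) @ \oo --> (0 : R).
  apply: cvg0_le (cvg0D cf' ck) => n; first exact: nrm_ge0.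
  rewrite [X in nrm X](_ : _ = (dx (u n) \- f') \- (gal c (u n) \- k)).
    by have := nrmD (L2B (dom_dx (Du n)) Lf') (L2N (L2B (dom_gal (Du n)) Lk)); rewrite nrmN.
  by apply/funext => x; rewrite /gal /=; move: (imx c x) => b; ring.
have e := imx_closed Lu (fun n => dom_imx (Du n)) Lf Lg cf cx.
have Lx : L2 (fun x => imx c x * f x).
  by apply: (L2_ae _ Lg e); apply: cmM; [exact: cm_imx|exact: L2_cm].
have hf : dom c f by split => //; exists f'.
exists f => // ep ep0.
have cN : (fun n => gnorm c (u n \- f)) @ \oo --> (0 : R).
  apply: cvg0_le (cvg0D (cvg0D cf ck) (cvg0Z (1 + c)^-1 cf')) => n; first exact: gnorm_ge0.
  have hB := domB (Du n) hf; rewrite /gnorm.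
  rewrite (nrm_ae (dom_dx hB) (L2B (dom_dx (Du n)) Lf')); last first.
    exact: ae_same_trans (dxB (Du n) hf) (ae_sameB (ae_same_refl _) (dx_eq w)).
  rewrite (nrm_ae (dom_gal hB) (L2B (dom_gal (Du n)) Lk))//.
  apply: ae_same_trans (galB (Du n) hf) (ae_sameB (ae_same_refl _) _).
  apply: ae_same_trans (gal_eq c w) _; apply: ae_imp e => x /= hx.
  by rewrite -hx opprB addrC subrK.
have /cvg0P := cN => /(_ (fun n => gnorm_ge0 _ c0) ep ep0) [n0 hn0].
by exists n0.
Qed.

Lemma H1P f : H1 f <-> exists g, wdf f g.
Proof.
split => [[Lf [g Lg h]]|[g w]]; first by exists g; exact: weak_wdf.
split; first exact: wdf_L2l w.
by exists g; [exact: wdf_L2r w|exact: wdf_weak].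
Qed.

Lemma H1_dom f : H1 f <-> dom 0 f.
Proof.
rewrite H1P; split => [h|[]//]; split => //.
by rewrite imx0; exact: L2_0.
Qed.

Lemma dom_H1 c f : dom c f -> H1 f.
Proof. by move=> [h _]; apply/H1P. Qed.

Lemma H1norm_le f : H1norm f <= nrm f + nrm (dx f).
Proof.
have n0 := nrm_ge0 f; have n1 := nrm_ge0 (dx f).
rewrite /H1norm -/(nrm f) -/(dx f) -/(nrm (dx f)).
rewrite -[leRHS](ger0_norm (addr_ge0 n0 n1)) -sqrtr_sqr ler_wsqrtr// sqrrD.
by rewrite -addrA [leRHS]addrA -addrA lerD2l lerDr mulrn_wge0// mulr_ge0.
Qed.

Lemma H1norm_ge0 f : 0 <= H1norm f. Proof. exact: sqrtr_ge0. Qed.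

Lemma nrm_H1norm f : nrm f <= H1norm f /\ nrm (dx f) <= H1norm f.
Proof.
have n0 := nrm_ge0 f; have n1 := nrm_ge0 (dx f).
rewrite /H1norm -/(nrm f) -/(dx f) -/(nrm (dx f)); split.
  by rewrite -{1}(ger0_norm n0) -sqrtr_sqr ler_wsqrtr// lerDl sqr_ge0.
by rewrite -{1}(ger0_norm n1) -sqrtr_sqr ler_wsqrtr// lerDr sqr_ge0.
Qed.

(** The constant grows with [c], which is harmless: the comparison is used only for convergence at
    fixed [c]. *)
Lemma H1norm_gnorm c f : 0 <= c -> H1norm f <= (2 + c) * gnorm c f.
Proof.
move=> c0; apply: le_trans (H1norm_le f) _.
by have := nrm_gnorm f c0; have := dx_gnorm f c0; have := gnorm_ge0 f c0; lra.
Qed.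

Lemma gnorm_H1norm f : gnorm 0 f <= 3 * H1norm f.
Proof.
have [h1 h2] := nrm_H1norm f; rewrite /gnorm addr0 invr1 mul1r.
have -> : gal 0 f = dx f by rewrite /gal imx0; apply/funext => x /=; rewrite subr0.
lra.
Qed.

End Space.

(** * The equation in the interaction picture *)

Section GalileanFlow.
Context {R : realType}.
Implicit Types (f g u v : R -> R[i]) (c t x : R).
Local Notation mu := (@lebesgue_measure R).
Local Notation U := (@schrodinger R).

Definition lam c t : R := 1 + 2 * c * t.

Lemma U_eqfun t f g : f =1 g -> U t f = U t g.
Proof. by move=> /funext ->. Qed.

Lemma U_zero t : ae_same (U t (fun=> 0)) (fun=> 0).
Proof.
have := UZ t 0 (@L2_0 R); rewrite (_ : (fun x => 0 * 0) = (fun=> 0) :> (R -> R[i])).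
  by move=> h; apply: ae_same_trans h _; apply: ae_same_eq => x; rewrite mul0r.
by apply/funext => x; rewrite mul0r.
Qed.

(** [U_x] multiplied by [c]. The case [c = 0] is separate, because then nothing is assumed on x
    f. *)
Lemma U_imx c t f f' : wdf f f' -> L2 (fun x => imx c x * f x) ->
  L2 (fun x => imx c x * U t f x) /\
  ae_same (fun x => imx c x * U t f x)
    (U t (fun x => imx c x * f x + (2 * c * t)%:C * f' x)).
Proof.
move=> w Lc; have [c0|c0] := eqVneq c 0.
  subst c; rewrite imx0; split; first exact: L2_0.
  rewrite (_ : (fun x => _ + _) = (fun=> 0)); first exact: ae_same_sym (U_zero t).
  by apply/funext => x; rewrite imxE !mulr0 !(mul0r, mulr0, addr0).
have Lx : L2 (fun x => (0 +i* x) * f x).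
  have := L2Z (c^-1)%:C Lc; congr L2; apply/funext => x.
  by rewrite imxE -mulrA mulrA -RCM mulVf// mul1r.
have [Lu eu] := U_x t w Lx; have [Lf Lf' _] := w.
have Lg : L2 (fun x => (0 +i* x) * f x + (2 * t)%:C * f' x) by apply: L2D => //; exact: L2Z.
split.
  have := L2Z c%:C Lu; congr L2; apply/funext => x.
  by rewrite imxE -mulrA.
have e1 : ae_same (fun x => imx c x * U t f x) (fun x => c%:C * U t (fun x => (0 +i* x) * f x + (2 * t)%:C * f' x) x).
  by apply: ae_imp eu => x hx; rewrite imxE -mulrA hx.
apply: ae_same_trans e1 _; apply: ae_same_trans (ae_same_sym (UZ t c%:C Lg)) _.
rewrite (@U_eqfun t _ (fun x => imx c x * f x + (2 * c * t)%:C * f' x)); first exact: ae_same_refl.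
move=> x; rewrite imxE mulrDr mulrA; congr (_ + _).
by rewrite mulrA -RCM; congr (_%:C * _); ring.
Qed.

Lemma U_dom c t f : dom c f -> dom c (U t f).
Proof.
move=> hf; have w := dom_wdf hf; split.
  by exists (U t (dx f)); exact: wdf_U w.
exact: (U_imx t w (dom_imx hf)).1.
Qed.

(* The Galilean operator K(t) = (1 + 2 c t) d/dx - i c x satisfies
   K(t) U(t) = U(t) K(0). *)
Lemma U_gal c t f f' : wdf f f' -> L2 (fun x => imx c x * f x) ->
  ae_same (fun x => (lam c t)%:C * U t f' x - imx c x * U t f x)
          (U t (f' \- (fun x => imx c x * f x))).
Proof.
move=> w Lc; have [Lf Lf' _] := w; have [_ e] := U_imx t w Lc.
have L1 := L2Z (lam c t)%:C Lf'.
have L2' : L2 (fun x => imx c x * f x + (2 * c * t)%:C * f' x) by apply: L2D => //; exact: L2Z.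
have h := ae_sameB (ae_same_sym (UZ t (lam c t)%:C Lf')) e.
apply: ae_same_trans h _; apply: ae_same_trans (ae_same_sym (UB t L1 L2')) _.
rewrite (@U_eqfun t _ (f' \- (fun x => imx c x * f x))); first exact: ae_same_refl.
by move=> x /=; rewrite /lam RCD; move: ((2 * c * t)%:C) (imx c x) (f x) (f' x) => a b y z; ring.
Qed.

Lemma sobc_ge0 : 0 <= sobc :> R.
Proof. by rewrite mulr_ge0 ?invr_ge0 ?sqrtr_ge0. Qed.

Lemma sup1 u u' : wdf u u' -> {ae mu, forall x, normc (u x) <= sobc * (nrm u + nrm u')}.
Proof. by move/(sobolev (@ltr01 R)); rewrite sqrtr1 divr1 mul1r. Qed.

(** A chirp does not change moduli and turns K(t) into [lam c t] times the derivative. The Sobolev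
    inequality at the length [lam c t] then gives the decay, the L^2 norms being conserved by the
    group. *)
Lemma U_sup c t f : 0 < lam c t -> dom c f ->
  {ae mu, forall x, normc (U t f x) <= sobc / Num.sqrt (lam c t) * (nrm f + nrm (gal c f))}.
Proof.
move=> l0 hf; have w := dom_wdf hf; have Lf := dom_L2 hf; have Lf' := dom_dx hf.
have wu := wdf_U t w.
have [c0|c0] := eqVneq c 0.
  subst c; have l1 : lam 0 t = 1 :> R by rewrite /lam mulr0 mul0r addr0.
  have -> : gal 0 f = dx f by rewrite /gal imx0; apply/funext => x /=; rewrite subr0.
  have n1 := nrm_U t Lf; have n2 := nrm_U t Lf'.
  have eqle (a b : R) : a = b -> a <= b by move=> ->.
  have e3 := eqle _ _ (congr1 ( *%R sobc) (congr2 +%R n1 n2)).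
  by rewrite l1 sqrtr1 divr1; apply: ae_imp (sup1 wu) => x hx; exact: le_trans hx e3.
have [Lc eg] := U_imx t w (dom_imx hf).
have Lx : L2 (fun x => (0 +i* x) * U t f x).
  have := L2Z (c^-1)%:C Lc; congr L2; apply/funext => x.
  by rewrite imxE mulrA mulrA -RCM mulVf// mul1r.
(* Chosen so that 2 k l = -c: then [l] times the derivative of the chirped function is the chirp
   times K(t) U(t) f. *)
set l := lam c t in l0 *; pose k : R := - c / (2 * l).
have wv := wdf_chirp k wu Lx.
have l1 : l != 0 by rewrite gt_eqF.
have e1 := (L2_chirp k (L2_U t Lf)).2; rewrite nrm_U// in e1.
pose q x := U t (dx f) x + (0 +i* (2 * k * x)) * U t f x.
have Lq : L2 q by exact: L2D (L2_U t Lf') (L2_imag (2 * k) (L2_cm (L2_U t Lf)) Lx).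
have Lgal := dom_gal hf.
have e2 : l * nrm (fun x => cis (k * x ^+ 2) * q x) = nrm (gal c f).
  rewrite (L2_chirp k Lq).2 -(nrm_U t Lgal) -{1}(gtr0_norm l0) -normcR -nrmZ//.
  apply: nrm_ae; [exact: L2Z|exact: L2_U|].
  have := U_gal t w (dom_imx hf); apply: ae_same_trans.
  apply: ae_same_eq => x; rewrite /q mulrDr; congr (_ + _).
  rewrite mulrA -mulNr; congr (_ * _); apply: complexP; rewrite /= ?(mul0r, mulr0, subr0, addr0, oppr0)//.
  by rewrite /k; field.
have := sobolev l0 wv; rewrite -/q e1 e2; apply: ae_imp => x.
by rewrite normcM normc_cis mul1r.
Qed.

End GalileanFlow.

(** * The nonlinearity on H^1 and the interaction vector field *)

Section VectorField.
Context {R : realType} (d : nat -> R[i]) (alpha : nat -> R).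
Context (alpha1 : forall k, 1 <= alpha k).
Context (wfin : forall m : R, 0 <= m -> exists B : R, forall n : nat,
  \sum_(0 <= k < n) wterm d alpha m k <= B).
Implicit Types (f g u v : R -> R[i]) (c t x m s : R).
Local Notation mu := (@lebesgue_measure R).
Local Notation U := (@schrodinger R).
Local Notation F := (nlF d alpha).
Local Notation DF := (nlD d alpha).
Local Notation S := (wsum d alpha).

Lemma F_L2 u m : L2 u -> {ae mu, forall x, normc (u x) <= m} ->
  L2 (fun x => F (u x)) /\ nrm (fun x => F (u x)) <= S m * nrm u.
Proof.
move=> Lu um; have mF := cm_nlF alpha1 wfin (L2_cm Lu).
have [m0|m0] := leP 0 m.
  have L1 := L2Z (S m)%:C Lu.
  have S0 := wsum_ge0 alpha1 wfin m0.
  rewrite -[X in X * nrm _](ger0_norm S0) -(normcR (S m)) -nrmZ//.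
  apply: L2_le => //; apply: ae_imp um => x xm.
  by rewrite normcRM (ger0_norm S0); exact: nlF_le.
have um0 : {ae mu, forall x, normc (u x) <= 0}.
  by apply: ae_imp um => x xm; rewrite (le_trans xm)// ltW.
have z : ae_same u (fun=> 0).
  by apply: ae_imp um0 => x xm; apply/eqP; rewrite -normc_eq0 eq_le xm normc_ge0.
have zF : ae_same (fun x => F (u x)) (fun=> 0).
  by apply: ae_imp z => x ->; rewrite nlF0.
have LF : L2 (fun x => F (u x)) := L2_ae mF (@L2_0 R) (ae_same_sym zF).
by split => //; rewrite (nrm_ae LF (@L2_0 R) zF) (nrm_ae Lu (@L2_0 R) z) nrm0 mulr0.
Qed.

Lemma F_dist u v m : 0 <= m -> L2 u -> L2 v -> {ae mu, forall x, normc (u x) <= m} ->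
  {ae mu, forall x, normc (v x) <= m} ->
  nrm ((fun x => F (u x)) \- (fun x => F (v x))) <= S m * nrm (u \- v).
Proof.
move=> m0 Lu Lv um vm; have Luv := L2B Lu Lv.
have L1 := L2Z (S m)%:C Luv.
have S0 := wsum_ge0 alpha1 wfin m0.
rewrite -(ger0_norm S0) -(normcR (S m)) -nrmZ//.
have mF := cmB (cm_nlF alpha1 wfin (L2_cm Lu)) (cm_nlF alpha1 wfin (L2_cm Lv)).
have [//|_ h] := L2_le mF L1 _; last exact: h.
apply: ae_imp2 um vm => x xm ym.
by rewrite normcRM (ger0_norm S0); exact: nlF_lip.
Qed.

Lemma DF_L2 u k m : 0 <= m -> L2 u -> L2 k -> {ae mu, forall x, normc (u x) <= m} ->
  L2 (fun x => DF (u x) (k x)) /\ nrm (fun x => DF (u x) (k x)) <= S m * nrm k.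
Proof.
move=> m0 Lu Lk um; have mF := cm_nlD alpha1 wfin (L2_cm Lu) (L2_cm Lk).
have L1 := L2Z (S m)%:C Lk; have S0 := wsum_ge0 alpha1 wfin m0.
rewrite -[X in X * nrm _](ger0_norm S0) -(normcR (S m)) -nrmZ//.
apply: L2_le => //; apply: ae_imp um => x xm.
by rewrite normcRM (ger0_norm S0); exact: nlD_le.
Qed.

Lemma DF_dist u v k j m s : 0 < m -> 0 <= s -> L2 u -> L2 v -> L2 k -> L2 j ->
  {ae mu, forall x, normc (u x) <= m} -> {ae mu, forall x, normc (v x) <= m} ->
  {ae mu, forall x, normc (u x - v x) <= s} ->
  nrm ((fun x => DF (u x) (k x)) \- (fun x => DF (v x) (j x))) <=
  S m * nrm (k \- j) + 5 * s * S m / m * nrm j.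
Proof.
move=> m0 s0 Lu Lv Lk Lj um vm uvs; have m0' := ltW m0.
have S0 := wsum_ge0 alpha1 wfin m0'.
have Lkj := L2B Lk Lj.
have [L1 n1] := DF_L2 m0' Lu Lkj um.
have [L2' _] := DF_L2 m0' Lu Lj um; have [L3 _] := DF_L2 m0' Lv Lj vm.
have c0 : 0 <= 5 * s * S m / m by rewrite !mulr_ge0 ?invr_ge0.
have n2 : nrm ((fun x => DF (u x) (j x)) \- (fun x => DF (v x) (j x))) <= 5 * s * S m / m * nrm j.
  rewrite -{1}(ger0_norm c0) -(normcR (5 * s * S m / m)) -nrmZ//.
  have [//|_ h] := L2_le (L2_cm (L2B L2' L3)) (L2Z (5 * s * S m / m)%:C Lj) _; last exact: h.
  apply: ae_imp2 uvs (ae_and um vm) => x xs [xm ym].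
  rewrite normcRM (ger0_norm c0); apply: le_trans (nlD_lip alpha1 wfin (j x) m0 xm ym) _.
  rewrite [leLHS](_ : _ = 5 * normc (u x - v x) * (S m / m * normc (j x))); last by ring.
  rewrite [leRHS](_ : _ = 5 * s * (S m / m * normc (j x))); last by ring.
  rewrite ler_wpM2r//; first by rewrite !mulr_ge0 ?invr_ge0 ?normc_ge0.
  by rewrite ler_wpM2l.
rewrite [X in nrm X](_ : _ = (fun x => DF (u x) ((k \- j) x)) \+
    ((fun x => DF (u x) (j x)) \- (fun x => DF (v x) (j x)))).
  by apply: le_trans (nrmD L1 (L2B L2' L3)) _; exact: lerD.
by apply/funext => x /=; rewrite (nlDB alpha1 wfin) addrA subrK.
Qed.

(** Chain rule by difference quotients. Functions with an L^2 derivative have translates that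
    converge uniformly, so the quadratic Taylor remainder divided by the step tends to 0 in L^2. *)
Lemma wdf_nlF u u' : wdf u u' -> wdf (fun x => F (u x)) (fun x => DF (u x) (u' x)).
Proof.
move=> w; have [Lu Lu' _] := w.
pose m := sobc * (nrm u + nrm u') + 1 : R.
have m0 : 0 < m by rewrite ltr_wpDl// mulr_ge0 ?sobc_ge0 ?addr_ge0 ?nrm_ge0.
have S0 := wsum_ge0 alpha1 wfin (ltW m0).
have um : {ae mu, forall x, normc (u x) <= m}.
  by apply: ae_imp (sup1 w) => x /le_trans; apply; rewrite lerDl.
pose h n : R := harmonic n.
have ws n := wdf_shift (h n) w.
have [Ls ns] : (forall n, L2 (shift (h n) u)) /\ (forall n, nrm (shift (h n) u) = nrm u).
  by split => n; have [] := L2_shift (h n) Lu.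
have [Ls' ns'] : (forall n, L2 (shift (h n) u')) /\ (forall n, nrm (shift (h n) u') = nrm u').
  by split => n; have [] := L2_shift (h n) Lu'.
have sm n : {ae mu, forall x, normc (shift (h n) u x) <= m}.
  apply: ae_imp (sup1 (ws n)) => x /le_trans; apply; rewrite ns ns'.
  by rewrite lerDl.
have [LF _] := F_L2 Lu um; have [LD _] := DF_L2 (ltW m0) Lu Lu' um.
apply: dq_wdf => //.
pose s n := sobc * (nrm (shift (h n) u \- u) + nrm (shift (h n) u' \- u')).
have su n : {ae mu, forall x, normc (shift (h n) u x - u x) <= s n}.
  exact: sup1 (wdfB (ws n) w).
have s0 n : 0 <= s n by rewrite mulr_ge0 ?sobc_ge0 ?addr_ge0 ?nrm_ge0.
have hc : h @ \oo --> (0 : R) := cvg_harmonic0.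
have sc : s @ \oo --> (0 : R) by apply: cvg0Z; apply: cvg0D; exact: shift_cvg.
have c1 := wdf_dq w (@harmonic_neq0 R) hc.
pose Q n := nrm (dq (h n) u \- u').
have c2 : (fun n => Q n * s n) @ \oo --> (0 : R).
  by rewrite -(mulr0 (0 : R)); exact: cvgM.
have c3 : (fun n => S m * Q n + (5 * S m / m) * (Q n * s n + nrm u' * s n)) @ \oo --> (0 : R).
  apply: cvg0D; first exact: cvg0Z.
  by apply: cvg0Z; apply: cvg0D => //; exact: cvg0Z.
apply: cvg0_le c3 => n; first exact: nrm_ge0.
have Ldq := L2_dq (h n) Lu.
have hn0 : h n != 0 := @harmonic_neq0 R n.
have [L1 n1] := DF_L2 (ltW m0) Lu (L2B Ldq Lu') um.
(* The remainder of the chain rule: its modulus is at most that of the quotient of [u], times a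
   constant multiple of [s n], the uniform size of the displacement. *)
pose E x := dq (h n) (fun x => F (u x)) x - DF (u x) (dq (h n) u x).
have mE : cmeasurable E.
  apply: cmB; first exact: L2_cm (L2_dq _ LF).
  exact: (cm_nlD alpha1 wfin (L2_cm Lu) (L2_cm Ldq)).
have sn := s0 n; have m0' := ltW m0.
have c0 : 0 <= 5 * s n * S m / m.
  by move: (s n) sn => r r0; rewrite !mulr_ge0 ?invr_ge0.
have eE : {ae mu, forall x, normc (E x) <= normc ((5 * s n * S m / m)%:C * dq (h n) u x)}.
  apply: ae_imp2 (su n) (ae_and um (sm n)) => x xs [xm ym].
  rewrite normcRM (ger0_norm c0).
  have -> : E x = ((h n)^-1)%:C * (F (shift (h n) u x) - F (u x) - DF (u x) (shift (h n) u x - u x)).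
    by rewrite /E /dq (nlDZ alpha1 wfin) -mulrBr.
  rewrite /dq !normcRM.
  set p := `|_|; have p0 : 0 <= p by rewrite normr_ge0.
  rewrite mulrCA ler_wpM2l//; apply: le_trans (nl_taylor alpha1 wfin m0 xm ym) _.
  set y := normc (_ - _) in xs *; have y0 : 0 <= y := normc_ge0 _.
  rewrite [leLHS](_ : _ = (5 * S m / m * y) * y); last by ring.
  rewrite [leRHS](_ : _ = (5 * S m / m * y) * s n); last by ring.
  by rewrite ler_wpM2l// !mulr_ge0 ?invr_ge0// ltW.
have [LE nE] := L2_le mE (L2Z _ Ldq) eE.
rewrite nrmZ// normcR (ger0_norm c0) in nE.
rewrite [X in nrm X](_ : _ = (fun x => DF (u x) ((dq (h n) u \- u') x)) \+ E); last first.
  by apply/funext => x /=; rewrite /E (nlDB alpha1 wfin) -/(h n); ring.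
apply: le_trans (nrmD L1 LE) _; apply: lerD => //.
apply: le_trans nE _.
have nd : nrm (dq (h n) u) <= Q n + nrm u'.
  have := nrmD (L2B Ldq Lu') Lu'; rewrite (_ : _ \+ u' = dq (h n) u)//.
  by apply/funext => x /=; rewrite subrK.
rewrite [leLHS](_ : _ = 5 * S m / m * (s n * nrm (dq (h n) u))); last by ring.
rewrite ler_wpM2l ?mulr_ge0 ?invr_ge0 ?(ltW m0)// -mulrDl mulrC.
by rewrite ler_wpM2r.
Qed.

(* the Duhamel integrand in the interaction picture u(t) = U(t) f(t) *)
Definition vf t f : R -> R[i] := fun x => (0 +i* 1) * U (- t) (fun y => F (U t f y)) x.

(** K(t) U(t) f written out; almost everywhere it is U(t) K(0) f. *)
Definition galt c t f : R -> R[i] := fun x => (lam c t)%:C * U t (dx f) x - imx c x * U t f x.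

Lemma L2_galt c t f : dom c f -> L2 (galt c t f) /\ ae_same (galt c t f) (U t (gal c f)).
Proof.
move=> hf; have w := dom_wdf hf; have e := U_gal t w (dom_imx hf); split; last exact: e.
apply: L2B; first exact: L2Z _ (L2_U t (dom_dx hf)).
exact: (U_imx t w (dom_imx hf)).1.
Qed.

(** Real-linearity handles the derivative and gauge invariance the imaginary multiple of [z], so the
    differential of [F] carries K(t) across the nonlinearity. *)
Lemma nlD_gal (z h : R[i]) (a c x : R) :
  DF z (a%:C * h - imx c x * z) = a%:C * DF z h - imx c x * F z.
Proof. by rewrite (nlDB alpha1 wfin) (nlDZ alpha1 wfin) (nlD_gauge alpha1 wfin). Qed.

(** K(0) U(-t) = U(-t) K(t), so the Galilean derivative of the field is, up to the factor i, the
    group applied to the differential of [F] along [galt]. *)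
Lemma vf_dom c t f : dom c f -> [/\ dom c (vf t f),
  ae_same (dx (vf t f)) (fun x => (0 +i* 1) * U (- t) (fun y => DF (U t f y) (U t (dx f) y)) x) &
  ae_same (gal c (vf t f)) (fun x => (0 +i* 1) * U (- t) (fun y => DF (U t f y) (galt c t f y)) x)].
Proof.
move=> hf; have wu := wdf_U t (dom_wdf hf); have wF := wdf_nlF wu.
have [Lu Lu' _] := wu; have [LF LF' _] := wF.
have [Lc _] := U_imx t (dom_wdf hf) (dom_imx hf).
have um := sup1 wu; set m := sobc * _ in um.
have m0 : 0 <= m by rewrite mulr_ge0 ?sobc_ge0// addr_ge0 ?nrm_ge0.
have S0 := wsum_ge0 alpha1 wfin m0.
have LcF : L2 (fun x => imx c x * F (U t f x)).
  have mF : cmeasurable (fun x => imx c x * F (U t f x)).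
    by apply: cmM; [exact: cm_imx|exact: L2_cm].
  have [] // := L2_le mF (L2Z (S m)%:C Lc) _.
  apply: ae_imp um => x xm; have := nlF_le alpha1 wfin xm.
  move: (U t f x) (F (U t f x)) => z y yz; rewrite normcRM (ger0_norm S0).
  rewrite [normc (_ * y)]normcM [normc (_ * z)]normcM mulrCA.
  by rewrite ler_wpM2l ?normc_ge0.
have wG := wdfZ (0 +i* 1) (wdf_U (- t) wF).
have [LcG _] := U_imx (- t) wF LcF.
have hG : dom c (vf t f).
  split; first by exists (fun x => (0 +i* 1) * U (- t) (fun y => DF (U t f y) (U t (dx f) y)) x).
  have := L2Z (0 +i* 1) LcG; congr L2; apply/funext => x; rewrite /vf.
  by rewrite mulrCA.
split => //; first exact: dx_eq wG.
apply: ae_same_trans (gal_eq c wG) _.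
have e := U_gal (- t) wF LcF.
pose w1 y := DF (U t f y) (U t (dx f) y).
pose w0 y := F (U t f y).
have [_ e1] := U_imx (- t) wF LcF.
have Lm : L2 (fun x => imx c x * w0 x + (2 * c * (- t))%:C * w1 x) by apply: L2D => //; exact: L2Z.
have e2 : ae_same (U (- t) w1 \- (fun x => imx c x * U (- t) w0 x))
    (U (- t) (w1 \- (fun x => imx c x * w0 x + (2 * c * (- t))%:C * w1 x))).
  exact: ae_same_trans (ae_sameB (ae_same_refl _) e1) (ae_same_sym (UB (- t) LF' Lm)).
have e3 : w1 \- (fun x => imx c x * w0 x + (2 * c * (- t))%:C * w1 x) =1
    (fun y => DF (U t f y) (galt c t f y)); last first.
  rewrite (U_eqfun (- t) e3) in e2; apply: ae_imp e2 => x /= <-; rewrite /vf -/w0 mulrBr; congr (_ - _).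
  by rewrite mulrCA.
move=> y; rewrite /galt nlD_gal -/(w1 y) -/(w0 y) /lam mulrN.
rewrite /= RCD (_ : (- _)%:C = - (2 * c * t)%:C); last exact: (rmorphN (@real_complex R)).
by move: (_%:C) (imx c y) (w0 y) (w1 y) => p q a b; ring.
Qed.

(** U(-t) is an isometry commuting with the derivative and intertwining K(t) with K(0), so the three
    parts of the norm become L^2 distances at time [t]. *)
Lemma vf_dist c t f g : dom c f -> dom c g ->
  gnorm c (vf t f \- vf t g) =
  nrm ((fun x => F (U t f x)) \- (fun x => F (U t g x))) +
  nrm ((fun x => DF (U t f x) (galt c t f x)) \- (fun x => DF (U t g x) (galt c t g x))) +
  (1 + c)^-1 * nrm ((fun x => DF (U t f x) (U t (dx f) x)) \- (fun x => DF (U t g x) (U t (dx g) x))).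
Proof.
move=> hf hg; have [df ef kf] := vf_dom t hf; have [dg eg kg] := vf_dom t hg.
have hB := domB df dg.
have LL h (k : R -> R[i]) : dom c h -> L2 k -> L2 (fun x => F (U t h x)) /\ L2 (fun x => DF (U t h x) (k x)).
  move=> hh Lk; have wu := wdf_U t (dom_wdf hh); have um := sup1 wu; split.
    exact: wdf_L2l (wdf_nlF wu).
  have [//|//] := DF_L2 _ (wdf_L2l wu) Lk um.
  by rewrite mulr_ge0 ?sobc_ge0// addr_ge0 ?nrm_ge0.
have gen (k1 k2 : R -> R[i]) (r : R -> R[i]) : L2 k1 -> L2 k2 -> L2 r ->
   ae_same r ((fun x => (0 +i* 1) * U (- t) k1 x) \- (fun x => (0 +i* 1) * U (- t) k2 x)) ->
   nrm r = nrm (k1 \- k2).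
  move=> L1 L2' Lr e.
  have i1 : normc (0 +i* 1 : R[i]) = 1 by rewrite normcI normr1.
  have Lu1 := L2_U (- t) L1; have Lu2 := L2_U (- t) L2'.
  rewrite (nrm_ae Lr (L2B (L2Z _ Lu1) (L2Z _ Lu2)) e).
  rewrite -(U_dist (- t) L1 L2'); apply: etrans (etrans _ (nrmZ (0 +i* 1) (L2B Lu1 Lu2))) _.
    by apply: (congr1 (@nrm R)); apply/funext => x /=; rewrite mulrBr.
  by rewrite i1 mul1r.
have e1 : nrm (vf t f \- vf t g) = nrm ((fun x => F (U t f x)) \- (fun x => F (U t g x))).
  apply: gen; [exact: (LL f _ hf (dom_L2 hf)).1|exact: (LL g _ hg (dom_L2 hg)).1|exact: dom_L2 hB|].
  exact: ae_same_refl.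
have [Lkf _] := L2_galt t hf; have [Lkg _] := L2_galt t hg.
have e2 : nrm (gal c (vf t f \- vf t g)) =
    nrm ((fun x => DF (U t f x) (galt c t f x)) \- (fun x => DF (U t g x) (galt c t g x))).
  apply: gen; [exact: (LL f _ hf Lkf).2|exact: (LL g _ hg Lkg).2|exact: dom_gal hB|].
  exact: ae_same_trans (galB df dg) (ae_sameB kf kg).
have Ldf := L2_U t (dom_dx hf); have Ldg := L2_U t (dom_dx hg).
have e3 : nrm (dx (vf t f \- vf t g)) =
    nrm ((fun x => DF (U t f x) (U t (dx f) x)) \- (fun x => DF (U t g x) (U t (dx g) x))).
  apply: gen; [exact: (LL f _ hf Ldf).2|exact: (LL g _ hg Ldg).2|exact: dom_dx hB|].
  exact: ae_same_trans (dxB df dg) (ae_sameB ef eg).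
exact: (congr2 (fun a b => a + (1 + c)^-1 * b) (congr2 +%R e1 e2) e3).
Qed.

End VectorField.

(** * Lipschitz rate and time continuity of the vector field *)

Section VectorFieldEstimates.
Context {R : realType} (d : nat -> R[i]) (alpha : nat -> R).
Context (alpha1 : forall k, 1 <= alpha k).
Context (wfin : forall m : R, 0 <= m -> exists B : R, forall n : nat,
  \sum_(0 <= k < n) wterm d alpha m k <= B).
Implicit Types (f g u v : R -> R[i]) (k w : R -> R -> R[i]) (c t x m s e r M a b : R).
Local Notation mu := (@lebesgue_measure R).
Local Notation U := (@schrodinger R).
Local Notation F := (nlF d alpha).
Local Notation DF := (nlD d alpha).
Local Notation S := (wsum d alpha).
Local Notation vf := (vf d alpha).

Lemma sobc_gt0 : 0 < sobc :> R.
Proof. by rewrite mulr_gt0 ?invr_gt0 ?sqrtr_gt0 ?mulr_gt0 ?pi_gt0. Qed.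

(* The dispersive decay of U(t) f in the sup norm. *)
Definition supbound c M t : R := sobc / Num.sqrt (lam c t) * M.

Lemma supbound_gt0 c M t : 0 < lam c t -> 0 < M -> 0 < supbound c M t.
Proof.
move=> l0 M0; apply: mulr_gt0 M0; apply: divr_gt0; first exact: sobc_gt0.
by rewrite sqrtr_gt0.
Qed.

Lemma U_supbound c M t f : 0 <= c -> 0 < lam c t -> dom c f -> gnorm c f <= M ->
  {ae mu, forall x, normc (U t f x) <= supbound c M t}.
Proof.
move=> c0 l0 hf fM; apply: ae_imp (U_sup l0 hf) => x /le_trans; apply.
rewrite ler_wpM2l ?mulr_ge0 ?sobc_ge0 ?invr_ge0 ?sqrtr_ge0//.
exact: le_trans (gal_gnorm f c0) fM.
Qed.

(** The constant 6 is 1 + 5: one from the Lipschitz bound of [F] and of its linear part, five from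
    the variation of the differential, whose factor 1/m cancels against the sup bound [m / M * G] of
    the difference. *)
Lemma vf_lip c M t f g : 0 <= c -> 0 < lam c t -> 0 < M -> dom c f -> dom c g ->
  gnorm c f <= M -> gnorm c g <= M ->
  gnorm c (vf t f \- vf t g) <= 6 * S (supbound c M t) * gnorm c (f \- g).
Proof.
move=> c0 l0 M0 hf hg fM gM; have hfg := domB hf hg.
have um := U_supbound c0 l0 hf fM; have vm := U_supbound c0 l0 hg gM.
set m := supbound c M t in um vm *.
have m0 : 0 < m := supbound_gt0 l0 M0.
have S0 := wsum_ge0 alpha1 wfin (ltW m0).
set G := gnorm c (f \- g); have G0 : 0 <= G := gnorm_ge0 _ c0.
(* By linearity of the group the difference obeys the same sup bound, with [M] replaced by its own
   norm [G]. *)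
have uv : {ae mu, forall x, normc (U t f x - U t g x) <= m / M * G}.
  have e : ae_same (U t (f \- g)) (U t f \- U t g) := UB t (dom_L2 hf) (dom_L2 hg).
  apply: ae_imp2 e (U_supbound c0 l0 hfg (lexx _)) => x /= <- /le_trans; apply.
  by rewrite /m /supbound -/G mulfK ?gt_eqF.
have s0 : 0 <= m / M * G by rewrite !mulr_ge0 ?invr_ge0 ?(ltW m0) ?(ltW M0).
have [Lu Lv] := (L2_U t (dom_L2 hf), L2_U t (dom_L2 hg)).
have [[Lkf ekf] [Lkg ekg]] := (L2_galt t hf, L2_galt t hg).
have [Ldf Ldg] := (L2_U t (dom_dx hf), L2_U t (dom_dx hg)).
rewrite (vf_dist alpha1 wfin t hf hg).
have n1 := F_dist alpha1 wfin (ltW m0) Lu Lv um vm.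
rewrite (U_dist t (dom_L2 hf) (dom_L2 hg)) in n1.
have n2 := DF_dist alpha1 wfin m0 s0 Lu Lv Lkf Lkg um vm uv.
have n3 := DF_dist alpha1 wfin m0 s0 Lu Lv Ldf Ldg um vm uv.
rewrite (U_dist t (dom_dx hf) (dom_dx hg)) (nrm_U t (dom_dx hg)) in n3.
have e1 : nrm (galt c t f \- galt c t g) = nrm (gal c (f \- g)).
  have e := ae_same_trans (ae_sameB ekf ekg)
    (ae_same_sym (UB t (dom_gal hf) (dom_gal hg))).
  have e' := U_ae t (L2B (dom_gal hf) (dom_gal hg)) (dom_gal hfg) (ae_same_sym (galB hf hg)).
  apply: etrans (nrm_ae (L2B Lkf Lkg) (L2_U t (dom_gal hfg)) (ae_same_trans e e')) _.
  exact: nrm_U (dom_gal hfg).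
have e2 : nrm (galt c t g) = nrm (gal c g).
  exact: etrans (nrm_ae Lkg (L2_U t (dom_gal hg)) ekg) (nrm_U t (dom_gal hg)).
have e3 : nrm (dx f \- dx g) = nrm (dx (f \- g)).
  exact: nrm_ae (L2B (dom_dx hf) (dom_dx hg)) (dom_dx hfg) (ae_same_sym (dxB hf hg)).
rewrite e1 e2 in n2; rewrite e3 in n3.
have gM' : nrm (gal c g) + (1 + c)^-1 * nrm (dx g) <= M.
  by apply: le_trans gM; rewrite /gnorm -addrA lerDr nrm_ge0.
have GE : G = nrm (f \- g) + nrm (gal c (f \- g)) + (1 + c)^-1 * nrm (dx (f \- g)) by [].
have q0 : 0 <= (1 + c)^-1 by rewrite invr_ge0 addr_ge0.
move: (nrm _) n1 => N1 n1; move: (nrm _) n2 => N2 n2; move: (nrm _) n3 => N3 n3.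
apply: le_trans (lerD (lerD n1 n2) (ler_wpM2l q0 n3)) _.
rewrite (_ : 5 * (m / M * G) * S m / m = 5 * G * S m / M); last by field; rewrite !gt_eqF.
rewrite [leLHS](_ : _ = S m * G + 5 * G * S m / M * (nrm (gal c g) + (1 + c)^-1 * nrm (dx g))); last first.
  by rewrite GE; ring.
rewrite [leRHS](_ : _ = S m * G + 5 * G * S m / M * M); last by field; rewrite gt_eqF.
by rewrite lerD2l ler_wpM2l// !mulr_ge0 ?invr_ge0// ltW.
Qed.

Lemma vf0 t : ae_same (vf t (fun=> 0)) (fun=> 0).
Proof.
have L0 := @L2_0 R; have L1 := L2_U t L0.
have e : ae_same (fun y => F (U t (fun=> 0) y)) (fun=> 0).
  by apply: ae_imp (U_zero t) => x ->; exact: nlF0.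
have LF := L2_ae (cm_nlF alpha1 wfin (L2_cm L1)) L0 (ae_same_sym e).
have := ae_same_trans (U_ae (- t) LF L0 e) (U_zero (- t)).
by apply: ae_imp => x xE; rewrite /vf xE mulr0.
Qed.

Lemma vf_le c M t f : 0 <= c -> 0 < lam c t -> 0 < M -> dom c f -> gnorm c f <= M ->
  gnorm c (vf t f) <= 6 * S (supbound c M t) * gnorm c f.
Proof.
move=> c0 l0 M0 hf fM; have h0 := @dom0 R c.
have g0 : gnorm c (fun=> 0 : R[i]) = 0 by apply/(gnorm_eq0 c0 h0); exact: ae_same_refl.
have := vf_lip c0 l0 M0 hf h0 fM _; rewrite g0 => /(_ (ltW M0)).
have [d1 _ _] := vf_dom alpha1 wfin t hf; have [d2 _ _] := vf_dom alpha1 wfin t h0.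
have hB := domB d1 d2.
rewrite (_ : f \- (fun=> 0) = f); last by apply/funext => x /=; rewrite subr0.
suff -> : gnorm c (vf t f \- vf t (fun=> 0)) = gnorm c (vf t f) by [].
apply: gnorm_ae hB (dom_L2 d1) _; apply: ae_imp (vf0 t) => x /= ->.
by rewrite subr0.
Qed.

Lemma eq_ler a b : a = b -> a <= b.
Proof. by move=> ->. Qed.

Definition cont_at w t := forall e, 0 < e -> exists2 r, 0 < r &
  forall s, `|s - t| < r -> nrm (w s \- w t) < e.

Lemma cont_at_le w (B : R -> R) t : (forall s, nrm (w s \- w t) <= B s) ->
  (forall e, 0 < e -> exists2 r, 0 < r & forall s, `|s - t| < r -> B s < e) -> cont_at w t.
Proof.
move=> h hB e e0; have [r r0 hr] := hB e e0; exists r => // s st.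
exact: le_lt_trans (h s) (hr s st).
Qed.

Lemma small_lin (a b : R) (P Q : R -> R) t : 0 <= a -> 0 <= b ->
  (forall e, 0 < e -> exists2 r, 0 < r & forall s, `|s - t| < r -> P s < e) ->
  (forall e, 0 < e -> exists2 r, 0 < r & forall s, `|s - t| < r -> Q s < e) ->
  forall e, 0 < e -> exists2 r, 0 < r & forall s, `|s - t| < r -> a * P s + b * Q s < e.
Proof.
move=> a0 b0 hP hQ e e0.
have k0 : 0 < e / (a + b + 1) by rewrite divr_gt0// ltr_wpDl// addr_ge0.
have [r1 r10 h1] := hP _ k0; have [r2 r20 h2] := hQ _ k0.
exists (Num.min r1 r2) => [|s]; first by rewrite lt_min r10.
rewrite lt_min => /andP[/h1 p /h2 q].
apply: le_lt_trans (lerD (ler_wpM2l a0 (ltW p)) (ler_wpM2l b0 (ltW q))) _.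
rewrite -mulrDl mulrA ltr_pdivrMr ?ltr_wpDl ?addr_ge0//.
by rewrite mulrC ltr_pM2l// ltrDl.
Qed.

Lemma small_add (P Q : R -> R) t :
  (forall e, 0 < e -> exists2 r, 0 < r & forall s, `|s - t| < r -> P s < e) ->
  (forall e, 0 < e -> exists2 r, 0 < r & forall s, `|s - t| < r -> Q s < e) ->
  forall e, 0 < e -> exists2 r, 0 < r & forall s, `|s - t| < r -> P s + Q s < e.
Proof.
move=> hP hQ e /(small_lin ler01 ler01 hP hQ)[r r0 h]; exists r => // s /h.
by rewrite !mul1r.
Qed.

Lemma cont_at_U f t : L2 f -> cont_at (U^~ f) t.
Proof.
by move=> Lf e /(U_cont Lf)[r r0 h]; exists r => // s; exact: h.
Qed.

Lemma cont_at_ae w w' t : (forall s, L2 (w s)) -> (forall s, L2 (w' s)) ->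
  (forall s, ae_same (w s) (w' s)) -> cont_at w t -> cont_at w' t.
Proof.
move=> L1 L1' e h; apply: cont_at_le h => s.
apply: eq_ler; apply: nrm_ae (L2B (L1' _) (L1' _)) (L2B (L1 _) (L1 _)) _.
exact: ae_same_sym (ae_sameB (e s) (e t)).
Qed.

Lemma cont_at_UN w t : (forall s, L2 (w s)) -> cont_at w t ->
  cont_at (fun s => U (- s) (w s)) t.
Proof.
move=> L1 h.
have hU : forall e, 0 < e -> exists2 r, 0 < r & forall s, `|s - t| < r ->
    nrm (U (- s) (w t) \- U (- t) (w t)) < e.
  move=> e /(U_cont (L1 t))[r r0 hr]; exists r => // s st.
  by apply: hr; rewrite -opprD normrN.
apply: cont_at_le (small_add h hU) => s.
rewrite -(U_dist (- s) (L1 s) (L1 t)).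
rewrite [X in nrm X <= _](_ : _ = (U (- s) (w s) \- U (- s) (w t)) \+
    (U (- s) (w t) \- U (- t) (w t))).
  by apply: nrmD; apply: L2B; exact: L2_U.
by apply/funext => x /=; rewrite addrA subrK.
Qed.

Lemma wdf_bound f f' : wdf f f' -> exists2 m, 0 < m &
  forall s, {ae mu, forall x, normc (U s f x) <= m}.
Proof.
move=> w; have [Lf Lf' _] := w.
exists (sobc * (nrm f + nrm f') + 1) => [|s].
  by rewrite ltr_wpDl// mulr_ge0 ?sobc_ge0// addr_ge0 ?nrm_ge0.
have e := eq_ler (congr1 ( *%R sobc) (congr2 +%R (nrm_U s Lf) (nrm_U s Lf'))).
apply: ae_imp (sup1 (wdf_U s w)) => x /le_trans; apply; apply: le_trans e _.
by rewrite lerDl.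
Qed.

Lemma cont_at_F f f' t : wdf f f' -> cont_at (fun s x => F (U s f x)) t.
Proof.
move=> w; have [Lf _ _] := w; have [m m0 um] := wdf_bound w.
have S0 := wsum_ge0 alpha1 wfin (ltW m0).
have c1 := cont_at_U t Lf.
apply: cont_at_le (small_lin S0 (lexx 0) c1 c1) => s; rewrite mul0r addr0.
exact: (F_dist alpha1 wfin (ltW m0) (L2_U s Lf) (L2_U t Lf) (um s) (um t)).
Qed.

Lemma cont_at_DF f f' k t : wdf f f' -> (forall s, L2 (k s)) -> cont_at k t ->
  cont_at (fun s x => DF (U s f x) (k s x)) t.
Proof.
move=> w Lk ck; have [Lf Lf' _] := w; have [m m0 um] := wdf_bound w.
have S0 := wsum_ge0 alpha1 wfin (ltW m0).
pose B s := nrm (U s f \- U t f) + nrm (U s f' \- U t f').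
have cB := small_add (cont_at_U t Lf) (cont_at_U t Lf').
have sb0 := @sobc_ge0 R.
pose C := 5 * sobc * S m / m * nrm (k t).
have C0 : 0 <= C by rewrite !mulr_ge0 ?invr_ge0 ?nrm_ge0 ?(ltW m0).
apply: cont_at_le (small_lin S0 C0 ck cB) => s.
have us : {ae mu, forall x, normc (U s f x - U t f x) <= sobc * B s}.
  exact: sup1 (wdfB (wdf_U s w) (wdf_U t w)).
have sB0 : 0 <= sobc * B s by apply: mulr_ge0 sb0 _; apply: addr_ge0; exact: nrm_ge0.
apply: le_trans (DF_dist alpha1 wfin m0 sB0 (L2_U s Lf) (L2_U t Lf) (Lk s) (Lk t) (um s) (um t) us) _.
by rewrite lerD2l /C -/(B s) le_eqVlt; apply/orP; left; apply/eqP; ring.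
Qed.

(** With [f] frozen, each of the three components is the group applied to a continuous expression in
    U(s) f and its derivatives; together with [vf_lip] this gives continuity along curves. *)
Lemma vf_cont c f t : 0 <= c -> dom c f ->
  forall e, 0 < e -> exists2 r, 0 < r & forall s, `|s - t| < r -> gnorm c (vf s f \- vf t f) < e.
Proof.
move=> c0 hf; have w := dom_wdf hf; have [Lf Lf' _] := w.
have [m m0 um] := wdf_bound w.
have LF s : L2 (fun x => F (U s f x)) by have [] := F_L2 alpha1 wfin (L2_U s Lf) (um s).
have LDF k s : L2 (k s) -> L2 (fun x => DF (U s f x) (k s x)).
  by move=> Lk; have [] := DF_L2 alpha1 wfin (ltW m0) (L2_U s Lf) Lk (um s).
have Lg s : L2 (galt c s f) by have [] := L2_galt s hf.
have Ld s : L2 (U s (dx f)) := L2_U s Lf'.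
have cg : cont_at (fun s => galt c s f) t.
  apply: (cont_at_ae (w := U^~ (gal c f)) _ Lg _ (cont_at_U t (dom_gal hf))) => s.
    exact: L2_U (dom_gal hf).
  by apply: ae_same_sym; have [] := L2_galt s hf.
have vd s := vf_dom alpha1 wfin s hf.
have Z w' : (forall s, L2 (w' s)) -> cont_at w' t ->
    cont_at (fun s x => (0 +i* 1) * U (- s) (w' s) x) t.
  move=> L1 cw; apply: cont_at_le (cont_at_UN L1 cw) => s; apply: eq_ler.
  have i1 : normc (0 +i* 1 : R[i]) = 1 by rewrite normcI normr1.
  have := nrmZ (0 +i* 1) (L2B (L2_U (- s) (L1 s)) (L2_U (- t) (L1 t))).
  rewrite i1 mul1r; apply: etrans.
  by apply: (congr1 (@nrm R)); apply/funext => x /=; rewrite mulrBr.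
have L1 s : L2 (vf s f) by have [/dom_L2] := vd s.
have L2' s : L2 (gal c (vf s f)) by have [/dom_gal] := vd s.
have L3 s : L2 (dx (vf s f)) by have [/dom_dx] := vd s.
have h1 : cont_at (vf^~ f) t := Z _ LF (cont_at_F t w).
have h2 : cont_at (fun s => gal c (vf s f)) t.
  have Lk s := LDF (fun s => galt c s f) s (Lg s).
  apply: (cont_at_ae (w := fun s x => (0 +i* 1) * U (- s) (fun y => DF (U s f y) (galt c s f y)) x)).
  - by move=> s; apply: L2Z; exact: L2_U (Lk s).
  - exact: L2'.
  - by move=> s; apply: ae_same_sym; have [] := vd s.
  - exact: Z Lk (cont_at_DF w Lg cg).
have h3 : cont_at (fun s => dx (vf s f)) t.
  have Lk s := LDF (U^~ (dx f)) s (Ld s).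
  apply: (cont_at_ae (w := fun s x => (0 +i* 1) * U (- s) (fun y => DF (U s f y) (U s (dx f) y)) x)).
  - by move=> s; apply: L2Z; exact: L2_U (Lk s).
  - exact: L3.
  - by move=> s; apply: ae_same_sym; have [] := vd s.
  - exact: Z Lk (cont_at_DF w Ld (cont_at_U t Lf')).
have q0 : 0 <= (1 + c)^-1 by rewrite invr_ge0 addr_ge0.
have h12 := small_add h1 h2.
move=> e e0; have [r r0 hr] := small_lin ler01 q0 h12 h3 e0.
exists r => // s /hr; apply: le_lt_trans; rewrite mul1r.
have [d1 _ _] := vd s; have [d2 _ _] := vd t.
have e2 := nrm_ae (dom_gal (domB d1 d2)) (L2B (L2' s) (L2' t)) (galB d1 d2).
have e3 := nrm_ae (dom_dx (domB d1 d2)) (L2B (L3 s) (L3 t)) (dxB d1 d2).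
exact: eq_ler (congr2 (fun a b => nrm (vf s f \- vf t f) + a + (1 + c)^-1 * b) e2 e3).
Qed.

Section Solve.
Context (c A B M L : R) (Lam : R -> R) (u0 : cfun R).
Context (c0 : 0 <= c) (A0 : A <= 0) (B0 : 0 <= B).
Context (lam0 : forall t, A <= t <= B -> 0 < lam c t).
Context (M0 : 0 < M).
Context (lL : forall t, A <= t <= B -> 6 * S (supbound c M t) <= L).
Local Notation D := (dom c : cfun R -> Prop).
Local Notation N := (gnorm c : cfun R -> R).

Lemma vf_rate_ge0 t : A <= t <= B -> 0 <= 6 * S (supbound c M t).
Proof.
move=> /lam0 l0; rewrite mulr_ge0//; apply: (wsum_ge0 alpha1 wfin).
exact: ltW (supbound_gt0 l0 M0).
Qed.

Lemma vf_ucont (f : R -> cfun R) : (forall t, A <= t <= B -> dom c (f t) /\ gnorm c (f t) <= M) ->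
  ucont N A B f -> ucont N A B (fun t => vf t (f t) : cfun R).
Proof.
move=> fM uf; apply: (heine_cantor (gspace c0)) => [t tAB|t tAB e e0].
  by have [hf _] := fM t tAB; have [] := vf_dom alpha1 wfin t hf.
have L0 : 0 <= L := le_trans (vf_rate_ge0 tAB) (lL tAB).
have [ht nt] := fM t tAB.
have [r1 r10 h1] := vf_cont t c0 ht (divr_gt0 e0 (ltr0n R 2)).
have k0 : 0 < e / 2 / (L + 1) by rewrite !divr_gt0// ltr_wpDl.
have [r2 r20 h2] := uf _ k0.
exists (Num.min r1 r2) => [|s sAB]; first by rewrite lt_min r10.
rewrite lt_min => /andP[/h1 p /(h2 s t sAB tAB) q].
have [hs ns] := fM s sAB.
have [d1 _ _] := vf_dom alpha1 wfin s hs; have [d2 _ _] := vf_dom alpha1 wfin s ht.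
have [d3 _ _] := vf_dom alpha1 wfin t ht.
apply: le_lt_trans (sn_triangle (gspace c0) d1 d2 d3) _.
have p' : gnorm c (vf s (f s) \- vf s (f t)) <= L * gnorm c (f s \- f t).
  apply: le_trans (vf_lip c0 (lam0 sAB) M0 hs ht ns nt) _.
  by rewrite ler_wpM2r ?lL ?gnorm_ge0.
have q' : gnorm c (f s \- f t) * (L + 1) < e / 2 by rewrite -ltr_pdivlMr ?ltr_wpDl.
have g0 : 0 <= gnorm c (f s \- f t) := gnorm_ge0 _ c0.
rewrite [ltRHS](_ : e = e / 2 + e / 2); last by field.
apply: ltrD p; apply: le_lt_trans p' (le_lt_trans _ q').
by rewrite mulrC ler_wpM2l// lerDl.
Qed.

Theorem vf_solve : dom c u0 -> 2 * gnorm c u0 <= M ->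
  (forall s t, A <= s -> s <= t -> t <= B -> exists2 tau, s <= tau <= t &
    6 * S (supbound c M tau) * (t - s) <= Lam t - Lam s) ->
  Lam B - Lam A <= 2^-1 ->
  exists f : R -> cfun R, [/\ forall t, A <= t <= B -> dom c (f t) /\ gnorm c (f t) <= M,
    antider D N A B f (fun t => vf t (f t)) & f 0 = u0].
Proof.
move=> Du0 Mu0 lLam Lam2.
have AB0 : A <= 0 <= B by rewrite A0.
have dG t (v : cfun R) : A <= t <= B -> dom c v -> dom c (vf t v).
  by move=> tAB hv; have [] := vf_dom alpha1 wfin t hv.
have Glip t (v w : cfun R) : A <= t <= B -> dom c v -> dom c w -> gnorm c v <= M ->
    gnorm c w <= M ->
    gnorm c ((vf t v : cfun R) - (vf t w : cfun R)) <= 6 * S (supbound c M t) * gnorm c (v - w).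
  by move=> tAB hv hw vM wM; exact: (vf_lip c0 (lam0 tAB) M0 hv hw vM wM).
have Gle t (v : cfun R) : A <= t <= B -> dom c v -> gnorm c v <= M ->
    gnorm c (vf t v) <= 6 * S (supbound c M t) * gnorm c v.
  by move=> tAB hv vM; exact: (vf_le c0 (lam0 tAB) M0 hv vM).
have rL t : A <= t <= B -> 0 <= 6 * S (supbound c M t) <= L.
  by move=> tAB; rewrite vf_rate_ge0//= lL.
have L0 : 0 <= L := le_trans (vf_rate_ge0 AB0) (lL AB0).
have [f [[fM _] fa f0]] := picard (gspace c0) (G := fun t v => vf t v : cfun R)
  A0 B0 Du0 Mu0 dG Glip Gle rL lLam Lam2 vf_ucont.
by exists f.
Qed.

End Solve.

End VectorFieldEstimates.

(** * Duhamel solutions and antiderivatives *)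

Section SchrodingerH1.
Context {R : realType}.
Implicit Types (f g h : R -> R[i]) (w : R -> R -> R[i]) (c s t a b e r : R).
Local Notation U := (@schrodinger R).

Lemma gal0 f : gal 0 f = dx f.
Proof. by rewrite /gal imx0; apply/funext => x /=; rewrite subr0. Qed.

Lemma gnorm0E f : gnorm 0 f = nrm f + 2 * nrm (dx f).
Proof. by rewrite /gnorm gal0 addr0 invr1 mul1r -addrA mulr_natl mulr2n. Qed.

Lemma gnorm0_U t f : dom 0 f -> gnorm 0 (U t f) = gnorm 0 f.
Proof.
move=> hf; have Lf := dom_L2 hf; have Ld := dom_dx hf.
have hU := U_dom t hf.
have e := etrans (nrm_ae (dom_dx hU) (L2_U t Ld) (dx_eq (wdf_U t (dom_wdf hf)))) (nrm_U t Ld).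
rewrite !gnorm0E; exact: (congr2 (fun a b => a + 2 * b) (nrm_U t Lf) e).
Qed.

Lemma gnorm0_c c f : 0 <= c -> gnorm 0 f <= 3 * (2 + c) * gnorm c f.
Proof.
move=> c0; apply: le_trans (gnorm_H1norm f) _.
by rewrite -mulrA ler_wpM2l//; exact: H1norm_gnorm.
Qed.

Lemma H1norm_gnorm0 f : H1norm f <= 2 * gnorm 0 f.
Proof. by have := H1norm_gnorm f (lexx 0); rewrite addr0. Qed.

Lemma gnormB_triangle c f g h : 0 <= c -> dom c f -> dom c g -> dom c h ->
  gnorm c (f \- h) <= gnorm c (f \- g) + gnorm c (g \- h).
Proof. by move=> c0 df dg dh; exact: (sn_triangle (gspace c0) df dg dh). Qed.

Definition cont_in (K : R -> Prop) w t := forall e, 0 < e -> exists2 r, 0 < r &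
  forall s, K s -> `|s - t| < r -> gnorm 0 (w s \- w t) < e.

(** Used with [q] the identity, to return from the interaction picture, and with [q] the opposite,
    to enter it. *)
Lemma cont_in_U K (q : R -> R) w t : (forall s, `|q s - q t| <= `|s - t|) ->
  (forall s, K s -> dom 0 (w s)) -> K t -> cont_in K w t ->
  cont_in K (fun s => U (q s) (w s)) t.
Proof.
move=> hq dw Kt cw; have dt := dw t Kt.
have Lt := dom_L2 dt; have Ldt := dom_dx dt.
move=> e e0; have e4 : 0 < e / 4 by rewrite divr_gt0.
have [r1 r10 h1] := cw _ e4.
have [r2 r20 h2] := U_cont Lt e4; have [r3 r30 h3] := U_cont Ldt e4.
exists (Num.min r1 (Num.min r2 r3)) => [|s Ks]; first by rewrite !lt_min r10 r20.
rewrite !lt_min => /and3P[/(h1 s Ks) p1 p2 p3].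
have {}p2 := h2 _ _ (le_lt_trans (hq s) p2); have {}p3 := h3 _ _ (le_lt_trans (hq s) p3).
have ds := dw s Ks.
have d1 := U_dom (q s) ds; have d2 := U_dom (q s) dt; have d3 := U_dom (q t) dt.
have n1 : gnorm 0 (U (q s) (w s) \- U (q s) (w t)) = gnorm 0 (w s \- w t).
  have hst := domB ds dt.
  apply: etrans (gnorm0_U (q s) hst); apply: gnorm_ae (domB d1 d2) (L2_U _ (dom_L2 hst)) _.
  exact: ae_same_sym (UB (q s) (dom_L2 ds) (dom_L2 dt)).
have n2 : nrm (dx (U (q s) (w t) \- U (q t) (w t))) = nrm (U (q s) (dx (w t)) \- U (q t) (dx (w t))).
  apply: nrm_ae (dom_dx (domB d2 d3)) (L2B (L2_U _ Ldt) (L2_U _ Ldt)) _.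
  exact: ae_same_trans (dxB d2 d3) (ae_sameB (dx_eq (wdf_U _ (dom_wdf dt))) (dx_eq (wdf_U _ (dom_wdf dt)))).
apply: le_lt_trans (gnormB_triangle (lexx 0) d1 d2 d3) _.
have n3 := etrans (gnorm0E _) (congr1 (fun a => _ + 2 * a) n2).
apply: le_lt_trans (lerD (eq_ler n1) (eq_ler n3)) _.
have small x y z : x < e / 4 -> y < e / 4 -> z < e / 4 -> x + (y + 2 * z) < e.
  by clear; lra.
exact: small p1 p2 p3.
Qed.

Lemma cfunDZE (f : cfun R) a (g : cfun R) :
  f + a *: g = (f : R -> R[i]) \+ (fun x => a%:C * g x).
Proof. by []. Qed.

(** Finite linear combinations pass through the group almost everywhere; this carries Riemann sums
    between the two pictures. *)
Lemma U_riemann n (del : 'I_n -> R) (G H : 'I_n -> cfun R) (z : R[i]) t :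
  (forall i, L2 (H i)) -> (forall i, ae_same (G i) (fun x => z * U t (H i) x)) ->
  ae_same (\sum_(i < n) del i *: G i) (fun x => z * U t (\sum_(i < n) del i *: H i) x).
Proof.
move=> LH; elim: n del G H LH => [|n IH] del G H LH e.
  rewrite !big_ord0; apply: ae_imp (U_zero t) => x ->.
  by rewrite mulr0.
rewrite !big_ord_recr /=.
have Ls m (de : 'I_m -> R) (K : 'I_m -> cfun R) : (forall i, L2 (K i)) ->
    L2 (\sum_(i < m) de i *: K i : R -> R[i]).
  elim: m de K => [|m IHm] de K LK; first by rewrite big_ord0; exact: L2_0.
  by rewrite big_ord_recr /=; apply: L2D; [exact: IHm|exact: L2Z (LK _)].
have L1 := Ls _ (fun i => del (widen_ord (leqnSn n) i)) _ (fun i => LH (widen_ord (leqnSn n) i)).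
have Lm := L2Z (del ord_max)%:C (LH ord_max).
have e1 := IH _ _ _ (fun i => LH (widen_ord (leqnSn n) i)) (fun i => e (widen_ord (leqnSn n) i)).
have e1' := e1 (fun i => del (widen_ord (leqnSn n) i)).
have e2 := UD t L1 Lm; have e3 := UZ t (del ord_max)%:C (LH ord_max).
move: e1' e2 e3 (e ord_max); set S1 := \sum_(i < n) _; set S2 := \sum_(i < n) _ => e1' e2 e3 e4.
rewrite (cfunDZE S1) (cfunDZE S2).
have e5 := ae_sameD (ae_same_refl (U t S2)) e3.
apply: ae_imp2 (ae_and e1' e2) (ae_and e5 e4) => x [x1 x2] [x3 x4].
have key (a b p q m o l : R[i]) : a = z * p -> b = z * q -> o = p + m * q -> l = o ->
  a + m * b = z * l by move=> -> -> -> ->; ring.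
exact: key x1 x4 x3 x2.
Qed.

Lemma U_gnorm0_dist (z : R[i]) t (X Y S I : cfun R) : normc z = 1 -> dom 0 X -> dom 0 Y ->
  L2 S -> L2 I -> ae_same S (fun x => z * U t X x) -> ae_same I (fun x => z * U t Y x) ->
  gnorm 0 (S \- I) = gnorm 0 (X \- Y).
Proof.
move=> z1 dX dY LS LI eS eI; have dXY := domB dX dY; have dU := domZ z (U_dom t dXY).
have e := UB t (dom_L2 dX) (dom_L2 dY).
have e1 : ae_same (fun x => z * U t (X \- Y) x) (S \- I).
  apply: ae_imp2 e (ae_and eS eI) => x x1 [x2 x3].
  by rewrite x1 /= x2 x3 mulrBr.
rewrite -(gnorm_ae dU (L2B LS LI) e1) (gnormZ _ (U_dom t dXY)) z1 mul1r.
exact: gnorm0_U.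
Qed.

Lemma partition_tag a b (r : seq R) (tag : nat -> R) del : itv_partition a b r ->
  (forall i, (i < size r)%N -> nth a (a :: r) i <= tag i <= nth a r i /\
     nth a r i - nth a (a :: r) i < del) ->
  forall i, (i < size r)%N -> a <= tag i <= b.
Proof.
move=> rp hr i ir; have [/andP[h1 h2] _] := hr i ir.
rewrite (le_trans _ h1) ?(le_trans h2)//.
  rewrite (set_nth_default b)//; exact: (itv_partition_nth_le (m := i.+1) _ rp).
rewrite (set_nth_default b) ?ltnS ?(ltnW ir)//.
by apply: itv_partition_nth_ge rp; rewrite ltnS ltnW.
Qed.

End SchrodingerH1.

(** * From antiderivatives to Duhamel solutions *)

Section Duhamel.
Context {R : realType} (d : nat -> R[i]) (alpha : nat -> R).
Context (alpha1 : forall k, 1 <= alpha k).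
Context (wfin : forall m : R, 0 <= m -> exists B : R, forall n : nat,
  \sum_(0 <= k < n) wterm d alpha m k <= B).
Implicit Types (f g : R -> R[i]) (u v : R -> R -> R[i]) (c t s tau a b A B e M : R).
Local Notation U := (@schrodinger R).
Local Notation F := (nlF d alpha).
Local Notation vf := (vf d alpha).
Local Notation mi := (0 +i* (-1) : R[i]).
Local Notation D c := (dom c : cfun R -> Prop).
Local Notation N c := (gnorm c : cfun R -> R).
Local Notation duhamel u t := (fun tau => U (t - tau) (fun x => nonlinearity d alpha (u tau x) * u tau x)).

Lemma normc_mi : normc mi = 1.
Proof. by rewrite normcI normrN normr1. Qed.

Lemma mi_i : mi * (0 +i* 1) = 1.
Proof. by apply: complexP => /=; ring. Qed.

Lemma dom_F f : dom 0 f -> dom 0 (fun x => F (f x)).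
Proof.
move=> hf; have w := wdf_nlF alpha1 wfin (dom_wdf hf); split.
  by exists (fun x => nlD d alpha (f x) (dx f x)).
by rewrite imx0; exact: L2_0.
Qed.

(** By the group law U(t - tau) = U(t) U(-tau), and the field carries a factor i; hence the constant
    -i. *)
Lemma duhamel_vf u t tau (h : cfun R) : dom 0 (u tau) -> dom 0 h ->
  ae_same (u tau) (U tau h) ->
  ae_same (duhamel u t tau) (fun x => mi * U t (vf tau h) x).
Proof.
move=> du dh e; have dU := U_dom tau dh.
have LF := dom_L2 (dom_F du); have LF' := dom_L2 (dom_F dU).
have eF : ae_same (fun x => F (u tau x)) (fun x => F (U tau h x)).
  by apply: ae_imp e => x ->.
have LU := L2_U (- tau) LF'.
have e1 := UZ t (0 +i* 1) LU; have e2 := U_add t (- tau) LF'.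
have e3 := U_ae (t - tau) LF LF' eF.
apply: ae_imp2 e1 (ae_and e2 e3) => x x1 [x2 x3].
have key (a b p q : R[i]) : q = (0 +i* 1) * p -> p = b -> a = b -> a = mi * q.
  by move=> -> -> ->; rewrite mulrA mi_i mul1r.
exact: key x1 x2 x3.
Qed.

Lemma riemann_sum_vf u (f : R -> cfun R) a t (s : seq R) (tag : nat -> R) :
  (forall i, (i < size s)%N -> [/\ dom 0 (u (tag i)), dom 0 (f (tag i)) &
     ae_same (u (tag i)) (U (tag i) (f (tag i)))]) ->
  L2 (riemann_sum a s tag (duhamel u t)) /\
  ae_same (riemann_sum a s tag (duhamel u t)) (fun x => mi * U t
    (\sum_(i < size s) (nth a s i - nth a (a :: s) i) *: (vf (tag i) (f (tag i)) : cfun R)) x).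
Proof.
move=> h.
have -> : riemann_sum a s tag (duhamel u t) =
    \sum_(i < size s) (nth a s i - nth a (a :: s) i) *: (duhamel u t (tag i) : cfun R).
  by apply/funext => x; rewrite /riemann_sum (cfun_sum _ x).
split; last first.
  apply: U_riemann => i; have [du df eu] := h i (ltn_ord i).
    by have [/dom_L2] := vf_dom alpha1 wfin (tag i) df.
  exact: duhamel_vf du df eu.
apply: (big_ind (fun f : cfun R => L2 (f : R -> R[i]))) => [|f1 f2|i _].
- exact: L2_0.
- exact: L2D.
- have [du _ _] := h i (ltn_ord i); apply: L2Z.
  exact: L2_U (dom_L2 (dom_F du)).
Qed.

(** The Riemann sums of the Duhamel integrand are, up to the isometry -i U(t), those of the vector
    field, which converge to the increment of [f]. *)
Lemma duhamel_RInt c A B u (f : R -> cfun R) a b t (I : R -> R[i]) :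
  0 <= c -> antider (D c) (N c) A B f (fun tau => vf tau (f tau)) -> A <= a -> a <= b -> b <= B ->
  (forall tau, A <= tau <= B -> dom 0 (u tau) /\ ae_same (u tau) (U tau (f tau))) ->
  dom 0 I -> ae_same I (fun x => mi * U t (f b - f a) x) ->
  is_RInt_H1_le a b (duhamel u t) I.
Proof.
move=> c0 af Aa ab bB hu dI eI; have [Df _] := af.
have inAB tau : a <= tau <= b -> A <= tau <= B.
  by move=> /andP[h1 h2]; rewrite (le_trans Aa h1) (le_trans h2 bB).
have dom0 (h : R -> R[i]) : dom c h -> dom 0 h by move=> /dom_H1/H1_dom.
have dG tau : A <= tau <= B -> dom 0 (duhamel u t tau).
  by move=> /hu[du _]; exact: U_dom (dom_F du).
split; first by move=> tau /inAB/dG/H1_dom.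
  exact/H1_dom.
(* A factor 2 passes from [gnorm 0] to [H1norm], and 3 (2 + c) from [gnorm c] to [gnorm 0]. *)
have k0 : 0 < 6 * (2 + c) by rewrite mulr_gt0// ltr_pwDl.
have ba : 0 < b - a + 1 by rewrite ltr_wpDl// subr_ge0.
move=> e e0; have e1 : 0 < e / (6 * (2 + c)) / (b - a + 1) by rewrite !divr_gt0.
have [r r0 hr] := riemann_cvg (gspace c0) af Aa ab bB e1.
exists r => // s tag sp ht; have tI := partition_tag sp ht.
have [dS nS] := hr s tag sp ht.
have [|LS eS] := @riemann_sum_vf u f a t s tag.
  move=> i ir; have tiAB := inAB _ (tI i ir).
  by have [du eu] := hu _ tiAB; have [/dom0 df _] := Df _ tiAB.
set X := (\sum_(i < size s) _) in dS nS eS.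
have [dfa _] := Df a (introT andP (conj Aa (le_trans ab bB))).
have [dfb _] := Df b (introT andP (conj (le_trans Aa ab) bB)).
have dY := sn_DB (gspace c0) dfb dfa.
have dist := U_gnorm0_dist normc_mi (dom0 _ dS) (dom0 _ dY) LS (dom_L2 dI) eS eI.
apply: le_lt_trans (H1norm_gnorm0 _) _.
apply: (@le_lt_trans _ _ (2 * gnorm 0 (X \- (f b \- f a)))); first by rewrite ler_wpM2l// (eq_ler dist).
apply: (@le_lt_trans _ _ (6 * (2 + c) * gnorm c (X \- (f b \- f a)))).
  have := gnorm0_c (X \- (f b \- f a)) c0; move: (gnorm 0 _) (gnorm c _) => x y h.
  rewrite [leRHS](_ : _ = 2 * (3 * (2 + c) * y)); last by ring.
  by rewrite ler_wpM2l.
rewrite mulrC -ltr_pdivlMr//; apply: le_lt_trans nS _.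
rewrite -mulrA -[ltRHS]mulr1 ltr_pM2l ?divr_gt0//.
by rewrite mulrC ltr_pdivrMr// mul1r ltrDl.
Qed.

(* In the interaction picture f(t) = U(-t) u(t) the Duhamel equation says that
   f is an antiderivative of t |-> vf t (f t). *)
Lemma antider_solution (J : set R) (u0 : R -> R[i]) u :
  H1 u0 ->
  (forall t, J t -> exists c A B (f : R -> cfun R) r,
    [/\ 0 <= c, A <= 0 <= B, A <= t <= B, 0 < r &
     [/\ forall s, J s -> `|s - t| < r -> A <= s <= B, ae_same (f 0) u0,
       antider (D c) (N c) A B f (fun t => vf t (f t)) &
       forall s, A <= s <= B -> dom 0 (u s) /\ ae_same (u s) (U s (f s))]]) ->
  is_solution d alpha J u0 u.
Proof.
move=> /H1_dom h0 hJ; split.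
  split => [t /hJ[c [A [B [f [r [c0 AB0 tAB r0 [hs f0 af hu]]]]]]]|].
    by have [/H1_dom] := hu t tAB.
  move=> t Jt; have [c [A [B [f [r [c0 AB0 tAB r0 [hs f0 af hu]]]]]]] := hJ t Jt.
  have [Df afe] := af.
  have dom0 (h : R -> R[i]) : dom c h -> dom 0 h by move=> /dom_H1/H1_dom.
  have df s : A <= s <= B -> dom 0 (f s) by move=> /Df[/dom0].
  (* Tolerance 1 in [antider] with tag [t] bounds short increments around [t] by (1 + |field at t|)
     times their length. *)
  have cf : cont_in (fun s => A <= s <= B) f t.
    move=> e e0; have [r1 r10 h1] := afe 1 ltr01.
    have [dft dgt] := Df t tAB; set g := N c (vf t (f t)).
    have g0 : 0 <= g := gnorm_ge0 _ c0.
    pose k := 3 * (2 + c) * (1 + g); have k0 : 0 < k.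
      by rewrite mulr_gt0 ?ltr_pwDl// mulr_gt0// ltr_pwDl.
    exists (Num.min r1 (e / k)) => [|s sAB]; first by rewrite lt_min r10 divr_gt0.
    rewrite lt_min => /andP[s1 s2]; have [dfs dgs] := Df s sAB.
    apply: le_lt_trans (gnorm0_c _ c0) _.
    apply: (@le_lt_trans _ _ (k * `|s - t|)); last by rewrite mulrC -ltr_pdivlMr.
    rewrite (_ : k * _ = 3 * (2 + c) * ((1 + g) * `|s - t|)); last by rewrite /k -!mulrA.
    rewrite ler_wpM2l ?mulr_ge0 ?addr_ge0//.
    have key p q : A <= p -> p <= t <= q -> q <= B -> q - p < r1 -> N c (f q - f p) <= (1 + g) * (q - p).
      move=> Ap /andP[pt tq] qB qp.
      have pAB : A <= p <= B by rewrite Ap (le_trans pt (le_trans tq qB)).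
      have qAB : A <= q <= B by rewrite qB (le_trans Ap (le_trans pt tq)).
      have [dp _] := Df p pAB; have [dq _] := Df q qAB.
      have := h1 p t q Ap (introT andP (conj pt tq)) qB qp; rewrite mul1r => n1.
      have qp0 : 0 <= q - p by rewrite subr_ge0 (le_trans pt).
      have := sn_Nle (gspace c0) (sn_DB (gspace c0) dq dp) (sn_DZ (gspace c0) (q - p) dgt).
      rewrite (sn_NZ (gspace c0) _ dgt) (ger0_norm qp0) -/g => n2.
      apply: le_trans n2 _; move: n1 qp0; move: (q - p) => z n1 z0.
      by rewrite [leRHS](_ : _ = z * g + z) ?lerD2l//; ring.
    have /andP[At tB] := tAB; have /andP[As sB] := sAB.
    have [st|ts] := leP t s.
      have st0 : 0 <= s - t by rewrite subr_ge0.
      rewrite (ger0_norm st0) in s1 *.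
      by apply: key => //; rewrite lexx st.
    have ts0 : s - t < 0 by rewrite subr_lt0.
    rewrite (ltr0_norm ts0) opprB in s1 *.
    have -> : gnorm c (f s \- f t) = N c (f t - f s) := sn_NBC (gspace c0) dfs dft.
    by apply: key => //; rewrite lexx (ltW ts).
  have cU := cont_in_U (q := id) (fun s => lexx _) df tAB cf.
  apply/cvgrPdist_lt => e e0; have e2 : 0 < e / 2 by rewrite divr_gt0.
  have [r1 r10 h1] := cU _ e2.
  have near_t : \forall s \near within J (nbhs t), `|s - t| < Num.min r r1.
    apply: (@filterS _ _ _ (fun s => `|t - s| < Num.min r r1)).
      by move=> s; rewrite distrC.
    apply: cvg_within; apply: (@cvgr_dist_lt _ _ _ (nbhs t)) => //.
    by rewrite lt_min r0 r10.
  near=> s.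
  have Js : J s by near: s; exact: withinT.
  have : `|s - t| < Num.min r r1 by near: s.
  rewrite lt_min => /andP[s1 s2]; have sAB := hs s Js s1.
  rewrite sub0r normrN ger0_norm ?H1norm_ge0//.
  have [dus eus] := hu s sAB; have [dut eut] := hu t tAB.
  have dB := domB dus dut.
  apply: le_lt_trans (H1norm_gnorm0 _) _; rewrite mulrC -ltr_pdivlMr//.
  have dU := domB (U_dom s (df s sAB)) (U_dom t (df t tAB)).
  apply: le_lt_trans (h1 s sAB s2); apply: eq_ler.
  exact: gnorm_ae dB (dom_L2 dU) (ae_sameB eus eut).
move=> t Jt; have [c [A [B [f [r [c0 AB0 tAB r0 [hs f0 af hu]]]]]]] := hJ t Jt.
have [Df _] := af.
have dom0 (h : R -> R[i]) : dom c h -> dom 0 h by move=> /dom_H1/H1_dom.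
have [dft _] := Df t tAB; have [df0 _] := Df 0 AB0.
have [/dom0 dft0 /dom0 df00] := (dft, df0).
have [dut eut] := hu t tAB.
have dUu0 := U_dom t h0.
pose I : R -> R[i] := fun x => mi * (u t x - U t u0 x).
have dI : dom 0 I by apply: (@domZ _ 0 mi (u t \- U t u0)); exact: domB.
have e0 := U_ae t (dom_L2 df00) (dom_L2 h0) f0.
have eB := UB t (dom_L2 dft0) (dom_L2 df00).
have eI : ae_same I (fun x => mi * U t (f t - f 0) x).
  apply: ae_imp2 eut (ae_and e0 eB) => x x1 [x2 x3].
  by rewrite /I x1 -x2; congr (_ * _); rewrite [RHS](x3).
have /andP[A0 B0] := AB0; have /andP[At tB] := tAB.
exists I; last first.
  apply: ae_same_eq => x; rewrite /I mulrA [_ * mi]mulrC mi_i mul1r.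
  by rewrite addrC subrK.
rewrite /is_RInt_H1; case: ifPn => [t0|]; first exact: (duhamel_RInt c0 af A0 t0 tB hu dI eI).
rewrite -ltNge => /ltW t0.
have dNI : dom 0 (fun x => - I x).
  have := domZ (-1) dI; rewrite (_ : (fun x => -1 * I x) = (fun x => - I x))//.
  by apply/funext => x; rewrite mulN1r.
have eB' := UB t (dom_L2 df00) (dom_L2 dft0).
have eNI : ae_same (fun x => - I x) (fun x => mi * U t (f 0 - f t) x).
  apply: ae_imp2 eI (ae_and eB eB') => x x1 [x2 x3].
  have key (i z p q a b : R[i]) : i = z * a -> a = p - q -> b = q - p -> - i = z * b.
    by move=> -> -> ->; ring.
  exact: key x1 x2 x3.
exact: (duhamel_RInt c0 af At t0 B0 hu dNI eNI).
Unshelve. all: by end_near.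
Qed.

End Duhamel.

Section UniformContinuity.
Context {R : realType} (V : lmodType R) (D : V -> Prop) (N : V -> R).
Context (H : seminormed D N).

Lemma ucont_bounded (A B : R) (G : R -> V) : A <= B ->
  (forall t, A <= t <= B -> D (G t)) -> ucont N A B G ->
  exists2 K, 0 < K & forall t, A <= t <= B -> N (G t) <= K.
Proof.
move=> AB DG uG; have [r r0 hr] := uG 1 ltr01.
have AI : A <= A <= B by rewrite lexx.
have rr : r / 2 < r by rewrite ltr_pdivrMr// ltr_pMr// ltr1n.
have key n t : A <= t <= B -> t - A < n%:R * (r / 2) -> N (G t) <= N (G A) + n%:R.
  elim: n t => [t /andP[At _]|n IH t tI].
    by rewrite mul0r subr_lt0 ltNge At.
  move=> tn; have [At tB] := andP tI; have [tr|tr] := ltP (t - A) (r / 2).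
    have tA : `|t - A| < r by rewrite ger0_norm ?subr_ge0// (lt_trans tr).
    apply: le_trans (sn_Nle H (DG t tI) (DG A AI)) _; rewrite lerD2l.
    by apply: ltW; apply: lt_le_trans (hr t A tI AI tA) _; rewrite ler1n.
  have sI : A <= t - r / 2 <= B.
    by apply/andP; split; [move: tr; lra|move: tB r0; lra].
  have ts : `|t - (t - r / 2)| < r.
    by rewrite opprB addrC subrK ger0_norm// ltW// divr_gt0.
  apply: le_trans (sn_Nle H (DG t tI) (DG _ sI)) _.
  rewrite -[n.+1%:R]natr1 addrA; apply: lerD; last exact: ltW (hr t _ tI sI ts).
  by apply: IH sI _; move: tn; rewrite -[n.+1%:R]natr1 mulrDl mul1r; lra.
have [n hn] : exists n : nat, B - A < n%:R * (r / 2).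
  exists (Num.truncn ((B - A) / (r / 2))).+1.
  by rewrite -ltr_pdivrMr ?divr_gt0// truncnS_gt.
exists (N (G A) + n%:R + 1) => [|t tI].
  by rewrite ltr_wpDl// addr_ge0 ?(sn_ge0 H).
apply: le_trans (key n t tI _) _; last by rewrite lerDl.
by apply: le_lt_trans hn; rewrite lerD2r; have /andP[] := tI.
Qed.

End UniformContinuity.

(** * From Duhamel solutions to antiderivatives, and uniqueness *)

Section Uniqueness.
Context {R : realType} (d : nat -> R[i]) (alpha : nat -> R).
Context (alpha1 : forall k, 1 <= alpha k).
Context (wfin : forall m : R, 0 <= m -> exists B : R, forall n : nat,
  \sum_(0 <= k < n) wterm d alpha m k <= B).
Implicit Types (f g : R -> R[i]) (u v w : R -> R -> R[i]) (c t s tau a b A B e M K : R).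
Local Notation U := (@schrodinger R).
Local Notation S := (wsum d alpha).
Local Notation vf := (vf d alpha).
Local Notation mi := (0 +i* (-1) : R[i]).
Local Notation D0 := (dom 0 : cfun R -> Prop).
Local Notation N0 := (gnorm 0 : cfun R -> R).
Local Notation duhamel u t := (fun tau => U (t - tau) (fun x => nonlinearity d alpha (u tau x) * u tau x)).

Lemma lam0t t : lam 0 t = 1 :> R.
Proof. by rewrite /lam mulr0 mul0r addr0. Qed.

Lemma supbound0 M t : supbound 0 M t = sobc * M :> R.
Proof. by rewrite /supbound lam0t sqrtr1 divr1. Qed.

(** The rate at [c = 0], where no decay is available and the bound does not depend on time. *)
Definition lipc M : R := 6 * S (sobc * M).

Lemma lipc_ge0 M : 0 <= M -> 0 <= lipc M.
Proof. by move=> M0; rewrite mulr_ge0// (wsum_ge0 alpha1 wfin)// mulr_ge0// sobc_ge0. Qed.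

Lemma vf_lip0 M t f g : 0 < M -> dom 0 f -> dom 0 g -> gnorm 0 f <= M -> gnorm 0 g <= M ->
  gnorm 0 (vf t f \- vf t g) <= lipc M * gnorm 0 (f \- g).
Proof.
move=> M0 df dg fM gM; have l0 : 0 < lam 0 t by rewrite lam0t.
have := vf_lip alpha1 wfin (lexx 0) l0 M0 df dg fM gM.
by rewrite supbound0.
Qed.

Lemma vf_ae t f g : dom 0 f -> dom 0 g -> ae_same f g -> gnorm 0 (vf t f \- vf t g) = 0.
Proof.
move=> df dg e; have g0 (h : R -> R[i]) : 0 <= gnorm 0 h := gnorm_ge0 h (lexx 0).
have e0 : gnorm 0 (f \- g) = 0.
  apply/(gnorm_eq0 (lexx 0) (domB df dg)); apply: ae_imp e => x /= ->.
  by rewrite subrr.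
have M0 : 0 < gnorm 0 f + gnorm 0 g + 1 by rewrite ltr_wpDl// addr_ge0.
have := vf_lip0 t M0 df dg _ _; rewrite e0 mulr0 => h.
apply/eqP; rewrite eq_le g0 andbT; apply: h.
  by rewrite -addrA lerDl addr_ge0.
by rewrite addrAC lerDr addr_ge0.
Qed.

(** Converse of [duhamel_RInt]: undoing the isometry, the given integral is a limit of Riemann sums
    of the field, hence equals the increment of any antiderivative. *)
Lemma RInt_antider A B v (g : R -> cfun R) (P : R -> cfun R) a b t (I : R -> R[i]) :
  antider D0 N0 A B P (fun tau => vf tau (g tau)) -> A <= a -> a <= b -> b <= B ->
  (forall tau, A <= tau <= B -> [/\ dom 0 (v tau), dom 0 (g tau) & ae_same (v tau) (U tau (g tau))]) ->
  is_RInt_H1_le a b (duhamel v t) I ->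
  ae_same (P b - P a) (fun x => (0 +i* 1) * U (- t) I x).
Proof.
move=> aP Aa ab bB hv [_ /H1_dom dI hI].
have dUI := U_dom (- t) dI.
pose Y : cfun R := fun x => (0 +i* 1) * U (- t) I x.
have dY : dom 0 Y := domZ _ dUI.
have eI : ae_same I (fun x => mi * U t Y x).
  have e1 := UZ t (0 +i* 1) (dom_L2 dUI); have e2 := UK t (dom_L2 dI).
  apply: ae_imp2 e1 e2 => x x1 x2.
  have key (i p q : R[i]) : q = (0 +i* 1) * p -> p = i -> i = mi * q.
    by move=> -> ->; rewrite mulrA mi_i mul1r.
  exact: key x1 x2.
have [DP _] := aP.
have [dPa _] := DP a (introT andP (conj Aa (le_trans ab bB))).
have [dPb _] := DP b (introT andP (conj (le_trans Aa ab) bB)).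
suff n0 : N0 (P b - P a - Y) = 0.
  have := (gnorm_eq0 (lexx 0) (domB (domB dPb dPa) dY)).1 n0.
  apply: ae_imp => x x0.
  have key (p y : R[i]) : p - y = 0 -> p = y by move=> /subr0_eq.
  exact: key x0.
apply: (riemann_unique (gspace (lexx 0)) aP Aa ab bB dY) => e e0.
have e3 : 0 < e / 3 by rewrite divr_gt0.
have [r r0 hr] := hI _ e3; exists r => // s tag sp ht.
have tI := partition_tag sp ht.
have inAB tau : a <= tau <= b -> A <= tau <= B.
  by move=> /andP[h1 h2]; rewrite (le_trans Aa h1) (le_trans h2 bB).
have [|LS eS] := @riemann_sum_vf R d alpha alpha1 wfin v g a t s tag.
  by move=> i ir; exact: hv (inAB _ (tI i ir)).
have dX : dom 0 (\sum_(i < size s) (nth a s i - nth a (a :: s) i) *: (vf (tag i) (g (tag i)) : cfun R)).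
  apply: (big_ind (fun f : cfun R => dom 0 (f : R -> R[i]))) => [|f1 f2|i _].
  - exact: dom0.
  - exact: domD.
  - have [_ dg _] := hv _ (inAB _ (tI i (ltn_ord i))).
    by apply: domZ; have [] := vf_dom alpha1 wfin (tag i) dg.
have dist := U_gnorm0_dist (@normc_mi R) dX dY LS (dom_L2 dI) eS eI.
apply: (@le_lt_trans _ _ (gnorm 0 (riemann_sum a s tag (duhamel v t) \- I))).
  exact: eq_ler (esym dist).
apply: le_lt_trans (gnorm_H1norm _) _.
by rewrite mulrC -ltr_pdivlMr//; exact: hr.
Qed.

(** The curve g(t) = U(-t) v(t) is continuous, hence uniformly continuous and bounded, so the field
    along it has an antiderivative. *)
Lemma solution_antider (J : set R) (u0 : R -> R[i]) v A B : A <= 0 -> 0 <= B ->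
  (forall t, A <= t <= B -> J t) -> H1 u0 -> is_solution d alpha J u0 v ->
  exists (Q : R -> cfun R) (K : R),
    [/\ 0 < K, antider D0 N0 A B Q (fun t => vf t (Q t)), Q 0 = u0 &
     forall t, A <= t <= B -> N0 (Q t) <= K /\ ae_same (v t) (U t (Q t))].
Proof.
move=> A0 B0 JAB /H1_dom d0 [[Hv cv] iv]; have AB := le_trans A0 B0.
have I0 : A <= 0 <= B by rewrite A0.
have sn := @gspace R 0 (lexx 0).
have dv t : A <= t <= B -> dom 0 (v t) by move=> /JAB/Hv/H1_dom.
have cont t : A <= t <= B -> cont_in (fun s => A <= s <= B) v t.
  move=> tI e e0; have e3 : 0 < e / 3 by rewrite divr_gt0.
  have /cvgrPdist_lt/(_ _ e3) := cv t (JAB t tI).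
  rewrite /within => -[r /= r0 hr]; exists r => // s sI st.
  have := hr s; rewrite /= distrC => /(_ st (JAB s sI)).
  rewrite sub0r normrN ger0_norm ?H1norm_ge0// ltr_pdivlMr// mulrC.
  exact: le_lt_trans (gnorm_H1norm _).
pose g t : cfun R := U (- t) (v t).
have dg t : A <= t <= B -> dom 0 (g t) by move=> /dv; exact: U_dom.
have eg t : A <= t <= B -> ae_same (v t) (U t (g t)).
  by move=> /dv/dom_L2 Lv; exact: ae_same_sym (UK t Lv).
have ug : ucont N0 A B g.
  apply: (heine_cantor sn dg) => t tI e e0.
  have hq s : `|- s - - t| <= `|s - t| by rewrite -opprD normrN.
  exact: cont_in_U hq dv tI (cont t tI) e e0.
have [M M0 gM] := ucont_bounded sn AB dg ug.
have lam0 t : A <= t <= B -> 0 < lam 0 t by rewrite lam0t.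
have lL t : A <= t <= B -> 6 * S (supbound 0 M t) <= lipc M by rewrite supbound0.
have uG := vf_ucont alpha1 wfin (lexx 0) lam0 M0 lL (fun t tI => conj (dg t tI) (gM t tI)) ug.
have dG t : A <= t <= B -> dom 0 (vf t (g t)).
  by move=> tI; have [] := vf_dom alpha1 wfin t (dg t tI).
have [P aP] := antider_exists sn AB dG uG.
have hg tau : A <= tau <= B -> [/\ dom 0 (v tau), dom 0 (g tau) & ae_same (v tau) (U tau (g tau))].
  by move=> tI; split; [exact: dv|exact: dg|exact: eg].
have [DP _] := aP; have [dP0 _] := DP 0 I0.
(* The Duhamel formula says that [g] and [Q] agree almost everywhere at each time. Replacing [g] by
   [Q] in the field is free up to seminorm zero, and [Q] has the initial value [u0] exactly. *)
pose Q t : cfun R := (u0 : cfun R) - P 0 + P t.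
have aQ : antider D0 N0 A B Q (fun t => vf t (g t)).
  exact: (antider_shift sn (domB d0 dP0 : D0 ((u0 : cfun R) - P 0)) aP).
have dQ t : A <= t <= B -> dom 0 (Q t) by move=> tI; have [/(_ t tI)[]] := aQ.
have gQ t : A <= t <= B -> ae_same (g t) (Q t).
  move=> tI; have [At tB] := andP tI; have [I hI eI] := iv t (JAB t tI).
  have [dI ePI] : dom 0 I /\ ae_same (P t - P 0) (fun x => (0 +i* 1) * U (- t) I x).
    move: hI; rewrite /is_RInt_H1; case: ifPn => [t0 hI|].
      split; first by have [_ /H1_dom] := hI.
      exact: RInt_antider aP A0 t0 tB hg hI.
    rewrite -ltNge => /ltW t0 hI.
    have dI : dom 0 I.
      have [_ /H1_dom/(domZ (-1))] := hI.
      rewrite (_ : (fun x => -1 * - I x) = I)//.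
      by apply/funext => x; rewrite mulN1r opprK.
    split => //.
    have e1 := RInt_antider aP At t0 B0 hg hI.
    have e2 := UZ (- t) (-1) (dom_L2 dI).
    have fE : (fun x => -1 * I x) = (fun x => - I x) by apply/funext => x; rewrite mulN1r.
    rewrite fE in e2.
    apply: ae_imp2 e1 e2 => x x1 x2.
    have key (p q i j z : R[i]) : p - q = z * i -> i = -1 * j -> q - p = z * j.
      by move=> h e; rewrite -(opprB p q) h e; ring.
    exact: key x1 x2.
  have LI := dom_L2 dI; have L0 := dom_L2 d0.
  have LU := L2_U t L0; have LZ := L2Z (0 +i* 1) LI.
  have e1 := U_ae (- t) (dom_L2 (dv t tI)) (L2D LU LZ) eI.
  have e2 := UD (- t) LU LZ; have e3 := UZ (- t) (0 +i* 1) LI; have e4 := NUK t L0.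
  apply: ae_imp2 (ae_and e1 e2) (ae_and (ae_and e3 e4) ePI) => x [x1 x2] [[x3 x4] x5].
  have key (a b p q r u i p0 p1 : R[i]) : a = b -> b = p + q -> q = r -> p = u -> p1 - p0 = r ->
    a = u - p0 + p1 by move=> -> -> -> -> <-; ring.
  exact: key x1 x2 x3 x4 x5.
exists Q, M; split; first exact: M0.
- apply: (antider_eq sn aQ) => t tI; split.
    by have [] := vf_dom alpha1 wfin t (dQ t tI).
  exact: vf_ae (dg t tI) (dQ t tI) (gQ t tI).
- by rewrite /Q subrK.
- move=> t tI; split.
    apply: le_trans (gM t tI); apply: eq_ler; apply/esym.
    exact: gnorm_ae (dg t tI) (dom_L2 (dQ t tI)) (gQ t tI).
  apply: ae_same_trans (eg t tI) _.
  exact: U_ae (dom_L2 (dg t tI)) (dom_L2 (dQ t tI)) (gQ t tI).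
Qed.

Lemma antider_dependence A B (P Q : R -> cfun R) K : A <= 0 -> 0 <= B -> 0 < K ->
  antider D0 N0 A B P (fun t => vf t (P t)) -> antider D0 N0 A B Q (fun t => vf t (Q t)) ->
  (forall t, A <= t <= B -> N0 (P t) <= K) -> (forall t, A <= t <= B -> N0 (Q t) <= K) ->
  forall t, A <= t <= B ->
    N0 (P t - Q t) <= 2 * N0 (P 0 - Q 0) * expR (2 * lipc K * `|t|).
Proof.
move=> A0 B0 K0 aP aQ PK QK; have sn := @gspace R 0 (lexx 0).
have [DP _] := aP; have [DQ _] := aQ.
apply: (gronwall sn A0 B0 (lipc_ge0 (ltW K0)) (antiderB sn aP aQ) (K := K + K)) => t tI.
  have [dP _] := DP t tI; have [dQ _] := DQ t tI.
  exact: vf_lip0 K0 dP dQ (PK t tI) (QK t tI).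
have [dP _] := DP t tI; have [dQ _] := DQ t tI.
by apply: le_trans (sn_NB sn dP dQ) _; rewrite lerD ?PK ?QK.
Qed.

(** No smallness is involved: both solutions are bounded on the segment joining 0 to [t], and
    Gronwall applies with the Lipschitz constant on a common ball. *)
Lemma solution_unique (J : set R) (u0 : R -> R[i]) v w :
  (forall t s, J t -> (0 <= s <= t) || (t <= s <= 0) -> J s) -> H1 u0 ->
  is_solution d alpha J u0 v -> is_solution d alpha J u0 w ->
  forall t, J t -> ae_same (v t) (w t).
Proof.
move=> Jc H0 sv sw t Jt; pose A := Num.min 0 t; pose B := Num.max 0 t.
have A0 : A <= 0 by rewrite ge_min lexx.
have B0 : 0 <= B by rewrite le_max lexx.
have tI : A <= t <= B by rewrite ge_min le_max !lexx !orbT.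
have JAB s : A <= s <= B -> J s.
  rewrite /A /B => sI; apply: (Jc t) Jt _; move: sI.
  by case: (leP 0 t) => t0 -> //; rewrite orbT.
have [P [K1 [K10 aP P0 hP]]] := solution_antider A0 B0 JAB H0 sv.
have [Q [K2 [K20 aQ Q0 hQ]]] := solution_antider A0 B0 JAB H0 sw.
have K0 : 0 < K1 + K2 by rewrite addr_gt0.
have := antider_dependence A0 B0 K0 aP aQ _ _ tI.
rewrite P0 Q0 subrr (sn_N0 (gspace (lexx 0))) mulr0 mul0r => h.
have n0 : N0 (P t - Q t) <= 0.
  apply: h => s sI; first by have [/le_trans h _] := hP s sI; apply: h; rewrite lerDl ltW.
  by have [/le_trans h _] := hQ s sI; apply: h; rewrite lerDr ltW.
have [/(_ t tI)[dP _] _] := aP; have [/(_ t tI)[dQ _] _] := aQ.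
have e0 : gnorm 0 (P t \- Q t) = 0.
  by apply/eqP; rewrite eq_le n0 gnorm_ge0.
have e : ae_same (P t) (Q t).
  have := (gnorm_eq0 (lexx 0) (domB dP dQ)).1 e0; apply: ae_imp => x /= /subr0_eq.
  exact.
have [_ e1] := hP t tI; have [_ e2] := hQ t tI.
have e3 := U_ae t (dom_L2 dP) (dom_L2 dQ) e.
exact: ae_same_trans e1 (ae_same_trans e3 (ae_same_sym e2)).
Qed.

End Uniqueness.

(** * Local well-posedness *)

Section LocalTheory.
Context {R : realType}.
Implicit Types (t s r e T M : R).
Local Notation U := (@schrodinger R).
Local Notation D0 := (dom 0 : cfun R -> Prop).
Local Notation N0 := (gnorm 0 : cfun R -> R).

Lemma nneseries_bounded (a : nat -> R) : (forall k, 0 <= a k) ->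
  (\sum_(0 <= k <oo) (a k)%:E < +oo)%E ->
  exists B : R, forall n : nat, \sum_(0 <= k < n) a k <= B.
Proof.
move=> a0 afin; have s0 : (0 <= \sum_(0 <= k <oo) (a k)%:E)%E.
  by apply: nneseries_ge0 => k _ _; rewrite lee_fin.
exists (fine (\sum_(0 <= k <oo) (a k)%:E)%E) => n.
rewrite -lee_fin fineK ?ge0_fin_numE// -sumEFin.
by apply: nneseries_lim_ge => k _ _; rewrite lee_fin.
Qed.

(** Finiteness is assumed at positive radii only; the radius [m + 1] dominates [m], including
    [m = 0]. *)
Lemma weights_finite (d : nat -> R[i]) (alpha : nat -> R) :
  (forall k, 1 <= alpha k) ->
  (forall r, 0 < r ->
    (\sum_(0 <= k <oo) (normc (d k) * (1 + `|alpha k| + `|alpha k| ^+ 2) * r `^ alpha k)%R%:E < +oo)%E) ->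
  forall m : R, 0 <= m -> exists B : R, forall n : nat, \sum_(0 <= k < n) wterm d alpha m k <= B.
Proof.
move=> a1 h m m0; have m1 : 0 < m + 1 by rewrite ltr_wpDl.
have a0 k : 0 <= alpha k := le_trans ler01 (a1 k).
have c0 k : 0 <= normc (d k) * (1 + `|alpha k| + `|alpha k| ^+ 2).
  by rewrite mulr_ge0 ?normc_ge0 ?addr_ge0.
have [|B hB] := nneseries_bounded _ (h _ m1).
  by move=> k; rewrite mulr_ge0 ?powR_ge0.
exists B => n; apply: le_trans (hB n); apply: ler_sum => k _.
rewrite /wterm -{1 2}(ger0_norm (a0 k)) ler_wpM2l//.
by rewrite ge0_ler_powR ?nnegrE// ?(ltW m1)// lerDl.
Qed.

Context (d : nat -> R[i]) (alpha : nat -> R).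
Context (alpha1 : forall k, 1 <= alpha k).
Context (wfin : forall m : R, 0 <= m -> exists B : R, forall n : nat,
  \sum_(0 <= k < n) wterm d alpha m k <= B).
Local Notation vf := (vf d alpha).
Local Notation lipc := (lipc d alpha).

Definition local_flow T M (w : R -> R[i]) (f : R -> cfun R) :=
  [/\ f 0 = w, antider D0 N0 (- T) T f (fun t => vf t (f t)) &
      forall t, - T <= t <= T -> gnorm 0 (f t) <= M].

(** The rate is constant, so [Lam] is linear; its total increase over [-T, T] is at most 1/2 by the
    choice of [T]. *)
Lemma local_flow_exists T M (w : R -> R[i]) : H1 w -> 0 < M -> 2 * gnorm 0 w <= M -> 0 <= T ->
  2 * T * lipc M <= 2^-1 -> exists f : R -> cfun R, local_flow T M w f.
Proof.
move=> /H1_dom hw M0 wM T0 TM.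
have lam0 t : - T <= t <= T -> 0 < lam 0 t by rewrite lam0t.
have lL t : - T <= t <= T -> 6 * wsum d alpha (supbound 0 M t) <= lipc M.
  by rewrite supbound0.
have NT : - T <= 0 by rewrite oppr_le0.
have tag s t : - T <= s -> s <= t -> t <= T -> exists2 tau, s <= tau <= t &
    6 * wsum d alpha (supbound 0 M tau) * (t - s) <= lipc M * t - lipc M * s.
  move=> _ st _; exists s; first by rewrite lexx.
  by rewrite supbound0 -mulrBr.
have tot : lipc M * T - lipc M * - T <= 2^-1.
  by rewrite mulrN opprK; apply: le_trans TM; rewrite le_eqVlt; apply/orP; left; apply/eqP; ring.
have [f [fM af f0]] := vf_solve alpha1 wfin (lexx 0) NT T0 lam0 M0 lL
  (Lam := fun t => lipc M * t) (u0 := w) hw wM tag tot.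
by exists f; split => // t /fM[].
Qed.

Lemma local_flow_solution T M (w : R -> R[i]) (f : R -> cfun R) : H1 w -> 0 <= T -> local_flow T M w f ->
  is_unique_solution d alpha `[- T, T] w (fun t => U t (f t)).
Proof.
move=> hw T0 [f0 af fM]; have [Df _] := af.
have NT : - T <= 0 by rewrite oppr_le0.
have sol : is_solution d alpha `[- T, T] w (fun t => U t (f t)).
  apply: (antider_solution alpha1 wfin hw) => t; rewrite /= in_itv /= => tT.
  exists 0, (- T), T, f, 1; split => //; first by rewrite NT.
  split.
  - by move=> s; rewrite /= in_itv.
  - by rewrite f0; exact: ae_same_refl.
  - exact: af.
  - by move=> s /Df[ds _]; split; [exact: U_dom|exact: ae_same_refl].
split => // v sv t tT; apply: (solution_unique alpha1 wfin _ hw sv sol tT).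
move=> p q; rewrite /= !in_itv /= => /andP[p1 p2] /orP[]/andP[q1 q2].
  by rewrite (le_trans NT q1) (le_trans q2).
by rewrite (le_trans p1 q1) (le_trans q2).
Qed.

Lemma local_time M : 0 <= M -> exists2 T, 0 < T & 2 * T * lipc M <= 2^-1.
Proof.
move=> M0; have L0 := lipc_ge0 alpha1 wfin M0.
have k0 : 0 < 4 * (lipc M + 1) by rewrite mulr_gt0// ltr_wpDl.
exists (4 * (lipc M + 1))^-1; first by rewrite invr_gt0.
rewrite -mulrA mulrCA mulrC ler_pdivrMr//.
by lra.
Qed.

Theorem local_wellposedness (u0 : R -> R[i]) : H1 u0 -> exists2 T : R, 0 < T &
  exists u : R -> R -> R[i], is_unique_solution d alpha `[- T, T] u0 u.
Proof.
move=> hu; have g0 : 0 <= gnorm 0 u0 := gnorm_ge0 _ (lexx 0).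
have M0 : 0 < 2 * gnorm 0 u0 + 1 by rewrite ltr_wpDl// mulr_ge0.
have [T T0 TM] := local_time (ltW M0); exists T => //.
have uM : 2 * gnorm 0 u0 <= 2 * gnorm 0 u0 + 1 by rewrite lerDl.
have [f hf] := local_flow_exists hu M0 uM (ltW T0) TM.
by exists (fun t => U t (f t)); exact: local_flow_solution hu (ltW T0) hf.
Qed.

Theorem local_continuous_flow (u0 : R -> R[i]) : H1 u0 -> exists2 T : R, 0 < T &
  exists V : set (R -> R[i]), H1_neighborhood u0 V /\
  exists Phi : (R -> R[i]) -> R -> R -> R[i],
    (forall w, V w -> is_unique_solution d alpha `[- T, T] w (Phi w)) /\
    continuous_flow V T Phi.
Proof.
move=> hu; have g0 : 0 <= gnorm 0 u0 := gnorm_ge0 _ (lexx 0).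
(* Data within [H1norm] distance 1 of [u0] have [gnorm 0] at most that of [u0] plus 3, so one ball
   and one time serve the whole neighborhood. *)
pose M := 2 * (gnorm 0 u0 + 3) + 1.
have M0 : 0 < M by rewrite ltr_wpDl// mulr_ge0// addr_ge0.
have [T T0 TM] := local_time (ltW M0); exists T => //.
pose V : set (R -> R[i]) := [set w | H1 w /\ H1norm (w \- u0) < 1].
have VM w : V w -> 2 * gnorm 0 w <= M.
  move=> [hw wu]; have [/H1_dom dw /H1_dom du] := (hw, hu).
  have := sn_Nle (gspace (lexx 0)) (dw : D0 w) (du : D0 u0).
  have := le_trans (gnorm_H1norm (w \- u0)) (ler_wpM2l (ler0n R 3) (ltW wu)).
  rewrite mulr1 => n1 n2; apply: (@le_trans _ _ (2 * (gnorm 0 u0 + 3))); last by rewrite lerDl.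
  by rewrite ler_wpM2l//; apply: le_trans n2 _; rewrite lerD2l.
exists V; split.
  split; first by move=> w [].
  by exists 1 => // w hw wu; split.
have /boolp.choice[f hf] : forall w, exists g : R -> cfun R, V w -> local_flow T M w g.
  move=> w; have [Vw|nVw] := pselect (V w); last by exists (fun=> 0).
  have [g hg] := local_flow_exists Vw.1 M0 (VM w Vw) (ltW T0) TM.
  by exists g.
exists (fun w t => U t (f w t)); split.
  by move=> w Vw; exact: local_flow_solution Vw.1 (ltW T0) (hf w Vw).
(* 12 = 2 * 2 * 3: the two norm comparisons contribute 2 and 3, and Gronwall contributes a factor
   2. *)
move=> w0 Vw0 e e0; pose E := 12 * expR (2 * lipc M * T).
have E0 : 0 < E by rewrite mulr_gt0// expR_gt0.
exists (e / E); first by rewrite divr_gt0.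
move=> w Vw ww tt tT; rewrite ltr_pdivlMr// mulrC in ww; apply: le_lt_trans ww.
have [a0 aa aM] := hf w Vw; have [b0 ba bM] := hf w0 Vw0.
have NT : - T <= 0 by rewrite oppr_le0 ltW.
have [[Da _] [Db _]] := (aa, ba).
have [da _] := Da tt tT; have [db _] := Db tt tT.
have dU := domB (U_dom tt da) (U_dom tt db).
apply: le_trans (H1norm_gnorm0 _) _.
have dab := domB da db.
have e1 : gnorm 0 (U tt (f w tt) \- U tt (f w0 tt)) = gnorm 0 (f w tt \- f w0 tt).
  apply: etrans (gnorm0_U tt dab); apply: gnorm_ae dU (L2_U tt (dom_L2 dab)) _.
  exact: ae_same_sym (UB tt (dom_L2 da) (dom_L2 db)).
have n1 := antider_dependence alpha1 wfin NT (ltW T0) M0 aa ba aM bM tT.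
rewrite a0 b0 in n1.
have n2 := gnorm_H1norm (w \- w0).
have tT' : `|tt| <= T by rewrite ler_norml.
have ex : expR (2 * lipc M * `|tt|) <= expR (2 * lipc M * T).
  by rewrite ler_expR ler_wpM2l// mulr_ge0// (lipc_ge0 alpha1 wfin (ltW M0)).
apply: (@le_trans _ _ (2 * (2 * (3 * H1norm (w \- w0)) * expR (2 * lipc M * T)))).
  rewrite ler_wpM2l//; apply: le_trans (eq_ler e1) (le_trans n1 _).
  apply: ler_pM; [|exact: expR_ge0|exact: ler_wpM2l|exact: ex].
  by apply: mulr_ge0 => //; exact: gnorm_ge0.
rewrite /E; move: (expR _) (H1norm _) => x y; rewrite le_eqVlt; apply/orP; left; apply/eqP.
by ring.
Qed.

End LocalTheory.

(** * Global solutions and scattering *)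

Section Decay.
Context {R : realType}.
Implicit Types (x y p c t s m M : R).

(* Comparison with the integral of y^(-p-1), with the tag at the right endpoint. *)
Lemma powR_decay x y p : 0 < x -> x <= y -> 0 <= p ->
  p * (y `^ (- (p + 1)) * (y - x)) <= x `^ (- p) - y `^ (- p).
Proof.
move=> x0 xy p0; have y0 := lt_le_trans x0 xy.
have yE : y `^ (- (p + 1)) = y `^ (- p) / y.
  have cnd : (- p + -1 == 0) ==> (y != 0) by rewrite (gt_eqF y0) implybT.
  by rewrite opprD (powRD cnd) (powR_inv1 (ltW y0)).
have xE : x `^ (- p) = y `^ (- p) * expR (- p * ln (x / y)).
  rewrite /powR !gt_eqF// -expRD -mulrDr; congr (expR (_ * _)).
  by rewrite ln_div ?posrE// addrC subrK.
have e1 : 1 + p * (1 - x / y) <= expR (- p * ln (x / y)).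
  apply: le_trans (expR_ge1Dx _); rewrite lerD2l mulNr -mulrN ler_wpM2l//.
  have xy0 : 0 < x / y by rewrite divr_gt0.
  have h : ln (1 + (x / y - 1)) <= x / y - 1 by apply: le_ln1Dx; move: xy0; lra.
  by rewrite [1 + _]addrC subrK in h; rewrite lerNr opprB.
rewrite yE xE; move: e1 (powR_ge0 y (- p)); move: (expR _) (_ `^ _) => E z e1 z0.
rewrite [leLHS](_ : _ = z * (p * (1 - x / y))); last by field; rewrite gt_eqF.
rewrite [leRHS](_ : _ = z * (E - 1)); last by ring.
by rewrite ler_wpM2l// lerBrDl.
Qed.

End Decay.

(** * Global flow and scattering for chirped data *)

Section GlobalTheory.
Context {R : realType} (d : nat -> R[i]) (alpha : nat -> R).
Context (alpha2 : forall k, 2 < alpha k).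
Implicit Types (t s r e c M m : R) (k n : nat).
Local Notation U := (@schrodinger R).
Local Notation S := (wsum d alpha).
Local Notation vf := (vf d alpha).

(** The singular factor 1/(alpha - 2) is the one produced by integrating (1 + 2ct)^(-alpha/2) over
    the half-line. *)
Definition vterm m k : R := normc (d k) / (alpha k - 2) * (1 + alpha k + alpha k ^+ 2) * m `^ alpha k.

Lemma vterm_ge0 m k : 0 <= vterm m k.
Proof.
have a2 := ltW (alpha2 k); have a0 : 0 <= alpha k := le_trans (ler0n R 2) a2.
by rewrite !mulr_ge0 ?normc_ge0 ?invr_ge0 ?subr_ge0 ?powR_ge0 ?addr_ge0 ?sqr_ge0.
Qed.

Lemma singular_weights_finite :
  (forall r, 0 < r ->
    (\sum_(0 <= k <oo) (normc (d k) / (alpha k - 2) * (1 + `|alpha k| + `|alpha k| ^+ 2)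
       * r `^ alpha k)%R%:E < +oo)%E) ->
  forall m, 0 <= m -> exists B : R, forall n, \sum_(0 <= k < n) vterm m k <= B.
Proof.
move=> h m m0; have m1 : 0 < m + 1 by rewrite ltr_wpDl.
have a0 k : 0 <= alpha k := le_trans (ler0n R 2) (ltW (alpha2 k)).
have c0 k : 0 <= normc (d k) / (alpha k - 2) * (1 + `|alpha k| + `|alpha k| ^+ 2).
  apply: mulr_ge0; last by rewrite !addr_ge0.
  by rewrite divr_ge0 ?normc_ge0// subr_ge0 ltW.
have [|B hB] := nneseries_bounded _ (h _ m1).
  by move=> k; rewrite mulr_ge0 ?powR_ge0.
exists B => n; apply: le_trans (hB n); apply: ler_sum => k _.
rewrite /vterm -{2 3}(ger0_norm (a0 k)) ler_wpM2l//.
by rewrite ge0_ler_powR ?nnegrE// ?(ltW m1)// lerDl.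
Qed.

Context (vfin : forall m, 0 <= m -> exists B : R, forall n, \sum_(0 <= k < n) vterm m k <= B).

Lemma alpha_ge1 k : 1 <= alpha k.
Proof. by have := alpha2 k; lra. Qed.

(** Since e^alpha >= alpha - 2, enlarging the radius by the factor e absorbs the missing factor
    alpha - 2; so the singular hypothesis contains the regular one. *)
Lemma weights_finite_singular m : 0 <= m ->
  exists B : R, forall n, \sum_(0 <= k < n) wterm d alpha m k <= B.
Proof.
move=> m0; have e0 : 0 <= expR 1 :> R := expR_ge0 1.
have [B hB] := vfin (mulr_ge0 e0 m0); exists B => n; apply: le_trans (hB n).
apply: ler_sum => k _; have a2 := alpha2 k; have a0 : 0 <= alpha k := le_trans ler01 (alpha_ge1 k).
rewrite /wterm /vterm powRM//.
have -> : expR 1 `^ alpha k = expR (alpha k) by rewrite /powR gt_eqF ?expR_gt0// expRK mulr1.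
rewrite [leRHS](_ : _ = normc (d k) * (1 + alpha k + alpha k ^+ 2) * m `^ alpha k *
  (expR (alpha k) / (alpha k - 2))); last by ring.
rewrite ler_peMr ?mulr_ge0 ?normc_ge0 ?addr_ge0 ?sqr_ge0 ?powR_ge0//.
rewrite ler_pdivlMr ?subr_gt0// mul1r; apply: le_trans (expR_ge1Dx _).
by move: (alpha k) => a; lra.
Qed.

Local Notation alpha1 := alpha_ge1.
Local Notation wfin := weights_finite_singular.

Section Global.
Context (c M B : R) (u0 : cfun R).
Context (c0 : 0 < c) (M0 : 0 < M) (Du0 : dom c u0) (uM : 2 * gnorm c u0 <= M).
Context (hB : forall n, \sum_(0 <= k < n) vterm (sobc * M) k <= B) (cB : 12 * B <= c).
Local Notation D := (dom c : cfun R -> Prop).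
Local Notation N := (gnorm c : cfun R -> R).
Local Notation m0 := (sobc * M).
Let c0' := ltW c0.
Let m00 : 0 <= m0 := mulr_ge0 (@sobc_ge0 R) (ltW M0).

(** Its time derivative is -c times the k-th term of [S (supbound c M t)]: differentiating the power
    produces the factor alpha - 2 that [vterm] has in its denominator. *)
Definition qterm t k : R := vterm m0 k * lam c t `^ (- ((alpha k - 2) / 2)).
(* Increments of budget dominate the integral of the contraction rate
   6 S (supbound c M t); this is where alpha_k > 2 enters, since the k-th term
   decays like (1 + 2 c t)^(- alpha_k / 2). *)
Definition budget t : R := - (6 / c) * limn (series (qterm t)).

Lemma lam_ge1 t : 0 <= t -> 1 <= lam c t.
Proof. by move=> t0; rewrite /lam lerDl !mulr_ge0. Qed.

Lemma lam_gt0 t : 0 <= t -> 0 < lam c t.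
Proof. by move/lam_ge1; exact: lt_le_trans. Qed.

Lemma qterm_le t k : 0 <= t -> 0 <= qterm t k <= vterm m0 k.
Proof.
move=> t0; rewrite mulr_ge0 ?vterm_ge0 ?powR_ge0//= ler_piMr ?vterm_ge0//.
rewrite powRN invf_le1 ?powR_gt0 ?lam_gt0//.
have e1 : 1 `^ ((alpha k - 2) / 2) = 1 :> R by rewrite powR1.
rewrite -[leLHS]e1 ge0_ler_powR ?nnegrE ?lam_ge1//.
  by rewrite divr_ge0// subr_ge0 ltW.
by rewrite ltW// lam_gt0.
Qed.

Lemma qsum_le t n : 0 <= t -> \sum_(0 <= k < n) `|qterm t k| <= B.
Proof.
move=> t0; apply: le_trans (hB n); apply: ler_sum => k _.
by have /andP[q0 q1] := qterm_le k t0; rewrite ger0_norm.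
Qed.

Lemma qterm_cvg t : 0 <= t -> cvgn (series (qterm t)).
Proof. by move=> t0; exact: bounded_series_cvg (fun n => qsum_le n t0). Qed.

Lemma budget_bounds t : 0 <= t -> - (6 / c) * B <= budget t <= 0.
Proof.
move=> t0; have q0 : 0 <= 6 / c by rewrite divr_ge0.
have l0 : 0 <= limn (series (qterm t)).
  apply: limr_ge; first exact: qterm_cvg.
  by near=> n; apply: sumr_ge0 => k _; have /andP[] := qterm_le k t0.
have lB : limn (series (qterm t)) <= B.
  apply: limr_le; first exact: qterm_cvg.
  near=> n; apply: le_trans (qsum_le n t0); apply: ler_sum => k _; exact: ler_norm.
by rewrite /budget !mulNr lerN2 ler_wpM2l//= oppr_le0 mulr_ge0.
Unshelve. all: by end_near.
Qed.

Lemma wterm_supbound t k : 0 <= t -> wterm d alpha (supbound c M t) k =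
  vterm m0 k * (alpha k - 2) * lam c t `^ (- ((alpha k - 2) / 2 + 1)).
Proof.
move=> t0; have l0 := lam_gt0 t0; have a2 := alpha2 k.
have -> : supbound c M t = m0 * lam c t `^ (- 2^-1).
  by rewrite powRN powR12_sqrt ?(ltW l0)// /supbound mulrAC.
rewrite /wterm /vterm powRM ?powR_ge0// -powRrM.
have -> : - 2^-1 * alpha k = - ((alpha k - 2) / 2 + 1) by field.
by field; rewrite gt_eqF// subr_gt0.
Qed.

(** Termwise [powR_decay], evaluated at the right endpoint because the rate decreases in time, and
    then passage to the limit of the series. *)
Lemma budget_rate s t : 0 <= s -> s <= t ->
  6 * S (supbound c M t) * (t - s) <= budget t - budget s.
Proof.
move=> s0 st; have t0 := le_trans s0 st.
have sb0 : 0 <= supbound c M t := ltW (supbound_gt0 (lam_gt0 t0) M0).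
have cw := wsum_cvg alpha1 wfin sb0; have cs := qterm_cvg s0; have ct := qterm_cvg t0.
rewrite [leRHS](_ : _ = 6 * ((limn (series (qterm s)) - limn (series (qterm t))) / c)); last first.
  by rewrite /budget; move: (limn _) (limn _) => x y; field; rewrite gt_eqF.
rewrite -mulrA ler_wpM2l// ler_pdivlMr// -mulrA /wsum.
have -> : limn (series (qterm s)) - limn (series (qterm t)) = limn (fun n => series (qterm s) n - series (qterm t) n).
  by apply/esym/cvg_lim; [|apply: cvgB; [exact: cs|exact: ct]].
have -> : limn (series (wterm d alpha (supbound c M t))) * ((t - s) * c) =
    limn (fun n => series (wterm d alpha (supbound c M t)) n * ((t - s) * c)).
  by apply/esym/cvg_lim; [|apply: cvgMl; exact: cw].
apply: ler_lim.
- by apply: cvgP; apply: cvgMl; exact: cw.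
- by apply: cvgP; apply: cvgB; [exact: cs|exact: ct].
near=> n; rewrite /series /= mulr_suml -sumrB; apply: ler_sum => k _.
rewrite (wterm_supbound k t0) /qterm -mulrBr.
move: (vterm _ _) (vterm_ge0 m0 k) => v v0; rewrite -!mulrA ler_wpM2l//.
have p0 : 0 <= (alpha k - 2) / 2 by rewrite divr_ge0// subr_ge0 ltW.
have lst : lam c s <= lam c t by rewrite /lam lerD2l ler_wpM2l ?mulr_ge0.
apply: le_trans (powR_decay (lam_gt0 s0) lst p0).
rewrite {3 4}/lam; move: (_ `^ _) => y; rewrite le_eqVlt; apply/orP; left; apply/eqP; field.
Unshelve. all: by end_near.
Qed.

Lemma budget_mono s t : 0 <= s -> s <= t -> budget s <= budget t.
Proof.
move=> s0 st; have t0 := le_trans s0 st; rewrite -subr_ge0; apply: le_trans (budget_rate s0 st).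
rewrite mulr_ge0 ?subr_ge0// mulr_ge0// (wsum_ge0 alpha1 wfin)//.
exact: ltW (supbound_gt0 (lam_gt0 t0) M0).
Qed.

Lemma rate_le t : 0 <= t -> 6 * S (supbound c M t) <= 6 * S m0.
Proof.
move=> t0; rewrite ler_wpM2l//; apply: (wsum_mono alpha1 wfin).
  exact: ltW (supbound_gt0 (lam_gt0 t0) M0).
rewrite /supbound ler_wpM2r ?(ltW M0)// ler_pdivrMr ?sqrtr_gt0 ?lam_gt0//.
rewrite ler_peMr ?sobc_ge0// -sqrtr1; exact: ler_wsqrtr (lam_ge1 t0).
Qed.

Definition interval_flow (T : R) (g : R -> cfun R) :=
  [/\ g 0 = u0, antider D N 0 T g (fun t => vf t (g t)) &
      forall t, 0 <= t <= T -> dom c (g t) /\ gnorm c (g t) <= M].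

(** The total budget is at most 6B/c, hence at most 1/2 by [12 * B <= c], whatever the length
    [T]. *)
Lemma interval_flow_exists (T : R) : 0 <= T -> exists g, interval_flow T g.
Proof.
move=> T0.
have l0 t : 0 <= t <= T -> 0 < lam c t by move=> /andP[/lam_gt0].
have lL t : 0 <= t <= T -> 6 * S (supbound c M t) <= 6 * S m0 by move=> /andP[/rate_le].
have tag s t : 0 <= s -> s <= t -> t <= T -> exists2 tau, s <= tau <= t &
    6 * S (supbound c M tau) * (t - s) <= budget t - budget s.
  by move=> s0 st _; exists t; [rewrite st lexx|exact: budget_rate].
have tot : budget T - budget 0 <= 2^-1.
  have /andP[_ h1] := budget_bounds T0; have /andP[h2 _] := budget_bounds (lexx 0).
  apply: (@le_trans _ _ (6 / c * B)); first by move: h1 h2; rewrite mulNr; lra.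
  by rewrite mulrAC ler_pdivrMr//; move: cB; lra.
have [g [gM ag g0]] := vf_solve alpha1 wfin c0' (lexx 0) T0 l0 M0 lL Du0 uM tag tot.
by exists g.
Qed.

(** Gronwall in the Galilean norm, with the rate at time 0 as uniform Lipschitz constant; this makes
    flows on different intervals compatible. *)
Lemma interval_flow_unique (T1 T2 : R) g h t : interval_flow T1 g -> interval_flow T2 h ->
  0 <= t -> t <= T1 -> t <= T2 -> ae_same (g t) (h t).
Proof.
move=> [g0 ag gM] [h0 ah hM] t0 t1 t2; have sn := gspace c0'.
have sub (T : R) (f G : R -> cfun R) : t <= T -> antider D N 0 T f G -> antider D N 0 t f G.
  move=> tT [Df ef]; split; first by move=> s /andP[s0 st]; apply: Df; rewrite s0 (le_trans st).
  by move=> e /ef[r r0 hr]; exists r => // s tau q s0 sq qt; apply: hr => //; exact: le_trans tT.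
have L0 : 0 <= 6 * S m0 by rewrite mulr_ge0// (wsum_ge0 alpha1 wfin).
have gm s : 0 <= s <= t -> dom c (g s) /\ gnorm c (g s) <= M.
  by move=> /andP[s0 st]; apply: gM; rewrite s0 (le_trans st).
have hm s : 0 <= s <= t -> dom c (h s) /\ gnorm c (h s) <= M.
  by move=> /andP[s0 st]; apply: hM; rewrite s0 (le_trans st).
have lip s : 0 <= s <= t ->
    N ((vf s (g s) : cfun R) - (vf s (h s) : cfun R)) <= 6 * S m0 * N (g s - h s).
  move=> sI; have /andP[s0 _] := sI; have [dg ng] := gm s sI; have [dh nh] := hm s sI.
  apply: le_trans (vf_lip alpha1 wfin c0' (lam_gt0 s0) M0 dg dh ng nh) _.
  by apply: ler_wpM2r (rate_le s0); exact: gnorm_ge0.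
have bd s : 0 <= s <= t -> N (g s - h s) <= M + M.
  move=> sI; have [dg ng] := gm s sI; have [dh nh] := hm s sI.
  by apply: le_trans (sn_NB sn dg dh) _; exact: lerD.
have tI : 0 <= t <= t by rewrite t0 lexx.
have := gronwall sn (lexx 0) t0 L0 (antiderB sn (sub _ _ _ t1 ag) (sub _ _ _ t2 ah)) lip bd tI.
rewrite g0 h0 subrr (sn_N0 sn) mulr0 mul0r => n0.
have [[dg _] [dh _]] := (gm t tI, hm t tI).
have e0 : gnorm c (g t \- h t) = 0.
  by apply/eqP; rewrite eq_le n0 gnorm_ge0.
have := (gnorm_eq0 c0' (domB dg dh)).1 e0; apply: ae_imp => x /= /subr0_eq.
exact.
Qed.

(** The field is at most [M] times the rate, so the curve moves no more than [M] times the budget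
    spent. Convergence at infinity follows from the bounded budget. *)
Lemma interval_flow_budget (T : R) g s t : interval_flow T g -> 0 <= s -> s <= t -> t <= T ->
  gnorm c (g t \- g s) <= M * budget t - M * budget s.
Proof.
move=> [g0 ag gM] s0 st tT.
apply: (mean_value (gspace c0') ag (L := fun t => M * budget t) _ s0 st tT).
move=> p q p0 pq qT; exists q; first by rewrite pq lexx.
have q0 := le_trans p0 pq; have [dq nq] := gM q (introT andP (conj q0 qT)).
have := vf_le alpha1 wfin c0' (lam_gt0 q0) M0 dq nq.
have r0 : 0 <= 6 * S (supbound c M q).
  by rewrite mulr_ge0// (wsum_ge0 alpha1 wfin)// ltW// (supbound_gt0 (lam_gt0 q0) M0).
move=> h1; rewrite -mulrBr; have := ler_wpM2l (ltW M0) (budget_rate p0 pq).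
apply: le_trans; rewrite mulrA ler_wpM2r ?subr_ge0//; apply: le_trans h1 _.
by rewrite mulrC ler_wpM2r.
Qed.

Theorem global_flow : exists f : R -> cfun R, exists2 g : nat -> R -> cfun R,
  forall n, interval_flow n.+1%:R (g n) &
  forall n t, 0 <= t <= n.+1%:R -> ae_same (f t) (g n t) /\ dom c (f t).
Proof.
have /boolp.choice[g hg] : forall n, exists g, interval_flow n.+1%:R g.
  by move=> n; apply: interval_flow_exists; exact: ler0n.
exists (fun t => g (Num.truncn t) t), g => // n t /andP[t0 tn].
have tt : t <= (Num.truncn t).+1%:R := ltW (truncnS_gt t).
split; first exact: interval_flow_unique (hg _) (hg _) t0 tt tn.
by have [_ _ /(_ t)] := hg (Num.truncn t); rewrite t0 tt => /(_ isT)[].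
Qed.

Theorem global_scattering : exists u : R -> R -> R[i],
  is_unique_solution d alpha `[0, +oo[ u0 u /\
  exists2 uplus : R -> R[i], H1 uplus &
    (fun t => H1norm (u t \- U t uplus)) @ +oo --> (0 : R).
Proof.
have [f [g hg fg]] := global_flow; have sn := gspace c0'.
have dom0 (h : R -> R[i]) : dom c h -> dom 0 h by move=> /dom_H1/H1_dom.
have df t : 0 <= t -> dom c (f t).
  move=> t0; have [] // := fg (Num.truncn t) t _.
  by rewrite t0 ltW// truncnS_gt.
have Hu0 : H1 u0 := dom_H1 Du0.
have sol : is_solution d alpha `[0, +oo[ u0 (fun t => U t (f t)).
  (* The representation is required only locally in time: around [t] the flow on an interval
     reaching past t + 1 is used. *)
  apply: (antider_solution alpha1 wfin Hu0) => t; rewrite /= in_itv /= andbT => t0.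
  pose n := (Num.truncn t).+1; have [g0 ag gM] := hg n.
  have tn : t + 1 <= n.+1%:R by rewrite -natr1 lerD2r ltW// truncnS_gt.
  exists c, 0, n.+1%:R, (g n), 1; split => //.
  - by rewrite lexx ler0n.
  - by rewrite t0 (le_trans _ tn)// lerDl.
  split.
  - move=> s; rewrite /= in_itv /= andbT => -> /=; rewrite ltr_norml => /andP[_ st].
    by apply: le_trans tn; move: st; lra.
  - by rewrite g0; exact: ae_same_refl.
  - exact: ag.
  - move=> s sI; have [e ds] := fg n s sI; have [dg _] := gM s sI.
    split; first exact: U_dom (dom0 _ ds).
    exact: U_ae (dom_L2 ds) (dom_L2 dg) e.
exists (fun t => U t (f t)); split.
  split => // v sv t Jt; apply: (solution_unique alpha1 wfin _ Hu0 sv sol Jt).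
  move=> p q; rewrite /= !in_itv /= !andbT => p0 /orP[/andP[]//|/andP[pq q0]].
  exact: le_trans pq.
have fB s t : 0 <= s -> s <= t -> gnorm c (f t \- f s) <= M * budget t - M * budget s.
  move=> s0 st; have t0 := le_trans s0 st; pose n := Num.truncn t.
  have tn : t <= n.+1%:R := ltW (truncnS_gt t).
  apply: le_trans (interval_flow_budget (hg n) s0 st tn).
  have [e1 d1] := fg n t (introT andP (conj t0 tn)).
  have [e2 d2] := fg n s (introT andP (conj s0 (le_trans st tn))).
  have [_ _ gM] := hg n.
  have [g1 _] := gM t (introT andP (conj t0 tn)).
  have [g2 _] := gM s (introT andP (conj s0 (le_trans st tn))).
  apply: eq_ler; apply: gnorm_ae (domB d1 d2) (dom_L2 (domB g1 g2)) _.
  exact: ae_sameB.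
have cb : cvgn (fun n : nat => budget n%:R).
  apply: nondecreasing_is_cvgn.
    by move=> p q pq; apply: budget_mono; rewrite ?ler0n ?ler_nat.
  by exists 0 => _ [n _ <-]; have /andP[] := budget_bounds (ler0n R n).
(* The budget is nondecreasing and bounded above by 0, so what remains to be spent after a late time
   is arbitrarily small. *)
have tail e : 0 < e -> exists n0 : nat, forall t, n0%:R <= t -> M * budget t - M * budget n0%:R < e.
  move=> e0; have eM : 0 < e / M by rewrite divr_gt0.
  have /cvgrPdist_lt/(_ _ eM)[n0 _ hn] := cb.
  exists n0 => t nt; have t0 := le_trans (ler0n R n0) nt.
  have h1 : budget t <= limn (fun n : nat => budget n%:R).
    apply: le_trans (_ : budget (Num.truncn t).+1%:R <= _).
      by apply: budget_mono => //; exact: ltW (truncnS_gt t).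
    apply: nondecreasing_cvgn_le => // p q pq.
    by apply: budget_mono; rewrite ?ler0n ?ler_nat.
  have := le_lt_trans (ler_norm _) (hn n0 (leqnn n0)).
  rewrite ltr_pdivlMr// mulrC -mulrBr; apply: le_lt_trans.
  by rewrite ler_wpM2l ?(ltW M0)// lerD2r.
have cau : forall e, 0 < e -> exists n0 : nat, forall n m : nat, (n0 <= n)%N -> (n0 <= m)%N ->
    N (f n%:R - f m%:R) < e.
  move=> e e0; have [n0 hn] := tail _ (divr_gt0 e0 (ltr0n R 2)).
  exists n0 => n m nn nm.
  have [dn [dm d0]] : dom c (f n%:R) /\ dom c (f m%:R) /\ dom c (f n0%:R).
    by split; [|split]; apply: df; exact: ler0n.
  apply: le_lt_trans (sn_triangle sn dn d0 dm) _.
  rewrite [ltRHS](_ : e = e / 2 + e / 2); last by field.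
  have le1 : n0%:R <= n%:R :> R by rewrite ler_nat.
  have le2 : n0%:R <= m%:R :> R by rewrite ler_nat.
  apply: ltrD; first exact: le_lt_trans (fB _ _ (ler0n R n0) le1) (hn _ le1).
  rewrite (sn_NBC sn d0 dm).
  exact: le_lt_trans (fB _ _ (ler0n R n0) le2) (hn _ le2).
have [_ _ _ _ complete] := sn.
have [up dup hup] := complete (fun n => f n%:R) (fun n => df n%:R (ler0n R n)) cau.
exists up; first exact: dom_H1 dup.
apply/cvgrPdist_lt => e e0.
pose k := 6 * (2 + c); have k0 : 0 < k by rewrite mulr_gt0// ltr_pwDl.
have ek : 0 < e / k / 2 by rewrite !divr_gt0.
have [n1 h1] := tail _ ek; have [n2 h2] := hup _ ek.
have [n3 h3] := tail _ ek.
near=> t.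
have tn : (maxn n1 n2)%:R <= t by near: t; exact: nbhs_pinfty_ge (num_real _).
have t0 := le_trans (ler0n R _) tn.
rewrite sub0r normrN ger0_norm ?H1norm_ge0//.
have dt := df t t0; have hN := ler0n R (maxn n1 n2).
have dn := df _ hN.
have nt : N (f t - up) < e / k.
  apply: le_lt_trans (sn_triangle sn dt dn dup) _.
  rewrite [ltRHS](_ : _ = e / k / 2 + e / k / 2); last by field; rewrite gt_eqF.
  apply: ltrD; last by apply: h2; exact: leq_maxr.
  apply: le_lt_trans (fB _ _ hN tn) _.
  have nn : n1%:R <= (maxn n1 n2)%:R :> R by rewrite ler_nat leq_maxl.
  apply: le_lt_trans (h1 t (le_trans nn tn)); rewrite lerD2l lerN2.
  by rewrite ler_wpM2l ?(ltW M0)//; apply: budget_mono => //; exact: ler0n.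
have [dt0 du0] := (dom0 _ dt, dom0 _ dup).
have dB := domB dt0 du0.
have dUB := domB (U_dom t dt0) (U_dom t du0).
(* The group preserves [gnorm 0], so scattering of u is convergence of f; only the fixed factor 6 (2
   + c) separates it from convergence in [gnorm c]. *)
have e1 : gnorm 0 (U t (f t) \- U t up) = gnorm 0 (f t \- up).
  apply: etrans (gnorm0_U t dB); apply: gnorm_ae dUB (L2_U t (dom_L2 dB)) _.
  exact: ae_same_sym (UB t (dom_L2 dt) (dom_L2 dup)).
apply: le_lt_trans (H1norm_gnorm0 _) _.
apply: (@le_lt_trans _ _ (k * gnorm c (f t \- up))); last by rewrite mulrC -ltr_pdivlMr.
have := gnorm0_c (f t \- up) c0'; have := eq_ler e1.
rewrite /k; move: (gnorm 0 _) (gnorm 0 _) (gnorm c _) => x y z xy yz.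
rewrite [leRHS](_ : _ = 2 * (3 * (2 + c) * z)); last by ring.
by rewrite ler_wpM2l//; exact: le_trans xy yz.
Unshelve. all: by end_near.
Qed.

End Global.

End GlobalTheory.

Section ChirpedData.
Context {R : realType}.
Implicit Types (c : R) (v : R -> R[i]).

(* The chirp carries v' to the Galilean derivative, so the gauge norm of the
   chirped datum is bounded uniformly in c. *)
Lemma gnorm_chirp c v : 0 <= c -> H1 v -> L2 (fun x => x%:C * v x) ->
  dom c (fun x => cis (c / 2 * x ^+ 2) * v x) /\
  gnorm c (fun x => cis (c / 2 * x ^+ 2) * v x) <=
    nrm v + 2 * nrm (dx v) + nrm (fun x => x%:C * v x).
Proof.
move=> c0 /H1_dom/dom_wdf w Lxv; have [Lv Ld _] := w.
have Lx : L2 (fun x => (0 +i* x) * v x).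
  have := L2Z (0 +i* 1) Lxv; congr L2; apply/funext => x; rewrite mulrA; congr (_ * _).
  by apply: complexP => /=; ring.
have nx : nrm (fun x => (0 +i* x) * v x) = nrm (fun x => x%:C * v x).
  have i1 : normc (0 +i* 1 : R[i]) = 1 by rewrite normcI normr1.
  rewrite -[RHS]mul1r -i1 -(nrmZ _ Lxv); congr nrm; apply/funext => x.
  by rewrite mulrA; congr (_ * _); apply: complexP => /=; ring.
have wu := wdf_chirp (c / 2) w Lx.
set u := (fun x => cis (c / 2 * x ^+ 2) * v x) in wu *.
have Lu : L2 u by have [] := wu.
have [Lcx ncx] := L2_chirp (c / 2) Lx.
have Lcu : L2 (fun x => imx c x * u x).
  have := L2Z c%:C Lcx; congr L2; apply/funext => x.
  by rewrite imxE /u; move: (cis _) (0 +i* x) => p q; ring.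
have du : dom c u by split => //; eexists; exact: wu.
split => //.
have n0 : nrm u = nrm v := (L2_chirp (c / 2) Lv).2.
(* The derivative of the phase c x^2/2 is c x, which cancels the weight in K(0): only the chirp
   times v' remains. *)
have n1 : nrm (gal c u) = nrm (dx v).
  have [Lcd ncd] := L2_chirp (c / 2) Ld; rewrite -ncd.
  apply: nrm_ae (dom_gal du) Lcd _; apply: ae_same_trans (gal_eq c wu) _.
  apply: ae_same_eq => x /=; rewrite /u /imx (_ : 2 * (c / 2) * x = c * x); last by field.
  by move: (cis _) (0 +i* _) => p q; ring.
have n2 : nrm (dx u) <= nrm (dx v) + c * nrm (fun x => x%:C * v x).
  have [Lcd ncd] := L2_chirp (c / 2) Ld.
  have Lz := L2Z c%:C Lcx.
  have e : ae_same (dx u) ((fun x => cis (c / 2 * x ^+ 2) * dx v x) \+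
      (fun x => c%:C * (cis (c / 2 * x ^+ 2) * ((0 +i* x) * v x)))).
    apply: ae_same_trans (dx_eq wu) _; apply: ae_same_eq => x /=.
    rewrite (_ : 0 +i* (2 * (c / 2) * x) = c%:C * (0 +i* x)).
      by move: (cis _) (0 +i* x) => p q; ring.
    by apply: complexP => /=; field.
  rewrite (nrm_ae (dom_dx du) (L2D Lcd Lz) e); apply: le_trans (nrmD Lcd Lz) _.
  by rewrite ncd (nrmZ _ Lcx) ncx nx normcR (ger0_norm c0).
rewrite /gnorm n0 n1.
have c1 : 0 < 1 + c by rewrite ltr_pwDl.
(* The part growing like c |x v| is absorbed by the factor 1/(1+c). *)
have n3 : (1 + c)^-1 * nrm (dx u) <= nrm (dx v) + nrm (fun x => x%:C * v x).
  rewrite mulrC ler_pdivrMr//; apply: le_trans n2 _.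
  have a0 := nrm_ge0 (dx v); have b0 := nrm_ge0 (fun x => x%:C * v x).
  by move: (nrm _) (nrm _) a0 b0 => a b a0 b0; nra.
by move: n3; move: (_ * nrm (dx u)) => z; lra.
Qed.

End ChirpedData.

Theorem theorem1p6 (R : realType) :
  (forall (d : nat -> R[i]) (alpha : nat -> R),
    (forall k, 1 <= alpha k) ->
    (forall R0 : R, 0 < R0 ->
      (\sum_(0 <= k <oo)
         (normc (d k) * (1 + `|alpha k| + `|alpha k| ^+ 2)
            * R0 `^ alpha k)%R%:E < +oo)%E) ->
    (forall u0 : R -> R[i], H1 u0 ->
      exists2 T : R, 0 < T &
      exists u : R -> R -> R[i], is_unique_solution d alpha `[- T, T] u0 u) /\
    (forall u0 : R -> R[i], H1 u0 ->
      exists2 T : R, 0 < T &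
      exists V : set (R -> R[i]), H1_neighborhood u0 V /\
      exists Phi : (R -> R[i]) -> R -> R -> R[i],
        (forall w, V w -> is_unique_solution d alpha `[- T, T] w (Phi w)) /\
        continuous_flow V T Phi)) /\
  (forall (d : nat -> R[i]) (alpha : nat -> R),
    (forall k, 2 < alpha k) ->
    (forall R0 : R, 0 < R0 ->
      (\sum_(0 <= k <oo)
         (normc (d k) / (alpha k - 2) * (1 + `|alpha k| + `|alpha k| ^+ 2)
            * R0 `^ alpha k)%R%:E < +oo)%E) ->
    forall v0 : R -> R[i], H1 v0 -> L2 (fun x => x%:C * v0 x) ->
    exists2 b0 : R, 0 < b0 &
    forall b : R, b0 <= b ->
    let u0 := fun x : R => cis (b * `|x| ^+ 2 / 4) * v0 x in
    exists u : R -> R -> R[i],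
      is_unique_solution d alpha `[0, +oo[ u0 u /\
      exists2 uplus : R -> R[i], H1 uplus &
        (fun t => H1norm (u t \- schrodinger t uplus)) @ +oo --> (0 : R)).
Proof.
split=> d alpha ha hd.
  have wfin := weights_finite ha hd.
  by split=> u0 hu; [exact: (local_wellposedness ha wfin hu)|exact: (local_continuous_flow ha wfin hu)].
move=> v0 hv Lxv; have vfin := singular_weights_finite ha hd.
pose K := nrm v0 + 2 * nrm (dx v0) + nrm (fun x => x%:C * v0 x).
have K0 : 0 <= K by rewrite !addr_ge0 ?mulr_ge0 ?nrm_ge0.
pose M := 2 * K + 1; have M0 : 0 < M by rewrite ltr_wpDl// mulr_ge0.
(* [M], and with it [B], depends on [v0] only, since the chirped norm is bounded uniformly; so [B]
   may be fixed before [b]. *)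
have [B hB] := vfin _ (mulr_ge0 (@sobc_ge0 R) (ltW M0)).
have B0 : 0 <= B by have := hB 0%N; rewrite big_nil.
(* The smallness condition [12 * B <= c] reads 24 B <= b for c = b/2; the added 1 keeps the
   threshold positive. With this c the phase b x^2/4 is (c/2) x^2. *)
exists (24 * B + 1) => [|b bB]; first by rewrite ltr_wpDl// mulr_ge0.
have b0 : 0 < b by apply: lt_le_trans bB; rewrite ltr_wpDl// mulr_ge0.
have c0 : 0 < b / 2 by rewrite divr_gt0.
have cB : 12 * B <= b / 2 by move: bB; lra.
have [du nu] := gnorm_chirp (ltW c0) hv Lxv.
have uM : 2 * gnorm (b / 2) (fun x => cis (b / 2 / 2 * x ^+ 2) * v0 x) <= M.
  by apply: le_trans (ler_wpM2l (ler0n R 2) nu) _; rewrite lerDl.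
have -> : (fun x : R => cis (b * `|x| ^+ 2 / 4) * v0 x) = (fun x => cis (b / 2 / 2 * x ^+ 2) * v0 x).
  apply/funext => x; congr (cis _ * _); rewrite real_normK ?num_real//.
  by field.
exact: (global_scattering ha vfin c0 M0 du uM hB cB).
Qed.
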